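(* Let $1<p<\infty$ and $w\in A_p$. Assume that $\psi$ satisfies the $\mathcal D_\kappa$ condition for some $0\leq\kappa<1$. Then every $\theta$-type Calderón–Zygmund operator $T_\theta$ is bounded on $\mathcal M^{p,\psi}(w)$, i.e. there is a constant $C>0$ such that $\|T_\theta f\|_{\mathcal M^{p,\psi}(w)}\leq C\|f\|_{\mathcal M^{p,\psi}(w)}$ for all $f\in\mathcal M^{p,\psi}(w)$.
   Context: Operators. Let $\theta:(0,\infty)\to[0,\infty)$ be non-decreasing with $\int_0^1\frac{\theta(t)}{t}\,dt<\infty$. A measurable function $K$ on $\mathbb R^n\times\mathbb R^n\setminus\{(x,x):x\in\mathbb R^n\}$ is a $\theta$-type kernel if for some constant $C>0$: (i) $|K(x,y)|\leq C|x-y|^{-n}$ for $x\neq y$; (ii) $|K(x,y)-K(z,y)|+|K(y,x)-K(y,z)|\leq C|x-y|^{-n}\,\theta\big(\frac{|x-z|}{|x-y|}\big)$ whenever $|x-z|<|x-y|/2$. A linear operator $T_\theta$ from $\mathscr S(\mathbb R^n)$ into $\mathscr S'(\mathbb R^n)$ is a $\theta$-type Calderón–Zygmund operator if (1) it extends to a bounded linear operator on $L^2(\mathbb R^n)$, and (2) there is a $\theta$-type kernel $K$ with $T_\theta f(x)=\int_{\mathbb R^n}K(x,y)f(y)\,dy$ for all $f\in C_0^\infty(\mathbb R^n)$ and all $x\notin\operatorname{supp}f$. For compactly supported $g\in L^1(\mathbb R^n)$, $T_\theta g$ is defined through the continuous (weak type $(1,1)$) extension of $T_\theta$ to $L^1(\mathbb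 R^n)$. For $f$ in a Morrey type space, $T_\theta f$ is defined on each ball $B$ by $T_\theta f(x)=T_\theta(f\chi_{2B})(x)+\int_{(2B)^c}K(x,y)f(y)\,dy$ for a.e. $x\in B$, where $2B$ is the concentric ball with twice the radius. Weights. A weight is a locally integrable function on $\mathbb R^n$ with values in $(0,\infty)$ a.e.; $w(E)=\int_E w\,dx$. For $1<p<\infty$, $1/p+1/p'=1$, $w\in A_p$ means that there is $C>0$ with $\big(\frac1{|B|}\int_B w\,dx\big)^{1/p}\big(\frac1{|B|}\int_B w^{-p'/p}\,dx\big)^{1/p'}\leq C$ for every ball $B$. Spaces. For $0\leq\kappa<1$, a positive increasing (in the weak sense; $\psi\equiv1$ is allowed) function $\psi$ on $(0,\infty)$ satisfies the $\mathcal D_\kappa$ condition if there is $C>0$ with $\frac{\psi(\xi)}{\xi^\kappa}\leq C\frac{\psi(\xi')}{(\xi')^\kappa}$ for all $0<\xi'<\xi<\infty$. $\mathcal M^{p,\psi}(w)$ is the space of locally integrable $f$ with $\|f\|_{\mathcal M^{p,\psi}(w)}:=\sup_B\big(\frac1{\psi(w(B))}\int_B|f(x)|^pw(x)\,dx\big)^{1/p}<\infty$, the supremum being over all balls $B\subset\mathbb R^n$. *)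

(* Defs.v *)
From HB Require Import structures.
From mathcomp Require Import all_boot all_order all_algebra.
From mathcomp Require Import all_classical all_reals all_analysis.
From mathcomp Require Import complex.

Set Implicit Arguments.
Unset Strict Implicit.
Unset Printing Implicit Defensive.

Import Order.TTheory GRing.Theory Num.Theory.
Import numFieldNormedType.Exports.
Import Normc.

Local Open Scope classical_set_scope.
Local Open Scope ring_scope.

Definition rV_display : Type -> measure_display. Proof. exact. Qed.

(* The sigma-algebra on 'rV[R]_n is generated by the coordinates: it is the
   Borel sigma-algebra of R^n. *)
Section measurable_rV.
Context (R : realType) (n : nat).

Let coors : 'I_n -> 'rV[R]_n -> measurableTypeR R := fun i x => x ord0 i.

Let rV_set0 : g_sigma_preimage coors set0.
Proof. exact: sigma_algebra0. Qed.

Let rV_setC A : g_sigma_preimage coors A -> g_sigma_preimage coors (~` A).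
Proof. exact: sigma_algebraC. Qed.

Let rV_bigcup (F : _^nat) : (forall i, g_sigma_preimage coors (F i)) ->
  g_sigma_preimage coors (\bigcup_i (F i)).
Proof. exact: sigma_algebra_bigcup. Qed.

HB.instance Definition _ := @isMeasurable.Build (rV_display R)
  'rV[R]_n (g_sigma_preimage coors) rV_set0 rV_setC rV_bigcup.

End measurable_rV.

Section rV_measurability.
Context (R : realType).

Lemma measurable_coord n (i : 'I_n) :
  measurable_fun setT (fun x : 'rV[R]_n => x ord0 i : measurableTypeR R).
Proof.
move=> _ Y mY; rewrite setTI; apply: sub_sigma_algebra => /=.
rewrite -bigcup_seq/=; exists i => /=; first by rewrite mem_index_enum.
by exists Y => //; rewrite setTI.
Qed.

Lemma measurable_fun_rV d (T : measurableType d) n (f : T -> 'rV[R]_n) :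
  (forall i, measurable_fun setT (fun t => f t ord0 i : measurableTypeR R)) ->
  measurable_fun setT f.
Proof.
move=> mf.
have : g_sigma_preimage
    (fun i : 'I_n => (fun x : 'rV[R]_n => x ord0 i : measurableTypeR R) \o f)
    `<=` measurable.
  apply: smallest_sub; first exact: sigma_algebra_measurable.
  case: n => [|n] in f mf *; first by rewrite big_ord0.
  rewrite -bigcup_mkord_ord; apply: bigcup_sub => i Ii.
  by move=> A [B mB <-]; exact: mf.
rewrite g_sigma_preimage_comp => prefS _ A mA.
by apply: prefS; exists A.
Qed.

Definition rV_cons n (z : measurableTypeR R * 'rV[R]_n) : 'rV[R]_n.+1 :=
  row_mx (const_mx z.1 : 'rV_1) z.2.

Definition rV_uncons n (x : 'rV[R]_n.+1) : measurableTypeR R * 'rV[R]_n :=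
  (x ord0 ord0, rsubmx (x : 'rV_(1 + n))).

Lemma rV_cons0 n (z : measurableTypeR R * 'rV[R]_n) :
  rV_cons z ord0 ord0 = z.1.
Proof.
have := row_mxEl (const_mx z.1 : 'rV_1) z.2 ord0 ord0; rewrite [RHS]mxE => <-.
by congr (row_mx _ _ _ _); apply/val_inj.
Qed.

Lemma rV_consS n (z : measurableTypeR R * 'rV[R]_n) (i : 'I_n) :
  rV_cons z ord0 (lift ord0 i) = z.2 ord0 i.
Proof.
rewrite -(row_mxEr (const_mx z.1 : 'rV_1) z.2 ord0 i).
by congr (row_mx _ _ _ _); apply/val_inj.
Qed.

Lemma rV_consK n : cancel (@rV_cons n) (@rV_uncons n).
Proof.
by move=> z; rewrite /rV_uncons rV_cons0 /rV_cons row_mxKr -surjective_pairing.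
Qed.

Lemma measurable_rV_cons n : measurable_fun setT (@rV_cons n).
Proof.
apply: measurable_fun_rV => i.
have [j ->|->] := unliftP ord0 i.
  under eq_fun do rewrite rV_consS.
  exact: (measurableT_comp (measurable_coord j) measurable_snd).
by under eq_fun do rewrite rV_cons0; exact: measurable_fst.
Qed.

Lemma measurable_rV_uncons n : measurable_fun setT (@rV_uncons n).
Proof.
apply: measurable_fun_pair; first exact: measurable_coord.
apply: measurable_fun_rV => i.
by under eq_fun do rewrite mxE; exact: measurable_coord.
Qed.

Section leb_succ.
Context (n : nat) (m : {sigma_finite_measure set 'rV[R]_n -> \bar R}).

Definition leb_succ : set 'rV[R]_n.+1 -> \bar R :=
  pushforward (lebesgue_measure \x m)%E (@rV_cons n).

HB.instance Definition _ := Measure.copy leb_succ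
  (measure_function_pushforward__canonical__measure_function_Measure
    (lebesgue_measure \x m)%E (@measurable_rV_cons n)).

Let leb_succ_sigma_finite : sigma_finite setT leb_succ.
Proof.
have /sigma_finiteP[F [TF ndF Foo]] := sigma_finiteT (@lebesgue_measure R).
have /sigma_finiteP[G [TG ndG Goo]] := sigma_finiteT m.
exists (fun k => @rV_uncons n @^-1` (F k `*` G k)).
  apply/esym; rewrite -subTset => x _.
  have [i _ Fi] : (\bigcup_i F i) (rV_uncons x).1 by rewrite -TF.
  have [j _ Gj] : (\bigcup_j G j) (rV_uncons x).2 by rewrite -TG.
  exists (maxn i j) => //; split.
  - by move: Fi; exact/subsetPset/ndF/leq_maxl.
  - by move: Gj; exact/subsetPset/ndG/leq_maxr.
move=> k; have [mFk Fkoo] := Foo k; have [mGk Gkoo] := Goo k; split.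
  rewrite -[X in measurable X]setTI; apply: measurable_rV_uncons => //.
  exact: measurableX.
rewrite /leb_succ /pushforward -comp_preimage.
rewrite (_ : _ \o _ = id) ?preimage_id.
  by rewrite product_measure1E// lte_mul_pinfty// ge0_fin_numE.
by apply/funext => z /=; rewrite rV_consK.
Qed.

HB.instance Definition _ :=
  @Measure_isSigmaFinite.Build _ _ _ leb_succ leb_succ_sigma_finite.

End leb_succ.

(* The n-fold product of lebesgue_measure. *)
Fixpoint leb n : {sigma_finite_measure set 'rV[R]_n -> \bar R} :=
  if n is m.+1 then leb_succ (leb m) else \d_(0 : 'rV[R]_0).

Lemma measurable_box n (A : 'I_n -> set (measurableTypeR R)) :
  (forall i, measurable (A i)) ->
  measurable [set x : 'rV[R]_n | forall i, A i (x ord0 i)].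
Proof.
move=> mA.
rewrite (_ : mkset _ = \bigcap_(i in [set: 'I_n])
    ((fun x : 'rV[R]_n => x ord0 i : measurableTypeR R) @^-1` A i)); last first.
  by apply/seteqP; split => x /= xA i; [move=> _; exact: xA|exact: (xA i I)].
apply: fin_bigcap_measurable => // i _.
by rewrite -[X in measurable X]setTI; exact: measurable_coord.
Qed.

Lemma leb_box n (A : 'I_n -> set (measurableTypeR R)) :
  (forall i, measurable (A i)) ->
  leb n [set x | forall i, A i (x ord0 i)] =
  (\prod_(i < n) lebesgue_measure (A i))%E.
Proof.
elim: n A => [|n IH] A mA.
  by rewrite big_ord0 /= diracE mem_set//= => -[].
have mA' i : measurable (A (lift ord0 i)) by [].
rewrite big_ord_recl -(IH _ mA').
rewrite -(product_measure1E _ _ (mA ord0) (measurable_box mA')).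
rewrite /= /leb_succ /pushforward; congr product_measure1.
apply/seteqP; split => [z /= zA|z [/= z1 z2] i].
  by split => [|i]; [rewrite -rV_cons0|rewrite -rV_consS]; exact: zA.
by have [j ->|->] := unliftP ord0 i; rewrite ?rV_consS ?rV_cons0.
Qed.

End rV_measurability.

Section functions_on_Rn.
Context (R : realType) (n : nat).
Local Notation E := 'rV[R]_n.
Local Notation C := R[i].
Implicit Types (f g h : E -> C) (x y : E) (u : (E -> C) -> C) (s : seq 'I_n).

(* The library norm of 'rV[R]_n is the sup norm. *)
Definition enorm x : R := Num.sqrt (\sum_(i < n) (x ord0 i) ^+ 2).

Definition eball x (r : R) : set E := [set y | enorm (y - x) < r].

Definition cmeasurable d (T : measurableType d) (D : set T) (F : T -> C) :=
  measurable_fun D (fun t => complex.Re (F t)) /\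
  measurable_fun D (fun t => complex.Im (F t)).

Definition cintegrable (D : set E) f :=
  (leb R n).-integrable D (fun x => (complex.Re (f x))%:E) /\
  (leb R n).-integrable D (fun x => (complex.Im (f x))%:E).

Definition cintegral (D : set E) f : C :=
  Complex (\int[leb R n]_(x in D) complex.Re (f x))%R
          (\int[leb R n]_(x in D) complex.Im (f x))%R.

Definition Lpnorm (p : R) f : \bar R :=
  ('N[leb R n]_(p%:E) [EFin \o (@normc R \o f)])%E.

Definition in_Lp (p : R) f := cmeasurable setT f /\ (Lpnorm p f < +oo)%E.

Definition locally_integrable_on_Rn f :=
  cmeasurable setT f /\
  forall K : set E, compact K ->
    (\int[leb R n]_(x in K) (normc (f x))%:E < +oo)%E.

(* pderivs [:: i1; ...; ik] = d_i1 ... d_ik. *)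
Definition pderivs s (g : E -> R) : E -> R :=
  foldr (fun i (k : E -> R) x => 'D_(delta_mx ord0 i) k x) g s.

Definition smooth (g : E -> R) := forall s,
  continuous (pderivs s g) /\
  forall i x, derivable (pderivs s g) x (delta_mx ord0 i).

Definition csmooth f :=
  smooth (fun x => complex.Re (f x)) /\ smooth (fun x => complex.Im (f x)).

Definition cpderivs s f x : C :=
  Complex (pderivs s (fun y => complex.Re (f y)) x)
          (pderivs s (fun y => complex.Im (f y)) x).

Definition support_of f : set E := closure [set x | f x != 0].

Definition Cc_infty f := csmooth f /\ compact (support_of f).

(* The seminorm sup_x |x|^k |d^s f(x)| of the Schwartz space is at most M. *)
Definition seminorm_le (k : nat) s (M : R) f :=
  forall x, enorm x ^+ k * normc (cpderivs s f x) <= M.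

Definition schwartz f :=
  csmooth f /\ forall k s, exists M, seminorm_le k s M f.

(* For a linear functional, continuity for the topology of the seminorms is
   continuity at 0, whose basic neighbourhoods are given by finitely many
   seminorms. *)
Definition tempered_distribution u :=
  (forall (a : C) f g, schwartz f -> schwartz g ->
     u (fun x => a * f x + g x) = a * u f + u g) /\
  (forall e : R, 0 < e -> exists (N : nat) (d : R), 0 < d /\
     forall f, schwartz f ->
       (forall k s, (k <= N)%N -> (size s <= N)%N -> seminorm_le k s d f) ->
       normc (u f) <= e).

(* The tempered distribution u is the function h. *)
Definition is_function u h :=
  cmeasurable setT h /\
  forall f, schwartz f ->
    cintegrable setT (fun x => h x * f x) /\
    u f = cintegral setT (fun x => h x * f x).

Definition linear_S_to_S' (T : (E -> C) -> (E -> C) -> C) :=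
  (forall f, schwartz f -> tempered_distribution (T f)) /\
  (forall (a : C) f g h, schwartz f -> schwartz g -> schwartz h ->
     T (fun x => a * f x + g x) h = a * T f h + T g h).

(* An operator given on representatives of the classes of L^p, and linear
   modulo equality almost everywhere. *)
Definition ae_linear_on_Lp (p : R) (S : (E -> C) -> (E -> C)) :=
  forall (a : C) f g, in_Lp p f -> in_Lp p g ->
    {ae leb R n, forall x, S (fun y => a * f y + g y) x = a * S f x + S g x}.

Definition L2_extension (T : (E -> C) -> (E -> C) -> C)
    (S : (E -> C) -> (E -> C)) :=
  [/\ ae_linear_on_Lp 2 S,
      forall f, in_Lp 2 f -> in_Lp 2 (S f),
      exists A : R, forall f, in_Lp 2 f ->
        (Lpnorm 2 (S f) <= A%:E * Lpnorm 2 f)%E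
    & forall f, schwartz f -> is_function (T f) (S f)].

Definition weak11_extension (T : (E -> C) -> (E -> C) -> C)
    (S : (E -> C) -> (E -> C)) :=
  [/\ ae_linear_on_Lp 1 S,
      forall f, in_Lp 1 f -> cmeasurable setT (S f),
      exists A : R, forall f (t : R), in_Lp 1 f -> 0 < t ->
        (t%:E * leb R n [set x | (t < normc (S f x))%R] <= A%:E * Lpnorm 1 f)%E
    & forall f, schwartz f -> is_function (T f) (S f)].

Definition dini (theta : R -> R) :=
  [/\ forall t, 0 < t -> 0 <= theta t,
      forall t1 t2, 0 < t1 -> t1 <= t2 -> theta t1 <= theta t2
    & (\int[lebesgue_measure]_(t in `]0%R, 1%R[) (theta t / t)%:E < +oo)%E].

Definition theta_kernel (theta : R -> R) (K : E -> E -> C) :=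
  cmeasurable [set z : E * E | z.1 != z.2] (fun z => K z.1 z.2) /\
  exists2 A : R, 0 < A &
    (forall x y, x != y -> normc (K x y) <= A * enorm (x - y) ^- n) /\
    (* theta is a function on (0, oo), whence x != z; the left-hand side is 0
       when x = z *)
    (forall x y z, x != z -> enorm (x - z) < enorm (x - y) / 2 ->
       normc (K x y - K z y) + normc (K y x - K y z) <=
       A * enorm (x - y) ^- n * theta (enorm (x - z) / enorm (x - y))).

(* T f is an element of L^2, so its values off the support of f make sense
   almost everywhere. *)
Record theta_CZ_operator (theta : R -> R) (T : (E -> C) -> (E -> C) -> C)
    (K : E -> E -> C) : Prop := ThetaCZ {
  CZ_linear : linear_S_to_S' T ;
  CZ_L2 : exists S, L2_extension T S ;
  CZ_kernel : theta_kernel theta K ;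
  CZ_repr : forall f h, Cc_infty f -> is_function (T f) h ->
    {ae leb R n, forall x, ~ support_of f x ->
       h x = cintegral setT (fun y => K x y * f y)} }.

(* h = T f for f in a Morrey space. By density of the Schwartz functions in L^1
   the extension S of T is unique modulo equality almost everywhere; f \1_B2 is
   in L^1 as f is locally integrable. *)
Definition is_CZ_image (T : (E -> C) -> (E -> C) -> C) (K : E -> E -> C) f h :=
  cmeasurable setT h /\
  exists2 S, weak11_extension T S &
    forall (c : E) (r : R), 0 < r ->
      let B2 := eball c (2 * r) in
      {ae leb R n, forall x, eball c r x ->
         cintegrable (~` B2) (fun y => K x y * f y) /\
         h x = S (fun y => f y * \1_B2 y) x +
               cintegral (~` B2) (fun y => K x y * f y)}.

Definition weight (w : E -> R) :=
  locally_integrable_on_Rn (fun x => (w x)%:C%C) /\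
  {ae leb R n, forall x, 0 < w x}.

Definition mean (B : set E) (g : E -> R) : \bar R :=
  ((fine (leb R n B))^-1%:E * \int[leb R n]_(x in B) (g x)%:E)%E.

Definition Muckenhoupt (p : R) (w : E -> R) :=
  weight w /\
  let p' := (1 - p^-1)^-1 in
  exists2 A : R, 0 < A & forall (c : E) (r : R), 0 < r ->
    (mean (eball c r) w `^ p^-1 *
     mean (eball c r) (fun x => powR (w x) (- (p' / p))) `^ p'^-1 <= A%:E)%E.

Definition D_condition (kappa : R) (psi : R -> R) :=
  [/\ forall t, 0 < t -> 0 < psi t,
      forall t1 t2, 0 < t1 -> t1 <= t2 -> psi t1 <= psi t2
    & exists2 A : R, 0 < A & forall t1 t2, 0 < t1 -> t1 < t2 ->
        psi t2 / powR t2 kappa <= A * (psi t1 / powR t1 kappa)].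

Definition Morrey_norm (p : R) (psi : R -> R) (w : E -> R) f : \bar R :=
  ereal_sup [set v | exists (c : E) (r : R), 0 < r /\
    let B := eball c r in
    v = (((psi (\int[leb R n]_(x in B) w x)%R)^-1%:E *
          \int[leb R n]_(x in B) (powR (normc (f x)) p * w x)%:E) `^ p^-1)%E].

Definition in_Morrey (p : R) (psi : R -> R) (w : E -> R) f :=
  locally_integrable_on_Rn f /\ (Morrey_norm p psi w f < +oo)%E.

End functions_on_Rn.

(* Main.v *)
(* On a ball B, T f is split into T (f 1_2B) and the integral of K f off 2B.

   Tail: on each dyadic annulus around B, Hölder's inequality and the A_p condition bound
   the integral by N (psi (w B_k) / w B_k)^(1/p), where N is the Morrey norm of f and
   B_k = 2^k B.  As psi (t) / t decays like t^(kappa - 1) and w B_k grows geometrically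
   in k (reverse doubling), these bounds sum to a multiple of N (psi (w B) / w B)^(1/p).

   Local part: T is bounded on L^p(w).  The Calderón-Zygmund decomposition gives the weak
   type (1,1), on dyadic step functions first, and then on L^1 by density.  Following
   Lerner, T F is dominated pointwise on a cube by a sum of averages of |F| over triples of
   dyadic cubes, each of which owns a disjoint part of at least half its measure; the sum
   is bounded on L^p(w) by duality and by a dyadic maximal inequality for the doubling
   weights w and w^(-p'/p). *)

Require Import Defs.
From HB Require Import structures.
From mathcomp Require Import all_boot all_order all_algebra.
From mathcomp Require Import all_classical all_reals all_analysis.
From mathcomp Require Import measurable_realfun.
From mathcomp Require Import complex ring lra.

Set Implicit Arguments.
Unset Strict Implicit.
Unset Printing Implicit Defensive.

Import Order.TTheory GRing.Theory Num.Theory.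
Import numFieldNormedType.Exports.
Import Normc.

Local Open Scope classical_set_scope.
Local Open Scope ring_scope.

(* The operator is known only through the distributions [T f], its L^2 extension and a kernel
   formula off the support of smooth functions. Its properties on rougher functions are transported
   from bumps to cubes, step functions and L^1 by one argument: images converge in measure, kernel
   integrals converge pointwise, so the limits agree almost everywhere. An image of f may be built
   with any weak type extension, hence all of them are shown to agree almost everywhere; and the
   kernel formula is extended to L^1 functions vanishing near x, so that the values given by
   different balls glue. With dyadic step functions the Calderón-Zygmund decomposition is a finite
   induction, and a density argument on dyadic cubes takes the place of Lebesgue differentiation. In
   the sparse domination one good point per selected cube, together with the oscillation of the
   kernel summed by the Dini condition, replaces a maximal truncation of T. The weighted sums run
   over finite families, so that the quantity to be bounded is finite and part of it can be
   absorbed. *)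
Reserved Notation "\nint [ mu ]_ ( x 'in' A ) F"
  (at level 36, F at level 36, mu at level 10, x, A at level 50,
   format "'[' \nint [ mu ]_ ( x  'in'  A ) '/  '  F ']'").
Notation "\nint [ mu ]_ ( x 'in' A ) F" :=
  (integral mu A (fun x => EFin F%R)).

(** * Integrals of nonnegative measurable real functions *)

Section nonneg_integrals.
Context d (T : measurableType d) (R : realType) (mu : {measure set T -> \bar R}).
Implicit Types (A B : set T) (f g h : T -> R).

(** Measurability on the whole space and nonnegativity everywhere travel together: the integral
    lemmas below then have a single premise per function, whatever the domain of integration. *)
Definition nnm f := measurable_fun setT f /\ forall x, 0 <= f x.

Lemma nnm_cst c : 0 <= c -> nnm (fun=> c).
Proof. by split=> //; exact: measurable_cst. Qed.

Lemma nnmD f g : nnm f -> nnm g -> nnm (fun x => f x + g x).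
Proof.
move=> [mf f0] [mg g0]; split; first exact: measurable_funD.
by move=> x; exact: addr_ge0.
Qed.

Lemma nnmM f g : nnm f -> nnm g -> nnm (fun x => f x * g x).
Proof.
move=> [mf f0] [mg g0]; split; first exact: measurable_funM.
by move=> x; exact: mulr_ge0.
Qed.

Lemma nnmZ c f : 0 <= c -> nnm f -> nnm (fun x => c * f x).
Proof. by move=> c0 nf; apply: nnmM => //; exact: nnm_cst. Qed.

Lemma nnm_indic A : measurable A -> nnm (\1_A : T -> R).
Proof. by move=> mA; split=> // x; rewrite indicE. Qed.

Lemma nnm_sum (I : Type) (s : seq I) (F : I -> T -> R) :
  (forall i, nnm (F i)) -> nnm (fun x => \sum_(i <- s) F i x).
Proof.
move=> nF; split.
  rewrite (_ : (fun _ => _) = \sum_(i <- s) F i); last first.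
    by apply/funext => x; rewrite fct_sumE.
  elim: s => [|i s IH]; first by rewrite big_nil; exact: measurable_cst.
  rewrite big_cons; apply: measurable_funD => //; exact: (nF i).1.
by move=> x; apply: sumr_ge0 => i _; exact: (nF i).2.
Qed.

Lemma nnm_powR f (p : R) : nnm f -> nnm (fun x => f x `^ p).
Proof.
move=> [mf f0]; split; last by move=> x; exact: powR_ge0.
by apply: (measurableT_comp (measurable_powR p)).
Qed.

Lemma nnm_norm f : measurable_fun setT f -> nnm (fun x => `|f x|).
Proof. by move=> mf; split=> //; apply: (measurableT_comp (@normr_measurable _ _)). Qed.

Lemma nnm_EFin f A : nnm f -> measurable_fun A (EFin \o f).
Proof. by move=> [mf _]; apply/measurable_EFinP; exact: measurable_funTS. Qed.

Lemma nint_ge0 A f : nnm f -> (0 <= \nint[mu]_(x in A) (f x))%E.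
Proof. by move=> [_ f0]; apply: integral_ge0 => x _; rewrite lee_fin. Qed.

Lemma nint_le A f g : measurable A -> nnm f -> nnm g ->
  (forall x, A x -> f x <= g x) ->
  (\nint[mu]_(x in A) (f x) <= \nint[mu]_(x in A) (g x))%E.
Proof.
move=> mA nf ng fg; apply: ge0_le_integral => //; try exact: nnm_EFin.
- by move=> x _; rewrite lee_fin nf.2.
Qed.

Lemma nint_ae_le A f g : measurable A -> nnm f -> nnm g ->
  {ae mu, forall x, A x -> f x <= g x} ->
  (\nint[mu]_(x in A) (f x) <= \nint[mu]_(x in A) (g x))%E.
Proof.
move=> mA nf ng fg; apply: ae_ge0_le_integral => //; try exact: nnm_EFin.
- by move=> x _; rewrite lee_fin nf.2.
- by move=> x _; rewrite lee_fin ng.2.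
Qed.

Lemma nint_ae_eq A f g : measurable A -> nnm f -> nnm g ->
  {ae mu, forall x, A x -> f x = g x} ->
  \nint[mu]_(x in A) (f x) = \nint[mu]_(x in A) (g x).
Proof.
move=> mA nf ng fg; apply/eqP; rewrite eq_le; apply/andP; split;
  apply: nint_ae_le => //; apply: filterS fg => x fg Ax; by rewrite fg.
Qed.

Lemma nint_sub A B f : measurable A -> measurable B -> nnm f -> A `<=` B ->
  (\nint[mu]_(x in A) (f x) <= \nint[mu]_(x in B) (f x))%E.
Proof.
move=> mA mB nf AB; apply: ge0_subset_integral => //; first exact: nnm_EFin.
by move=> x _; rewrite lee_fin nf.2.
Qed.

Lemma nintU A B f : measurable A -> measurable B -> nnm f -> A `&` B = set0 ->
  \nint[mu]_(x in A `|` B) (f x) =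
  (\nint[mu]_(x in A) (f x) + \nint[mu]_(x in B) (f x))%E.
Proof.
move=> mA mB nf AB; apply: ge0_integral_setU => //; first exact: nnm_EFin.
  by move=> x _; rewrite lee_fin nf.2.
by apply/disj_setPS; rewrite AB.
Qed.

Lemma nintD A f g : measurable A -> nnm f -> nnm g ->
  \nint[mu]_(x in A) (f x + g x) =
  (\nint[mu]_(x in A) (f x) + \nint[mu]_(x in A) (g x))%E.
Proof.
move=> mA nf ng; under eq_integral do rewrite EFinD.
apply: ge0_integralD => //; try exact: nnm_EFin.
  by move=> x _; rewrite lee_fin nf.2.
by move=> x _; rewrite lee_fin ng.2.
Qed.

Lemma nintZ A f c : measurable A -> nnm f -> 0 <= c ->
  \nint[mu]_(x in A) (c * f x) = (c%:E * \nint[mu]_(x in A) (f x))%E.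
Proof.
move=> mA nf c0; under eq_integral do rewrite EFinM.
apply: ge0_integralZl_EFin => //; last exact: nnm_EFin.
by move=> x _; rewrite lee_fin nf.2.
Qed.

Lemma nint_cst A c : measurable A ->
  \nint[mu]_(x in A) c = (c%:E * mu A)%E.
Proof. by move=> mA; rewrite integral_cst. Qed.

Lemma nint_sum (I : Type) (s : seq I) A (F : I -> T -> R) : measurable A ->
  (forall i, nnm (F i)) ->
  \nint[mu]_(x in A) (\sum_(i <- s) F i x) =
  (\sum_(i <- s) \nint[mu]_(x in A) (F i x))%E.
Proof.
move=> mA nF; under eq_integral do rewrite -sumEFin.
apply: ge0_integral_sum => //.
- by move=> i; exact: nnm_EFin.
- by move=> i x _; rewrite lee_fin (nF i).2.
Qed.

Lemma nint_indic A B f : measurable A -> measurable B -> nnm f ->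
  \nint[mu]_(x in A) (f x * \1_B x) = \nint[mu]_(x in A `&` B) (f x).
Proof.
move=> mA mB nf; rewrite [RHS]integral_mkcondr; apply: eq_integral => x _.
by rewrite epatch_indic EFinM.
Qed.

Lemma nint_chebyshev A f (t : R) : measurable A -> nnm f -> 0 <= t ->
  (t%:E * mu (A `&` [set x | (t <= f x)%R]) <= \nint[mu]_(x in A) (f x))%E.
Proof.
move=> mA nf t0.
have mB : measurable (A `&` [set x | t <= f x]).
  rewrite (_ : [set x | t <= f x] = f @^-1` `[t, +oo[).
    by apply: measurable_funTS => //; exact: nf.1.
  by apply/seteqP; split => x /=; rewrite in_itv/= andbT.
rewrite -nint_cst//; apply: (@le_trans _ _
   (\nint[mu]_(x in A `&` [set x | (t <= f x)%R]) (f x))%E).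
  by apply: (@nint_le _ (fun=> t) f) => // x [].
by apply: nint_sub => // x [].
Qed.

Lemma measurable_gt f (t : R) : measurable_fun setT f -> measurable [set x | t < f x].
Proof.
move=> mf; rewrite (_ : [set x | t < f x] = f @^-1` `]t, +oo[).
  by rewrite -[X in measurable X]setTI; exact: mf.
by apply/seteqP; split => x /=; rewrite in_itv/= andbT.
Qed.

(** The union is made disjoint by [seqDU], each piece of which lies in the corresponding set. *)
Lemma nint_bigcup_le (F : (set T)^nat) f : (forall k, measurable (F k)) ->
  nnm f ->
  (\nint[mu]_(x in \bigcup_k F k) (f x) <=
   \sum_(0 <= k <oo) \nint[mu]_(x in F k) (f x))%E.
Proof.
move=> mF nf.
have mS k : measurable (seqDU F k).
  by apply: measurableD => //; exact: bigsetU_measurable.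
rewrite seqDU_bigcup_eq ge0_integral_bigcup//.
- apply: lee_nneseries => k _; first by move=> _; exact: nint_ge0.
  by apply: nint_sub => //; exact: subset_seqDU.
- exact: nnm_EFin.
- by move=> x _; rewrite lee_fin nf.2.
Qed.

End nonneg_integrals.

(** * The modulus of a complex number *)

Section complex_norm.
Context (R : realType).
Implicit Types (z : R[i]).

Lemma normc_ge0 z : 0 <= normc z.
Proof. by case: z => a b /=; exact: sqrtr_ge0. Qed.

Lemma Re_le_normc z : `|complex.Re z| <= normc z.
Proof.
case: z => a b /=; rewrite -sqrtr_sqr ler_wsqrtr// lerDl; exact: sqr_ge0.
Qed.

Lemma Im_le_normc z : `|complex.Im z| <= normc z.
Proof.
case: z => a b /=; rewrite -sqrtr_sqr ler_wsqrtr// lerDr; exact: sqr_ge0.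
Qed.

Lemma normc_le_ReIm z : normc z <= `|complex.Re z| + `|complex.Im z|.
Proof.
case: z => a b /=; rewrite -[leRHS]ger0_norm ?addr_ge0// -sqrtr_sqr.
apply: ler_wsqrtr; rewrite sqrrD !real_normK ?num_real// -addrA lerD2l.
by rewrite lerDr mulrn_wge0// mulr_ge0.
Qed.

Lemma normc_triangle z1 z2 : normc (z1 + z2) <= normc z1 + normc z2.
Proof. exact: le_normcD. Qed.

Lemma normc_opp z : normc (- z) = normc z.
Proof. by case: z => a b /=; rewrite !sqrrN. Qed.

Lemma normc_sub z1 z2 : normc (z1 - z2) <= normc z1 + normc z2.
Proof. by rewrite -(normc_opp z2); exact: normc_triangle. Qed.

Lemma normc_real (a : R) : normc (a%:C)%C = `|a|.
Proof. by rewrite /= expr0n addr0 sqrtr_sqr. Qed.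

Lemma normc_distC z1 z2 : normc (z1 - z2) = normc (z2 - z1).
Proof. by rewrite -normc_opp opprB. Qed.

End complex_norm.

(** * Cubes, their children and triples; the Euclidean norm *)

Section cubes.
Context (R : realType) (n : nat).
Local Notation E := 'rV[R]_n.
Local Notation mu := (leb R n).
Implicit Types (a x y c : E) (s r : R).

(** Half-open, so that the [2 ^ n] children partition the cube exactly and not only up to a null
    set. *)
Definition cube a s : set E :=
  [set x | forall i, a ord0 i <= x ord0 i < a ord0 i + s].

Lemma measurable_cube a s : measurable (cube a s).
Proof.
apply: (measurable_box (A := fun i => `[a ord0 i, a ord0 i + s[%classic)).
by move=> i; exact: measurable_itv.
Qed.

Lemma leb_cube a s : 0 <= s -> mu (cube a s) = (s ^+ n)%:E.
Proof.
move=> s0; rewrite /cube.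
have := @leb_box R n (fun i => `[a ord0 i, a ord0 i + s[%classic)
  (fun i => measurable_itv _).
rewrite (_ : [set x | _] = [set x | forall i : 'I_n, a ord0 i <= x ord0 i < a ord0 i + s]).
  move=> ->; rewrite (eq_bigr (fun=> s%:E)); last first.
    move=> i _; rewrite lebesgue_measure_itv/= lte_fin ltrDl.
    case: ltP => [_|s0']; first by rewrite -EFinD addrAC subrr add0r.
    by congr EFin; apply/eqP; rewrite eq_le s0 s0'.
  by rewrite -(big_morph EFin (@EFinM R) erefl) prodr_const card_ord.
by apply/seteqP; split => x /= xA i; have := xA i; rewrite in_itv/=.
Qed.

Definition child a s (e : {ffun 'I_n -> bool}) : E :=
  \row_i (a ord0 i + s / 2 * (e i)%:R).

Lemma childE a s e i : child a s e ord0 i = a ord0 i + s / 2 * (e i)%:R.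
Proof. by rewrite mxE. Qed.

Lemma child_sub a s e : 0 <= s -> cube (child a s e) (s / 2) `<=` cube a s.
Proof.
move=> s0 x xe i; have := xe i; rewrite childE.
by case: (e i) => /= /andP[? ?]; apply/andP; split; lra.
Qed.

Lemma child_cover a s x : cube a s x ->
  cube (child a s [ffun i => a ord0 i + s / 2 <= x ord0 i]) (s / 2) x.
Proof.
move=> xa i; have := xa i; rewrite childE ffunE.
have [H|H] := leP (a ord0 i + s / 2) (x ord0 i);
  by move=> /andP[? ?]; apply/andP; split; rewrite ?mulr1 ?mulr0; lra.
Qed.

Lemma child_inj a s e e' x :
  cube (child a s e) (s / 2) x -> cube (child a s e') (s / 2) x -> e = e'.
Proof.
move=> xe xe'; apply/ffunP => i; have := xe i; have := xe' i; rewrite !childE.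
by case: (e i); case: (e' i) => //= /andP[? ?] /andP[? ?]; exfalso; lra.
Qed.

Lemma cube_children a s : 0 <= s ->
  cube a s = \big[setU/set0]_e cube (child a s e) (s / 2).
Proof.
move=> s0; apply/seteqP; split => [x xa|x].
  by rewrite -bigcup_seq; exists [ffun i => a ord0 i + s / 2 <= x ord0 i];
    [rewrite /= mem_index_enum|exact: child_cover].
by rewrite -bigcup_seq => -[e _]; exact: child_sub.
Qed.

Lemma nint_children a s (f : E -> R) : 0 <= s -> nnm f ->
  \nint[mu]_(x in cube a s) (f x) =
  (\sum_e \nint[mu]_(x in cube (child a s e) (s / 2)) (f x))%E.
Proof.
move=> s0 nf; rewrite cube_children// ge0_integral_bigsetU//.
- by move=> e; exact: measurable_cube.
- exact: index_enum_uniq.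
- by move=> e e' _ _ [x [xe xe']]; exact: child_inj xe xe'.
- exact: nnm_EFin.
- by move=> x _; rewrite lee_fin nf.2.
Qed.

(** The cube with the same centre and three times the side; being a [cube], it inherits
    measurability and volume. *)
Definition triple a s : set E := cube (\row_i (a ord0 i - s)) (3 * s).

Lemma tripleP a s x :
  triple a s x <-> forall i, a ord0 i - s <= x ord0 i < a ord0 i + 2 * s.
Proof.
by split => xa i; have := xa i; rewrite mxE => /andP[? ?]; apply/andP; split; lra.
Qed.

Lemma measurable_triple a s : measurable (triple a s).
Proof. exact: measurable_cube. Qed.

Lemma leb_triple a s : 0 <= s -> mu (triple a s) = ((3 * s) ^+ n)%:E.
Proof. by move=> s0; rewrite leb_cube// mulr_ge0. Qed.

Lemma cube_sub_triple a s : 0 <= s -> cube a s `<=` triple a s.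
Proof.
move=> s0 x xa; apply/tripleP => i; have := xa i => /andP[? ?].
by apply/andP; split; lra.
Qed.

Lemma triple_child a s e : 0 <= s ->
  triple (child a s e) (s / 2) `<=` triple a s.
Proof.
move=> s0 x /tripleP xa; apply/tripleP => i; have := xa i; rewrite childE.
by case: (e i) => /= /andP[? ?]; apply/andP; split; lra.
Qed.

Lemma cube_meet_triple a s a' s' : s' <= s ->
  cube a s `&` cube a' s' !=set0 -> cube a' s' `<=` triple a s.
Proof.
move=> ss [y [ya ya']] x xa'; apply/tripleP => i.
by have := ya i; have := ya' i; have := xa' i => /andP[? ?] /andP[? ?] /andP[? ?];
  apply/andP; split; lra.
Qed.

Lemma enorm_ge0 x : 0 <= enorm x.
Proof. exact: sqrtr_ge0. Qed.

Lemma sum_sqr_ge0 x : 0 <= \sum_i x ord0 i ^+ 2.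
Proof. by apply: sumr_ge0 => i _; exact: sqr_ge0. Qed.

Lemma enormK x : enorm x ^+ 2 = \sum_i x ord0 i ^+ 2.
Proof. by rewrite sqr_sqrtr// sum_sqr_ge0. Qed.

Lemma coord_le_enorm x i : `|x ord0 i| <= enorm x.
Proof.
rewrite -sqrtr_sqr ler_wsqrtr// (bigD1 i)//= lerDl.
by apply: sumr_ge0 => j _; exact: sqr_ge0.
Qed.

(** The factor [n] bounds the square root of [n]. In dimension 0 the premise is empty and [r] may be
    negative, whence the separate case. *)
Lemma enorm_le x r : (forall i, `|x ord0 i| <= r) -> enorm x <= n%:R * r.
Proof.
move=> xr; have [n0|n0] := posnP n.
  rewrite /enorm big1 ?sqrtr0 ?n0 ?mul0r// => i.
  by move: (ltn_ord i); rewrite {2}n0.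
have r0 : 0 <= r by apply: le_trans (xr (Ordinal n0)).
rewrite -[leRHS]ger0_norm ?mulr_ge0// -sqrtr_sqr ler_wsqrtr//.
rewrite (@le_trans _ _ (\sum_(i < n) r ^+ 2))//.
  by apply: ler_sum => i _; rewrite -[_ ^+ 2]real_normK ?num_real// lerXn2r ?nnegrE.
rewrite sumr_const card_ord -[_ *+ n]mulr_natl exprMn.
apply: ler_wpM2r; first exact: sqr_ge0.
by rewrite -natrX ler_nat -{1}(expn1 n) leq_pexp2l.
Qed.

Lemma enormN x : enorm (- x) = enorm x.
Proof. by congr Num.sqrt; apply: eq_bigr => i _; rewrite mxE sqrrN. Qed.

Lemma enorm_sub x y : enorm (x - y) = enorm (y - x).
Proof. by rewrite -enormN opprB. Qed.

Lemma enorm_eq0 x : enorm x = 0 -> x = 0.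
Proof.
move=> x0; apply/rowP => i; rewrite mxE; apply/eqP.
by rewrite -normr_le0 -x0 coord_le_enorm.
Qed.

Lemma enorm_gt0 x y : x != y -> 0 < enorm (x - y).
Proof.
move=> xy; rewrite lt_neqAle enorm_ge0 andbT eq_sym.
by apply: contra xy => /eqP /enorm_eq0 /eqP; rewrite subr_eq0.
Qed.

(** Cauchy-Schwarz is summed from [x_i y_i <= (|y| / |x| x_i^2 + |x| / |y| y_i^2) / 2], which
    divides by both norms: the cases where one of them is 0 come before. *)
Lemma enormD x y : enorm (x + y) <= enorm x + enorm y.
Proof.
have [/enorm_eq0->|x0] := eqVneq (enorm x) 0.
  by rewrite add0r lerDr enorm_ge0.
have [/enorm_eq0->|y0] := eqVneq (enorm y) 0.
  by rewrite addr0 lerDl enorm_ge0.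
have {}x0 : 0 < enorm x by rewrite lt_neqAle eq_sym x0 enorm_ge0.
have {}y0 : 0 < enorm y by rewrite lt_neqAle eq_sym y0 enorm_ge0.
rewrite -(ler_pXn2r (ltn0Sn 1)) ?nnegrE ?addr_ge0 ?enorm_ge0//.
rewrite sqrrD !enormK.
suff : \sum_i x ord0 i * y ord0 i <= enorm x * enorm y.
  move=> H; rewrite (eq_bigr (fun i => x ord0 i ^+ 2 + (2 * (x ord0 i * y ord0 i) + y ord0 i ^+ 2))); last first.
    by move=> i _; rewrite mxE sqrrD -addrA mulr2n mulrDl mul1r.
  rewrite !big_split/= -mulr_sumr -addrA lerD2l lerD2r mulr2n; lra.
have key i : x ord0 i * y ord0 i <=
    2^-1 * (enorm y / enorm x * x ord0 i ^+ 2 + enorm x / enorm y * y ord0 i ^+ 2).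
  have H := sqr_ge0 (enorm y * x ord0 i - enorm x * y ord0 i).
  rewrite -(ler_pM2l (mulr_gt0 x0 y0)).
  rewrite [leRHS](_ : _ = 2^-1 * (enorm y ^+ 2 * x ord0 i ^+ 2 + enorm x ^+ 2 * y ord0 i ^+ 2)); last first.
    by field; rewrite !gt_eqF.
  move: H; rewrite sqrrB; nra.
apply: (le_trans (ler_sum _ (fun i _ => key i))).
rewrite -mulr_sumr big_split/= -!mulr_sumr -!enormK.
rewrite le_eqVlt; apply/orP; left; apply/eqP.
by field; rewrite !gt_eqF.
Qed.

Lemma enorm_dist_triangle y x z : enorm (x - z) <= enorm (x - y) + enorm (y - z).
Proof. by rewrite -[x - z](subrKA y) enormD. Qed.

Lemma measurable_enorm c : measurable_fun setT (fun x : E => enorm (x - c)).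
Proof.
have H : measurable_fun setT (fun x : E => \sum_i (x - c) ord0 i ^+ 2).
  rewrite (_ : (fun _ => _) = \sum_i (fun x : E => (x - c) ord0 i ^+ 2)); last first.
    by apply/funext => x; rewrite fct_sumE.
  elim/big_ind: _ => [|f g mf mg|i _]; first exact: measurable_cst.
    exact: measurable_funD.
  apply: measurable_funX.
  under eq_fun do rewrite !mxE.
  by apply: measurable_funB; [exact: measurable_coord|exact: measurable_cst].
have S : measurable_fun setT (@Num.sqrt R).
  by apply: continuous_measurable_fun => x; exact: sqrt_continuous.
exact: (measurableT_comp S H).
Qed.

Lemma measurable_eball c r : measurable (eball c r).
Proof.
rewrite (_ : eball c r = (fun x => enorm (x - c)) @^-1` `]-oo, r[).
  by rewrite -[X in measurable X]setTI; apply: measurable_enorm.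
by apply/seteqP; split => x /=; rewrite in_itv.
Qed.

Lemma eball_sub_cube c r : eball c r `<=` cube (\row_i (c ord0 i - r)) (2 * r).
Proof.
move=> x xc i; rewrite mxE.
have := le_lt_trans (coord_le_enorm (x - c) i) xc; rewrite !mxE ltr_norml.
by move=> /andP[? ?]; apply/andP; split; lra.
Qed.

Lemma cube_sub_eball a s : (0 < n)%N -> 0 < s ->
  cube a s `<=` eball (\row_i (a ord0 i + s / 2)) (n%:R * s).
Proof.
move=> n0 s0 x xa; apply: (@le_lt_trans _ _ (n%:R * (s / 2))).
  apply: enorm_le => i; rewrite !mxE ler_norml; have /andP[? ?] := xa i.
  by apply/andP; split; lra.
by rewrite ltr_pM2l ?ltr0n//; lra.
Qed.

End cubes.

(** * Dominated convergence for real functions *)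

Section convergence_tools.
Context d (T : measurableType d) (R : realType) (mu : {measure set T -> \bar R}).
Implicit Types (A : set T) (f g : T -> R).

Lemma cvge0_lt (u : (\bar R)^nat) (e : R) : u @ \oo --> 0%E -> 0 < e ->
  exists N, forall k, (N <= k)%N -> (u k < e%:E)%E.
Proof.
move=> u0 e0; have /u0 [N _ uN] : nbhs (0%E : \bar R) [set y | (y < e%:E)%E].
  by apply: open_ereal_lt'; rewrite lte_fin.
by exists N => k Nk; exact: uN.
Qed.

Lemma cvg_EFinP (u : R^nat) (l : R) : u @ \oo --> l ->
  (EFin \o u) @ \oo --> l%:E.
Proof. by move=> ul; apply/fine_cvgP; split => //; exact: nearW. Qed.

Lemma dominated_cvg_nint A (f_ : (T -> R)^nat) f g : measurable A ->
  (forall k, measurable_fun setT (f_ k)) -> measurable_fun setT f -> nnm g ->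
  (\nint[mu]_(x in A) (g x) < +oo)%E ->
  {ae mu, forall x, A x -> f_ ^~ x @ \oo --> f x} ->
  {ae mu, forall x, A x -> forall k, `|f_ k x| <= g x} ->
  (fun k => \nint[mu]_(x in A) `|f_ k x - f x|) @ \oo --> 0%E.
Proof.
move=> mA mf_ mf ng goo cf dom.
have ig : mu.-integrable A (EFin \o g).
  apply/integrableP; split; first exact: nnm_EFin.
  apply: le_lt_trans goo; rewrite le_eqVlt; apply/orP; left; apply/eqP.
  by apply: eq_integral => x _ /=; rewrite ger0_norm// ng.2.
have [] := @dominated_convergence _ _ _ mu A mA (fun k => EFin \o f_ k)
  (EFin \o f) (EFin \o g) _ _ _ ig.
- by move=> k; apply/measurable_EFinP; exact: measurable_funTS.
- by apply/measurable_EFinP; exact: measurable_funTS.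
- apply: filterS cf => x cx Ax; apply: cvg_EFinP; exact: cx.
- apply: filterS dom => x dx k Ax /=; rewrite lee_fin; exact: dx.
by move=> _ + _.
Qed.

Lemma bounded_cvg_nint A (f_ : (T -> R)^nat) f (M : R) : measurable A ->
  (mu A < +oo)%E -> (forall k, measurable_fun setT (f_ k)) ->
  measurable_fun setT f -> (forall x, A x -> f_ ^~ x @ \oo --> f x) ->
  (forall x k, A x -> `|f_ k x| <= M) ->
  (fun k => \nint[mu]_(x in A) `|f_ k x - f x|) @ \oo --> 0%E.
Proof.
move=> mA Aoo mf_ mf cf dom.
(* When [A] is empty [M] may be negative, whence the maximum with 0. *)
apply: (@dominated_cvg_nint A f_ f (fun=> Num.max M 0)) => //.
- by apply: nnm_cst; rewrite le_max lexx orbT.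
- rewrite nint_cst// lte_mul_pinfty// ?lee_fin ?le_max ?lexx ?orbT//.
- exact: aeW.
- by apply: aeW => x Ax k; rewrite le_max dom.
Qed.

End convergence_tools.

(** * Dyadic step functions *)

Section step_functions.
Import HBSimple.
Context (R : realType) (n : nat).
Local Notation E := 'rV[R]_n.
Local Notation mu := (leb R n).
Local Notation D := {ffun 'I_n -> bool}.
Implicit Types (a x y : E) (s r : R) (h g : E -> R) (A : set E).

(** The functions that are constant on the dyadic subcubes of generation [N] of [cube a s] and 0
    outside. The recursion through the children turns statements about them into inductions on the
    depth, with no indexing of the subcubes. *)
Fixpoint step N a s h : Prop :=
  if N is N'.+1 then
    exists k : D -> E -> R, (forall e, step N' (child a s e) (s / 2) (k e)) /\
      h = (fun x => \sum_e k e x)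
  else exists c, h = (fun x => c * \1_(cube a s) x).

Lemma halfr_ge0 s : 0 <= s -> 0 <= s / 2.
Proof. by move=> s0; rewrite divr_ge0. Qed.

Lemma halfr_gt0 s : 0 < s -> 0 < s / 2.
Proof. by move=> s0; rewrite divr_gt0. Qed.

Lemma step_supp N a s h x : 0 <= s -> step N a s h -> ~ cube a s x -> h x = 0.
Proof.
elim: N a s h => [|N IH] a s h s0 /=.
  by move=> [c ->] xa; rewrite indicE memNset// mulr0.
move=> [k [ks ->]] xa; rewrite big1// => e _.
by apply: (IH _ _ _ (halfr_ge0 s0) (ks e)) => /(child_sub s0); exact.
Qed.

Lemma step_zero N a s : step N a s (fun=> 0).
Proof.
elim: N a s => [|N IH] a s /=; first by exists 0; apply/funext => x; rewrite mul0r.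
by exists (fun _ _ => 0); split => //; apply/funext => x; rewrite big1.
Qed.

(** At each point at most one child contributes to the sum, so that [phi] may be applied child by
    child; [phi 0 0 = 0] keeps the result 0 outside the cube. *)
Lemma step_comp2 N a s h g (phi : R -> R -> R) : 0 <= s -> phi 0 0 = 0 ->
  step N a s h -> step N a s g -> step N a s (fun x => phi (h x) (g x)).
Proof.
move=> + phi0; elim: N a s h g => [|N IH] a s h g s0 /=.
  move=> [c ->] [c' ->]; exists (phi c c'); apply/funext => x; rewrite indicE.
  by case: (x \in _); rewrite ?mulr1 ?mulr0.
move=> [k [ks ->]] [l [ls ->]]; exists (fun e x => phi (k e x) (l e x)); split.
  by move=> e; apply: IH => //; exact: halfr_ge0.
apply/funext => x.
have kS e y : ~ cube (child a s e) (s / 2) y -> k e y = 0.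
  by move/(step_supp (halfr_ge0 s0) (ks e)).
have lS e y : ~ cube (child a s e) (s / 2) y -> l e y = 0.
  by move/(step_supp (halfr_ge0 s0) (ls e)).
have [xa|xa] := pselect (cube a s x); last first.
  have xe e : ~ cube (child a s e) (s / 2) x by move/(child_sub s0); exact.
  by rewrite !big1// => e _; rewrite ?kS ?lS.
set e0 : D := [ffun i => a ord0 i + s / 2 <= x ord0 i].
have xe e : e != e0 -> ~ cube (child a s e) (s / 2) x.
  move=> ee0 /child_inj /(_ (child_cover xa)) ee; move: ee0.
  by rewrite ee eqxx.
rewrite (@big_only1 _ _ _ _ e0)//; last by move=> e ee0 _; rewrite kS//; exact: xe.
rewrite (@big_only1 _ _ _ _ e0)//; last by move=> e ee0 _; rewrite lS//; exact: xe.
rewrite (@big_only1 _ _ _ _ e0)// => e ee0 _; rewrite kS ?lS//; exact: xe.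
Qed.

Lemma step_comp N a s h (phi : R -> R) : 0 <= s -> phi 0 = 0 ->
  step N a s h -> step N a s (fun x => phi (h x)).
Proof.
by move=> s0 phi0 sh; exact: (@step_comp2 N a s h h (fun u _ => phi u)).
Qed.

Lemma step_lin N a s h g (c : R) : 0 <= s ->
  step N a s h -> step N a s g -> step N a s (fun x => c * h x + g x).
Proof.
move=> s0 sh sg; apply: (@step_comp2 N a s h g (fun u v => c * u + v)) => //.
by rewrite mulr0 addr0.
Qed.

Lemma indic_children a s x : 0 <= s ->
  \1_(cube a s) x = \sum_e \1_(cube (child a s e) (s / 2)) x :> R.
Proof.
move=> s0; have [xa|xa] := pselect (cube a s x); last first.
  rewrite indicE memNset// big1// => e _.
  by rewrite indicE memNset// => /(child_sub s0); exact.
rewrite indicE mem_set// (bigD1 [ffun i => a ord0 i + s / 2 <= x ord0 i])//=.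
rewrite indicE mem_set ?big1 ?addr0//; last exact: child_cover.
move=> e ee0; rewrite indicE memNset// => /child_inj /(_ (child_cover xa)) ee.
by rewrite ee eqxx in ee0.
Qed.

Lemma step_lift N a s h : 0 <= s -> step N a s h -> step N.+1 a s h.
Proof.
elim: N a s h => [|N IH] a s h s0.
  move=> [c ->]; exists (fun e x => c * \1_(cube (child a s e) (s / 2)) x).
  split; first by move=> e; exists c.
  by apply/funext => x; rewrite -mulr_sumr -indic_children.
move=> [k [ks ->]]; exists k; split => // e.
exact: IH (halfr_ge0 s0) (ks e).
Qed.

Lemma step_leq N M a s h : 0 <= s -> (N <= M)%N -> step N a s h -> step M a s h.
Proof.
move=> s0; elim: M => [|M IH]; first by rewrite leqn0 => /eqP ->.
rewrite leq_eqVlt => /orP[/eqP -> //|]; rewrite ltnS => NM sh.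
by apply: step_lift => //; exact: IH.
Qed.

Lemma measurable_step N a s h : step N a s h -> measurable_fun setT h.
Proof.
elim: N a s h => [|N IH] a s h /=.
  move=> [c ->]; apply: measurable_funM; first exact: measurable_cst.
  apply: measurable_indic; exact: measurable_cube.
move=> [k [ks ->]].
rewrite (_ : (fun _ => _) = \sum_e k e); last first.
  by apply/funext => x; rewrite fct_sumE.
elim/big_ind: _ => [|f1 f2 m1 m2|e _]; first exact: measurable_cst.
  exact: measurable_funD.
exact: IH (ks e).
Qed.

Lemma step_bounded N a s h : step N a s h -> exists M, forall x, `|h x| <= M.
Proof.
elim: N a s h => [|N IH] a s h /=.
  move=> [c ->]; exists `|c| => x; rewrite normrM indicE.
  by case: (_ \in _); rewrite ?normr1 ?normr0 ?mulr1 ?mulr0.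
move=> [k [ks ->]].
have /choice[M Mk] e : exists M, forall x, `|k e x| <= M by exact: IH (ks e).
exists (\sum_e M e) => x; apply: (le_trans (ler_norm_sum _ _ _)).
by apply: ler_sum => e _; exact: Mk.
Qed.

(** The cube is the child with the same corner of the cube of doubled side. *)
Lemma step_enlarge N a s h : step N a s h -> step N.+1 a (2 * s) h.
Proof.
move=> sh; pose e0 : D := [ffun=> false].
have ca : child a (2 * s) e0 = a.
  by apply/rowP => i; rewrite childE ffunE mulr0 addr0 (ord1 ord0).
exists (fun e x => if e == e0 then h x else 0); split => [e|].
  have [->|ee0] := eqVneq e e0; last exact: step_zero.
  by rewrite ca mulrAC divff// mul1r.
apply/funext => x; rewrite (bigD1 e0)//= eqxx big1 ?addr0// => e /negbTE -> //.
Qed.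

(** The side may be negative: the cube is then empty, except in dimension 0, where every cube is the
    whole space. *)
Lemma cube_lt_pinfty a s : (mu (cube a s) < +oo)%E.
Proof.
have [s0|s0] := leP 0 s; first by rewrite leb_cube// ltry.
have [n0|n0] := posnP n.
  have -> : mu (cube a s) = mu (cube a 0).
    congr (mu _); apply/seteqP; split => x _ i; exfalso;
    by move: (ltn_ord i); rewrite {2}n0.
  by rewrite leb_cube// ltry.
rewrite (_ : cube a s = set0) ?measure0//.
by apply/seteqP; split => // x /(_ (Ordinal n0)) /andP[? ?]; lra.
Qed.

(** Density of step functions in L^1 of the cube, as a property of one function: it is stable under
    linear combinations and L^1 limits, which is what a Dynkin induction requires. *)
Definition approximable a s h := forall eps : R, 0 < eps -> exists N g,
  step N a s g /\ (\nint[mu]_(x in cube a s) `|h x - g x| <= eps%:E)%E.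

Lemma nnm_dist h g : measurable_fun setT h -> measurable_fun setT g ->
  nnm (fun x => `|h x - g x|).
Proof. by move=> mh mg; apply: nnm_norm; exact: measurable_funB. Qed.

Lemma approximable_lin a s h g (c : R) : 0 <= s -> measurable_fun setT h ->
  measurable_fun setT g -> approximable a s h -> approximable a s g ->
  approximable a s (fun x => c * h x + g x).
Proof.
move=> s0 mh mg ah ag eps e0.
have c0 : 0 < `|c| + 1 by rewrite ltr_wpDl.
have [N [h' [sh' hh']]] := ah (eps / 2 / (`|c| + 1))
  (divr_gt0 (halfr_gt0 e0) c0).
have [M [g' [sg' gg']]] := ag (eps / 2) (halfr_gt0 e0).
exists (maxn N M), (fun x => c * h' x + g' x); split.
  by apply: step_lin => //; [apply: (step_leq _ _ sh')|apply: (step_leq _ _ sg')];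
    rewrite ?leq_maxl ?leq_maxr.
have mh' := measurable_step sh'; have mg' := measurable_step sg'.
have nh : nnm (fun x => `|h x - h' x|) by exact: nnm_dist.
have ng : nnm (fun x => `|g x - g' x|) by exact: nnm_dist.
have mcube := @measurable_cube R n a s.
apply: (@le_trans _ _ (\nint[mu]_(x in cube a s)
  (`|c| * `|h x - h' x| + `|g x - g' x|))%E).
  apply: nint_le => //.
  - apply: nnm_dist; apply: measurable_funD => //; exact: measurable_funM.
  - by apply: nnmD => //; exact: nnmZ.
  - move=> x _; rewrite -normrM.
    rewrite (_ : _ - _ = c * (h x - h' x) + (g x - g' x)); last by ring.
    exact: ler_normD.
rewrite nintD//; last exact: nnmZ.
rewrite nintZ// (_ : eps = `|c| * (eps / 2 / (`|c| + 1)) + (eps - `|c| * (eps / 2 / (`|c| + 1)))); last by ring.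
rewrite EFinD; apply: leeD; first by rewrite EFinM lee_wpmul2l// lee_fin.
apply: (le_trans gg'); rewrite lee_fin.
suff : `|c| * (eps / 2 / (`|c| + 1)) <= eps / 2 by move=> H; lra.
rewrite mulrCA -[leRHS]mulr1 ler_wpM2l ?halfr_ge0 ?(ltW e0)//.
by rewrite ler_pdivrMr// mul1r lerDl.
Qed.

Lemma approximable_lim a s h (hk : (E -> R)^nat) : 0 <= s ->
  measurable_fun setT h -> (forall k, measurable_fun setT (hk k)) ->
  (forall k, approximable a s (hk k)) ->
  \nint[mu]_(x in cube a s) `|h x - hk k x| @[k --> \oo] --> 0%E ->
  approximable a s h.
Proof.
move=> s0 mh mhk ahk hk0 eps e0.
have [k kP] := cvge0_lt hk0 (halfr_gt0 e0).
have {}kP := ltW (kP k (leqnn k)).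
have [N [g [sg gP]]] := ahk k _ (halfr_gt0 e0).
exists N, g; split => //; have mg := measurable_step sg.
apply: (@le_trans _ _ (\nint[mu]_(x in cube a s)
  (`|h x - hk k x| + `|hk k x - g x|))%E).
  apply: nint_le; [exact: measurable_cube|exact: nnm_dist| |].
    by apply: nnmD; exact: nnm_dist.
  move=> x _; exact: ler_distD.
rewrite nintD; [|exact: measurable_cube|exact: nnm_dist|exact: nnm_dist].
by rewrite [eps]splitr EFinD; exact: leeD.
Qed.

(** The indicator of the union of the dyadic subcubes of generation [N] contained in [A]. *)
Fixpoint inner_approx N a s A : E -> R :=
  if N is N'.+1 then
    fun x => \sum_e inner_approx N' (child a s e) (s / 2) A x
  else fun x => (`[< cube a s `<=` A >])%:R * \1_(cube a s) x.

Lemma step_inner_approx N a s A : step N a s (inner_approx N a s A).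
Proof.
elim: N a s => [|N IH] a s /=; first by eexists.
by exists (fun e => inner_approx N (child a s e) (s / 2) A).
Qed.

Lemma inner_approx_out N a s A x : ~ A x -> inner_approx N a s A x = 0.
Proof.
move=> Ax; elim: N a s => [|N IH] a s /=; last by rewrite big1.
have [xa|xa] := pselect (cube a s x); last by rewrite indicE memNset// mulr0.
case: asboolP => [aA|_]; last by rewrite mul0r.
by exfalso; exact/Ax/aA.
Qed.

Lemma inner_approx_in N a s A x : 0 <= s -> cube a s x ->
  (forall z : E, (forall i, `|z ord0 i - x ord0 i| < s / 2 ^+ N) -> A z) ->
  inner_approx N a s A x = 1.
Proof.
elim: N a s => [|N IH] a s s0 xa xA /=.
  rewrite asboolT ?mul1r ?indicE ?mem_set// => z za; apply: xA => i.
  rewrite expr0 divr1 ltr_norml; have /andP[? ?] := xa i; have /andP[? ?] := za i.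
  by apply/andP; split; lra.
rewrite (@big_only1 _ _ _ _ [ffun i => a ord0 i + s / 2 <= x ord0 i])//.
  apply: IH; [exact: halfr_ge0|exact: child_cover|].
  move=> z zx; apply: xA => i; apply: lt_le_trans (zx i) _.
  by rewrite exprS invfM mulrA.
move=> e ee0 _; apply: (step_supp (halfr_ge0 s0) (step_inner_approx _ _ _ _)).
by move=> /child_inj /(_ (child_cover xa)) ee; rewrite ee eqxx in ee0.
Qed.

(** Openness for the sup norm, spelled out coordinatewise because it is compared with the sides of
    cubes. *)
Definition supopen A := forall x, A x -> exists2 r, 0 < r &
  forall z : E, (forall i, `|z ord0 i - x ord0 i| < r) -> A z.

Lemma approximable_step N a s h : 0 <= s -> step N a s h -> approximable a s h.
Proof.
move=> s0 sh eps e0; exists N, h; split => //.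
rewrite (@eq_integral _ _ _ mu _ (cst 0%E)) ?integral0 ?lee_fin ?(ltW e0)//.
by move=> x _; rewrite subrr normr0.
Qed.

Lemma half_expr_lt r s : 0 < r -> exists N, forall k, (N <= k)%N -> s / 2 ^+ k < r.
Proof.
move=> r0; have [s0|s0] := leP s 0.
  by exists 0%N => k _; apply: le_lt_trans r0; rewrite ler_pdivrMr ?exprn_gt0// mul0r.
exists (Num.bound (s / r)) => k Nk; rewrite ltr_pdivrMr ?exprn_gt0//.
rewrite mulrC -ltr_pdivrMr//; apply: lt_le_trans (archi_boundP _) _.
  by rewrite divr_ge0 ?ltW.
rewrite -natrX ler_nat; apply: leq_trans Nk _.
by apply: ltnW; exact: ltn_expl.
Qed.

Lemma inner_approx_cvg a s A x : 0 <= s -> supopen A -> cube a s x ->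
  (fun k => inner_approx k a s A x) @ \oo --> (\1_A x : R).
Proof.
move=> s0 oA xa; have [Ax|Ax] := pselect (A x); last first.
  rewrite indicE memNset//; under eq_fun do rewrite inner_approx_out//.
  exact: cvg_cst.
have [r r0 rA] := oA _ Ax; have [N NP] := half_expr_lt s r0.
rewrite indicE mem_set//; apply: cvg_near_cst; exists N => // k /= Nk.
apply: inner_approx_in => // z zx; apply: rA => i.
exact: lt_trans (zx i) (NP _ Nk).
Qed.

Lemma inner_approx_le1 k a s A x : 0 <= s -> cube a s x -> `|inner_approx k a s A x| <= 1.
Proof.
elim: k a s => [|k IH] a s s0 xa /=.
  by rewrite indicE normrM ger0_norm//; case: asboolP => _; case: (_ \in _);
    rewrite ?normr0 ?normr1 ?mulr0 ?mul0r ?mulr1.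
rewrite (@big_only1 _ _ _ _ [ffun i => a ord0 i + s / 2 <= x ord0 i])//.
  by apply: IH; [exact: halfr_ge0|exact: child_cover].
move=> e ee0 _; apply: (step_supp (halfr_ge0 s0) (step_inner_approx _ _ _ _)).
by move=> /child_inj /(_ (child_cover xa)) ee; rewrite ee eqxx in ee0.
Qed.

Lemma approximable_supopen a s A : 0 <= s -> measurable A -> supopen A ->
  approximable a s \1_A.
Proof.
move=> s0 mA oA; apply: (@approximable_lim a s _ (fun k => inner_approx k a s A)) => //.
- by move=> k; exact: measurable_step (step_inner_approx _ _ _ _).
- by move=> k; apply: approximable_step => //; exact: step_inner_approx.
under eq_fun do under eq_integral do rewrite distrC.
apply: (@bounded_cvg_nint _ _ _ mu _ _ _ 1).
- exact: measurable_cube.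
- exact: cube_lt_pinfty.
- by move=> k; exact: measurable_step (step_inner_approx _ _ _ _).
- exact: measurable_indic.
- by move=> x xa; exact: inner_approx_cvg.
- by move=> x k; exact: inner_approx_le1.
Qed.

Definition open_sets : set (set E) := [set A | measurable A /\ supopen A].

(** The half-spaces [x_i < b] are open and generate the coordinate maps, which generate the
    sigma-algebra. This makes [open_sets] a generating system stable under intersection. *)
Lemma measurable_open_sets : @measurable _ E = <<s open_sets >>.
Proof.
apply/seteqP; split; last first.
  by apply: smallest_sub; [exact: sigma_algebra_measurable|move=> A []].
have key (i : 'I_n) (b : R) : open_sets [set x : E | x ord0 i < b].
  split.
    rewrite (_ : [set x | _] = (fun x : E => x ord0 i : measurableTypeR R) @^-1` `]-oo, b[).
      by rewrite -[X in measurable X]setTI; apply: measurable_coord.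
    by apply/seteqP; split => x /=; rewrite in_itv.
  move=> x /= xb; exists (b - x ord0 i); first by rewrite subr_gt0.
  by move=> z /(_ i); rewrite ltr_norml => /andP[_]; rewrite ltrD2r.
have mc (i : 'I_n) : measurable_fun setT
    (fun x : g_sigma_algebraType open_sets => (x : E) ord0 i : measurableTypeR R).
  apply: (measurability (@RGenInftyO.G R)).
    exact: RGenInftyO.measurableE.
  move=> _ [_ [b ->] <-]; apply: sub_sigma_algebra; rewrite setTI.
  rewrite (_ : _ @^-1` _ = [set x : E | x ord0 i < b])//.
apply: smallest_sub; first exact: smallest_sigma_algebra.
rewrite -bigcup_seq; apply: bigcup_sub => i _ A [B mB <-].
exact: (mc i).
Qed.

(** Dynkin induction: open sets are limits of their inner approximations, complements use [1 - 1_A],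
    and disjoint countable unions pass to the limit by bounded convergence. *)
Lemma approximable_indic a s A : 0 <= s -> measurable A -> approximable a s \1_A.
Proof.
move=> s0; rewrite measurable_open_sets; move: A.
apply: (dynkin_induction measurable_open_sets (P := fun A => approximable a s \1_A)).
- move=> A B [mA oA] [mB oB]; split; first exact: measurableI.
  move=> x [Ax Bx]; have [r r0 rA] := oA _ Ax; have [r' r0' rB] := oB _ Bx.
  exists (Num.min r r'); first by rewrite lt_min r0.
  move=> z zx; split.
    by apply: rA => i; apply: lt_le_trans (zx i) _; rewrite ge_min lexx.
  by apply: rB => i; apply: lt_le_trans (zx i) _; rewrite ge_min lexx orbT.
- by apply: approximable_supopen => // x _; exists 1.
- by move=> A [mA oA]; exact: approximable_supopen.
- move=> A mA aA.
  rewrite (_ : \1_(~` A) = (fun x => -1 * \1_A x + \1_setT x) :> (E -> R)).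
    apply: approximable_lin => //; try exact: measurable_indic.
    by apply: approximable_supopen => // x _; exists 1.
  apply/funext => x; rewrite !indicE in_setC in_setT.
  by case: (x \in A) => /=; ring.
- move=> F mF tF aF.
  pose G k := \big[setU/set0]_(i < k) F i.
  have mG k : measurable (G k) by exact: bigsetU_measurable.
  have aG k : approximable a s \1_(G k).
    elim: k => [|k IH].
      rewrite /G big_ord0 indic0; apply: approximable_step => //.
      exact: (step_zero 0).
    rewrite /G big_ord_recr/= -/(G k).
    rewrite (_ : \1_(G k `|` F k) = (fun x => 1 * \1_(G k) x + \1_(F k) x) :> (E -> R)).
      by apply: approximable_lin => //; exact: measurable_indic.
    apply/funext => x; rewrite mul1r !indicE.
    have [xF|xF] := pselect (F k x).
      rewrite [x \in F k]mem_set// mem_set; last by right.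
      rewrite memNset ?add0r// => Gx.
      move: Gx; rewrite /G -bigcup_mkord => -[j /= jk Fj].
      by have := tF j k I I (ex_intro _ x (conj Fj xF)) => jk'; rewrite jk' ltnn in jk.
    rewrite [x \in F k]memNset// addr0.
    have [xG|xG] := pselect (G k x); first by rewrite !mem_set//; left.
    by rewrite !memNset// => -[].
  apply: (@approximable_lim a s _ (fun k => \1_(G k))) => //.
  + by apply: measurable_indic; exact: bigcup_measurable.
  under eq_fun do under eq_integral do rewrite distrC.
  apply: (@bounded_cvg_nint _ _ _ mu _ _ _ 1).
  + exact: measurable_cube.
  + exact: cube_lt_pinfty.
  + by move=> k; exact: measurable_indic.
  + by apply: measurable_indic; exact: bigcup_measurable.
  + move=> x _; have [[j _ Fj]|xF] := pselect ((\bigcup_k F k) x).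
      rewrite [X in _ --> X]indicE mem_set; last by exists j.
      apply: cvg_near_cst; exists j.+1 => // k /= jk.
      by rewrite indicE mem_set// /G -bigcup_mkord; exists j.
    rewrite [X in _ --> X]indicE memNset//; apply: cvg_near_cst; exists 0%N => // k _.
    rewrite indicE memNset// /G -bigcup_mkord => -[j _ Fj].
    by apply: xF; exists j.
  + by move=> x k _; rewrite indicE ger0_norm//; case: (_ \in _).
Qed.

Lemma approximable_integrable a s h : 0 <= s -> measurable_fun setT h ->
  (\nint[mu]_(x in cube a s) `|h x| < +oo)%E -> approximable a s h.
Proof.
move=> s0 mh hoo.
have ih : mu.-integrable (cube a s) (EFin \o h).
  by apply/integrableP; split => //; apply/measurable_EFinP; exact: measurable_funTS.
have [g [_ _ gh]] := approximation_sfun_integrable (measurable_cube a s) ih.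
refine (@approximable_lim a s h (fun k => (g k : E -> R)) s0 mh _ _ gh) => k.
  exact: measurable_funP.
(* A simple function as a finite list of values with their level sets, so that linearity applies by
   induction on the list. *)
pose F := [seq (y, g k @^-1` [set (y : R)]) | y : R <- finmap.enum_fset (fset_set (range (g k)))].
rewrite (_ : (g k : E -> R) = (fun x => \sum_(z <- F) z.1 * \1_(z.2) x)); last first.
  by apply/funext => x; rewrite {1}fimfunE fsbig_finite//= big_map.
have mF z : z \in F -> measurable z.2.
  by move=> /mapP[y _ ->] /=; exact: measurable_sfunP.
elim: F mF => [|z F IH] mF.
  under eq_fun do rewrite big_nil; apply: approximable_step => //.
  exact: (step_zero 0).
under eq_fun do rewrite big_cons.
have mF' z' : z' \in F -> measurable z'.2 by move=> zF; apply: mF; rewrite inE zF orbT.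
have mz : measurable z.2 by apply: mF; rewrite mem_head.
apply: approximable_lin => //.
- rewrite (_ : (fun _ => _) = \sum_(z <- F) (fun x => z.1 * \1_(z.2) x)); last first.
    by apply/funext => x; rewrite fct_sumE.
  rewrite big_seq; elim/big_ind: _ => [|f1 f2 m1 m2|z' z'F]; first exact: measurable_cst.
    exact: measurable_funD.
  apply: measurable_funM; first exact: measurable_cst.
  by apply: measurable_indic; exact: mF'.
- exact: approximable_indic.
- exact: IH.
Qed.

(* A word lists the choices of children from the last one to the first, so that
   [e :: t] is a child of [t]. *)
Fixpoint corner a s (t : seq D) : E :=
  if t is e :: t' then child (corner a s t') (s / 2 ^+ size t') e else a.

Definition dcube a s t := cube (corner a s t) (s / 2 ^+ size t).

Lemma dcube_nil a s : dcube a s [::] = cube a s.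
Proof. by rewrite /dcube /= expr0 divr1. Qed.

Lemma dcube_cons a s e t :
  dcube a s (e :: t) = cube (child (corner a s t) (s / 2 ^+ size t) e) (s / 2 ^+ size t / 2).
Proof. by rewrite /dcube /= exprS invfM mulrA mulrAC. Qed.

(** The last letter of a word is the first choice of a child, so removing it moves the root to that
    child. *)
Lemma corner_rcons a s e t :
  corner a s (rcons t e) = corner (child a s e) (s / 2) t.
Proof.
elim: t => [|e' t IH] /=; first by rewrite expr0 divr1.
by rewrite IH size_rcons exprS invfM mulrA.
Qed.

Lemma dcube_rcons a s e t : dcube a s (rcons t e) = dcube (child a s e) (s / 2) t.
Proof. by rewrite /dcube corner_rcons size_rcons exprS invfM mulrA. Qed.

(* The distance in L^1 from the indicator of Z to a step function is at least
   the measure of Z: on each of its cubes Z has density at most 1/2. *)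
Lemma thin_null a s (Z : set E) : 0 <= s -> measurable Z -> Z `<=` cube a s ->
  (forall t, Z `&` dcube a s t !=set0 ->
     (mu (Z `&` dcube a s t) <= 2^-1%:E * mu (dcube a s t))%E) ->
  mu Z = 0%E.
Proof.
move=> s0 mZ Za thin.
have key N h : step N a s h ->
    (mu (Z `&` cube a s) <= \nint[mu]_(x in cube a s) `|\1_Z x - h x|)%E.
  elim: N a s h s0 thin {Za} => [|N IH] a s h s0 thin /=.
    move=> [c ->]; have [Z0|] := pselect (Z `&` cube a s !=set0); last first.
      by move=> /set0P/negP/negPn/eqP ->; rewrite measure0; apply: integral_ge0.
    have := thin [::]; rewrite dcube_nil => /(_ Z0) zc.
    have mC := @measurable_cube R n a s.
    have mD : measurable (cube a s `\` Z) by exact: measurableD.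
    have mI : measurable (Z `&` cube a s) by exact: measurableI.
    have nf : nnm (fun x => `|\1_Z x - c * \1_(cube a s) x|).
      apply: nnm_dist; first exact: measurable_indic.
      by apply: measurable_funM => //; exact: measurable_indic.
    have E1 : cube a s = (Z `&` cube a s) `|` (cube a s `\` Z).
      apply/seteqP; split => [x Cx|x [[]|[]]//].
      by have [Zx|Zx] := pselect (Z x); [left|right].
    have E2 : mu (cube a s) = (mu (Z `&` cube a s) + mu (cube a s `\` Z))%E.
      rewrite {1}E1 measureU//; apply/seteqP; split => // x [[? ?] []//].
    rewrite [X in integral _ X]E1 nintU//; last first.
      by apply/seteqP; split => // x [[? ?] []//].
    have -> : \nint[mu]_(x in Z `&` cube a s) `|\1_Z x - c * \1_(cube a s) x| =
        (`|1 - c|%:E * mu (Z `&` cube a s))%E.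
      rewrite -nint_cst//; apply: eq_integral => x; rewrite inE => -[Zx Cx].
      by rewrite !indicE !mem_set// mulr1.
    have -> : \nint[mu]_(x in cube a s `\` Z) `|\1_Z x - c * \1_(cube a s) x| =
        (`|c|%:E * mu (cube a s `\` Z))%E.
      rewrite -nint_cst//; apply: eq_integral => x; rewrite inE => -[Cx Zx].
      by rewrite !indicE (memNset Zx) mem_set// mulr1 sub0r normrN.
    have foo A : A `<=` cube a s -> measurable A -> mu A \is a fin_num.
      move=> AC mA; rewrite ge0_fin_numE//; apply: le_lt_trans (cube_lt_pinfty a s).
      by apply: le_measure; rewrite ?inE.
    move: zc; rewrite E2.
    have /fineK <- := foo _ (@subIsetr _ Z (cube a s)) mI.
    have /fineK <- := foo _ (@subDsetl _ (cube a s) Z) mD.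
    set u := fine (mu (Z `&` _)); set v := fine (mu (_ `\` _)).
    have u0 : 0 <= u by exact: fine_ge0.
    have v0 : 0 <= v by exact: fine_ge0.
    rewrite -!EFinM -!EFinD -?EFinM !lee_fin => uv.
    have {}uv : u <= v by lra.
    (* Since [u <= v], the distance [|1 - c| u + |c| v] is at least [(|1 - c| + |c|) u], hence at
       least [u]. *)
    have c1 : 1 <= `|1 - c| + `|c|.
      by apply: le_trans (ler_normD _ _); rewrite subrK normr1.
    have := normr_ge0 c; have := normr_ge0 (1 - c); nra.
  move=> [k [ks ->]].
  (* The measure of [Z] is written as an integral, so that both sides split over the children. *)
  rewrite -[X in (X <= _)%E](_ : \nint[mu]_(x in cube a s) \1_Z x = _); last first.
    rewrite -[X in _ = mu X]setIC -[RHS]mul1e -nint_cst; last first.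
      by apply: measurableI => //; exact: measurable_cube.
    rewrite -nint_indic//; last exact: measurable_cube.
    by apply: eq_integral => x _; rewrite mul1r.
  rewrite !nint_children//; last first.
    apply: nnm_dist; first exact: measurable_indic.
    by apply: (@measurable_step N.+1 a s); exists k.
  apply: lee_sum => e _.
  have := IH _ _ (k e) (halfr_ge0 s0) _ (ks e).
  have mCe := @measurable_cube R n (child a s e) (s / 2).
  have -> : mu (Z `&` cube (child a s e) (s / 2)) =
      \nint[mu]_(x in cube (child a s e) (s / 2)) \1_Z x.
    rewrite -[X in mu X]setIC -[LHS]mul1e -nint_cst; last exact: measurableI.
    rewrite -nint_indic//.
    by apply: eq_integral => x _; rewrite mul1r.
  have -> : \nint[mu]_(x in cube (child a s e) (s / 2)) `|\1_Z x - \sum_e0 k e0 x| =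
      \nint[mu]_(x in cube (child a s e) (s / 2)) `|\1_Z x - k e x|.
    apply: eq_integral => x; rewrite inE => xe.
    rewrite (@big_only1 _ _ _ _ e)// => e' e'e _.
    apply: (step_supp (halfr_ge0 s0) (ks e')) => /child_inj /(_ xe) ee.
    by rewrite ee eqxx in e'e.
  by apply => t; rewrite -dcube_rcons; exact: thin.
apply/eqP; rewrite eq_le measure_ge0 andbT; apply/lee_addgt0Pr => eps e0.
rewrite add0e; have [N [g [sg gP]]] := approximable_indic a s0 mZ e0.
by rewrite -(setIidl Za); exact: le_trans (key _ _ sg) gP.
Qed.

End step_functions.

(** * Smooth approximations of cubes *)

Section flat_functions.
Context (R : realType).
Implicit Types (P Q : {poly R}) (t : R).

(* P(1/t) exp(-1/t) for t > 0: these functions are closed under derivation. *)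
Definition flat P t : R := if 0 < t then P.[t^-1] * expR (- t^-1) else 0.

(** The exponential of [1 / t] exceeds [(1 / t)^(i + 2) / (i + 2)!], so every monomial of [P] leaves
    a factor [t^2]. The quadratic bound gives the derivative 0 at the origin. *)
Lemma flat_bound P : exists2 C, 0 <= C & forall t, `|flat P t| <= C * t ^+ 2.
Proof.
pose C := \sum_(i < size P) `|P`_i| * (i.+2)`!%:R.
have C0 : 0 <= C by apply: sumr_ge0 => i _; rewrite mulr_ge0.
exists C => // t; rewrite /flat; case: ltP => [t0|_]; last first.
  by rewrite normr0 mulr_ge0// sqr_ge0.
have u0 : 0 < t^-1 by rewrite invr_gt0.
rewrite normrM (ger0_norm (expR_ge0 _)) horner_coef.
apply: (@le_trans _ _ ((\sum_(i < size P) `|P`_i| * t^-1 ^+ i) * expR (- t^-1))).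
  rewrite ler_wpM2r ?expR_ge0//; apply: (le_trans (ler_norm_sum _ _ _)).
  apply: ler_sum => i _; rewrite normrM ler_wpM2l// ger0_norm// exprn_ge0// ltW//.
rewrite !mulr_suml; apply: ler_sum => i _.
rewrite -!mulrA ler_wpM2l// expRN.
have := expR_ge1Dxn i.+1 (ltW u0).
set e := expR _ => He; have e0 : 0 < e by exact: expR_gt0.
have f0 : 0 < (i.+2)`!%:R :> R by rewrite ltr0n fact_gt0.
rewrite ler_pdivrMr// -ler_pdivrMl ?mulr_gt0 ?exprn_gt0//.
apply: (@le_trans _ _ (t^-1 ^+ i.+2 / (i.+2)`!%:R)); last first.
  by apply: le_trans He; rewrite lerDr ler01.
have E2 : t^-1 ^+ i.+2 = t^-1 ^+ i * t^-1 ^+ 2 by rewrite -exprD addn2.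
rewrite E2 invfM -exprVn le_eqVlt.
by apply/orP; left; apply/eqP; ring.
Qed.

Lemma flat_derive0 (f : R -> R) (C : R) : 0 <= C -> f 0 = 0 ->
  (forall t, `|f t| <= C * t ^+ 2) -> is_derive (0 : R) 1 f 0.
Proof.
move=> C0 f0 fC.
have H : (fun h : R => h^-1 *: ((f \o shift 0) (h *: 1) - f 0)) @ 0^' --> (0 : R).
  apply/cvgr0Pnorm_le => eps e0; have C1 : 0 < C + 1 by rewrite ltr_wpDl.
  near=> h.
  have h0 : h != 0 by near: h; exact: nbhs_dnbhs_neq.
  have hC : `|h| <= eps / (C + 1).
    by near: h; apply: dnbhs0_le; rewrite divr_gt0.
  rewrite /= f0 subr0 addr0 /GRing.scale/= mulr1 normrM normfV.
  rewrite ler_pdivrMl ?normr_gt0//; apply: (le_trans (fC h)).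
  rewrite -real_normK ?num_real// expr2 mulrA mulrC ler_wpM2l//.
  apply: (@le_trans _ _ ((C + 1) * `|h|)); first by rewrite ler_wpM2r// lerDl.
  by rewrite mulrC -ler_pdivlMr.
split; first by apply/cvg_ex; exists 0.
by apply: cvg_lim.
Unshelve. all: by end_near.
Qed.

(** With [u = 1 / t], the derivative of [P(u) exp(- u)] in [t] is [u^2 (P - P')(u) exp(- u)]: again
    of the same form, with another polynomial. *)
Lemma is_derive_flat P t : is_derive t 1 (flat P) (flat ('X^2 * (P - P^`())) t).
Proof.
have [t0|t0|<-] := ltgtP 0 t.
- suff H : is_derive t 1 (fun s => P.[s^-1] * expR (- s^-1))
      (flat ('X^2 * (P - P^`())) t).
    apply: near_eq_is_derive H.
    near=> s; rewrite /flat ifT//; near: s; exact: lt_nbhsr.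
  rewrite /flat t0.
  have t0' : id t != 0 by rewrite gt_eqF.
  have d1 : is_derive t 1 (fun y : R => y^-1) (- t ^- 2).
    have := is_deriveV t0' (is_derive_id t 1).
    by rewrite /GRing.scale/= mulr1.
  have d2 : is_derive t 1 (fun y : R => - y^-1) (t ^- 2).
    by have := is_deriveN d1; rewrite opprK.
  have d3 : is_derive t 1 (fun y : R => expR (- y^-1)) (t ^- 2 * expR (- t^-1)).
    by rewrite mulrC; exact: (@is_derive1_comp _ expR (fun y => - y^-1)).
  have d4 : is_derive t 1 (fun y : R => P.[y^-1]) (- t ^- 2 * P^`().[t^-1]).
    by rewrite mulrC; exact: (@is_derive1_comp _ (horner P) (fun y => y^-1)).
  have := is_deriveM d4 d3.
  rewrite [X in is_derive _ _ _ X -> _](_ : _ = ('X^2 * (P - P^`())).[t^-1] * expR (- t^-1))//.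
  rewrite hornerM hornerXn hornerD hornerN exprVn.
  by rewrite /GRing.scale/=; ring.
- suff H : is_derive t 1 (cst (0 : R)) (flat ('X^2 * (P - P^`())) t).
    apply: near_eq_is_derive H.
    near=> s; rewrite /flat ifF//; apply/negbTE; rewrite -leNgt ltW//.
    near: s; exact: lt_nbhsl.
  rewrite /flat ifF; first exact: is_derive_cst.
  by apply/negbTE; rewrite -leNgt ltW.
- have [C C0 PC] := flat_bound P.
  rewrite {2}/flat ltxx; apply: (flat_derive0 C0 _ PC).
  by rewrite /flat ltxx.
Unshelve. all: by end_near.
Qed.

Lemma continuous_flat P : continuous (flat P).
Proof.
move=> t; apply: differentiable_continuous; apply/derivable1_diffP.
by have [] := is_derive_flat P t.
Qed.

Lemma flat1_ge0 t : 0 <= flat 1 t.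
Proof. by rewrite /flat; case: ifP => // _; rewrite hornerE mul1r expR_ge0. Qed.

Lemma flat1_le1 t : flat 1 t <= 1.
Proof.
rewrite /flat; case: ifP => // t0; rewrite hornerE mul1r.
by rewrite -expR0 ler_expR oppr_le0 invr_ge0 ltW.
Qed.

Lemma flat1_le t1 t2 : t1 <= t2 -> flat 1 t1 <= flat 1 t2.
Proof.
move=> t12; rewrite {1}/flat; case: ltP => [t1p|_]; last exact: flat1_ge0.
have t2p := lt_le_trans t1p t12; rewrite /flat t2p !hornerE.
by rewrite ler_expR lerN2 lef_pV2.
Qed.

Lemma flat1_gt0 t : 0 < t -> 0 < flat 1 t.
Proof. by move=> t0; rewrite /flat t0 hornerE mul1r expR_gt0. Qed.

Lemma flat1_cvg t : 0 < t -> (fun k : nat => flat 1 (k.+1%:R * t)) @ \oo --> (1 : R).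
Proof.
move=> t0; under eq_fun do rewrite /flat mulr_gt0// hornerE mul1r.
suff H : (fun k : nat => expR (- (k.+1%:R * t)^-1)) @ \oo --> expR (0 : R).
  by rewrite expR0 in H.
apply: continuous_cvg; first exact: continuous_expR.
have -> : 0 = - 0 :> R by rewrite oppr0.
apply: cvgN.
under eq_fun do rewrite invfM.
have -> : 0 = 0 * t^-1 :> R by rewrite mul0r.
apply: cvgM; last exact: cvg_cst.
exact: cvg_harmonic.
Qed.

End flat_functions.

Section smooth_algebra.
Context (R : realType) (n : nat).
Local Notation E := 'rV[R]_n.
Local Notation mu := (leb R n).
Implicit Types (g f : E -> R) (x : E).

(** A class of continuous functions closed under partial derivatives: all its members are smooth,
    and no higher derivative is ever computed. *)
Inductive flat_algebra : (E -> R) -> Prop :=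
| flat_algebra_cst (c : R) : flat_algebra (fun=> c)
| flat_algebra_coord P (i : 'I_n) (k b : R) :
    flat_algebra (fun x => flat P (k * x ord0 i + b))
| flat_algebraD f g : flat_algebra f -> flat_algebra g ->
    flat_algebra (fun x => f x + g x)
| flat_algebraM f g : flat_algebra f -> flat_algebra g ->
    flat_algebra (fun x => f x * g x).

Lemma flat_algebra_continuous f : flat_algebra f -> continuous f.
Proof.
elim=> [c|P i k b|f1 f2 _ c1 _ c2|f1 f2 _ c1 _ c2] x; first exact: cst_continuous.
- apply: (@continuous_comp _ _ _ (fun x : E => k * x ord0 i + b) (flat P)).
    apply: continuousD; last exact: cst_continuous.
    apply: continuousM; [exact: cst_continuous|exact: coord_continuous].
  exact: continuous_flat.
- by apply: continuousD; [exact: c1|exact: c2].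
- by apply: continuousM; [exact: c1|exact: c2].
Qed.

Lemma flat_algebra_derive f i : flat_algebra f ->
  exists2 f', flat_algebra f' & forall x, is_derive x (delta_mx ord0 i : E) f (f' x).
Proof.
elim=> [c|P j k b|f1 f2 a1 [d1 D1 H1] a2 [d2 D2 H2]|f1 f2 a1 [d1 D1 H1] a2 [d2 D2 H2]].
- exists (fun=> 0); first exact: flat_algebra_cst.
  by move=> x; exact: is_derive_cst.
- pose c : R := k * (delta_mx ord0 i : E) ord0 j.
  exists (fun x => c * flat ('X^2 * (P - P^`())) (k * x ord0 j + b)).
    by apply: flat_algebraM; [exact: flat_algebra_cst|exact: flat_algebra_coord].
  move=> x; set y := k * x ord0 j + b.
  have [dP eP] := is_derive_flat P y.
  have dy : differentiable (flat P) y by apply/derivable1_diffP.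
  have [dc ec] : is_derive y c (flat P) (c * flat ('X^2 * (P - P^`())) y).
    split; first exact: diff_derivable.
    by rewrite deriveE// deriv1E// derive1E eP.
  (* The function depends on the coordinate [j] only: its difference quotient along a basis vector
     is that of [flat P] at [y] in the direction [c]. *)
  have EQ : (fun h : R => h^-1 *: (((fun x : E => flat P (k * x ord0 j + b)) \o shift x)
        (h *: (delta_mx ord0 i : E)) - flat P y)) =
      (fun h : R => h^-1 *: ((flat P \o shift y) (h *: c) - flat P y)).
    apply/funext => h /=; rewrite !mxE; congr (_ *: (flat P _ - _)).
    by rewrite /c /y /GRing.scale/= !mxE; ring.
  split; first by rewrite /derivable EQ.
  by rewrite /derive EQ.
- exists (fun x => d1 x + d2 x); first exact: flat_algebraD.
  by move=> x; exact: is_deriveD.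
- exists (fun x => f1 x * d2 x + f2 x * d1 x).
    by apply: flat_algebraD; apply: flat_algebraM.
  by move=> x; exact: is_deriveM.
Qed.

Lemma flat_algebra_pderivs f s : flat_algebra f -> flat_algebra (pderivs s f).
Proof.
move=> af; elim: s => [//|i s IH] /=.
have [f' af' Df'] := flat_algebra_derive i IH.
rewrite (_ : (fun x => _) = f')//; apply/funext => x.
by have [] := Df' x.
Qed.

Lemma flat_algebra_smooth f : flat_algebra f -> smooth f.
Proof.
move=> af s; split; first exact/flat_algebra_continuous/flat_algebra_pderivs.
move=> i x; have [f' _ Df'] := flat_algebra_derive i (flat_algebra_pderivs s af).
by have [] := Df' x.
Qed.

Lemma flat_algebra_prod (I : Type) (r : seq I) (F : I -> E -> R) :
  (forall i, flat_algebra (F i)) -> flat_algebra (fun x => \prod_(i <- r) F i x).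
Proof.
move=> aF; elim: r => [|i r IH].
  by under eq_fun do rewrite big_nil; exact: flat_algebra_cst.
by under eq_fun do rewrite big_cons; exact: flat_algebraM.
Qed.

(** Positive exactly on the open cube; as the steepness [m] grows it tends to the indicator of that
    cube. The arguments are written in the affine form [k x_i + b] that [flat_algebra_coord]
    accepts. *)
Definition bump_fun (m : R) (a : E) (s : R) : E -> R := fun x =>
  \prod_(i < n) (flat 1 (m * x ord0 i + - (m * a ord0 i)) *
                 flat 1 (- m * x ord0 i + m * (a ord0 i + s))).

Definition open_cube (a : E) (s : R) : set E :=
  [set x | forall i, a ord0 i < x ord0 i < a ord0 i + s].

Definition closed_cube (a : E) (s : R) : set E :=
  [set x | forall i, a ord0 i <= x ord0 i <= a ord0 i + s].

Lemma open_cube_sub a s : open_cube a s `<=` cube a s.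
Proof. by move=> x xa i; have /andP[/ltW -> ->] := xa i. Qed.

Lemma cube_sub_closed a s : cube a s `<=` closed_cube a s.
Proof. by move=> x xa i; have /andP[-> /ltW ->] := xa i. Qed.

Lemma bump_fun_algebra m a s : flat_algebra (bump_fun m a s).
Proof.
apply: flat_algebra_prod => i.
by apply: flat_algebraM; exact: flat_algebra_coord.
Qed.

Lemma bump_funE m a s x : bump_fun m a s x = \prod_(i < n)
  (flat 1 (m * (x ord0 i - a ord0 i)) * flat 1 (m * (a ord0 i + s - x ord0 i))).
Proof.
by apply: eq_bigr => i _; congr (flat _ _ * flat _ _); ring.
Qed.

Lemma bump_fun_ge0 m a s x : 0 <= bump_fun m a s x.
Proof. by apply: prodr_ge0 => i _; rewrite mulr_ge0 ?flat1_ge0. Qed.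

Lemma bump_fun_le1 m a s x : bump_fun m a s x <= 1.
Proof.
apply: prodr_ile1 => i _; rewrite mulr_ge0 ?flat1_ge0//=.
by rewrite -[leRHS](mulr1 1) ler_pM ?flat1_ge0 ?flat1_le1.
Qed.

Lemma bump_fun_out m a s x : 0 < m -> ~ open_cube a s x -> bump_fun m a s x = 0.
Proof.
move=> m0 /existsNP[i /negP]; rewrite negb_and -!leNgt => xi.
rewrite bump_funE (bigD1 i)//=; apply/eqP; rewrite mulf_eq0; apply/orP; left.
rewrite mulf_eq0; case/orP: xi => xi; apply/orP; [left|right];
  rewrite /flat ifF//; apply/negbTE; rewrite -leNgt pmulr_rle0//; lra.
Qed.

Lemma bump_fun_lower (m s r : R) (a x : E) : 0 < m -> 0 < r ->
  (forall i, a ord0 i + r <= x ord0 i <= a ord0 i + s - r) ->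
  (flat 1 (m * r) ^+ 2) ^+ n <= bump_fun m a s x.
Proof.
move=> m0 r0 xr; rewrite bump_funE -[n in leLHS]card_ord -prodr_const.
apply: ler_prod => i _; rewrite exprn_ge0 ?flat1_ge0//= expr2.
have /andP[? ?] := xr i.
by apply: ler_pM; rewrite ?flat1_ge0//; apply: flat1_le; rewrite (ler_pM2l m0); lra.
Qed.

Lemma cvgn_prod (I : Type) (r : seq I) (F : I -> R^nat) (l : I -> R) :
  (forall i, F i @ \oo --> l i) ->
  (fun k => \prod_(i <- r) F i k) @ \oo --> \prod_(i <- r) l i.
Proof.
move=> Fl; elim: r => [|i r IH].
  rewrite (_ : (fun k => _) = cst (\prod_(i <- [::]) l i)); first exact: cvg_cst.
  by apply/funext => k; rewrite !big_nil.
rewrite (_ : (fun k => _) = (fun k => F i k * \prod_(j <- r) F j k)).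
  by rewrite big_cons; exact: cvgM.
by apply/funext => k; rewrite big_cons.
Qed.

Lemma bump_fun_cvg a s x :
  (fun k : nat => bump_fun k.+1%:R a s x) @ \oo --> (\1_(open_cube a s) x : R).
Proof.
have [xa|xa] := pselect (open_cube a s x); last first.
  under eq_fun do rewrite bump_fun_out//.
  by rewrite indicE memNset//; exact: cvg_cst.
rewrite indicE mem_set//; under eq_fun do rewrite bump_funE.
have -> : true%:R = \prod_(i < n) (1 * 1) :> R.
  by rewrite big1// => i _; rewrite mulr1.
apply: cvgn_prod => i; have /andP[? ?] := xa i.
by apply: cvgM; apply: flat1_cvg; lra.
Qed.

Lemma closed_cube_closed a s : closed (closed_cube a s).
Proof.
rewrite (_ : closed_cube a s = \bigcap_(i in [set: 'I_n])
    ((fun x : E => x ord0 i) @^-1` `[a ord0 i, a ord0 i + s])); last first.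
  by apply/seteqP; split => x /= H i; have := H i; rewrite ?in_itv/=; auto.
apply: closed_bigI => i _; apply: closed_comp; last exact: interval_closed.
move=> x _; exact: coord_continuous.
Qed.

Lemma closed_cube_compact a s : compact (closed_cube a s).
Proof.
rewrite (_ : closed_cube a s = [set v : E | forall i, (`[a ord0 i, a ord0 i + s]%classic) (v ord0 i)]).
  apply: (@rV_compact R n (fun i => `[a ord0 i, a ord0 i + s]%classic)) => i.
  exact: segment_compact.
by apply/seteqP; split => x /= H i; have := H i; rewrite in_itv.
Qed.

(** Off a closed set the function vanishes in a neighbourhood, and so do its derivatives. *)
Lemma pderivs_out g (A : set E) s x : closed A -> (forall y, ~ A y -> g y = 0) ->
  ~ A x -> pderivs s g x = 0.
Proof.
move=> cA g0; elim: s x => [|i s IH] x Ax /=; first exact: g0.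
rewrite (@near_eq_derive _ _ _ _ (cst 0)) ?derive_cst//.
have : nbhs x (~` A) by apply: open_nbhs_nbhs; split => //; exact: closed_openC.
by apply: filterS => y; exact: IH.
Qed.

Lemma smooth_zero : smooth (fun _ : E => 0 : R).
Proof. by apply: flat_algebra_smooth; exact: flat_algebra_cst. Qed.

Lemma bump_Cc_infty m a s : 0 < m -> Cc_infty (fun x => (bump_fun m a s x)%:C%C).
Proof.
move=> m0; split.
  split; [exact/flat_algebra_smooth/bump_fun_algebra|exact: smooth_zero].
apply: (@subclosed_compact _ _ (closed_cube a s)).
- exact: closed_closure.
- exact: closed_cube_compact.
- have H : [set x | (bump_fun m a s x)%:C%C != 0] `<=` closed_cube a s.
    move=> x /= xa; apply: contrapT => nx; move/negP: xa; apply.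
    rewrite bump_fun_out// => /open_cube_sub/cube_sub_closed; exact: nx.
  rewrite /support_of closureE => x; apply; split => //; exact: closed_cube_closed.
Qed.

Lemma bump_schwartz m a s : 0 < m -> schwartz (fun x => (bump_fun m a s x)%:C%C).
Proof.
move=> m0; split; first by have [] := bump_Cc_infty a s m0.
move=> k t.
pose g := pderivs t (bump_fun m a s).
have gc : continuous g by apply/flat_algebra_continuous/flat_algebra_pderivs/bump_fun_algebra.
have g0 x : ~ closed_cube a s x -> g x = 0.
  apply: pderivs_out; first exact: closed_cube_closed.
  move=> y ya; apply: bump_fun_out => // /open_cube_sub/cube_sub_closed; exact: ya.
have h0 x : pderivs t (fun _ : E => 0 : R) x = 0.
  by apply: (@pderivs_out _ set0) => //; exact: closed0.
have [M [_ /(_ (M + 1))]] : bounded_set (g @` closed_cube a s).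
  apply: compact_bounded; apply: continuous_compact; last exact: closed_cube_compact.
  exact: continuous_subspaceT.
rewrite ltrDl ltr01 => /(_ isT) gM.
(* A bound of the Euclidean norm on the closed cube, where all the derivatives of the bump are
   supported. *)
pose N := n%:R * \sum_i (`|a ord0 i| + `|s|).
have N0 : 0 <= N by rewrite mulr_ge0// sumr_ge0// => i _; rewrite addr_ge0.
exists (N ^+ k * `|M + 1|) => x.
rewrite /cpderivs /= h0 expr0n/= addr0 sqrtr_sqr.
have [xa|xa] := pselect (closed_cube a s x); last first.
  by rewrite -/(g x) g0// normr0 mulr0 mulr_ge0// exprn_ge0.
apply: ler_pM => //; first by rewrite exprn_ge0// enorm_ge0.
  rewrite lerXn2r ?nnegrE ?enorm_ge0//; apply: enorm_le => i.
  apply: (@le_trans _ _ (`|a ord0 i| + `|s|)).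
    have /andP[x1 x2] := xa i.
    rewrite ler_norml; have := ler_norm (a ord0 i); have := ler_norm s.
    have := lerNnormlW (lexx `|a ord0 i|); have := lerNnormlW (lexx `|s|) => ? ? ? ?.
    by apply/andP; split; lra.
  by rewrite (bigD1 i)//= lerDl sumr_ge0// => j _; rewrite addr_ge0.
apply: le_trans (ler_norm _); apply: gM; by exists x.
Qed.

End smooth_algebra.

(** * Faces of cubes; functions whose integrals against bumps vanish *)

Section null_sets.
Context (R : realType) (n : nat).
Local Notation E := 'rV[R]_n.
Local Notation mu := (leb R n).
Implicit Types (x a : E) (s r : R) (A : set E).

Lemma flat_algebra_measurable (f : E -> R) : flat_algebra f -> measurable_fun setT f.
Proof.
elim=> [c|P i k b|f1 f2 _ c1 _ c2|f1 f2 _ c1 _ c2]; first exact: measurable_cst.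
- apply: (@measurableT_comp _ _ _ _ _ _ (flat P)).
    apply: continuous_measurable_fun; exact: continuous_flat.
  apply: measurable_funD; last exact: measurable_cst.
  by apply: measurable_funM; [exact: measurable_cst|exact: measurable_coord].
- exact: measurable_funD.
- exact: measurable_funM.
Qed.

Lemma measurable_bump m a s : measurable_fun setT (bump_fun m a s : E -> R).
Proof. by apply: flat_algebra_measurable; exact: bump_fun_algebra. Qed.

Lemma leb_hyperplane (i : 'I_n) (b : R) : mu [set x : E | x ord0 i = b] = 0%E.
Proof.
rewrite (_ : [set x : E | x ord0 i = b] = [set x | forall j : 'I_n,
    (if j == i then [set b] else setT) (x ord0 j)]).
  rewrite (@leb_box R n (fun j => if j == i then [set b] else setT)).
    by rewrite (bigD1 i)//= eqxx lebesgue_measure_set1 mul0e.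
  by move=> j; case: ifP => _; [exact: measurable_set1|exact: measurableT].
apply/seteqP; split => x /= H; last by have := H i; rewrite eqxx.
by move=> j; have [->|] := eqVneq j i.
Qed.

Lemma ae_coord_neq (i : 'I_n) (b : R) : {ae mu, forall x, x ord0 i != b}.
Proof.
exists [set x : E | x ord0 i = b]; split; last first.
  by move=> x /= /negP/negPn/eqP.
- exact: leb_hyperplane.
- rewrite (_ : [set x : E | _] = (fun x : E => x ord0 i : measurableTypeR R) @^-1` [set b])//.
  rewrite -[X in measurable X]setTI; apply: measurable_coord => //.
Qed.

(** The faces of a cube lie in finitely many coordinate hyperplanes, which are null. *)
Lemma ae_open_cube a s : {ae mu, forall x, closed_cube a s x -> open_cube a s x}.
Proof.
have H1 : {ae mu, forall x, forall i : 'I_n, x ord0 i != a ord0 i}.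
  by apply: filter_forall => i; exact: ae_coord_neq.
have H2 : {ae mu, forall x, forall i : 'I_n, x ord0 i != a ord0 i + s}.
  by apply: filter_forall => i; exact: ae_coord_neq.
apply: filterS2 H1 H2 => x H1 H2 xa i; have /andP[x1 x2] := xa i.
by rewrite !lt_neqAle x1 x2 H2 eq_sym H1.
Qed.

Lemma ae_cubes (P : E -> Prop) :
  (forall a s, 0 < s -> {ae mu, forall x, cube a s x -> P x}) ->
  {ae mu, forall x, P x}.
Proof.
move=> H.
have := ae_foralln (fun k => H (const_mx (- k.+1%:R)) (2 * k.+1%:R) _).
move=> /(_ (fun k => mulr_gt0 (ltr0Sn _ _) (ltr0Sn _ _))).
apply: filterS => x Px; pose M := \sum_i `|x ord0 i|.
have M0 : 0 <= M by exact: sumr_ge0.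
apply: (Px (Num.bound M)) => i; rewrite mxE.
have xM : `|x ord0 i| <= M by rewrite /M (bigD1 i)//= lerDl sumr_ge0.
have := archi_boundP M0; rewrite -(ltr_pM2l (@ltr0Sn R 0)).
have : (Num.bound M)%:R <= (Num.bound M).+1%:R :> R by rewrite ler_nat.
have := ler_norm (x ord0 i); have := lerNnormlW (lexx `|x ord0 i|).
by move=> ? ? ? ?; apply/andP; split; lra.
Qed.

(** Dominated convergence in the form used below: integrals constantly equal to [c] keep this value
    in the limit. *)
Lemma integral_cvg_dominated A (f_ : (E -> R)^nat) (f g : E -> R) (c : \bar R) :
  measurable A -> (forall k, measurable_fun A (f_ k)) -> measurable_fun A f ->
  {ae mu, forall x, A x -> f_ ^~ x @ \oo --> f x} ->
  mu.-integrable A (EFin \o g) -> (forall x k, A x -> `|f_ k x| <= g x) ->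
  (forall k, \int[mu]_(x in A) (f_ k x)%:E = c)%E ->
  (\int[mu]_(x in A) (f x)%:E = c)%E.
Proof.
move=> mA mf_ mf cf ig dom Ic.
have [] := @dominated_convergence _ _ _ mu A mA (fun k => EFin \o f_ k)
  (EFin \o f) (EFin \o g) _ _ _ ig.
- by move=> k; apply/measurable_EFinP.
- exact/measurable_EFinP.
- by apply: filterS cf => x cx Ax; apply: cvg_EFinP; exact: cx.
- by apply: aeW => x k Ax /=; rewrite lee_fin; exact: dom.
move=> _ _ H; apply: (cvg_unique _ H) => //.
rewrite (_ : [sequence _]_n = cst c); first exact: cvg_cst.
by apply/funext => k; exact: Ic.
Qed.

(** The bump over the tripled cube is bounded below by a positive constant on the cube, so the
    integrability of its product with [g] gives that of [g] there. *)
Lemma bump_integrable_loc (g : E -> R) a s : 0 < s -> measurable_fun setT g ->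
  (forall b r, 0 < r -> mu.-integrable setT (fun x => (g x * bump_fun 1 b r x)%:E)) ->
  mu.-integrable (cube a s) (EFin \o g).
Proof.
move=> s0 mg ig; pose b : E := \row_i (a ord0 i - s).
have s3 : 0 < 3 * s by rewrite mulr_gt0.
pose c : R := (flat 1 (1 * s) ^+ 2) ^+ n.
have c0 : 0 < c by rewrite !exprn_gt0// mul1r flat1_gt0.
have lo x : cube a s x -> c <= bump_fun 1 b (3 * s) x.
  move=> xa; apply: bump_fun_lower => // i; rewrite mxE; have /andP[? ?] := xa i.
  by apply/andP; split; lra.
apply: (@le_integrable _ _ _ mu (cube a s) (measurable_cube a s) _
    (fun x => (c^-1%:E * (g x * bump_fun 1 b (3 * s) x)%:E)%E)).
- by apply/measurable_EFinP; exact: measurable_funTS.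
- move=> x /lo xc /=; rewrite lee_fin !normrM mulrCA -[leLHS]mulr1 ler_wpM2l//.
  have ci : 0 < c^-1 by rewrite invr_gt0.
  rewrite (gtr0_norm ci) mulrC ler_pdivlMr// mul1r.
  exact: le_trans xc (ler_norm _).
- apply: integrableZl; first exact: measurable_cube.
  by apply: (@integrableS _ _ _ mu setT) => //; [exact: measurable_cube|exact: ig].
Qed.

(** The vanishing of the integrals passes from bumps to cubes by dominated convergence, to step
    functions by linearity, to open sets through [inner_approx], and to measurable sets by Dynkin
    induction. It shows that a distribution is represented by at most one function, up to a null
    set. *)
Lemma ae_zero_of_bumps (g : E -> R) : measurable_fun setT g ->
  (forall a s (k : nat), 0 < s ->
    mu.-integrable setT (fun x => (g x * bump_fun k.+1%:R a s x)%:E) /\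
    (\int[mu]_x (g x * bump_fun k.+1%:R a s x)%:E = 0)%E) ->
  {ae mu, forall x, g x = 0}.
Proof.
move=> mg Hg.
have loc a s : 0 < s -> mu.-integrable (cube a s) (EFin \o g).
  by move=> s0; apply: bump_integrable_loc => // b r r0; have [] := Hg b r 0%N r0.
have cube0 a s : 0 < s -> (\int[mu]_(x in cube a s) (g x)%:E = 0)%E.
  move=> s0; have mC := @measurable_cube R n a s.
  apply: (@integral_cvg_dominated _ (fun k x => g x * bump_fun k.+1%:R a s x) _
    (fun x => `|g x|)) => //.
  - by move=> k; apply: measurable_funTS; apply: measurable_funM => //; exact: measurable_bump.
  - exact: measurable_funTS.
  - apply: filterS (ae_open_cube a s) => x + /cube_sub_closed => /[apply] xo.
    rewrite -[X in _ --> X]mulr1; apply: cvgM; first exact: cvg_cst.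
    by have := @bump_fun_cvg R n a s x; rewrite indicE mem_set.
  - exact: integrable_norm (loc a s s0).
  - move=> x k _; rewrite normrM -[leRHS]mulr1 ler_wpM2l//.
    by rewrite ger0_norm ?bump_fun_ge0 ?bump_fun_le1.
  - move=> k; have [_ <-] := Hg a s k s0.
    rewrite [LHS]integral_mkcond; apply: eq_integral => x _.
    rewrite patchE; case: ifPn => //; rewrite notin_setE => xa.
    by rewrite bump_fun_out ?mulr0// => /open_cube_sub; exact: xa.
have step0 N a s h : 0 < s -> step N a s h ->
    mu.-integrable setT (fun x => (g x * h x)%:E) /\
    (\int[mu]_x (g x * h x)%:E = 0)%E.
  elim: N a s h => [|N IH] a s h s0 /=.
    move=> [c ->]; have E1 : (fun x => (g x * (c * \1_(cube a s) x))%:E) =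
        (fun x => (c%:E * ((EFin \o g) \_ (cube a s)) x)%E).
      apply/funext => x; rewrite patchE indicE.
      by case: ifP => _; rewrite ?mulr0 ?mule0// mulr1 mulrC EFinM.
    have I1 : mu.-integrable setT ((EFin \o g) \_ (cube a s)).
      apply/(integrable_mkcond _ (measurable_cube a s)); exact: loc.
    rewrite E1; split; first exact: integrableZl.
    by rewrite integralZl// -integral_mkcond cube0 ?mule0.
  move=> [k [ks ->]].
  have E1 : (fun x => (g x * \sum_e k e x)%:E) =
      (fun x => \sum_(e <- index_enum {ffun 'I_n -> bool}) (g x * k e x)%:E)%E.
    by apply/funext => x; rewrite mulr_sumr -sumEFin.
  have IH' e := IH _ _ (k e) (halfr_gt0 s0) (ks e).
  rewrite E1; split.
    by apply: integrable_sum => // e _; have [] := IH' e.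
  rewrite integral_sum//; last by move=> e; have [] := IH' e.
  by rewrite big1// => e _; have [] := IH' e.
apply: ae_cubes => a s s0.
have mC := @measurable_cube R n a s.
suff g0 A : measurable A -> (\int[mu]_(x in A `&` cube a s) (g x)%:E = 0)%E.
  have : ae_eq mu (cube a s) (EFin \o g) (cst 0%E).
    apply: integral_ae_eq => //; first exact: loc.
    by move=> A sA mA; rewrite -(setIidl sA) [LHS]g0// integral0.
  by apply: filterS => x /[apply] -[].
have ig := loc a s s0.
have igA B : measurable B -> mu.-integrable (B `&` cube a s) (EFin \o g).
  by move=> mB; apply: integrableS ig => //; exact: measurableI.
rewrite measurable_open_sets; move: A.
apply: (dynkin_induction (@measurable_open_sets R n)
  (P := fun A => (\int[mu]_(x in A `&` cube a s) (g x)%:E = 0)%E)).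
- move=> A B [mA oA] [mB oB]; split; first exact: measurableI.
  move=> x [Ax Bx]; have [r r0 rA] := oA _ Ax; have [r' r0' rB] := oB _ Bx.
  exists (Num.min r r'); first by rewrite lt_min r0.
  move=> z zx; split.
    by apply: rA => i; apply: lt_le_trans (zx i) _; rewrite ge_min lexx.
  by apply: rB => i; apply: lt_le_trans (zx i) _; rewrite ge_min lexx orbT.
- by rewrite setTI cube0.
- move=> A [mA oA].
  rewrite setIC integral_mkcondr.
  under eq_integral do rewrite epatch_indic -EFinM.
  apply: (@integral_cvg_dominated _ (fun k x => g x * inner_approx k a s A x) _
    (fun x => `|g x|)) => //.
  - move=> k; apply: measurable_funTS; apply: measurable_funM => //.
    exact: measurable_step (step_inner_approx _ _ _ _).
  - by apply: measurable_funTS; apply: measurable_funM => //; exact: measurable_indic.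
  - apply: aeW => x xa; apply: cvgM; first exact: cvg_cst.
    exact: inner_approx_cvg (ltW s0) oA xa.
  - exact: integrable_norm.
  - move=> x k xa; rewrite normrM -[leRHS]mulr1 ler_wpM2l//.
    exact: inner_approx_le1 (ltW s0) xa.
  - move=> k; have [_ <-] := step0 _ _ _ _ s0 (step_inner_approx k a s A).
    rewrite [LHS]integral_mkcond; apply: eq_integral => x _.
    rewrite patchE; case: ifPn => //; rewrite notin_setE => xa.
    by rewrite (step_supp (ltW s0) (step_inner_approx _ _ _ _) xa) mulr0.
- move=> A mA A0; have := cube0 a s s0.
  rewrite -[X in integral _ X](setTI (cube a s)) -(setUv A) setIUl.
  rewrite integral_setU_EFin//; last 4 first.
  + exact: measurableI.
  + by apply: measurableI => //; exact: measurableC.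
  + exact: measurable_funTS.
  + by apply/disj_setPS => x [[Ax _] []].
  by rewrite A0 add0e.
- move=> F mF tF F0; rewrite setI_bigcupl integral_bigcup//.
  + by apply: eseries0 => k _ _; exact: F0.
  + move=> i j _ _ [x [[Fi _] [Fj _]]]; apply: tF => //; by exists x.
  + by move=> k; exact: measurableI.
  + by rewrite -setI_bigcupl; apply: igA; exact: bigcup_measurable.
Qed.

End null_sets.

(** * Complex measurable functions and operators linear almost everywhere *)

Section complex_functions.
Context (R : realType).
Local Notation C := R[i].

Lemma ReD (z1 z2 : C) : complex.Re (z1 + z2) = complex.Re z1 + complex.Re z2.
Proof. by case: z1; case: z2. Qed.
Lemma ImD (z1 z2 : C) : complex.Im (z1 + z2) = complex.Im z1 + complex.Im z2.
Proof. by case: z1; case: z2. Qed.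
Lemma ReN (z : C) : complex.Re (- z) = - complex.Re z.
Proof. by case: z. Qed.
Lemma ImN (z : C) : complex.Im (- z) = - complex.Im z.
Proof. by case: z. Qed.
Lemma ReM (z1 z2 : C) : complex.Re (z1 * z2) =
  complex.Re z1 * complex.Re z2 - complex.Im z1 * complex.Im z2.
Proof. by case: z1; case: z2. Qed.
Lemma ImM (z1 z2 : C) : complex.Im (z1 * z2) =
  complex.Re z1 * complex.Im z2 + complex.Im z1 * complex.Re z2.
Proof. by case: z1; case: z2. Qed.
Lemma complex_eqP (z1 z2 : C) : complex.Re z1 = complex.Re z2 ->
  complex.Im z1 = complex.Im z2 -> z1 = z2.
Proof. by case: z1 => a b; case: z2 => c d /= -> ->. Qed.

Context d (T : measurableType d).
Implicit Types (f g : T -> C) (D : set T) (u : T -> R).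
Local Notation cmeas f := (cmeasurable setT f).

Lemma cmeas_cst (z : C) : cmeas (fun _ : T => z).
Proof. by split; exact: measurable_cst. Qed.

Lemma cmeasD f g : cmeas f -> cmeas g -> cmeas (fun x => f x + g x).
Proof.
move=> [f1 f2] [g1 g2]; split.
  by under eq_fun do rewrite ReD; exact: measurable_funD.
by under eq_fun do rewrite ImD; exact: measurable_funD.
Qed.

Lemma cmeasM f g : cmeas f -> cmeas g -> cmeas (fun x => f x * g x).
Proof.
move=> [f1 f2] [g1 g2]; split.
  by under eq_fun do rewrite ReM; apply: measurable_funB; exact: measurable_funM.
by under eq_fun do rewrite ImM; apply: measurable_funD; exact: measurable_funM.
Qed.

Lemma cmeasN f : cmeas f -> cmeas (fun x => - f x).
Proof.
move=> mf; under eq_fun do rewrite -mulN1r.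
by apply: cmeasM => //; exact: cmeas_cst.
Qed.

Lemma cmeasB f g : cmeas f -> cmeas g -> cmeas (fun x => f x - g x).
Proof. by move=> mf mg; apply: cmeasD => //; exact: cmeasN. Qed.

Lemma cmeas_real u : measurable_fun setT u -> cmeas (fun x => (u x)%:C%C).
Proof. by move=> mu; split => //=; exact: measurable_cst. Qed.

Lemma indic_real D x : \1_D x = ((\1_D x : R)%:C)%C :> C.
Proof. by rewrite !indicE; case: (_ \in _). Qed.

Lemma cmeas_indic f D : measurable D -> cmeas f -> cmeas (fun x => f x * \1_D x).
Proof.
move=> mD mf; under eq_fun do rewrite indic_real.
by apply: cmeasM => //; apply: cmeas_real; exact: measurable_indic.
Qed.

Lemma nnm_normc f : cmeas f -> nnm (fun x => normc (f x)).
Proof.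
move=> [f1 f2]; split; last by move=> x; exact: normc_ge0.
have sq : measurable_fun setT (@Num.sqrt R).
  by apply: continuous_measurable_fun => x; exact: sqrt_continuous.
rewrite (_ : (fun _ => _) = (fun x => Num.sqrt (complex.Re (f x) ^+ 2 + complex.Im (f x) ^+ 2))).
  apply: (measurableT_comp sq); apply: measurable_funD; exact: measurable_funX.
by apply/funext => x; case: (f x).
Qed.

Lemma normc_indic f D x : normc (f x * \1_D x) = normc (f x) * \1_D x.
Proof. by rewrite indic_real normcM normc_real ger0_norm. Qed.

Lemma normc0 : normc (0 : C) = 0.
Proof. by rewrite /= expr0n addr0 sqrtr0. Qed.

Lemma normc_eq0 (z : C) : normc z = 0 -> z = 0.
Proof. exact: eq0_normc. Qed.

Context (mu : {measure set T -> \bar R}).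

(** Convergence in measure makes null, for all [j] and [N], the set where [|F - F_m| > 1 / (j + 1)]
    for all [m >= N]. At the other points [F] is approached by arbitrarily late [F_m], whose
    pointwise limit is [k]. *)
Lemma cvg_measure_ae_eq D (F k : T -> C) (F_ : nat -> T -> C) : cmeas F ->
  (forall m, cmeas (F_ m)) ->
  (forall (t e : R), 0 < t -> 0 < e -> exists N, forall m, (N <= m)%N ->
     (mu [set x | (t < normc (F x - F_ m x))%R] <= e%:E)%E) ->
  {ae mu, forall x, D x -> (fun m => normc (F_ m x - k x)) @ \oo --> (0 : R)} ->
  {ae mu, forall x, D x -> F x = k x}.
Proof.
move=> mF mF_ cm ck.
pose B (j m : nat) := [set x | j.+1%:R^-1 < normc (F x - F_ m x)].
have mB j m : measurable (B j m).
  by apply: measurable_gt; apply: (nnm_normc _).1; exact: cmeasB.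
have null (j N : nat) : {ae mu, forall x, exists2 m, (N <= m)%N & ~ B j m x}.
  exists (\bigcap_m B j (m + N)%N); split.
  - exact: bigcapT_measurable.
  - apply/eqP; rewrite eq_le measure_ge0 andbT; apply/lee_addgt0Pr => e e0.
    have j0 : 0 < j.+1%:R^-1 :> R by rewrite invr_gt0.
    have [M MP] := cm j.+1%:R^-1 e j0 e0.
    rewrite add0e; apply: le_trans (MP (M + N)%N (leq_addr _ _)).
    apply: le_measure; rewrite ?inE//; first exact: bigcapT_measurable.
    - exact: mB.
    - by move=> x /(_ M); apply.
  - move=> x /= nx m _; apply: contrapT => Bx; apply: nx.
    by exists (m + N)%N => //; exact: leq_addl.
have {}null := ae_foralln (fun j => ae_foralln (null j)).
apply: filterS2 null ck => x nx cx Dx; apply/eqP; rewrite -subr_eq0; apply/eqP.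
apply: normc_eq0; apply/eqP; rewrite eq_le normc_ge0 andbT.
apply/ler_addgt0Pr => e e0; rewrite add0r.
have [j je] : exists j : nat, j.+1%:R^-1 < e / 2 :> R.
  exists (Num.bound (e / 2)^-1); rewrite -[X in _ < X]invrK ltf_pV2 ?posrE ?invr_gt0 ?divr_gt0//.
  apply: lt_trans (archi_boundP _) _; first by rewrite invr_ge0 divr_ge0// ltW.
  by rewrite ltr_nat.
have /cvgr0Pnorm_lt/(_ _ (divr_gt0 e0 (ltr0Sn _ 1)))[N _ NP] := cx Dx.
have [m Nm /negP] := nx j N; rewrite -leNgt => Fm.
have := NP m Nm; rewrite /= ger0_norm ?normc_ge0// => Fk.
rewrite -(subrKA (F_ m x)); apply: (le_trans (normc_triangle _ _)).
rewrite [e]splitr; apply: lerD; last exact: ltW.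
exact: le_trans Fm (ltW je).
Qed.

Section linear_ops.
Context (P : (T -> C) -> Prop) (S : (T -> C) -> (T -> C)).
Hypothesis linS : forall (a : C) f g, P f -> P g ->
  {ae mu, forall x, S (fun y => a * f y + g y) x = a * S f x + S g x}.

(** [S 0 = S 0 + S 0] almost everywhere. *)
Lemma ae_lin0 : P (fun=> 0) -> {ae mu, forall x, S (fun=> 0) x = 0}.
Proof.
move=> P0; have := linS 1 P0 P0.
rewrite (_ : (fun _ : T => 1 * 0 + 0) = (fun=> 0 : C)); last first.
  by apply/funext => x; rewrite mulr0 addr0.
by apply: filterS => x; rewrite mul1r => /eqP; rewrite addrC -subr_eq subrr eq_sym => /eqP.
Qed.

Lemma ae_linD f g : P f -> P g ->
  {ae mu, forall x, S (fun y => f y + g y) x = S f x + S g x}.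
Proof.
move=> Pf Pg; have := linS 1 Pf Pg.
rewrite (_ : (fun y : T => 1 * f y + g y) = (fun y => f y + g y)).
  by apply: filterS => x; rewrite mul1r.
by apply/funext => x; rewrite mul1r.
Qed.

Lemma ae_linB f g : P f -> P g ->
  {ae mu, forall x, S (fun y => f y - g y) x = S f x - S g x}.
Proof.
move=> Pf Pg; have := linS (-1) Pg Pf.
rewrite (_ : (fun y : T => -1 * g y + f y) = (fun y => f y - g y)).
  by apply: filterS => x ->; rewrite mulN1r addrC.
by apply/funext => x; rewrite mulN1r addrC.
Qed.

Lemma ae_lin_sum (I : Type) (r : seq I) (F : I -> T -> C) : P (fun=> 0) ->
  (forall f g, P f -> P g -> P (fun x => f x + g x)) -> (forall i, P (F i)) ->
  P (fun x => \sum_(i <- r) F i x) /\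
  {ae mu, forall x, S (fun y => \sum_(i <- r) F i y) x = \sum_(i <- r) S (F i) x}.
Proof.
move=> P0 PD PF; elim: r => [|i r [PIH IH]].
  rewrite (_ : (fun x => _) = (fun=> 0)); last by apply/funext => x; rewrite big_nil.
  split => //; apply: filterS (ae_lin0 P0) => x ->; by rewrite big_nil.
rewrite (_ : (fun x => _) = (fun y => F i y + \sum_(i <- r) F i y)); last first.
  by apply/funext => x; rewrite big_cons.
split; first exact: PD.
apply: filterS2 IH (ae_linD (PF i) PIH) => x IH ->.
by rewrite big_cons IH.
Qed.

End linear_ops.
End complex_functions.

(** * Complex integrals and Lebesgue spaces *)

Section complex_integrals.
Context (R : realType) (n : nat).
Local Notation E := 'rV[R]_n.
Local Notation C := R[i].
Local Notation mu := (leb R n).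
Implicit Types (f g : E -> C) (D : set E).
Local Notation cmeas f := (cmeasurable setT f).

Lemma cintegrable_normc D f : measurable D -> cmeas f ->
  (\nint[mu]_(x in D) (normc (f x)) < +oo)%E -> cintegrable D f.
Proof.
move=> mD mf foo; have nf := nnm_normc mf.
have H (u : E -> R) : measurable_fun setT u -> (forall x, `|u x| <= normc (f x)) ->
    mu.-integrable D (EFin \o u).
  move=> mu' uf; apply/integrableP; split.
    by apply/measurable_EFinP; exact: measurable_funTS.
  by apply: le_lt_trans foo; apply: nint_le => //; exact: nnm_norm.
split; apply: H; [exact: mf.1| |exact: mf.2|] => x.
  exact: Re_le_normc.
exact: Im_le_normc.
Qed.

(** The factor 2 comes from bounding the real and the imaginary parts separately by the modulus. *)
Lemma normc_cintegral_le D f : measurable D -> cmeas f ->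
  ((normc (cintegral D f))%:E <= 2%:E * \nint[mu]_(x in D) (normc (f x)))%E.
Proof.
move=> mD mf; have nf := nnm_normc mf.
have H (u : E -> R) : measurable_fun setT u -> (forall x, `|u x| <= normc (f x)) ->
    (`|Rintegral mu D u|%:E <= \nint[mu]_(x in D) (normc (f x)))%E.
  move=> mu' uf; apply: (@le_trans _ _ `|\int[mu]_(x in D) (u x)%:E|%E).
    (* [Rintegral] takes the value 0 when the integral is infinite; the bound is then trivial. *)
    rewrite /Rintegral; case: (integral _ _ _) => [r| |] //=; rewrite ?normr0 ?leey//.
  apply: (@le_trans _ _ (\int[mu]_(x in D) `|(u x)%:E|)%E).
    by apply: le_abse_integral => //; apply/measurable_EFinP; exact: measurable_funTS.
  by apply: nint_le => //; exact: nnm_norm.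
apply: (@le_trans _ _ (`|complex.Re (cintegral D f)| + `|complex.Im (cintegral D f)|)%:E).
  by rewrite lee_fin; exact: normc_le_ReIm.
rewrite EFinD; have -> : 2%:E = (1%:E + 1%:E)%E :> \bar R by rewrite -EFinD.
rewrite ge0_muleDl ?lee_fin// !mul1e; apply: leeD; apply: H.
- exact: mf.1.
- by move=> x; exact: Re_le_normc.
- exact: mf.2.
- by move=> x; exact: Im_le_normc.
Qed.

Lemma cintegral_lin D (a : C) f g : measurable D -> cintegrable D f -> cintegrable D g ->
  cintegral D (fun x => a * f x + g x) = a * cintegral D f + cintegral D g.
Proof.
move=> mD [f1 f2] [g1 g2].
have Z (r : R) (u : E -> R) : mu.-integrable D (EFin \o u) ->
    mu.-integrable D (EFin \o (fun x => r * u x)).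
  move=> iu; rewrite (_ : _ \o _ = (fun x => (r%:E * (EFin \o u) x)%E)).
    exact: integrableZl.
  by apply/funext => x /=.
have Dd (u v : E -> R) : mu.-integrable D (EFin \o u) -> mu.-integrable D (EFin \o v) ->
    mu.-integrable D (EFin \o (fun x => u x + v x)).
  by move=> iu iv; exact: (integrableD mD iu iv).
apply: complex_eqP.
- rewrite ReD ReM /=.
  under eq_Rintegral do rewrite ReD ReM -mulNr.
  rewrite RintegralD//; last by apply: (Dd _ _ (Z _ _ f1) (Z _ _ f2)).
  rewrite RintegralD//; [|exact: Z|exact: Z].
  by rewrite !RintegralZl// mulNr.
- rewrite ImD ImM /=.
  under eq_Rintegral do rewrite ImD ImM.
  rewrite RintegralD//; last by apply: (Dd _ _ (Z _ _ f2) (Z _ _ f1)).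
  rewrite RintegralD//; [|exact: Z|exact: Z].
  by rewrite !RintegralZl.
Qed.

Lemma cintegrable_lin D (a : C) f g : measurable D -> cmeas f -> cmeas g ->
  (\nint[mu]_(x in D) (normc (f x)) < +oo)%E ->
  (\nint[mu]_(x in D) (normc (g x)) < +oo)%E ->
  (\nint[mu]_(x in D) (normc (a * f x + g x)) < +oo)%E.
Proof.
move=> mD mf mg foo goo; have nf := nnm_normc mf; have ng := nnm_normc mg.
have a0 := normc_ge0 a.
apply: (@le_lt_trans _ _ (\nint[mu]_(x in D) (normc a * normc (f x) + normc (g x)))%E).
  apply: nint_le => //.
  - by apply: nnm_normc; apply: cmeasD => //; apply: cmeasM => //; exact: cmeas_cst.
  - by apply: nnmD => //; exact: nnmZ.
  - by move=> x _; rewrite -normcM; exact: normc_triangle.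
rewrite nintD//; last exact: nnmZ.
by rewrite nintZ// lte_add_pinfty// lte_mul_pinfty// lee_fin.
Qed.

Lemma LpnormE (p : R) f : 0 < p ->
  (Lpnorm p f `^ p)%E = \nint[mu]_(x in setT) (normc (f x) `^ p).
Proof.
move=> p0; rewrite /Lpnorm.
rewrite poweR_Lnorm; last by rewrite gt_eqF.
congr (integral _ _ _); apply/funext => x.
by rewrite /= ger0_norm ?normc_ge0.
Qed.

Lemma in_LpP (p : R) f : 0 < p -> in_Lp p f <->
  cmeas f /\ (\nint[mu]_(x in setT) (normc (f x) `^ p) < +oo)%E.
Proof.
move=> p0; rewrite -LpnormE//; split => -[mf foo]; split => //.
  exact: poweR_lty.
by apply: lty_poweRy foo; rewrite gt_eqF.
Qed.

Lemma Lpnorm1 f : Lpnorm 1 f = \nint[mu]_(x in setT) (normc (f x)).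
Proof.
rewrite /Lpnorm Lnorm1; apply: eq_integral => x _ /=.
by rewrite ger0_norm ?normc_ge0.
Qed.

Lemma in_L1P f : in_Lp 1 f <->
  cmeas f /\ (\nint[mu]_(x in setT) (normc (f x)) < +oo)%E.
Proof. by rewrite /in_Lp Lpnorm1. Qed.

Lemma in_L2P f : in_Lp 2 f <->
  cmeas f /\ (\nint[mu]_(x in setT) (normc (f x) ^+ 2) < +oo)%E.
Proof.
rewrite in_LpP//; under eq_integral do rewrite powR_mulrn ?normc_ge0//.
by [].
Qed.

End complex_integrals.

(** * The Dini and Hörmander conditions *)

Section dini.
Context (R : realType).
Implicit Types (theta : R -> R).

Lemma half_expr_gt0 (k : nat) : 0 < 2^-1 ^+ k :> R.
Proof. by rewrite exprn_gt0. Qed.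

Lemma half_expr_le1 (k : nat) : 2^-1 ^+ k <= 1 :> R.
Proof. by rewrite exprn_ile1 ?invr_ge0// invf_le1// ler1n. Qed.

(** On the interval from [2^-(k+1)] to [2^-k], of length [2^-(k+1)], the quotient [theta t / t] is
    at least [2^k theta (2^-(k+1))]: each term of the sum is at most twice the integral over its
    interval. *)
Lemma dini_sum theta : dini theta ->
  exists2 M : R, 0 <= M & forall N, \sum_(k < N) theta (2^-1 ^+ k.+1) <= M.
Proof.
move=> [th0 thm Ioo].
pose I := (\int[lebesgue_measure]_(t in `]0%R, 1%R[) (theta t / t)%:E)%E.
pose F (k : nat) : set R := `]2^-1 ^+ k.+1, 2^-1 ^+ k[%classic.
have mF k : measurable (F k) by exact: measurable_itv.
have mth : measurable_fun (`]0%R, 1%R[ : set R) (fun t => theta t / t).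
  apply: measurable_funM.
    (* Extended by 0 to the left of the origin, [theta] is monotone on the whole line, hence
       measurable. *)
    pose th' t := if 0 < t then theta t else 0.
    apply: (@eq_measurable_fun _ _ _ _ _ th').
      by move=> t; rewrite inE/= in_itv/= => /andP[t0 _]; rewrite /th' t0.
    apply: measurable_funTS; apply: nondecreasing_measurable => //.
    move=> t1 t2 t12; rewrite /th'; case: ltP => t10; last first.
      by case: ltP => // t20; exact: th0.
    by rewrite (lt_le_trans t10 t12); exact: thm.
  apply: open_continuous_measurable_fun; first exact: interval_open.
  move=> t; rewrite inE/= in_itv/= => /andP[t0 _].
  by apply: inv_continuous; rewrite gt_eqF.
have I0 : (0 <= I)%E.
  apply: integral_ge0 => t /=; rewrite in_itv/= => /andP[t0 _].
  by rewrite lee_fin divr_ge0 ?th0 ?ltW.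
have If : I \is a fin_num by rewrite ge0_fin_numE.
exists (2 * fine I); first by rewrite mulr_ge0// fine_ge0.
move=> N.
have F01 k : F k `<=` `]0%R, 1%R[.
  move=> t; rewrite /F /= !in_itv/= => /andP[t1 t2]; apply/andP; split.
    exact: lt_trans (half_expr_gt0 _) t1.
  exact: lt_le_trans t2 (half_expr_le1 _).
have key : (\sum_(k < N) (theta (2^-1 ^+ k.+1) / 2)%:E <= I)%E.
  apply: (@le_trans _ _ (\sum_(k < N) \int[lebesgue_measure]_(t in F k) (theta t / t)%:E)%E).
    apply: lee_sum => k _.
    apply: (@le_trans _ _ (\int[lebesgue_measure]_(t in F k) (theta (2^-1 ^+ k.+1) / 2^-1 ^+ k)%:E)%E).
      have lF : lebesgue_measure (F k) = (2^-1 ^+ k - 2^-1 ^+ k.+1)%:E.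
        rewrite /F lebesgue_measure_itv/= lte_fin ifT ?EFinB// exprS.
        have := half_expr_gt0 k; lra.
      have -> : \nint[lebesgue_measure]_(_ in F k) (theta (2^-1 ^+ k.+1) / 2^-1 ^+ k) =
          ((theta (2^-1 ^+ k.+1) / 2^-1 ^+ k)%:E * (2^-1 ^+ k - 2^-1 ^+ k.+1)%:E)%E.
        rewrite -lF.
        first [exact (integral_cst _ (mF k) _) | exact (nint_cst _ _ (mF k)) |
          (have Hc := @nint_cst _ _ R lebesgue_measure (F k) (theta (2^-1 ^+ k.+1) / 2^-1 ^+ k) (mF k); exact Hc)
          | (rewrite integral_cst; [reflexivity|exact (mF k)])|(rewrite integral_cst; [done|exact (mF k)])].
      rewrite -EFinM lee_fin le_eqVlt.
      apply/orP; left; apply/eqP.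
      rewrite exprS; have := half_expr_gt0 k; set y := 2^-1 ^+ k => y0.
      by field; rewrite gt_eqF.
    apply: ge0_le_integral => //.
    - exact: mF.
    - by move=> t _; rewrite lee_fin divr_ge0 ?th0 ?half_expr_gt0// ltW ?half_expr_gt0.
    - apply/measurable_EFinP; apply: measurable_funS mth => //; exact: F01.
    - move=> t; rewrite /F /= in_itv/= => /andP[t1 t2].
      have t0 : 0 < t := lt_trans (half_expr_gt0 _) t1.
      rewrite lee_fin ler_pM ?th0 ?half_expr_gt0// ?invr_ge0 ?(ltW (half_expr_gt0 _))//.
        exact: thm (half_expr_gt0 _) (ltW t1).
      by rewrite lef_pV2 ?posrE ?half_expr_gt0//; exact: ltW.
  have tF : trivIset setT F.
    apply: ltn_trivIset => k j jk; apply/seteqP; split => // t [].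
    rewrite /F /= !in_itv/= => /andP[t1 t2] /andP[t3 t4].
    have : 2^-1 ^+ k <= 2^-1 ^+ j.+1 :> R by rewrite ler_wiXn2l ?invr_ge0 ?invf_le1// ler1n.
    lra.
  rewrite -(big_mkord xpredT (fun k => \int[lebesgue_measure]_(t in F k) (theta t / t)%:E)%E).
  rewrite -(@ge0_integral_bigsetU _ _ _ lebesgue_measure _ F (fun t => (theta t / t)%:E) (index_iota 0 N))//.
  - apply: ge0_subset_integral => //.
    + by apply: bigsetU_measurable => k _; exact: mF.
    + exact/measurable_EFinP.
    + move=> t /=; rewrite in_itv/= => /andP[t0 _].
      by rewrite lee_fin divr_ge0 ?th0 ?ltW.
    + by rewrite -bigcup_seq => t [k _ Fk]; exact: F01 Fk.
  - exact: iota_uniq.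
  - by apply: sub_trivIset tF.
  - apply/measurable_EFinP; apply: measurable_funS mth => //.
    by rewrite -bigcup_seq => t [k _ Fk]; exact: F01 Fk.
  - rewrite -bigcup_seq => t [k _ /F01]; rewrite /= in_itv/= => /andP[t0 _].
    by rewrite lee_fin divr_ge0 ?th0 ?ltW.
move: key; rewrite sumEFin -(fineK If) lee_fin -mulr_suml; lra.
Qed.

End dini.

Section kernel.
Context (R : realType) (n : nat).
Local Notation E := 'rV[R]_n.
Local Notation C := R[i].
Local Notation mu := (leb R n).
Local Notation cmeas f := (cmeasurable setT f).
Implicit Types (a x y c : E) (s r : R) (u h : E -> R) (f g : E -> C) (D : set E).

Definition rc u : E -> C := fun x => (u x)%:C%C.

Lemma nneseries_le (u : (\bar R)^nat) (c : \bar R) : (forall k, (0 <= u k)%E) ->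
  (forall N, (\sum_(0 <= k < N) u k <= c)%E) -> (\sum_(0 <= k <oo) u k <= c)%E.
Proof.
move=> u0 uc; apply: lime_le; first by apply: is_cvg_nneseries => k _ _; exact: u0.
by apply: nearW => N; exact: uc.
Qed.

Lemma leb_eball_le c r : 0 <= r -> (mu (eball c r) <= ((2 * r) ^+ n)%:E)%E.
Proof.
move=> r0; rewrite -(@leb_cube R n (\row_i (c ord0 i - r))) ?mulr_ge0//.
apply: le_measure; rewrite ?inE; [exact: measurable_eball|exact: measurable_cube|].
exact: eball_sub_cube.
Qed.

Lemma eball_annuli c r : 0 < r ->
  ~` eball c r `<=` \bigcup_k (eball c (2 ^+ k.+1 * r) `\` eball c (2 ^+ k * r)).
Proof.
move=> r0 x /= xr.
have H (m : nat) : eball c (2 ^+ m * r) x ->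
    exists2 k : nat, True & (eball c (2 ^+ k.+1 * r) `\` eball c (2 ^+ k * r)) x.
  elim: m => [|m IH]; first by rewrite expr0 mul1r => /xr.
  by move=> xm; have [/IH//|xm'] := pselect (eball c (2 ^+ m * r) x); exists m.
have [//|k _ ?] := H (Num.bound (enorm (x - c) / r)).
  rewrite /eball /= -ltr_pdivrMr//; apply: lt_trans (archi_boundP _) _.
    by rewrite divr_ge0 ?enorm_ge0// ltW.
  by rewrite -natrX ltr_nat ltn_expl.
by exists k.
Qed.

Context (theta : R -> R) (K : E -> E -> C) (AK : R).
Hypothesis hn : (0 < n)%N.
Hypothesis htheta : dini theta.
Hypothesis AK0 : 0 < AK.
Hypothesis mK : cmeasurable setT (fun z : E * E => K z.1 z.2).
Hypothesis K1 : forall x y, x != y -> normc (K x y) <= AK * enorm (x - y) ^- n.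
Hypothesis K2 : forall x y z, x != z -> enorm (x - z) < enorm (x - y) / 2 ->
  normc (K x y - K z y) + normc (K y x - K y z) <=
  AK * enorm (x - y) ^- n * theta (enorm (x - z) / enorm (x - y)).

Lemma cmeas_kernel_r x : cmeas (fun y => K x y).
Proof.
split; [exact: (measurable_fun_pair2 x mK.1)|exact: (measurable_fun_pair2 x mK.2)].
Qed.

Lemma cmeas_kernel_l y : cmeas (fun x => K x y).
Proof.
split; [exact: (measurable_fun_pair1 y mK.1)|exact: (measurable_fun_pair1 y mK.2)].
Qed.

Lemma enorm_cube_le a s x y : cube a s x -> cube a s y -> enorm (x - y) <= n%:R * s.
Proof.
move=> xa ya; apply: enorm_le => i; rewrite !mxE ler_norml.
have /andP[? ?] := xa i; have /andP[? ?] := ya i; apply/andP; split; lra.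
Qed.

Lemma corner_in_cube a s : 0 < s -> cube a s a.
Proof. by move=> s0 i; rewrite lexx ltrDl. Qed.

(** On the annulus at distance about [2^k rho] of the corner the smoothness condition bounds the
    difference by [AK (2^k rho)^-n theta (2^-(k+1))]. The volume contributes [4^n (2^k rho)^n], and
    the Dini sum adds up the annuli. *)
Lemma hormander : exists2 CH : R, 0 <= CH & forall a s y, 0 < s -> cube a s y ->
  (\nint[mu]_(x in ~` eball a (4 * n%:R * s)) (normc (K x y - K x a)) <= CH%:E)%E.
Proof.
have [M M0 thM] := dini_sum htheta.
exists (AK * 4 ^+ n * M); first by rewrite !mulr_ge0 ?exprn_ge0// ltW.
move=> a s y s0 ya; set rho := 4 * n%:R * s.
have nR0 : 0 < n%:R :> R by rewrite ltr0n.
have rho0 : 0 < rho by rewrite !mulr_gt0.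
have nf : nnm (fun x => normc (K x y - K x a)).
  by apply: nnm_normc; apply: cmeasB; exact: cmeas_kernel_l.
pose F k := eball a (2 ^+ k.+1 * rho) `\` eball a (2 ^+ k * rho).
have mF k : measurable (F k) by apply: measurableD; exact: measurable_eball.
have [th0 thm _] := htheta.
apply: (@le_trans _ _ (\nint[mu]_(x in \bigcup_k F k) (normc (K x y - K x a)))%E).
  apply: nint_sub => //; last exact: eball_annuli.
  - by apply: measurableC; exact: measurable_eball.
  - exact: bigcup_measurable.
apply: (le_trans (nint_bigcup_le _ mF nf)).
have piece k : (\nint[mu]_(x in F k) (normc (K x y - K x a)) <=
    (AK * 4 ^+ n * theta (2^-1 ^+ k.+1))%:E)%E.
  have q0 : 0 < 2 ^+ k * rho by rewrite mulr_gt0// exprn_gt0.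
  pose c := AK * (2 ^+ k * rho) ^- n * theta (2^-1 ^+ k.+1).
  have thk : 0 <= theta (2^-1 ^+ k.+1) by apply: th0; exact: half_expr_gt0.
  have c0 : 0 <= c by rewrite /c !mulr_ge0 ?invr_ge0 ?exprn_ge0// ltW.
  apply: (@le_trans _ _ (\nint[mu]_(x in F k) c)%E).
    apply: nint_le => //.
    move=> x [_ /negP]; rewrite -leNgt => xk.
    have [->|ay] := eqVneq a y; first by rewrite subrr normc0.
    (* The removed ball has radius four times the bound [n s] of the distance between points of the
       cube, which leaves room for the condition [|a - y| < |a - x| / 2]. *)
    have d1 : enorm (a - y) <= rho / 4.
      have -> : rho / 4 = n%:R * s by rewrite /rho; field.
      exact: enorm_cube_le (corner_in_cube _ s0) ya.
    have d2 : 2 ^+ k * rho <= enorm (a - x) by rewrite enorm_sub.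
    have d3 : rho <= 2 ^+ k * rho.
      by rewrite ler_peMl ?(ltW rho0)// exprn_ege1// ler1n.
    have dx0 : 0 < enorm (a - x) := lt_le_trans q0 d2.
    have d4 : enorm (a - y) < enorm (a - x) / 2 by lra.
    rewrite normc_distC.
    apply: (@le_trans _ _ (AK * enorm (a - x) ^- n * theta (enorm (a - y) / enorm (a - x)))).
      apply: le_trans (K2 ay d4); rewrite lerDr; exact: normc_ge0.
    have ay0 := enorm_gt0 ay.
    apply: ler_pM.
    - by rewrite mulr_ge0 ?invr_ge0 ?exprn_ge0 ?enorm_ge0// ltW.
    - by rewrite th0// divr_gt0.
    - rewrite ler_pM2l// lef_pV2 ?posrE ?exprn_gt0//.
      by apply: lerXn2r => //; rewrite nnegrE ltW.
    - apply: thm; first by rewrite divr_gt0.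
      rewrite ler_pdivrMr// (le_trans d1)//.
      apply: (@le_trans _ _ (2^-1 ^+ k.+1 * (2 ^+ k * rho))).
        have h1 : 2^-1 ^+ k * 2 ^+ k = 1 :> R by rewrite -exprMn mulVf// expr1n.
        by rewrite exprS -mulrA [X in _ <= _ * X]mulrA h1; lra.
      by rewrite ler_pM2l ?half_expr_gt0.
  rewrite nint_cst//; apply: (@le_trans _ _ (c%:E * ((2 * (2 ^+ k.+1 * rho)) ^+ n)%:E)%E).
    rewrite lee_wpmul2l ?lee_fin//; apply: le_trans (leb_eball_le a _).
      apply: le_measure; rewrite ?inE//; first exact: measurable_eball.
      by move=> x [].
    by rewrite mulr_ge0 ?exprn_ge0// ltW.
  rewrite -EFinM lee_fin /c le_eqVlt; apply/orP; left; apply/eqP.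
  have qn0 : (2 ^+ k * rho) ^+ n != 0 by rewrite gt_eqF// exprn_gt0.
  have -> : 2 * (2 ^+ k.+1 * rho) = (2 ^+ k * rho) * 4 by rewrite exprS; ring.
  rewrite (exprMn n (2 ^+ k * rho)); move: qn0; set Q := (2 ^+ k * rho) ^+ n => qn0.
  by field.
apply: nneseries_le; first by move=> k; exact: nint_ge0.
move=> N; apply: (@le_trans _ _ (\sum_(0 <= k < N) (AK * 4 ^+ n * theta (2^-1 ^+ k.+1))%:E)%E).
  by apply: lee_sum => k _; exact: piece.
rewrite sumEFin lee_fin -mulr_sumr big_mkord.
by rewrite ler_wpM2l// !mulr_ge0 ?exprn_ge0// ltW.
Qed.

Lemma dist_closed_cube a s x : ~ closed_cube a s x ->
  exists2 d, 0 < d & forall y, cube a s y -> d <= enorm (x - y).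
Proof.
move=> /existsNP[i /negP]; rewrite negb_and -!ltNge => /orP[xi|xi].
  exists (a ord0 i - x ord0 i); first by rewrite subr_gt0.
  move=> y /(_ i)/andP[? ?]; apply: le_trans (coord_le_enorm _ i).
  by rewrite !mxE distrC ler_normr; apply/orP; left; lra.
exists (x ord0 i - (a ord0 i + s)); first by rewrite subr_gt0.
move=> y /(_ i)/andP[? ?]; apply: le_trans (coord_le_enorm _ i).
by rewrite !mxE ler_normr; apply/orP; left; lra.
Qed.

Lemma kernel_bound (d : R) x y : 0 < d -> d <= enorm (x - y) ->
  normc (K x y) <= AK * d ^- n.
Proof.
move=> d0 dxy; have xy : x != y.
  apply: contraTneq dxy => ->; rewrite subrr -ltNge.
  rewrite /enorm big1 ?sqrtr0// => i _; by rewrite mxE expr0n.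
apply: (le_trans (K1 xy)); rewrite ler_pM2l// lef_pV2 ?posrE ?exprn_gt0//.
  by rewrite lerXn2r ?nnegrE ?enorm_ge0// ltW.
exact: lt_le_trans dxy.
Qed.

(** The alternative [f y = 0] lets one bound serve both for functions supported away from [x] and
    for integrals over sets away from [x]. *)
Lemma kernel_mul_fin (d : R) D x f : measurable D -> cmeas f -> 0 < d ->
  (forall y, D y -> d <= enorm (x - y) \/ f y = 0) ->
  (\nint[mu]_(y in D) (normc (K x y * f y)) <=
   (AK * d ^- n)%:E * \nint[mu]_(y in D) (normc (f y)))%E.
Proof.
move=> mD mf d0 dx; have nf := nnm_normc mf.
have c0 : 0 <= AK * d ^- n by rewrite mulr_ge0 ?invr_ge0 ?exprn_ge0// ltW.
rewrite -nintZ//; apply: nint_le => //.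
- by apply: nnm_normc; apply: cmeasM => //; exact: cmeas_kernel_r.
- exact: nnmZ.
- move=> y Dy; rewrite normcM; have [dy|->] := dx y Dy; last by rewrite normc0 !mulr0.
  by rewrite ler_wpM2r ?normc_ge0// kernel_bound.
Qed.

End kernel.

(** * Bounded functions supported in a cube *)

Section bounded_compact.
Context (R : realType) (n : nat).
Local Notation E := 'rV[R]_n.
Local Notation C := R[i].
Local Notation mu := (leb R n).
Local Notation cmeas f := (cmeasurable setT f).
Implicit Types (a x y c : E) (s r : R) (u h : E -> R) (f g : E -> C) (D : set E).

Lemma ae_le_measure D D' : measurable D -> measurable D' ->
  {ae mu, forall x, D x -> D' x} -> (mu D <= mu D')%E.
Proof.
move=> mD mD' DD'; have I A : measurable A -> mu A = \nint[mu]_(x in setT) (\1_A x).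
  by move=> mA; rewrite integral_indic// setIT.
rewrite (I _ mD) (I _ mD'); apply: nint_ae_le => //.
apply: filterS DD' => x DD' _; rewrite !indicE.
have [Dx|Dx] := pselect (D x); last by rewrite (memNset Dx).
by rewrite (mem_set Dx) (mem_set (DD' Dx)).
Qed.

Lemma measurable_ge h (t : R) : measurable_fun setT h -> measurable [set x | t <= h x].
Proof.
move=> mh; rewrite (_ : mkset _ = h @^-1` `[t, +oo[).
  by rewrite -[X in measurable X]setTI; apply: mh.
by apply/seteqP; split => x /=; rewrite in_itv/= andbT.
Qed.

Lemma measurable_normc_gt f (t : R) : cmeas f -> measurable [set x | t < normc (f x)].
Proof. by move=> mf; apply: measurable_gt; exact: (nnm_normc mf).1. Qed.

(** Tonelli's theorem for a majorant that is known only almost everywhere on [D]. *)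
Lemma nint_tonelli_le (H : E * E -> R) D h : measurable D -> nnm H -> nnm h ->
  {ae mu, forall x, D x -> ((h x)%:E <= \int[mu]_y (H (x, y))%:E)%E} ->
  (\nint[mu]_(x in D) (h x) <= \int[mu]_y \int[mu]_x (H (x, y))%:E)%E.
Proof.
move=> mD nH nh hH.
have mH : measurable_fun setT (EFin \o H) by apply/measurable_EFinP; exact: nH.1.
have H0 z : (0 <= (EFin \o H) z)%E by rewrite lee_fin nH.2.
have fubE : (\int[mu]_x \int[mu]_y (H (x, y))%:E = \int[mu]_y \int[mu]_x (H (x, y))%:E)%E.
  by apply: (@fubini_tonelli _ _ _ _ _ mu mu (EFin \o H)).
have mF : measurable_fun setT (fun x => \int[mu]_y (H (x, y))%:E)%E.
  exact: (@measurable_fun_fubini_tonelli_F _ _ _ _ _ mu (EFin \o H)).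
have F0 x : (0 <= \int[mu]_y (H (x, y))%:E)%E.
  by apply: integral_ge0 => y _; exact: H0.
rewrite -fubE; apply: (@le_trans _ _ (\int[mu]_(x in D) \int[mu]_y (H (x, y))%:E)%E).
  apply: ae_ge0_le_integral => //.
  - by move=> x _; rewrite lee_fin nh.2.
  - exact: nnm_EFin.
  - exact: measurable_funTS.
by apply: ge0_subset_integral.
Qed.

Lemma nint_cst_cube a s r : 0 <= s -> \nint[mu]_(x in cube a s) r = (r * s ^+ n)%:E.
Proof.
move=> s0; apply: (etrans (nint_cst _ _ (measurable_cube a s))).
by rewrite EFinM -(leb_cube a s0).
Qed.

Lemma nint_supp D h : measurable D -> nnm h -> (forall x, ~ D x -> h x = 0) ->
  \nint[mu]_(x in setT) (h x) = \nint[mu]_(x in D) (h x).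
Proof.
move=> mD nh hD; rewrite -[in RHS](setTI D) -(nint_indic mu measurableT mD nh).
congr (integral _ _ _); apply/funext => x; congr EFin; rewrite indicE.
have [Dx|Dx] := pselect (D x); first by rewrite mem_set// mulr1.
by rewrite memNset// mulr0 hD.
Qed.

Lemma nintT_ge D h : measurable D -> nnm h ->
  (\nint[mu]_(x in D) (h x) <= \nint[mu]_(x in setT) (h x))%E.
Proof. by move=> mD nh; apply: nint_sub => //. Qed.

(** These functions belong to L^1 and L^2 at once, so that the two bounds of the operator apply to
    them. *)
Definition bcs a s f := [/\ cmeas f, (exists M, forall x, normc (f x) <= M)
  & forall x, ~ cube a s x -> f x = 0].

Lemma bcs_fin a s f k : bcs a s f -> (0 < k)%N ->
  (\nint[mu]_(x in setT) (normc (f x) ^+ k) < +oo)%E.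
Proof.
move=> [mf [M fM] fs] k0; have nf := nnm_normc mf.
have nfk : nnm (fun x => normc (f x) ^+ k).
  by split=> [|x]; [apply: measurable_funX; exact: nf.1|rewrite exprn_ge0// normc_ge0].
have M0 : 0 <= M := le_trans (normc_ge0 _) (fM a).
rewrite (@nint_supp (cube a s))//; last first.
- by move=> x /fs ->; rewrite normc0 expr0n gtn_eqF.
- exact: measurable_cube.
apply: (@le_lt_trans _ _ (\nint[mu]_(x in cube a s) (M ^+ k))%E).
  apply: nint_le => //; [exact: measurable_cube|by apply: nnm_cst; rewrite exprn_ge0|].
  move=> x _; apply: lerXn2r => //; rewrite nnegrE; exact: normc_ge0.
rewrite nint_cst; last exact: measurable_cube.
by rewrite lte_mul_pinfty ?lee_fin ?exprn_ge0// cube_lt_pinfty.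
Qed.

Lemma bcs_L2 a s f : bcs a s f -> in_Lp 2 f.
Proof. by move=> bf; apply/in_L2P; split; [case: bf|exact: bcs_fin bf _]. Qed.

Lemma bcs_fin1 a s f : bcs a s f -> (\nint[mu]_(x in setT) (normc (f x)) < +oo)%E.
Proof. by move=> /(@bcs_fin _ _ _ 1%N)/(_ isT). Qed.

Lemma bcs_L1 a s f : bcs a s f -> in_Lp 1 f.
Proof. by move=> bf; apply/in_L1P; split; [case: bf|exact: bcs_fin1 bf]. Qed.

Lemma bcs_zero a s : bcs a s (fun=> 0).
Proof.
split=> //.
by exists 0 => x; rewrite normc0.
Qed.

Lemma bcs_lin a s (z : C) f g : bcs a s f -> bcs a s g ->
  bcs a s (fun x => z * f x + g x).
Proof.
move=> [mf [M fM] fs] [mg [M' gM] gs]; split.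
- by apply: cmeasD => //; apply: cmeasM => //; exact: cmeas_cst.
- exists (normc z * M + M') => x; apply: le_trans (normc_triangle _ _) _.
  by rewrite lerD// normcM ler_wpM2l// normc_ge0.
- by move=> x xs; rewrite fs// gs// mulr0 addr0.
Qed.

Lemma bcs_D a s f g : bcs a s f -> bcs a s g -> bcs a s (fun x => f x + g x).
Proof.
move=> bf bg; have := bcs_lin 1 bf bg; congr bcs.
by apply/funext => x; rewrite mul1r.
Qed.

Lemma bcs_sub a s a' s' f : cube a s `<=` cube a' s' -> bcs a s f -> bcs a' s' f.
Proof. by move=> sub [mf Mf fs]; split=> // x xs; apply: fs => /sub. Qed.

Lemma bcs_real a s u : measurable_fun setT u -> (exists M, forall x, `|u x| <= M) ->
  (forall x, ~ cube a s x -> u x = 0) -> bcs a s (rc u).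
Proof.
move=> mu' [M uM] us; split; first exact: cmeas_real.
- by exists M => x; rewrite normc_real.
- by move=> x /us; rewrite /rc => ->.
Qed.

Lemma bcs_step N a s u : 0 <= s -> step N a s u -> bcs a s (rc u).
Proof.
move=> s0 su; apply: bcs_real; first exact: measurable_step su.
- exact: step_bounded su.
- by move=> x; exact: step_supp su.
Qed.

Lemma bcs_cube a s : bcs a s (rc \1_(cube a s)).
Proof.
apply: bcs_real; first by apply: measurable_indic; exact: measurable_cube.
- by exists 1 => x; rewrite indicE; case: (_ \in _); rewrite ?normr0 ?normr1.
- by move=> x xs; rewrite indicE memNset.
Qed.

Lemma bcs_bump k a s : bcs a s (rc (bump_fun k.+1%:R a s)).
Proof.
apply: bcs_real; first exact: measurable_bump.
- by exists 1 => x; rewrite ger0_norm ?bump_fun_ge0 ?bump_fun_le1.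
- by move=> x xs; rewrite bump_fun_out// => /open_cube_sub.
Qed.

Lemma bump_cvg_cube a s : (fun k => \nint[mu]_(y in setT)
  (normc (rc \1_(cube a s) y - rc (bump_fun k.+1%:R a s) y)))%E @ \oo --> 0%E.
Proof.
rewrite (_ : (fun k => _) = fun k =>
  \nint[mu]_(y in setT) `|bump_fun k.+1%:R a s y - \1_(cube a s) y|)%E; last first.
  apply/funext => k; congr (integral _ _ _); apply/funext => y.
  by rewrite /rc -rmorphB normc_real distrC.
apply: (@dominated_cvg_nint _ _ _ mu setT _ _ \1_(cube a s)) => //.
- by move=> k; exact: measurable_bump.
- by apply: measurable_indic; exact: measurable_cube.
- by apply: nnm_indic; exact: measurable_cube.
- rewrite integral_indic ?setIT//; [exact: cube_lt_pinfty|exact: measurable_cube].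
- apply: filterS (ae_open_cube a s) => x oc _.
  rewrite (_ : \1_(cube a s) x = \1_(open_cube a s) x :> R); first exact: bump_fun_cvg.
  rewrite !indicE; have [xo|xo] := pselect (open_cube a s x).
    by rewrite !mem_set//; exact: open_cube_sub.
  by rewrite (memNset xo) memNset// => /cube_sub_closed/oc.
- apply: nearW => x _ k; rewrite ger0_norm ?bump_fun_ge0// indicE.
  have [xc|xc] := pselect (cube a s x); first by rewrite mem_set ?bump_fun_le1.
  by rewrite (memNset xc) bump_fun_out// => /open_cube_sub.
Qed.

Lemma rc_sum (I : Type) (r : seq I) (k : I -> E -> R) :
  rc (fun x => \sum_(i <- r) k i x) = (fun x => \sum_(i <- r) rc (k i) x).
Proof. by apply/funext => x; rewrite /rc rmorph_sum. Qed.

End bounded_compact.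

(** * Weak type (1,1) on step functions *)

Section L2_part.
Context (R : realType) (n : nat).
Local Notation E := 'rV[R]_n.
Local Notation C := R[i].
Local Notation mu := (leb R n).
Local Notation cmeas f := (cmeasurable setT f).
Implicit Types (a x y c : E) (s r : R) (u h : E -> R) (f g : E -> C) (D : set E).
Context (theta : R -> R) (K : E -> E -> C) (AK A2 : R) (S : (E -> C) -> (E -> C)).
Hypothesis hn : (0 < n)%N.
Hypothesis htheta : dini theta.
Hypothesis AK0 : 0 < AK.
Hypothesis mK : cmeasurable setT (fun z : E * E => K z.1 z.2).
Hypothesis K1 : forall x y, x != y -> normc (K x y) <= AK * enorm (x - y) ^- n.
Hypothesis K2 : forall x y z, x != z -> enorm (x - z) < enorm (x - y) / 2 ->
  normc (K x y - K z y) + normc (K y x - K y z) <=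
  AK * enorm (x - y) ^- n * theta (enorm (x - z) / enorm (x - y)).
Hypothesis linS : ae_linear_on_Lp 2 S.
Hypothesis S_in : forall f, in_Lp 2 f -> in_Lp 2 (S f).
Hypothesis A20 : 0 <= A2.
Hypothesis S_bd : forall f, in_Lp 2 f ->
  (\nint[mu]_(x in setT) (normc (S f x) ^+ 2) <=
   A2%:E * \nint[mu]_(x in setT) (normc (f x) ^+ 2))%E.
Hypothesis S_bump : forall a s (k : nat), 0 < s -> {ae mu, forall x, ~ closed_cube a s x ->
  S (rc (bump_fun k.+1%:R a s)) x =
  cintegral setT (fun y => K x y * rc (bump_fun k.+1%:R a s) y)}.

Lemma nnm_normc2 f : cmeas f -> nnm (fun x => normc (f x) ^+ 2).
Proof.
move=> /nnm_normc[mf _]; split=> [|x]; first exact: measurable_funX.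
by rewrite exprn_ge0// normc_ge0.
Qed.

Lemma L2_chebyshev f (t : R) : in_Lp 2 f -> 0 < t ->
  ((t ^+ 2)%:E * mu [set x | (t < normc (S f x))%R] <=
   A2%:E * \nint[mu]_(x in setT) (normc (f x) ^+ 2))%E.
Proof.
move=> f2 t0; have [mS _] := S_in f2; apply: le_trans (S_bd f2).
have t20 : 0 <= t ^+ 2 by rewrite exprn_ge0// ltW.
apply: le_trans (nint_chebyshev mu measurableT (nnm_normc2 mS) t20).
rewrite lee_wpmul2l ?lee_fin// setTI; apply: le_measure; rewrite ?inE.
- exact: measurable_normc_gt.
- by apply: measurable_ge; exact: (nnm_normc2 mS).1.
- move=> x /= tx; rewrite lerXn2r ?nnegrE ?normc_ge0//; first exact: ltW t0.
  exact: ltW.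
Qed.

Lemma L2_chebyshev_diff f g (t : R) : in_Lp 2 f -> in_Lp 2 g ->
  in_Lp 2 (fun x => f x - g x) -> 0 < t ->
  ((t ^+ 2)%:E * mu [set x | (t < normc (S f x - S g x))%R] <=
   A2%:E * \nint[mu]_(x in setT) (normc (f x - g x) ^+ 2))%E.
Proof.
move=> f2 g2 fg2 t0; apply: le_trans (L2_chebyshev fg2 t0).
rewrite lee_wpmul2l ?lee_fin ?exprn_ge0 ?(ltW t0)//.
have [m1 _] := S_in f2; have [m2 _] := S_in g2; have [m3 _] := S_in fg2.
apply: ae_le_measure.
- by apply: measurable_normc_gt; exact: cmeasB.
- exact: measurable_normc_gt.
- by apply: filterS (ae_linB linS f2 g2) => x /= ->.
Qed.

(** The kernel formula off the closed cube; the faces are included because the support of a bump is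
    only known to lie in the closed cube. *)
Definition has_repr a s f := bcs a s f /\
  {ae mu, forall x, ~ closed_cube a s x -> S f x = cintegral setT (fun y => K x y * f y)}.

Lemma kernel_mul_finT a s x f : bcs a s f -> ~ closed_cube a s x ->
  (\nint[mu]_(y in setT) (normc (K x y * f y)) < +oo)%E.
Proof.
move=> bf xs; have [d d0 dx] := dist_closed_cube xs.
have [mf _ fs] := bf.
apply: le_lt_trans (kernel_mul_fin AK0 mK K1 measurableT mf d0 _) _.
  by move=> y _; have [/dx|/fs] := pselect (cube a s y); [left|right].
apply: lte_mul_pinfty (bcs_fin1 bf); last by [].
by rewrite lee_fin mulr_ge0 ?invr_ge0 ?exprn_ge0// ltW.
Qed.

Lemma cmeas_kernel_mul x f : cmeas f -> cmeas (fun y => K x y * f y).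
Proof. by apply: cmeasM; exact: cmeas_kernel_r. Qed.

Lemma has_repr_lin a s (z : C) f g : has_repr a s f -> has_repr a s g ->
  has_repr a s (fun x => z * f x + g x).
Proof.
move=> [bf rf] [bg rg]; split; first exact: bcs_lin.
have l := linS z (bcs_L2 bf) (bcs_L2 bg).
apply: filterS3 rf rg l => x fx gx -> xs; rewrite fx// gx//.
have [mf _ _] := bf; have [mg _ _] := bg.
rewrite -cintegral_lin//.
- by congr (cintegral _ _); apply/funext => y; ring.
- by apply: cintegrable_normc => //; [exact: cmeas_kernel_mul|exact: kernel_mul_finT bf xs].
- by apply: cintegrable_normc => //; [exact: cmeas_kernel_mul|exact: kernel_mul_finT bg xs].
Qed.

Lemma has_repr_zero a s : has_repr a s (fun=> 0).
Proof.
split; first exact: bcs_zero.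
apply: filterS (ae_lin0 linS (bcs_L2 (bcs_zero a s))) => x -> _.
have -> : (fun y => K x y * 0) = (fun=> 0) by apply/funext => y; rewrite mulr0.
by rewrite /cintegral /= /Rintegral !integral0.
Qed.

Lemma has_repr_sub a s a' s' f : cube a s `<=` cube a' s' ->
  closed_cube a s `<=` closed_cube a' s' -> has_repr a s f -> has_repr a' s' f.
Proof.
move=> cc cc' [bf rf]; split; first exact: bcs_sub cc bf.
by apply: filterS rf => x rf xs; apply: rf => /cc'.
Qed.

(** Bumps tend to the indicator in L^2, so their images converge in measure by Chebyshev's
    inequality. At a point off the closed cube the kernel is bounded on the cube, so the kernel
    integrals converge as well. Both limits then agree almost everywhere. *)
Lemma has_repr_cube a s : 0 < s -> has_repr a s (rc \1_(cube a s)).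
Proof.
move=> s0; have bc := bcs_cube a s; split=> //.
pose b k := rc (bump_fun k.+1%:R a s).
have bb k : bcs a s (b k) by exact: bcs_bump.
pose I k := (\nint[mu]_(y in setT) (normc (rc \1_(cube a s) y - b k y)))%E.
have nI k : nnm (fun y => normc (rc \1_(cube a s) y - b k y)).
  by apply: nnm_normc; apply: cmeasB; [case: bc|case: (bb k)].
have nIE k y : normc (rc \1_(cube a s) y - b k y) =
    `|bump_fun k.+1%:R a s y - \1_(cube a s) y|.
  by rewrite /b /rc -rmorphB normc_real distrC.
have I0 : I @ \oo --> 0%E := bump_cvg_cube a s.
apply: (@cvg_measure_ae_eq _ _ _ _ _ _ _ (fun k => S (b k))).
- by have [] := S_in (bcs_L2 bc).
- by move=> k; have [] := S_in (bcs_L2 (bb k)).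
- move=> t e t0 e0.
  have t2 : 0 < t ^+ 2 by rewrite exprn_gt0.
  have q0 : 0 < t ^+ 2 * e / (A2 + 1) by rewrite divr_gt0 ?mulr_gt0 ?ltr_wpDl.
  have [N IN] := cvge0_lt I0 q0; exists N => k /IN Ik.
  have b2 : in_Lp 2 (fun x => rc \1_(cube a s) x - b k x).
    apply: (@bcs_L2 _ _ a s); have := bcs_lin (-1) (bb k) bc; congr bcs.
    by apply/funext => x; rewrite mulN1r addrC.
  have h := L2_chebyshev_diff (bcs_L2 bc) (bcs_L2 (bb k)) b2 t0.
  rewrite -(@lee_pmul2l _ (t ^+ 2)%:E)// ?lte_fin//.
  apply: (le_trans h); apply: (@le_trans _ _ (A2%:E * I k)%E).
    rewrite lee_wpmul2l ?lee_fin//; apply: nint_le => //.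
    + by apply: nnm_normc2; exact: b2.1.
    (* The difference has modulus at most 1, so its square is at most its modulus and L^1
       convergence gives L^2 convergence. *)
    + move=> x _; rewrite expr2 ler_piMl ?normc_ge0// nIE indicE.
      have := bump_fun_ge0 k.+1%:R a s x; have := bump_fun_le1 k.+1%:R a s x.
      by case: (_ \in _) => /= *; rewrite ler_norml; apply/andP; split; lra.
  apply: (@le_trans _ _ (A2%:E * (t ^+ 2 * e / (A2 + 1))%:E)%E).
    by rewrite lee_wpmul2l ?lee_fin// ltW.
  rewrite -!EFinM lee_fin mulrA ler_pdivrMr ?ltr_wpDl//.
  by rewrite mulrC ler_wpM2l ?lerDl// mulr_ge0 ?ltW.
- have Hb : {ae mu, forall x k, ~ closed_cube a s x -> S (b k) x =
      cintegral setT (fun y => K x y * b k y)} by apply/ae_foralln => k; exact: S_bump.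
  apply: filterS Hb => x Hb xs.
  have [d d0 dx] := dist_closed_cube xs.
  pose c := 2 * (AK * d ^- n).
  have c0 : 0 <= c by rewrite mulr_ge0// mulr_ge0 ?invr_ge0 ?exprn_ge0// ltW.
  have bnd k : ((normc (S (b k) x - cintegral setT (fun y => K x y * rc \1_(cube a s) y)))%:E
      <= c%:E * I k)%E.
    rewrite (Hb _ xs) normc_distC.
    have e : cintegral setT (fun y => K x y * rc \1_(cube a s) y) -
        cintegral setT (fun y => K x y * b k y) =
        cintegral setT (fun y => K x y * (rc \1_(cube a s) y - b k y)).
      have := @cintegral_lin _ _ setT (-1) (fun y => K x y * b k y)
        (fun y => K x y * rc \1_(cube a s) y) measurableT.
      rewrite mulN1r addrC => <-.
      - by congr (cintegral _ _); apply/funext => y; ring.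
      - apply: cintegrable_normc => //; last exact: kernel_mul_finT (bb k) xs.
        by apply: cmeas_kernel_mul; case: (bb k).
      - apply: cintegrable_normc => //; last exact: kernel_mul_finT bc xs.
        by apply: cmeas_kernel_mul; case: bc.
    have md : cmeas (fun y => rc \1_(cube a s) y - b k y).
      by apply: cmeasB; [case: bc|case: (bb k)].
    rewrite e; apply: le_trans (normc_cintegral_le measurableT (cmeas_kernel_mul x md)) _.
    rewrite /c EFinM -muleA lee_wpmul2l ?lee_fin//.
    apply: (kernel_mul_fin AK0 mK K1 measurableT md d0) => y _.
    have [/dx|ys] := pselect (cube a s y); [by left|right].
    by have [_ _ ->//] := bc; have [_ _ ->//] := bb k; rewrite subr0.
  apply/cvgrPdist_le => e e0.
  have [N IN] := cvge0_lt I0 (divr_gt0 e0 (ltr_wpDl c0 (@ltr01 R))).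
  exists N => // k /= /IN Ik; rewrite sub0r normrN ger0_norm ?normc_ge0//.
  rewrite -lee_fin; apply: (le_trans (bnd k)).
  apply: (@le_trans _ _ (c%:E * (e / (c + 1))%:E)%E).
    by rewrite lee_wpmul2l ?lee_fin// ltW.
  rewrite -EFinM lee_fin mulrA ler_pdivrMr ?ltr_wpDl//.
  by rewrite mulrC ler_wpM2l ?lerDl// ltW.
Qed.

Lemma closed_child a s e : 0 <= s ->
  closed_cube (child a s e) (s / 2) `<=` closed_cube a s.
Proof.
move=> s0 x xs i; have := xs i; rewrite childE.
by case: (e i); rewrite ?mulr0 ?mulr1 => /andP[? ?]; apply/andP; split; lra.
Qed.

Lemma has_repr_step N a s u : 0 < s -> step N a s u -> has_repr a s (rc u).
Proof.
elim: N a s u => [|N IH] a s u s0 /=.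
  move=> [c ->]; rewrite (_ : rc _ = fun x => c%:C%C * rc \1_(cube a s) x + 0).
    exact: has_repr_lin (has_repr_cube _ s0) (has_repr_zero _ _).
  by apply/funext => x; rewrite /rc rmorphM addr0.
move=> [k [sk ->]]; rewrite rc_sum.
have ke e : has_repr a s (rc (k e)).
  apply: has_repr_sub (IH _ _ _ (halfr_gt0 s0) (sk e)).
  - by apply: child_sub; exact: ltW.
  - by apply: closed_child; exact: ltW.
elim: (index_enum _) => [|e l IHl].
  rewrite (_ : (fun x => _) = (fun=> 0)); first exact: has_repr_zero.
  by apply/funext => x; rewrite big_nil.
rewrite (_ : (fun x => _) = (fun x => 1 * rc (k e) x + \sum_(e' <- l) rc (k e') x)).
  exact: has_repr_lin.
by apply/funext => x; rewrite big_cons mul1r.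
Qed.

(** As [b] has mean 0, [K x a] may be subtracted from the kernel; Tonelli's theorem then brings in
    the Hörmander integral for each [y] of the cube. The factor 2 is that of
    [normc_cintegral_le]. *)
Lemma bad_part N a s b : 0 < s -> step N a s b ->
  (\int[mu]_(x in cube a s) (b x)%:E = 0)%E ->
  forall CH : R, 0 <= CH -> (forall y, cube a s y ->
    (\nint[mu]_(x in ~` eball a (4 * n%:R * s)) (normc (K x y - K x a)) <= CH%:E)%E) ->
  (\nint[mu]_(x in ~` eball a (4 * n%:R * s)) (normc (S (rc b) x)) <=
   (2 * CH)%:E * \nint[mu]_(x in cube a s) `|b x|)%E.
Proof.
move=> s0 sb b0 CH CH0 hH; set D := ~` eball a _.
have mD : measurable D by apply: measurableC; exact: measurable_eball.
have mQ : measurable (cube a s) by exact: measurable_cube.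
have [bb rb] := has_repr_step s0 sb; have [mb _ _] := bb.
have mbr : measurable_fun setT b by exact: measurable_step sb.
have nb : nnm (fun x => `|b x|) by exact: nnm_norm.
have [mSb _] := S_in (bcs_L2 bb).
pose H (z : E * E) := 2 * (normc (K z.1 z.2 - K z.1 a) * (\1_D z.1 * `|b z.2|)).
have nH : nnm H.
  have nD : nnm (\1_D : E -> R) by exact: nnm_indic.
  apply: nnmZ => //; apply: nnmM; last first.
    apply: nnmM.
      split=> [|z]; last by rewrite indicE.
      by apply: (measurableT_comp nD.1).
    split=> [|z]; last by rewrite normr_ge0.
    by apply: (measurableT_comp nb.1).
  apply: nnm_normc; apply: cmeasB => //.
  have [h1 h2] := cmeas_kernel_l mK a.
  by split; [apply: (measurableT_comp h1)|apply: (measurableT_comp h2)].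
have nHx x : nnm (fun y => normc (K x y - K x a) * `|b y|).
  apply: nnmM => //; apply: nnm_normc; apply: cmeasB; [exact: cmeas_kernel_r|exact: cmeas_cst].
have nHy y : nnm (fun x => normc (K x y - K x a)).
  by apply: nnm_normc; apply: cmeasB; exact: cmeas_kernel_l.
have nR : 1 <= n%:R :> R by rewrite (ler_nat R 1 n).
have far x : D x -> ~ closed_cube a s x.
  move=> /= /negP; rewrite -leNgt => xD xQ.
  suff : enorm (x - a) <= n%:R * s.
    move=> h; have : 4 * n%:R * s <= n%:R * s by exact: le_trans h.
    have : 0 < n%:R * s by rewrite mulr_gt0// (lt_le_trans _ nR).
    by rewrite -mulrA; lra.
  apply: enorm_le => i; rewrite !mxE; have /andP[? ?] := xQ i.
  by rewrite ler_norml; apply/andP; split; lra.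
apply: (@le_trans _ _ (\int[mu]_y \int[mu]_x (H (x, y))%:E)%E).
  apply: nint_tonelli_le => //; first exact: nnm_normc.
  apply: filterS rb => x rb Dx; have xs := far x Dx; rewrite (rb xs).
  (* The cancellation: the integral of [K x a * b y] in [y] is [K x a] times the mean of [b], that
     is 0. *)
  have ea : cintegral setT (fun y => K x y * rc b y) =
      cintegral setT (fun y => (K x y - K x a) * rc b y).
    have := @cintegral_lin _ _ setT (- K x a) (rc b) (fun y => K x y * rc b y) measurableT.
    have -> : cintegral setT (rc b) = 0.
      rewrite /cintegral /rc /= /Rintegral integral0.
      suff -> : (\int[mu]_y (b y)%:E = 0)%E by [].
      rewrite -[RHS]b0 [in RHS]integral_mkcond; apply: eq_integral => y _.
      rewrite patchE; case: ifPn => // /negP; rewrite inE => yQ.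
      by rewrite (step_supp _ sb) ?ltW.
    rewrite mulr0 add0r => <-.
    - by congr (cintegral _ _); apply/funext => y; ring.
    - by apply: cintegrable_normc => //; exact: bcs_fin1 bb.
    - by apply: cintegrable_normc => //; [exact: cmeas_kernel_mul|exact: kernel_mul_finT bb xs].
  rewrite ea; apply: le_trans (normc_cintegral_le measurableT _) _.
    by apply: cmeasM => //; apply: cmeasB; [exact: cmeas_kernel_r|exact: cmeas_cst].
  rewrite -nintZ//; last first.
    by apply: nnm_normc; apply: cmeasM => //; apply: cmeasB; [exact: cmeas_kernel_r|exact: cmeas_cst].
  rewrite le_eqVlt; apply/orP; left; apply/eqP.
  congr (integral _ _ _); apply/funext => y; congr EFin.
  by rewrite /H /= normcM /rc normc_real indicE mem_set// mul1r.
rewrite -nintZ//; last by rewrite mulr_ge0.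
rewrite [leRHS]integral_mkcond; apply: ge0_le_integral => //.
- by move=> y _; apply: integral_ge0 => x _; rewrite lee_fin nH.2.
- apply: (@measurable_fun_fubini_tonelli_G _ _ _ _ _ mu (EFin \o H)) => //.
    by apply/measurable_EFinP; exact: nH.1.
  by move=> z; rewrite lee_fin nH.2.
- by apply/(measurable_restrictT _ _).1 => //; apply: nnm_EFin; apply: nnmZ => //; rewrite mulr_ge0.
move=> y _; rewrite patchE.
have -> : (\int[mu]_x (H (x, y))%:E = (2 * `|b y|)%:E * \nint[mu]_(x in D) (normc (K x y - K x a)))%E.
  rewrite -[D]setTI -nint_indic// -nintZ ?mulr_ge0//; last first.
    by apply: nnmM => //; exact: nnm_indic.
  by congr (integral _ _ _); apply/funext => x; congr EFin; rewrite /H /=; ring.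
case: ifPn => [|/negP]; rewrite inE => yQ; last first.
  by rewrite (step_supp (ltW s0) sb yQ) normr0 mulr0 mul0e.
rewrite (mulrAC 2 CH) (EFinM (2 * _) CH) lee_wpmul2l ?lee_fin ?mulr_ge0//; exact: hH.
Qed.

Context (CH : R).
Hypothesis CH0 : 0 <= CH.
Hypothesis hCH : forall a s y, 0 < s -> cube a s y ->
  (\nint[mu]_(x in ~` eball a (4 * n%:R * s)) (normc (K x y - K x a)) <= CH%:E)%E.

(** Good part, bad part and exceptional set, described only by the estimates that the weak type
    uses. The right-hand sides are multiples of the L^1 norm of [u] on the cube, hence additive over
    the children: this is what allows the induction. *)
Definition cz_parts N a s u (lam : R) (t : (E -> R) * (E -> R) * set E) :=
  let: (g, b, Om) := t in
  [/\ step N a s g, step N a s b, u = (fun x => g x + b x) & measurable Om] /\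
  [/\ (\nint[mu]_(x in cube a s) (g x ^+ 2) <=
        (2 ^+ n * lam)%:E * \nint[mu]_(x in cube a s) `|u x|)%E,
      (lam%:E * mu Om <= ((8 * n%:R) ^+ n)%:E * \nint[mu]_(x in cube a s) `|u x|)%E
    & (\nint[mu]_(x in ~` Om) (normc (S (rc b) x)) <=
        (4 * CH)%:E * \nint[mu]_(x in cube a s) `|u x|)%E].

Lemma step_integral_fin N a s u : 0 <= s -> step N a s u ->
  exists2 J : R, 0 <= J & \nint[mu]_(x in cube a s) `|u x| = J%:E.
Proof.
move=> s0 su; have := bcs_fin1 (bcs_step s0 su).
have nu : nnm (fun x => `|u x|) by apply: nnm_norm; exact: measurable_step su.
rewrite (@nint_supp _ _ (cube a s)); first last.
- by move=> x xs; rewrite /rc (step_supp s0 su)// normc0.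
- by apply: nnm_normc; case: (bcs_step s0 su).
- exact: measurable_cube.
under eq_integral do rewrite /rc normc_real.
have := nint_ge0 mu (cube a s) nu.
by case: (integral _ _ _) => // J; rewrite lee_fin => J0 _; exists J.
Qed.

(** The good part is the mean, of modulus at most [2^n lam]; the exceptional set is a ball of radius
    [4 n s], whose volume is at most [(8 n s)^n], where [lam s^n] is at most the L^1 norm of [u].
    Subtracting the mean at most doubles that norm, whence [4 CH]. *)
Lemma cz_bad_cube N a s u lam : 0 < s -> 0 < lam -> step N a s u ->
  ((lam * s ^+ n)%:E <= \nint[mu]_(x in cube a s) `|u x|)%E ->
  (\nint[mu]_(x in cube a s) `|u x| <= (2 ^+ n * lam * s ^+ n)%:E)%E ->
  exists t, cz_parts N a s u lam t.
Proof.
move=> s0 lam0 su lo hi; have [J J0 JE] := step_integral_fin (ltW s0) su.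
have sn0 : 0 < s ^+ n by rewrite exprn_gt0.
move: lo hi; rewrite JE !lee_fin => lo hi.
have mQ := measurable_cube a s.
have mu' := measurable_step su.
have nu : nnm (fun x => `|u x|) by exact: nnm_norm.
have iu : mu.-integrable (cube a s) (EFin \o u).
  apply/integrableP; split; first by apply/measurable_EFinP; exact: measurable_funTS.
  by rewrite /= JE ltry.
pose I := Rintegral mu (cube a s) u.
have IE : (\int[mu]_(x in cube a s) (u x)%:E)%E = I%:E.
  by rewrite /I /Rintegral fineK//; exact: integrable_fin_num.
have IJ : `|I| <= J.
  rewrite -lee_fin -JE; have -> : (`|I|%:E = `|I%:E|)%E by [].
  rewrite -IE; apply: le_abse_integral => //.
  by apply/measurable_EFinP; exact: measurable_funTS.
pose c := s ^- n * I.
have cE : c * s ^+ n = I by rewrite /c mulrAC mulVf ?mul1r// gt_eqF.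
have cJ : `|c| * s ^+ n <= J.
  by rewrite -[s ^+ n]ger0_norm ?(ltW sn0)// -normrM cE.
have clam : `|c| <= 2 ^+ n * lam.
  by rewrite -(ler_pM2r sn0) (le_trans cJ).
pose g := fun x => c * \1_(cube a s) x : R.
have sg : step N a s g by apply: (@step_leq _ _ 0%N) => //; [exact: ltW|exists c].
pose b := fun x => -1 * g x + u x.
have sb : step N a s b by apply: step_lin => //; exact: ltW.
have gE x : cube a s x -> g x = c by move=> xs; rewrite /g indicE mem_set// mulr1.
have bint : (\int[mu]_(x in cube a s) (b x)%:E = 0)%E.
  have -> : (\int[mu]_(x in cube a s) (b x)%:E = \int[mu]_(x in cube a s) ((u x)%:E - c%:E))%E.
    apply: eq_integral => x; rewrite inE => xs.
    by rewrite /b gE// -EFinB; congr EFin; ring.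
  rewrite integralB//.
    have -> : \nint[mu]_(x in cube a s) c = I%:E.
      by rewrite nint_cst_cube ?(ltW s0)// cE.
    by rewrite IE -EFinB subrr.
  apply/integrableP; split; first by apply/measurable_EFinP.
  have -> : (\int[mu]_(x in cube a s) `|c%:E| = \nint[mu]_(x in cube a s) `|c|)%E by [].
  by rewrite nint_cst_cube ?(ltW s0)// ltry.
exists (g, b, eball a (4 * n%:R * s)); split.
  split => //; first by apply/funext => x; rewrite /b; ring.
  exact: measurable_eball.
rewrite JE -!EFinM; split.
- apply: (@le_trans _ _ (\nint[mu]_(x in cube a s) (`|c| * `|c|))%E).
    apply: nint_le => //.
    + split=> [|x]; [apply: measurable_funX; exact: measurable_step sg|exact: sqr_ge0].
    + by move=> x xs; rewrite gE// -expr2 real_normK ?num_real.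
  rewrite nint_cst_cube ?(ltW s0)// lee_fin -mulrA.
  by apply: ler_pM => //; rewrite mulr_ge0 ?(ltW sn0).
- apply: (@le_trans _ _ (lam%:E * ((2 * (4 * n%:R * s)) ^+ n)%:E)%E).
    rewrite lee_wpmul2l ?lee_fin ?(ltW lam0)//; apply: leb_eball_le.
    by rewrite !mulr_ge0 ?(ltW s0).
  rewrite -EFinM lee_fin.
  have -> : 2 * (4 * n%:R * s) = 8 * n%:R * s by ring.
  by rewrite [X in lam * X]exprMn mulrCA ler_wpM2l// exprn_ge0// mulr_ge0.
- have := bad_part s0 sb bint CH0 (fun y => hCH s0).
  move=> h; apply: (le_trans h).
  apply: (@le_trans _ _ ((2 * CH)%:E * (2 * J)%:E)%E).
    rewrite lee_wpmul2l ?lee_fin ?mulr_ge0//.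
    apply: (@le_trans _ _ (\nint[mu]_(x in cube a s) (`|u x| + `|c|))%E).
      apply: nint_le => //.
      + by apply: nnm_norm; exact: measurable_step sb.
      + exact: nnmD.
      + move=> x xs; rewrite /b gE// mulN1r addrC; exact: ler_normB.
    rewrite nintD// nint_cst_cube ?(ltW s0)// JE -EFinD lee_fin; lra.
  by rewrite -EFinM lee_fin; lra.
Qed.

Lemma measure_bigU_le (I : Type) (l : seq I) (F : I -> set E) : (forall i, measurable (F i)) ->
  measurable (\big[setU/set0]_(i <- l) F i) /\
  (mu (\big[setU/set0]_(i <- l) F i) <= \sum_(i <- l) mu (F i))%E.
Proof.
move=> mF; elim/big_ind2 : _ => [|A x B y [mA Ax] [mB By]|i _]; rewrite ?measure0 //.
split; first exact: measurableU.
exact: le_trans (measureU2 _ mA mB) (leeD Ax By).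
Qed.

Lemma sum_on_child a s (F : {ffun 'I_n -> bool} -> E -> R) e x :
  (forall e x, ~ cube (child a s e) (s / 2) x -> F e x = 0) ->
  cube (child a s e) (s / 2) x -> \sum_e' F e' x = F e x.
Proof.
move=> F0 xe; rewrite (@big_only1 _ _ _ _ e)// => e' e'e _.
by apply: F0 => /(child_inj xe) ee'; rewrite ee' eqxx in e'e.
Qed.

(* Induction on the depth of u: a child on which the average of |u| exceeds lam is a bad
   cube, where the average is at most 2^n lam; the induction hypothesis applies to the
   other children. *)
Lemma cz_decomposition N a s u lam : 0 < s -> 0 < lam -> step N a s u ->
  (\nint[mu]_(x in cube a s) `|u x| <= (lam * s ^+ n)%:E)%E ->
  exists t, cz_parts N a s u lam t.
Proof.
elim: N a s u => [|N IH] a s u s0 lam0 su hu; have [J J0 JE] := step_integral_fin (ltW s0) su.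
  (* At depth 0 the function is a constant of modulus at most [lam] on the cube: all of it is
     good. *)
  have sz := step_zero 0%N a s.
  exists (u, (fun=> 0), set0); split.
    by split=> //; apply/funext => x; rewrite addr0.
  rewrite measure0 mule0 JE -!EFinM lee_fin; split; last first.
  - rewrite (@nint_ae_eq _ _ _ mu _ _ (fun=> 0)) ?integral0 ?lee_fin ?mulr_ge0//.
    + exact: measurableC.
    + by apply: nnm_normc; have [] := S_in (bcs_L2 (bcs_step (ltW s0) sz)).
    + apply: filterS (ae_lin0 linS (bcs_L2 (bcs_zero a s))) => x + _ => h.
      have -> : rc (fun=> 0) = (fun=> 0) :> (E -> C) by [].
      by rewrite h normc0.
  - by rewrite mulr_ge0// exprn_ge0// mulr_ge0.
  move: su hu JE => /= [c ->] hu JE.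
  have cE x : cube a s x -> c * \1_(cube a s) x = c.
    by move=> xs; rewrite indicE mem_set// mulr1.
  have JE' : J = `|c| * s ^+ n.
    apply: EFin_inj; rewrite -JE -(@nint_cst_cube _ _ a) ?(ltW s0)//.
    by apply: eq_integral => x; rewrite inE => xs; rewrite cE.
  have clam : `|c| <= lam.
    by move: hu; rewrite JE JE' lee_fin ler_pM2r// exprn_gt0.
  have -> : \nint[mu]_(x in cube a s) ((c * \1_(cube a s) x) ^+ 2) = (`|c| * J)%:E.
    rewrite JE' mulrA -(@nint_cst_cube _ _ a) ?(ltW s0)//.
    apply: eq_integral => x; rewrite inE => xs; rewrite cE//.
    by rewrite -expr2 real_normK ?num_real.
  rewrite lee_fin ler_wpM2r//; apply: (le_trans clam); rewrite ler_peMl ?(ltW lam0)//.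
  by rewrite exprn_ege1// ler1n.
have mu' := measurable_step su.
have nu : nnm (fun x => `|u x|) by exact: nnm_norm.
have [k [sk uE]] := su.
have h0 := ltW s0; have h20 := halfr_gt0 s0.
have koff e x : ~ cube (child a s e) (s / 2) x -> k e x = 0.
  by move=> xs; rewrite (step_supp (ltW h20) (sk e)).
have kE e : \nint[mu]_(x in cube (child a s e) (s / 2)) `|u x| =
    \nint[mu]_(x in cube (child a s e) (s / 2)) `|k e x|.
  by apply: eq_integral => x; rewrite inE => xe; rewrite uE (sum_on_child koff xe).
have sumE := nint_children a h0 nu.
have He e : exists t, cz_parts N (child a s e) (s / 2) (k e) lam t.
  have [h|h] := leP (\nint[mu]_(x in cube (child a s e) (s / 2)) `|k e x|)%E
      (lam * (s / 2) ^+ n)%:E; first exact: (IH _ _ _ h20 lam0 (sk e) h).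
  apply: (cz_bad_cube h20 lam0 (sk e) (ltW h)).
  (* The integral over a child is at most that over the parent, and the parent has [2^n] times the
     volume of the child: the average on a child is at most [2^n lam]. *)
  rewrite -kE; apply: (@le_trans _ _ (\nint[mu]_(x in cube a s) `|u x|)%E).
    apply: nint_sub => //; [exact: measurable_cube|exact: measurable_cube|exact: child_sub].
  rewrite (le_trans hu)// lee_fin mulrAC -exprMn.
  have -> : 2 * (s / 2) = s by field.
  by rewrite mulrC.
have [t ht] := choice He.
pose g e := (t e).1.1; pose b e := (t e).1.2; pose Om e := (t e).2.
have {}ht e : [/\ step N (child a s e) (s / 2) (g e), step N (child a s e) (s / 2) (b e),
    k e = (fun x => g e x + b e x) & measurable (Om e)] /\
  [/\ (\nint[mu]_(x in cube (child a s e) (s / 2)) (g e x ^+ 2) <=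
        (2 ^+ n * lam)%:E * \nint[mu]_(x in cube (child a s e) (s / 2)) `|k e x|)%E,
      (lam%:E * mu (Om e) <= ((8 * n%:R) ^+ n)%:E *
        \nint[mu]_(x in cube (child a s e) (s / 2)) `|k e x|)%E
    & (\nint[mu]_(x in ~` (Om e)) (normc (S (rc (b e)) x)) <=
        (4 * CH)%:E * \nint[mu]_(x in cube (child a s e) (s / 2)) `|k e x|)%E].
  by have := ht e; rewrite /g /b /Om; case: (t e) => [[? ?] ?].
have mOm e : measurable (Om e) by have [[]] := ht e.
have [mU Ule] := measure_bigU_le (index_enum {ffun 'I_n -> bool}) mOm.
exists ((fun x => \sum_e g e x), (fun x => \sum_e b e x), \big[setU/set0]_e Om e).
have sg : step N.+1 a s (fun x => \sum_e g e x).
  by exists g; split=> // e; have [[]] := ht e.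
split.
  split=> //.
  - by exists b; split=> // e; have [[]] := ht e.
  - rewrite uE; apply/funext => x; rewrite -big_split; apply: eq_bigr => e _ /=.
    by have [[_ _ -> _] _] := ht e.
have pullr (c : R) : 0 <= c -> (c%:E * \nint[mu]_(x in cube a s) `|u x| =
    \sum_e c%:E * \nint[mu]_(x in cube (child a s e) (s / 2)) `|k e x|)%E.
  move=> c0; rewrite sumE ge0_sume_distrr; last by move=> e _; exact: nint_ge0.
  by apply: eq_bigr => e _; rewrite kE.
split.
- rewrite pullr ?mulr_ge0 ?exprn_ge0 ?(ltW lam0)// nint_children//; last first.
    split=> [|x]; [apply: measurable_funX; exact: measurable_step sg|exact: sqr_ge0].
  apply: lee_sum => e _; have [[sge _ _ _] [h _ _]] := ht e; apply: le_trans h.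
  rewrite le_eqVlt; apply/orP; left; apply/eqP.
  apply: eq_integral => x; rewrite inE => xe.
  rewrite (@sum_on_child a s g e)// => e' y ye'.
  by have [[sge' _ _ _] _] := ht e'; rewrite (step_supp (ltW h20) sge').
- apply: (@le_trans _ _ (lam%:E * \sum_e mu (Om e))%E).
    by rewrite lee_wpmul2l ?lee_fin ?(ltW lam0).
  rewrite ge0_sume_distrr// pullr ?exprn_ge0 ?mulr_ge0//.
  by apply: lee_sum => e _; have [_ []] := ht e.
- rewrite pullr ?mulr_ge0//.
  have sbe e : bcs (child a s e) (s / 2) (rc (b e)).
    by have [[_ h _ _] _] := ht e; apply: bcs_step h; exact: ltW.
  have bbe e : bcs a s (rc (b e)) by apply: bcs_sub (sbe e); exact: child_sub.
  have ms e : cmeas (S (rc (b e))) by have [] := S_in (bcs_L2 (bbe e)).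
  have [bS lS] : bcs a s (fun x => \sum_e rc (b e) x) /\
      {ae mu, forall x, S (fun y => \sum_e rc (b e) y) x = \sum_e S (rc (b e)) x}.
    apply: (@ae_lin_sum _ _ _ mu (bcs a s) S) => //.
    + by move=> z f f' /bcs_L2 bf /bcs_L2 bf'; exact: linS.
    + exact: bcs_zero.
    + exact: bcs_D.
  apply: (@le_trans _ _ (\nint[mu]_(x in ~` \big[setU/set0]_e Om e)
      (\sum_e normc (S (rc (b e)) x)))%E).
    apply: nint_ae_le.
    + exact: measurableC.
    + by apply: nnm_normc; rewrite rc_sum; have [] := S_in (bcs_L2 bS).
    + by apply: nnm_sum => e; exact: nnm_normc.
    + apply: filterS lS => x h _; rewrite rc_sum h.
      elim/big_ind2 : _ => [|z1 r1 z2 r2 h1 h2|//]; first by rewrite normc0.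
      by apply: le_trans (normc_triangle _ _) _; exact: lerD.
  rewrite nint_sum; [|exact: measurableC|by move=> e; exact: nnm_normc].
  apply: lee_sum => e _; have [_ [_ _ h]] := ht e; apply: le_trans h.
  apply: nint_sub; [exact: measurableC|exact: measurableC|exact: nnm_normc|].
  apply: subsetC; rewrite -bigcup_seq => x xe; exists e => //=.
  by rewrite mem_index_enum.
Qed.

(** Doubling the cube repeatedly leaves [u] and its integral unchanged while the volume tends to
    infinity, so the average drops below [lam]. *)
Lemma enlarge_cube N a s u lam : 0 < s -> 0 < lam -> step N a s u ->
  exists N' s', [/\ 0 < s', step N' a s' u &
    (\nint[mu]_(x in cube a s') `|u x| <= (lam * s' ^+ n)%:E)%E].
Proof.
move=> s0 lam0 su; have [J J0 JE] := step_integral_fin (ltW s0) su.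
have [k Hk] : exists k : nat, J <= lam * (2 ^+ k * s) ^+ n.
  exists (Num.bound (J / lam / s ^+ n)); rewrite exprMn mulrCA.
  set m := Num.bound _.
  have h1 : J / lam / s ^+ n <= m%:R.
    by apply/ltW/archi_boundP; rewrite !divr_ge0 ?exprn_ge0// ltW.
  have h2 : m%:R <= (2 ^+ m) ^+ n :> R.
    apply: (@le_trans _ _ (2 ^+ m)); first by rewrite -natrX ler_nat ltnW// ltn_expl.
    by rewrite -[leLHS]expr1 ler_weXn2l// exprn_ege1// ler1n.
  have := le_trans h1 h2; rewrite -mulrA -invfM ler_pdivrMr ?mulr_gt0 ?exprn_gt0//.
exists (k + N)%N, (2 ^+ k * s).
have sk : step (k + N) a (2 ^+ k * s) u.
  elim: k {Hk} => [|k IH]; first by rewrite expr0 mul1r.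
  by rewrite exprS -mulrA addSn; exact: step_enlarge.
split=> //; first by rewrite mulr_gt0// exprn_gt0.
have [J' J'0 J'E] := step_integral_fin (mulr_ge0 (exprn_ge0 k (ltW (@ltr0Sn R 1))) (ltW s0)) sk.
have nu : nnm (fun x => `|u x|) by apply: nnm_norm; exact: measurable_step su.
rewrite -(@nint_supp _ _ (cube a (2 ^+ k * s)))//.
- rewrite (@nint_supp _ _ (cube a s))//; last first.
  + by move=> x xs; rewrite (step_supp (ltW s0) su)// normr0.
  + exact: measurable_cube.
  by rewrite JE lee_fin.
- exact: measurable_cube.
- by move=> x xs; rewrite (step_supp _ sk)// ?normr0// mulr_ge0 ?exprn_ge0// ltW.
Qed.

(** One term each for the good part by Chebyshev's inequality in L^2, for the exceptional set, and
    for the bad part outside it. *)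
Definition Cweak : R := A2 * 2 ^+ n * 4 + (8 * n%:R) ^+ n * 2 + 4 * CH * 2.

Lemma Cweak_ge0 : 0 <= Cweak.
Proof. by rewrite /Cweak !addr_ge0 ?mulr_ge0 ?exprn_ge0 ?mulr_ge0. Qed.

(** The decomposition is taken at height [t] itself: the integral of [g^2] is then of order [t]
    times the norm of [u], which compensates the [t^2] of Chebyshev's inequality. *)
Lemma weak11_step N a s u t : 0 < s -> 0 < t -> step N a s u ->
  (t%:E * mu [set x | (t < normc (S (rc u) x))%R] <=
   Cweak%:E * \nint[mu]_(x in setT) `|u x|)%E.
Proof.
move=> s0 t0 su; have [N' [s' [s'0 su' hu]]] := enlarge_cube s0 t0 su.
have [[[g b] Om] [[sg sb ugb mOm] [h1 h2 h3]]] := cz_decomposition s'0 t0 su' hu.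
have nu : nnm (fun x => `|u x|) by apply: nnm_norm; exact: measurable_step su.
have [J J0 JE] := step_integral_fin (ltW s'0) su'.
have -> : \nint[mu]_(x in setT) `|u x| = J%:E.
  rewrite -JE (@nint_supp _ _ (cube a s'))//; first exact: measurable_cube.
  by move=> x xs; rewrite (step_supp (ltW s'0) su')// normr0.
move: h1 h2 h3; rewrite JE -!EFinM => h1 h2 h3.
have bg := bcs_step (ltW s'0) sg; have bb := bcs_step (ltW s'0) sb.
have [mg _] := S_in (bcs_L2 bg); have [mb _] := S_in (bcs_L2 bb).
have [mS _] := S_in (bcs_L2 (bcs_step (ltW s'0) su')).
have t20 : 0 < t / 2 by rewrite divr_gt0.
pose G := [set x | t / 2 < normc (S (rc g) x)].
pose B := ~` Om `&` [set x | t / 2 <= normc (S (rc b) x)].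
have mG : measurable G by exact: measurable_normc_gt.
have mB : measurable B.
  by apply: measurableI; [exact: measurableC|apply: measurable_ge; exact: (nnm_normc mb).1].
have sub : (mu [set x | (t < normc (S (rc u) x))%R] <= mu (G `|` (Om `|` B)))%E.
  apply: ae_le_measure.
  - exact: measurable_normc_gt.
  - by apply: measurableU => //; exact: measurableU.
  have := ae_linD linS (bcs_L2 bg) (bcs_L2 bb).
  rewrite (_ : (fun y => _) = rc u); last first.
    by apply/funext => x; rewrite ugb /rc rmorphD.
  apply: filterS => x /= ->.
  have [Gx|/negP] := pselect (G x); first by left.
  rewrite /= -leNgt => Gx h; right.
  have [Ox|Ox] := pselect (Om x); [by left|right; split=> //=].
  have := lt_le_trans h (normc_triangle _ _); lra.
have hG : ((t / 2)%:E * mu G <= (A2 * 2 ^+ n * 2 * J)%:E)%E.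
  have := L2_chebyshev (bcs_L2 bg) t20.
  have -> : \nint[mu]_(x in setT) (normc (rc g x) ^+ 2) = \nint[mu]_(x in cube a s') (g x ^+ 2).
    rewrite (@nint_supp _ _ (cube a s')).
    - by apply: eq_integral => x _; rewrite /rc normc_real real_normK ?num_real.
    - exact: measurable_cube.
    - by apply: nnm_normc2; case: bg.
    - by move=> x xs; rewrite /rc (step_supp (ltW s'0) sg)// normc0 expr0n.
  move=> h; rewrite -(@lee_pmul2l _ (t / 2)%:E)// ?lte_fin// muleA -EFinM -expr2.
  apply: (le_trans h); apply: (@le_trans _ _ (A2%:E * (2 ^+ n * t * J)%:E)%E).
    by rewrite lee_wpmul2l ?lee_fin.
  by rewrite -!EFinM lee_fin le_eqVlt; apply/orP; left; apply/eqP; field.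
have hB : ((t / 2)%:E * mu B <= (4 * CH * J)%:E)%E.
  apply: le_trans h3; apply: nint_chebyshev; [exact: measurableC|exact: nnm_normc|exact: ltW].
apply: (@le_trans _ _ (t%:E * (mu G + (mu Om + mu B)))%E).
  rewrite lee_wpmul2l ?lee_fin ?(ltW t0)//; apply: (le_trans sub).
  apply: le_trans (measureU2 _ mG (measurableU _ _ mOm mB)) _.
  by apply: leeD => //; exact: measureU2.
have tE : t%:E = (2%:E * (t / 2)%:E)%E by rewrite -EFinM; congr EFin; field.
rewrite !ge0_muleDr ?adde_ge0// /Cweak.
have -> : ((A2 * 2 ^+ n * 4 + (8 * n%:R) ^+ n * 2 + 4 * CH * 2) * J)%:E =
  (2%:E * (A2 * 2 ^+ n * 2 * J)%:E + (((8 * n%:R) ^+ n * 2 * J)%:E + 2%:E * (4 * CH * J)%:E))%E.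
  by rewrite -!EFinM -!EFinD; congr EFin; ring.
apply: leeD; first by rewrite tE -muleA lee_wpmul2l ?lee_fin.
apply: leeD; last by rewrite tE -muleA lee_wpmul2l ?lee_fin.
by apply: (le_trans h2); rewrite lee_fin ler_wpM2r// ler_peMr ?exprn_ge0 ?mulr_ge0// ler1n.
Qed.

End L2_part.

(** * The extension to L^1 *)

Section convergence_in_measure.
Context (R : realType) (n : nat).
Local Notation E := 'rV[R]_n.
Local Notation C := R[i].
Local Notation mu := (leb R n).
Local Notation cmeas f := (cmeasurable setT f).
Implicit Types (F G : E -> C).

Definition cvgm F (F_ : nat -> E -> C) := forall t e : R, 0 < t -> 0 < e -> exists N, forall m, (N <= m)%N ->
  (mu [set x | (t < normc (F x - F_ m x))%R] <= e%:E)%E.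

(** With [phi t = t] for a weak type (1,1) bound and [phi t = t^2] for Chebyshev's inequality in
    L^2. *)
Lemma cvgm_of_bound F (F_ : nat -> E -> C) (phi : R -> R) (c : R) (u : (\bar R)^nat) :
  0 <= c -> (forall t, 0 < t -> 0 < phi t) -> u @ \oo --> 0%E ->
  (forall t m, 0 < t ->
    ((phi t)%:E * mu [set x | (t < normc (F x - F_ m x))%R] <= c%:E * u m)%E) ->
  cvgm F F_.
Proof.
move=> c0 phi0 u0 h t e t0 e0; have p0 := phi0 t t0.
have q0 : 0 < phi t * e / (c + 1) by rewrite divr_gt0 ?mulr_gt0 ?ltr_wpDl.
have [N uN] := cvge0_lt u0 q0; exists N => m /uN um.
rewrite -(@lee_pmul2l _ (phi t)%:E)// ?lte_fin//; apply: (le_trans (h t m t0)).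
apply: (@le_trans _ _ (c%:E * (phi t * e / (c + 1))%:E)%E).
  by rewrite lee_wpmul2l ?lee_fin// ltW.
rewrite -!EFinM lee_fin mulrA ler_pdivrMr ?ltr_wpDl//.
by rewrite mulrC ler_wpM2l ?lerDl// mulr_ge0 ?ltW.
Qed.

Lemma measure_normcD_le F G (t : R) : cmeas F -> cmeas G -> 0 < t ->
  (mu [set x | (t < normc (F x + G x))%R] <=
   mu [set x | (t / 2 < normc (F x))%R] + mu [set x | (t / 2 < normc (G x))%R])%E.
Proof.
move=> mF mG t0.
have mA := measurable_normc_gt (t / 2) mF; have mB := measurable_normc_gt (t / 2) mG.
apply: le_trans (measureU2 _ mA mB).
apply: le_measure; rewrite ?inE.
- by apply: measurable_normc_gt; exact: cmeasD.
- exact: measurableU.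
- move=> x /= h; apply: contrapT => /not_orP[/negP + /negP]; rewrite -!leNgt => h1 h2.
  have := lt_le_trans h (normc_triangle _ _); lra.
Qed.

Lemma measure_normcZ F (z : C) (t : R) : cmeas F -> 0 < t ->
  (mu [set x | (t < normc (z * F x))%R] <= mu [set x | (t / (normc z + 1) < normc (F x))%R])%E.
Proof.
move=> mF t0; have z0 := normc_ge0 z; apply: le_measure; rewrite ?inE.
- by apply: measurable_normc_gt; apply: cmeasM => //; exact: cmeas_cst.
- exact: measurable_normc_gt.
move=> x /=; rewrite normcM ltr_pdivrMr ?ltr_wpDl// => h.
apply: (lt_le_trans h); rewrite mulrC ler_wpM2l ?normc_ge0//; lra.
Qed.

Lemma cvgm_lin F G (F_ G_ : nat -> E -> C) (z : C) : cmeas F -> cmeas G ->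
  (forall m, cmeas (F_ m)) -> (forall m, cmeas (G_ m)) ->
  cvgm F F_ -> cvgm G G_ -> cvgm (fun x => z * F x + G x) (fun m x => z * F_ m x + G_ m x).
Proof.
move=> mF mG mF_ mG_ cF cG t e t0 e0; have z0 := normc_ge0 z.
have t20 : 0 < t / 2 by rewrite divr_gt0.
have e20 : 0 < e / 2 by rewrite divr_gt0.
have [N1 h1] := cF (t / 2 / (normc z + 1)) (e / 2) (divr_gt0 t20 (ltr_wpDl z0 ltr01)) e20.
have [N2 h2] := cG (t / 2) (e / 2) t20 e20.
exists (maxn N1 N2) => m; rewrite geq_max => /andP[/h1 {}h1 /h2 {}h2].
have mzF : cmeas (fun x => z * (F x - F_ m x)).
  by apply: cmeasM; [exact: cmeas_cst|exact: cmeasB].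
have -> : [set x | (t < normc (z * F x + G x - (z * F_ m x + G_ m x)))%R] =
    [set x | (t < normc (z * (F x - F_ m x) + (G x - G_ m x)))%R].
  by apply/funext => x; congr (_ < normc _); ring.
apply: le_trans (measure_normcD_le mzF (cmeasB mG (mG_ m)) t0) _.
have -> : e%:E = ((e / 2)%:E + (e / 2)%:E)%E by rewrite -EFinD; congr EFin; field.
apply: leeD => //; apply: le_trans h1.
by apply: measure_normcZ => //; exact: cmeasB.
Qed.

Lemma cvgm_ae F F' (F_ F_' : nat -> E -> C) : cmeas F -> cmeas F' -> (forall m, cmeas (F_ m)) ->
  (forall m, cmeas (F_' m)) -> {ae mu, forall x, F x = F' x} ->
  (forall m, {ae mu, forall x, F_ m x = F_' m x}) -> cvgm F F_ -> cvgm F' F_'.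
Proof.
move=> mF mF' mF_ mF_' FF' FF_ h t e t0 e0; have [N hN] := h t e t0 e0.
exists N => m /hN; apply: le_trans; apply: ae_le_measure.
- by apply: measurable_normc_gt; exact: cmeasB.
- by apply: measurable_normc_gt; exact: cmeasB.
- by apply: filterS2 FF' (FF_ m) => x /= -> ->.
Qed.

Lemma cvgm_unique F G (F_ : nat -> E -> C) : cmeas F -> cmeas G -> (forall m, cmeas (F_ m)) ->
  cvgm F F_ -> cvgm G F_ -> {ae mu, forall x, F x = G x}.
Proof.
move=> mF mG mF_ cF cG.
have : cvgm (fun x => -1 * G x + F x) (fun m x => -1 * F_ m x + F_ m x) by exact: cvgm_lin.
have -> : (fun m x => -1 * F_ m x + F_ m x) = (fun m (x : E) => 0 : C).
  by apply/funext => m; apply/funext => x; rewrite mulN1r addNr.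
move=> c0; have : {ae mu, forall x, setT x -> -1 * G x + F x = 0}.
  apply: (@cvg_measure_ae_eq _ _ _ _ _ _ (fun=> 0) (fun _ _ => 0)) => //.
  - by apply: cmeasD => //; apply: cmeasM => //; exact: cmeas_cst.
  - by apply: nearW => x _; under eq_fun do rewrite subr0 normc0; exact: cvg_cst.
by apply: filterS => x /(_ I); rewrite mulN1r addrC => /eqP; rewrite subr_eq0 => /eqP.
Qed.

(** If [|F x| > t], then [|F_m x| > t] for all large [m]. The set is thus contained, up to a null
    set, in the increasing union of the intersections of tails, each of measure at most [c]. *)
Lemma weak_limit F (F_ : nat -> E -> C) (t : R) (c : \bar R) : cmeas F -> (forall m, cmeas (F_ m)) ->
  {ae mu, forall x, (fun m => normc (F_ m x - F x)) @ \oo --> (0 : R)} ->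
  (forall m, (mu [set x | (t < normc (F_ m x))%R] <= c)%E) ->
  (mu [set x | (t < normc (F x))%R] <= c)%E.
Proof.
move=> mF mF_ cF h.
pose A m := [set x | t < normc (F_ m x)].
have mA m : measurable (A m) by exact: measurable_normc_gt.
pose B k := \bigcap_(m in [set m | (k <= m)%N]) A m.
have mB k : measurable (B k) by apply: bigcap_measurable => //; exists k => /=.
have ndB : nondecreasing_seq B.
  by move=> k l kl; apply/subsetPset => x Bx m /= lm; apply: Bx => /=; exact: leq_trans lm.
have mU : measurable (\bigcup_k B k) by exact: bigcup_measurable.
apply: (@le_trans _ _ (mu (\bigcup_k B k))).
  apply: ae_le_measure => //; first exact: measurable_normc_gt.
  apply: filterS cF => x cx /= tx.
  have d0 : 0 < normc (F x) - t by rewrite subr_gt0.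
  have /cvgrPdist_lt/(_ _ d0)[k _ hk] := cx; exists k => // m /= /hk /=.
  rewrite sub0r normrN ger0_norm ?normc_ge0// /A /= => hd.
  have := normc_triangle (F_ m x) (F x - F_ m x).
  by rewrite addrC subrK normc_distC; lra.
have cB := @nondecreasing_cvg_mu _ _ _ mu B mB mU ndB.
rewrite -(cvg_lim _ cB)//; apply: lime_le; first by apply/cvg_ex; exists (mu (\bigcup_k B k)).
apply: nearW => k; apply: le_trans (h k); apply: le_measure; rewrite ?inE//; first exact: mA.
by move=> x; apply => /=.
Qed.

End convergence_in_measure.

(** * Approximation by step functions and by truncations *)

Section approximation.
Context (R : realType) (n : nat).
Local Notation E := 'rV[R]_n.
Local Notation C := R[i].
Local Notation mu := (leb R n).
Local Notation cmeas f := (cmeasurable setT f).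
Implicit Types (a x y : E) (s r : R) (u v h : E -> R) (f g : E -> C).

Lemma cmeas_lin (z : C) f g : cmeas f -> cmeas g -> cmeas (fun x => z * f x + g x).
Proof. by move=> mf mg; apply: cmeasD => //; apply: cmeasM => //; exact: cmeas_cst. Qed.

Lemma step_approx_real a s h (eps : R) : 0 <= s -> 0 < eps -> measurable_fun setT h ->
  (\nint[mu]_(x in setT) `|h x| < +oo)%E -> (forall x, ~ cube a s x -> h x = 0) ->
  exists N u, step N a s u /\ (\nint[mu]_(x in setT) `|h x - u x| <= eps%:E)%E.
Proof.
move=> s0 e0 mh hoo hs; have nh : nnm (fun x => `|h x|) by exact: nnm_norm.
have hc : (\nint[mu]_(x in cube a s) `|h x| < +oo)%E.
  by apply: le_lt_trans hoo; apply: nintT_ge => //; exact: measurable_cube.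
have [N [u [su ue]]] := approximable_integrable s0 mh hc e0.
exists N, u; split=> //; rewrite (@nint_supp _ _ (cube a s))//; first exact: measurable_cube.
  by apply: nnm_dist => //; exact: measurable_step su.
by move=> x xs; rewrite hs// (step_supp s0 su)// subrr normr0.
Qed.

Definition clamp (M r : R) := Num.max (- M) (Num.min M r).

Lemma clamp0 M : 0 <= M -> clamp M 0 = 0.
Proof. by move=> M0; rewrite /clamp; rewrite min_r// max_r// oppr_le0. Qed.

Lemma clamp_le M r : 0 <= M -> `|clamp M r| <= M.
Proof.
move=> M0; rewrite /clamp ler_norml le_max lexx /= ge_max ge_min lexx /= andbT.
lra.
Qed.

Lemma clamp_dist M r r' : `|r| <= M -> `|r - clamp M r'| <= `|r - r'|.
Proof.
rewrite ler_norml => /andP[h1 h2]; rewrite /clamp.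
have [h3|h3] := leP M r'.
  rewrite max_r; last lra.
  rewrite ler0_norm; last lra.
  by rewrite ler0_norm; lra.
have [h4|h4] := leP (- M) r'; first by [].
rewrite ger0_norm; last lra.
by rewrite ger0_norm; lra.
Qed.

Definition icplx : C := Complex 0 1.

Lemma normc_icplx : normc icplx = 1.
Proof. by rewrite /icplx /= expr0n expr1n add0r sqrtr1. Qed.

Definition rci u v : E -> C := fun x => icplx * rc v x + rc u x.

Lemma normc_ReIm_dist f u v x :
  normc (f x - rci u v x) <= `|complex.Re (f x) - u x| + `|complex.Im (f x) - v x|.
Proof.
apply: le_trans (normc_le_ReIm _) _; rewrite /rci /rc /icplx.
by case: (f x) => a b /=; apply: lerD; rewrite le_eqVlt; apply/orP; left; apply/eqP; congr (`|_|); ring.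
Qed.

Lemma step_approx a s f (eps : R) : 0 <= s -> 0 < eps -> in_Lp 1 f ->
  (forall x, ~ cube a s x -> f x = 0) ->
  exists N u v, [/\ step N a s u, step N a s v &
    (\nint[mu]_(x in setT) (normc (f x - rci u v x)) <= eps%:E)%E].
Proof.
move=> s0 e0 /in_L1P[mf foo] fs.
have e20 : 0 < eps / 2 by rewrite divr_gt0.
have nf := nnm_normc mf.
have H h : measurable_fun setT h -> (forall x, `|h x| <= normc (f x)) ->
    exists N u, step N a s u /\ (\nint[mu]_(x in setT) `|h x - u x| <= (eps / 2)%:E)%E.
  move=> mh hf; apply: step_approx_real => //.
    by apply: le_lt_trans foo; apply: nint_le => //; exact: nnm_norm.
  by move=> x /fs fx; have := hf x; rewrite fx normc0 normr_le0 => /eqP.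
have [N1 [u [su ue]]] := H _ mf.1 (fun x => Re_le_normc _).
have [N2 [v [sv ve]]] := H _ mf.2 (fun x => Im_le_normc _).
exists (maxn N1 N2), u, v; split.
- by apply: step_leq su => //; exact: leq_maxl.
- by apply: step_leq sv => //; exact: leq_maxr.
have mu' := measurable_step su; have mv := measurable_step sv.
apply: (@le_trans _ _ (\nint[mu]_(x in setT)
    (`|complex.Re (f x) - u x| + `|complex.Im (f x) - v x|))%E).
  apply: nint_le => //.
  - apply: nnm_normc; apply: cmeasB => //; apply: cmeas_lin; exact: cmeas_real.
  - by apply: nnmD; apply: nnm_dist => //; [exact: mf.1|exact: mf.2].
  - by move=> x _; exact: normc_ReIm_dist.
rewrite nintD//; [|by apply: nnm_dist => //; exact: mf.1|by apply: nnm_dist => //; exact: mf.2].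
have -> : eps%:E = ((eps / 2)%:E + (eps / 2)%:E)%E by rewrite -EFinD; congr EFin; field.
exact: leeD.
Qed.

(** Clamping the step functions at the bound of [f] does not increase the L^1 error and keeps the
    error bounded; its square is then at most a constant times its modulus, so the same
    approximation is good in L^2. *)
Lemma step_approx_bcs a s f (eps : R) : 0 <= s -> 0 < eps -> bcs a s f ->
  exists N u v, [/\ step N a s u, step N a s v,
    (\nint[mu]_(x in setT) (normc (f x - rci u v x)) <= eps%:E)%E &
    (\nint[mu]_(x in setT) (normc (f x - rci u v x) ^+ 2) <= eps%:E)%E].
Proof.
move=> s0 e0 bf; have [mf [M fM] fs] := bf.
have M0 : 0 <= M := le_trans (normc_ge0 _) (fM a).
(* The two parts of [f] and the two clamped step functions are at most [M] in modulus, so the error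
   is at most [4 M]; 1 is added to have [B >= 1]. *)
pose B := 4 * M + 1; have B1 : 1 <= B by rewrite /B lerDr mulr_ge0.
have B0 : 0 < B := lt_le_trans ltr01 B1.
have eB : 0 < eps / 2 / B by rewrite !divr_gt0.
have H h : measurable_fun setT h -> (forall x, `|h x| <= normc (f x)) ->
    exists N u, [/\ step N a s u, forall x, `|u x| <= M &
      (\nint[mu]_(x in setT) `|h x - u x| <= (eps / 2 / B)%:E)%E].
  move=> mh hf.
  have [N [u [su ue]]] : exists N u, step N a s u /\
      (\nint[mu]_(x in setT) `|h x - u x| <= (eps / 2 / B)%:E)%E.
    apply: step_approx_real => //.
      apply: le_lt_trans (bcs_fin1 bf).
      by apply: nint_le => //; [exact: nnm_norm|exact: nnm_normc].
    by move=> x /fs fx; have := hf x; rewrite fx normc0 normr_le0 => /eqP.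
  have sc : step N a s (fun x => clamp M (u x)) by apply: step_comp => //; exact: clamp0.
  exists N, (fun x => clamp M (u x)); split=> //; first by move=> x; exact: clamp_le.
  apply: le_trans ue; apply: nint_le => //.
  - by apply: nnm_dist => //; exact: measurable_step sc.
  - by apply: nnm_dist => //; exact: measurable_step su.
  - by move=> x _; apply: clamp_dist; exact: le_trans (hf x) _.
have [N1 [u [su uM ue]]] := H _ mf.1 (fun x => Re_le_normc _).
have [N2 [v [sv vM ve]]] := H _ mf.2 (fun x => Im_le_normc _).
exists (maxn N1 N2), u, v.
have mu' := measurable_step su; have mv := measurable_step sv.
have md : cmeas (fun x => f x - rci u v x).
  by apply: cmeasB => //; apply: cmeas_lin; exact: cmeas_real.
have nd := nnm_normc md.
have d1 : (\nint[mu]_(x in setT) (normc (f x - rci u v x)) <= (eps / B)%:E)%E.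
  apply: (@le_trans _ _ (\nint[mu]_(x in setT)
      (`|complex.Re (f x) - u x| + `|complex.Im (f x) - v x|))%E).
    apply: nint_le => //.
    - by apply: nnmD; apply: nnm_dist => //; [exact: mf.1|exact: mf.2].
    - by move=> x _; exact: normc_ReIm_dist.
  rewrite nintD//; [|by apply: nnm_dist => //; exact: mf.1|by apply: nnm_dist => //; exact: mf.2].
  have -> : (eps / B)%:E = ((eps / 2 / B)%:E + (eps / 2 / B)%:E)%E.
    by rewrite -EFinD; congr EFin; field; rewrite gt_eqF.
  exact: leeD.
split.
- by apply: step_leq su => //; exact: leq_maxl.
- by apply: step_leq sv => //; exact: leq_maxr.
- apply: (le_trans d1); rewrite lee_fin ler_pdivrMr// ler_peMr// ltW//.
apply: (@le_trans _ _ (\nint[mu]_(x in setT) (B * normc (f x - rci u v x)))%E).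
  apply: nint_le => //; first exact: nnm_normc2.
    by apply: nnmZ => //; exact: ltW.
  move=> x _; rewrite expr2 ler_wpM2r ?normc_ge0//.
  apply: le_trans (normc_ReIm_dist _ _ _ _) _.
  have := ler_normB (complex.Re (f x)) (u x); have := ler_normB (complex.Im (f x)) (v x).
  have := uM x; have := vM x; have := le_trans (Re_le_normc _) (fM x).
  have := le_trans (Im_le_normc _) (fM x); rewrite /B; lra.
rewrite nintZ//; last exact: ltW.
apply: (@le_trans _ _ (B%:E * (eps / B)%:E)%E).
  by rewrite lee_wpmul2l// lee_fin ltW.
by rewrite -EFinM lee_fin mulrCA mulfV ?mulr1// gt_eqF.
Qed.

(** Cut in size and in space at once, so that any measurable function becomes bounded with support
    in a cube. *)
Definition trunc (k : nat) f : E -> C :=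
  fun x => f x * \1_([set x | normc (f x) <= k%:R] `&` cube (const_mx (- k%:R)) (2 * k%:R)) x.

Lemma measurable_trunc_set k f : cmeas f ->
  measurable ([set x | normc (f x) <= k%:R] `&` cube (const_mx (- k%:R)) (2 * k%:R)).
Proof.
move=> mf; apply: measurableI; last exact: measurable_cube.
rewrite (_ : mkset _ = ~` [set x | k%:R < normc (f x)]).
  by apply: measurableC; exact: measurable_normc_gt.
by apply/seteqP; split => x /=; [move=> h; apply/negP; rewrite -leNgt|move/negP; rewrite -leNgt].
Qed.

Lemma bcs_trunc k f : cmeas f -> bcs (const_mx (- k%:R)) (2 * k%:R) (trunc k f).
Proof.
move=> mf; split.
- by apply: cmeas_indic => //; exact: measurable_trunc_set.
- exists k%:R => x; rewrite /trunc normc_indic indicE.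
  case: (boolP (x \in _)) => [|_]; last by rewrite mulr0.
  by rewrite inE mulr1 => -[h _]; exact: h.
- by move=> x xs; rewrite /trunc indicE memNset ?mulr0// => -[].
Qed.

Lemma trunc_cases k f x : trunc k f x = 0 \/ trunc k f x = f x.
Proof. by rewrite /trunc indicE; case: (_ \in _); rewrite ?mulr1 ?mulr0; [right|left]. Qed.

Lemma trunc_eventually f x : exists N, forall k, (N <= k)%N -> trunc k f x = f x.
Proof.
pose N := Num.bound (normc (f x) + enorm x).
exists N => k Nk; rewrite /trunc indicE mem_set ?mulr1//.
have fx0 := normc_ge0 (f x); have x0 := enorm_ge0 x.
have hk : normc (f x) + enorm x < k%:R.
  apply: (@lt_le_trans _ _ N%:R); last by rewrite ler_nat.
  by apply: archi_boundP; rewrite addr_ge0.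
split => /=; first lra.
move=> i; rewrite !mxE; have := coord_le_enorm x i; rewrite ler_norml => /andP[? ?].
apply/andP; split; lra.
Qed.

Lemma trunc_dist k f x : normc (f x - trunc k f x) <= normc (f x).
Proof.
by have [->|->] := trunc_cases k f x; rewrite ?subr0// subrr normc0 normc_ge0.
Qed.

Lemma trunc_cvg (q : nat) f : (0 < q)%N -> cmeas f ->
  (\nint[mu]_(x in setT) (normc (f x) ^+ q) < +oo)%E ->
  (fun k => \nint[mu]_(x in setT) (normc (f x - trunc k f x) ^+ q))%E @ \oo --> 0%E.
Proof.
move=> q0 mf foo.
have mt k : cmeas (trunc k f) by case: (bcs_trunc k mf).
have nq g : cmeas g -> nnm (fun x => normc (g x) ^+ q).
  move=> mg; split=> [|x]; last by rewrite exprn_ge0// normc_ge0.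
  by apply: measurable_funX; exact: (nnm_normc mg).1.
rewrite (_ : (fun k => _) = fun k =>
    \nint[mu]_(x in setT) `|normc (f x - trunc k f x) ^+ q - 0|)%E; last first.
  apply/funext => k; congr (integral _ _ _); apply/funext => x.
  by rewrite subr0 ger0_norm// exprn_ge0// normc_ge0.
apply: (@dominated_cvg_nint _ _ _ mu setT (fun k x => normc (f x - trunc k f x) ^+ q) (fun=> 0)
  (fun x => normc (f x) ^+ q)) => //.
- by move=> k; apply: (nq _ _).1; exact: cmeasB.
- exact: nq.
- apply: nearW => x _; apply/cvgrPdist_le => e e0.
  have [N hN] := trunc_eventually f x; exists N => // k /= /hN ->.
  by rewrite subrr normc0 expr0n gtn_eqF// subrr normr0 ltW.
- apply: nearW => x _ k; rewrite ger0_norm ?exprn_ge0 ?normc_ge0//.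
  by apply: lerXn2r; rewrite ?nnegrE ?normc_ge0// trunc_dist.
Qed.

Lemma trunc_cvg1 f : in_Lp 1 f ->
  (fun k => \nint[mu]_(x in setT) (normc (f x - trunc k f x)))%E @ \oo --> 0%E.
Proof. by move=> /in_L1P[mf foo]; exact: (@trunc_cvg 1%N). Qed.

End approximation.

Section L1_extension.
Context (R : realType) (n : nat).
Local Notation E := 'rV[R]_n.
Local Notation C := R[i].
Local Notation mu := (leb R n).
Local Notation cmeas f := (cmeasurable setT f).
Implicit Types (a x y : E) (s r : R) (u v h : E -> R) (f g : E -> C).

Lemma nint_real (D : set E) h : nnm h -> (\nint[mu]_(x in D) (h x) < +oo)%E ->
  exists2 J : R, 0 <= J & \nint[mu]_(x in D) (h x) = J%:E.
Proof.
move=> nh; have := nint_ge0 mu D nh.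
by case: (integral _ _ _) => // J; rewrite lee_fin => J0 _; exists J.
Qed.

Lemma sum_half_expr N : \sum_(j < N) 2^-1 ^+ j = 2 - 2 * 2^-1 ^+ N :> R.
Proof.
elim: N => [|N IH]; first by rewrite big_ord0 expr0; ring.
by rewrite big_ord_recr /= IH exprS; field.
Qed.

Lemma cauchy_cvg_real (u : R^nat) J :
  (forall i, (J <= i)%N -> `|u i.+1 - u i| <= 2^-1 ^+ i) -> cvgn u.
Proof.
move=> h; have H i k : (J <= i)%N -> `|u (i + k)%N - u i| <= 2 * 2^-1 ^+ i - 2 * 2^-1 ^+ (i + k).
  move=> Ji; elim: k => [|k IH]; first by rewrite addn0 !subrr normr0.
  have -> : u (i + k.+1)%N - u i = (u (i + k).+1 - u (i + k)%N) + (u (i + k)%N - u i).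
    by rewrite addnS; ring.
  apply: le_trans (ler_normD _ _) _.
  have := h (i + k)%N (leq_trans Ji (leq_addr _ _)).
  rewrite addnS exprS; lra.
apply/cauchy_cvgP; apply: cauchy_exP => e e0.
have [N hN] := half_expr_lt 1 (divr_gt0 e0 (ltr0Sn R 2)).
pose i := maxn J N; exists (u i); exists i => // m /= im.
have /hN := leq_maxr J N; rewrite -/i mul1r -exprVn => hi.
have := H i (m - i)%N (leq_maxl J N); rewrite subnKC// => h2.
have := half_expr_gt0 R m; have := half_expr_gt0 R i; rewrite /ball /= distrC; lra.
Qed.

(** By Borel-Cantelli almost every point lies in finitely many of the sets where consecutive terms
    differ by more than [2^-j]; there the sequence is Cauchy. *)
Lemma cauchy_limit (F_ : nat -> E -> C) (c : R) : 0 <= c -> (forall j, cmeas (F_ j)) ->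
  (forall j, (mu [set x | (2^-1 ^+ j < normc (F_ j.+1 x - F_ j x))%R] <= (c * 2^-1 ^+ j)%:E)%E) ->
  exists2 F, cmeas F &
    {ae mu, forall x, (fun m => normc (F_ m x - F x)) @ \oo --> (0 : R)}.
Proof.
move=> c0 mF_ hB.
pose B j := [set x | (2^-1 ^+ j < normc (F_ j.+1 x - F_ j x))%R].
have mB j : measurable (B j) by apply: measurable_normc_gt; exact: cmeasB.
have B0 : mu (lim_sup_set B) = 0%E.
  apply: lim_sup_set_cvg0 => //; apply: (@le_lt_trans _ _ (c * 2)%:E); last by rewrite ltry.
  apply: nneseries_le => // N; apply: (@le_trans _ _ (\sum_(0 <= j < N) (c * 2^-1 ^+ j)%:E)%E).
    by apply: lee_sum => j _; exact: hB.
  rewrite sumEFin lee_fin -mulr_sumr big_mkord sum_half_expr ler_wpM2l//.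
  have := half_expr_gt0 R N; lra.
(* The upper limit exists and is measurable at every point, so the limit function is defined before
   convergence is known. *)
pose L (p : C -> R) x := fine (limn_esup (fun j => (p (F_ j x))%:E)).
have mL p : (forall j, measurable_fun setT (fun x => p (F_ j x))) -> measurable_fun setT (L p).
  move=> mp; apply: (@measurableT_comp _ _ _ _ _ _ (@fine R)) => //.
  by apply: measurable_fun_limn_esup => j; apply/measurable_EFinP.
exists (fun x => Complex (L (@complex.Re R) x) (L (@complex.Im R) x)).
  by split; apply: mL => j; [exact: (mF_ j).1|exact: (mF_ j).2].
exists (lim_sup_set B); split=> //.
  apply: bigcap_measurable => [|k _]; first by exists 0%N.
  by apply: bigcup_measurable => i _.
move=> x /= hx; apply: contrapT => nx; apply: hx.
have [J hJ] : exists J, forall j, (J <= j)%N -> normc (F_ j.+1 x - F_ j x) <= 2^-1 ^+ j.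
  apply: contrapT => /forallNP nJ; apply: nx => k _.
  have /existsNP[j /not_implyP[kj /negP]] := nJ k; rewrite -ltNge => hj.
  by exists j.
have conv (p : C -> R) : (forall z z', p (z - z') = p z - p z') -> (forall z, `|p z| <= normc z) ->
    (fun j => p (F_ j x)) @ \oo --> L p x.
  move=> pB pn; have cu : cvgn (fun j => p (F_ j x)).
    by apply: (@cauchy_cvg_real _ J) => j /hJ; rewrite -pB; apply: le_trans.
  have ce := cvg_EFinP cu; rewrite /L (is_cvg_limn_esupE _); last by apply/cvg_ex; eexists; exact: ce.
  by rewrite (cvg_lim _ ce).
have cR := conv _ (fun z z' => etrans (ReD z (- z')) (congr1 _ (ReN z'))) (@Re_le_normc R).
have cI := conv _ (fun z z' => etrans (ImD z (- z')) (congr1 _ (ImN z'))) (@Im_le_normc R).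
apply/cvgrPdist_le => e e0.
have e20 : 0 < e / 2 by rewrite divr_gt0.
have /cvgrPdist_le/(_ _ e20)[N1 _ h1] := cR; have /cvgrPdist_le/(_ _ e20)[N2 _ h2] := cI.
exists (maxn N1 N2) => // m /=; rewrite geq_max => /andP[/h1 /= {}h1 /h2 /= {}h2].
rewrite sub0r normrN ger0_norm ?normc_ge0//; apply: le_trans (normc_le_ReIm _) _.
by rewrite ReD ImD ReN ImN /= distrC (distrC _ (L _ x)); lra.
Qed.

Context (S : (E -> C) -> (E -> C)) (A2 CW : R).
Hypothesis linS : ae_linear_on_Lp 2 S.
Hypothesis S_in : forall f, in_Lp 2 f -> in_Lp 2 (S f).
Hypothesis A20 : 0 <= A2.
Hypothesis S_bd : forall f, in_Lp 2 f ->
  (\nint[mu]_(x in setT) (normc (S f x) ^+ 2) <=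
   A2%:E * \nint[mu]_(x in setT) (normc (f x) ^+ 2))%E.
Hypothesis CW0 : 0 <= CW.
Hypothesis S_step : forall N a s u t, 0 < s -> 0 < t -> step N a s u ->
  (t%:E * mu [set x | (t < normc (S (rc u) x))%R] <=
   CW%:E * \nint[mu]_(x in setT) `|u x|)%E.

Lemma bcs_rci N a s u v : 0 <= s -> step N a s u -> step N a s v -> bcs a s (rci u v).
Proof. by move=> s0 su sv; apply: bcs_lin; [exact: bcs_step sv|exact: bcs_step su]. Qed.

(** A step function approximates [f] in L^1 and L^2: the step function is controlled by its weak
    type bound, the error by Chebyshev's inequality in L^2. The real and imaginary parts, each at
    level [t / 4], give the constant [8 CW]. *)
Lemma weak11_bcs a s f t : 0 < s -> 0 < t -> bcs a s f ->
  (t%:E * mu [set x | (t < normc (S f x))%R] <=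
   (8 * CW)%:E * \nint[mu]_(x in setT) (normc (f x)))%E.
Proof.
move=> s0 t0 bf; have [mf _ _] := bf.
have [J J0 JE] := nint_real (nnm_normc mf) (bcs_fin1 bf); rewrite JE.
apply/lee_addgt0Pr => e e0.
(* The coefficient of the approximation error in the final bound: [8 CW] from the L^1 error,
   [4 A2 / t] from the L^2 error, and 1 for positivity. *)
pose d := 8 * CW + 4 * A2 / t + 1.
have h4 : 0 <= 4 * A2 / t by rewrite divr_ge0 ?mulr_ge0// ltW.
have d0 : 0 < d by rewrite /d ltr_wpDl// addr_ge0// mulr_ge0.
have eps0 : 0 < e / d by rewrite divr_gt0.
have [N [u [v [su sv h1 h2]]]] := step_approx_bcs (ltW s0) eps0 bf.
have bw := bcs_rci (ltW s0) su sv.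
have bu := bcs_step (ltW s0) su; have bv := bcs_step (ltW s0) sv.
have br : bcs a s (fun x => f x - rci u v x).
  by have := bcs_lin (-1) bw bf; congr bcs; apply/funext => x; rewrite mulN1r addrC.
have [mr _ _] := br; have [mw _ _] := bw.
have [mSf _] := S_in (bcs_L2 bf); have [mSr _] := S_in (bcs_L2 br).
have [mSu _] := S_in (bcs_L2 bu); have [mSv _] := S_in (bcs_L2 bv).
have t20 : 0 < t / 2 by rewrite divr_gt0.
have t40 : 0 < t / 2 / 2 by rewrite divr_gt0.
have miv : cmeas (fun x => icplx R * S (rc v) x) by apply: cmeasM => //; exact: cmeas_cst.
have ae1 : {ae mu, forall x, S f x = S (fun x => f x - rci u v x) x +
    (icplx R * S (rc v) x + S (rc u) x)}.
  apply: filterS2 (linS (icplx R) (bcs_L2 bv) (bcs_L2 bu))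
    (ae_linB linS (bcs_L2 bf) (bcs_L2 bw)) => x l1 l2.
  by rewrite -l1 l2 subrK.
have stp (h : E -> R) N' : step N' a s h -> (forall x, `|h x| <= normc (rci u v x)) ->
    (\nint[mu]_(x in setT) `|h x| <= (J + e / d)%:E)%E.
  move=> sh hw; have mh := measurable_step sh.
  apply: (@le_trans _ _ (\nint[mu]_(x in setT) (normc (f x) + normc (f x - rci u v x)))%E).
    apply: nint_le => //; [exact: nnm_norm|by apply: nnmD; exact: nnm_normc|].
    move=> x _; apply: (le_trans (hw x)).
    rewrite -[X in normc X](@subKr _ (f x)); exact: normc_sub.
  by rewrite nintD//; [rewrite EFinD -JE; exact: leeD|exact: nnm_normc|exact: nnm_normc].
have Iu := stp u N su (fun x => _); have Iv := stp v N sv (fun x => _).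
have {}Iu : (\nint[mu]_(x in setT) `|u x| <= (J + e / d)%:E)%E.
  apply: Iu => x; have := Re_le_normc (rci u v x).
  by rewrite /rci /rc /icplx /=; congr (`|_| <= _); ring.
have {}Iv : (\nint[mu]_(x in setT) `|v x| <= (J + e / d)%:E)%E.
  apply: Iv => x; have := Im_le_normc (rci u v x).
  by rewrite /rci /rc /icplx /=; congr (`|_| <= _); ring.
set M0 := mu _.
have hM : (M0 <= mu [set x | (t / 2 < normc (S (fun x => f x - rci u v x) x))%R] +
    (mu [set x | (t / 2 / 2 < normc (icplx R * S (rc v) x))%R] +
     mu [set x | (t / 2 / 2 < normc (S (rc u) x))%R]))%E.
  apply: (@le_trans _ _ (mu [set x | (t < normc (S (fun x => f x - rci u v x) x +
    (icplx R * S (rc v) x + S (rc u) x)))%R])).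
    apply: ae_le_measure; first exact: measurable_normc_gt.
      by apply: measurable_normc_gt; apply: cmeasD => //; exact: cmeasD.
    by apply: filterS ae1 => x /= ->.
  apply: le_trans (measure_normcD_le mSr (cmeasD miv mSu) t0) _.
  by apply: leeD => //; exact: measure_normcD_le.
apply: (@le_trans _ _ (t%:E * (mu [set x | (t / 2 < normc (S (fun x => f x - rci u v x) x))%R] +
    (mu [set x | (t / 2 / 2 < normc (icplx R * S (rc v) x))%R] +
     mu [set x | (t / 2 / 2 < normc (S (rc u) x))%R])))%E).
  by rewrite lee_wpmul2l ?lee_fin ?(ltW t0).
rewrite !ge0_muleDr ?adde_ge0//.
have q1 : (t%:E * mu [set x | (t / 2 < normc (S (fun x => f x - rci u v x) x))%R] <=
    (4 * A2 / t * (e / d))%:E)%E.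
  have := L2_chebyshev S_in S_bd (bcs_L2 br) t20 => h.
  have -> : t%:E = ((4 / t)%:E * ((t / 2) ^+ 2)%:E)%E.
    by rewrite -EFinM; congr EFin; field; rewrite gt_eqF.
  rewrite -muleA; apply: (@le_trans _ _ ((4 / t)%:E * (A2%:E * (e / d)%:E))%E).
    rewrite lee_wpmul2l ?lee_fin ?divr_ge0 ?(ltW t0)//; apply: (le_trans h).
    by rewrite lee_wpmul2l ?lee_fin.
  by rewrite -!EFinM lee_fin le_eqVlt; apply/orP; left; apply/eqP; ring.
have q2 (h : E -> R) N' : step N' a s h -> (\nint[mu]_(x in setT) `|h x| <= (J + e / d)%:E)%E ->
    (t%:E * mu [set x | (t / 2 / 2 < normc (S (rc h) x))%R] <= (4 * (CW * (J + e / d)))%:E)%E.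
  move=> sh hh; have := S_step s0 t40 sh => hs.
  have -> : t%:E = (4%:E * (t / 2 / 2)%:E)%E by rewrite -EFinM; congr EFin; field.
  rewrite -muleA (EFinM 4) lee_wpmul2l ?lee_fin//; apply: (le_trans hs).
  by rewrite EFinM lee_wpmul2l ?lee_fin.
have -> : [set x | (t / 2 / 2 < normc (icplx R * S (rc v) x))%R] =
    [set x | (t / 2 / 2 < normc (S (rc v) x))%R].
  by apply/funext => x; rewrite /= normcM normc_icplx mul1r.
apply: le_trans (leeD q1 (leeD (q2 _ _ sv Iv) (q2 _ _ su Iu))) _.
rewrite -!EFinM -!EFinD lee_fin.
have ed : e / d * d = e by rewrite mulfVK// gt_eqF.
move: ed (ltW eps0); set q := e / d; rewrite /d; move: (4 * A2 / t) => w ed q0.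
have -> : e = q * (8 * CW + w + 1) by [].
have -> : w * q + (4 * (CW * (J + q)) + 4 * (CW * (J + q))) = 8 * CW * J + q * (8 * CW + w) by ring.
by rewrite lerD2l ler_wpM2l// lerDl.
Qed.

(* S is only given on L^2; the weak type (1,1) makes the images of the truncations
   converge in measure. *)
Definition limit_of_trunc f F := cmeas F /\ cvgm F (fun k => S (trunc k f)).

Lemma cmeas_S_trunc f k : cmeas f -> cmeas (S (trunc k f)).
Proof. by move=> mf; have [] := S_in (bcs_L2 (bcs_trunc k mf)). Qed.

Lemma cube_enlarge a s a' s' : exists b r, 0 < r /\ cube a s `<=` cube b r /\ cube a' s' `<=` cube b r.
Proof.
pose M := enorm a + enorm a' + `|s| + `|s'| + 1.
have M0 : 0 < M by rewrite ltr_wpDl// !addr_ge0 ?enorm_ge0.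
exists (const_mx (- M)), (2 * M); split; first by rewrite mulr_gt0.
split=> x xa i; have /andP[h1 h2] := xa i; rewrite !mxE /M.
  have := coord_le_enorm a i; rewrite ler_norml => /andP[? ?].
  have := ler_norm s; have := enorm_ge0 a'; have := normr_ge0 s; have := normr_ge0 s'.
  by move=> *; apply/andP; split; lra.
have := coord_le_enorm a' i; rewrite ler_norml => /andP[? ?].
have := ler_norm s'; have := enorm_ge0 a; have := normr_ge0 s; have := normr_ge0 s'.
by move=> *; apply/andP; split; lra.
Qed.

Lemma bcs_sub_trunc f g k l : cmeas f -> cmeas g ->
  exists b r, 0 < r /\ bcs b r (fun x => trunc k f x - trunc l g x).
Proof.
move=> mf mg; have [b [r [r0 [h1 h2]]]] := cube_enlarge
  (const_mx (- k%:R)) (2 * k%:R) (const_mx (- l%:R)) (2 * l%:R).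
exists b, r; split=> //.
have := bcs_lin (-1) (bcs_sub h2 (bcs_trunc l mg)) (bcs_sub h1 (bcs_trunc k mf)).
by congr bcs; apply/funext => x; rewrite mulN1r addrC.
Qed.

Lemma S_trunc_diff f k l t : in_Lp 1 f -> 0 < t ->
  (t%:E * mu [set x | (t < normc (S (trunc k f) x - S (trunc l f) x))%R] <=
   (8 * CW)%:E * (\nint[mu]_(x in setT) (normc (f x - trunc k f x)) +
                  \nint[mu]_(x in setT) (normc (f x - trunc l f x))))%E.
Proof.
move=> /in_L1P[mf foo] t0; have [b [r [r0 bd]]] := bcs_sub_trunc k l mf mf.
have bk := bcs_trunc k mf; have bl := bcs_trunc l mf.
have [mk _ _] := bk; have [ml _ _] := bl; have [md _ _] := bd.
apply: (@le_trans _ _ ((8 * CW)%:E *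
    \nint[mu]_(x in setT) (normc (trunc k f x - trunc l f x)))%E).
  apply: le_trans (weak11_bcs r0 t0 bd).
  rewrite lee_wpmul2l ?lee_fin ?(ltW t0)//; apply: ae_le_measure.
  - by apply: measurable_normc_gt; apply: cmeasB; exact: cmeas_S_trunc.
  - by apply: measurable_normc_gt; have [] := S_in (bcs_L2 bd).
  - by apply: filterS (ae_linB linS (bcs_L2 bk) (bcs_L2 bl)) => x /= ->.
rewrite lee_wpmul2l ?lee_fin ?mulr_ge0// -nintD//.
- apply: nint_le => //; first exact: nnm_normc.
    by apply: nnmD; apply: nnm_normc; exact: cmeasB.
  move=> x _; rewrite (_ : _ - trunc l f x = (f x - trunc l f x) - (f x - trunc k f x)); last ring.
  by rewrite [leRHS]addrC; exact: normc_sub.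
- by apply: nnm_normc; exact: cmeasB.
- by apply: nnm_normc; exact: cmeasB.
Qed.

(** Along a subsequence with L^1 errors at most [4^-j], consecutive images differ by more than
    [2^-j] on a set of measure at most [16 CW 2^-j]. [cauchy_limit] gives a limit, and [weak_limit]
    brings back the whole sequence in measure. *)
Lemma limit_of_trunc_L1 f : in_Lp 1 f -> exists F, limit_of_trunc f F.
Proof.
move=> f1; have /in_L1P[mf foo] := f1; have u0 := trunc_cvg1 f1.
pose u k := (\nint[mu]_(x in setT) (normc (f x - trunc k f x)))%E; rewrite -/u in u0.
have /choice[k hk] : forall j, exists k, (j <= k)%N /\ (u k <= (2^-1 ^+ j * 2^-1 ^+ j)%:E)%E.
  move=> j; have p : 0 < 2^-1 ^+ j * 2^-1 ^+ j :> R by rewrite mulr_gt0 ?half_expr_gt0.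
  have [N hN] := cvge0_lt u0 p.
  by exists (maxn j N); split; [exact: leq_maxl|apply/ltW/hN; exact: leq_maxr].
have c0 : 0 <= 16 * CW by rewrite mulr_ge0.
have mS j : cmeas (S (trunc j f)) := cmeas_S_trunc j mf.
have [||F mF cF] := @cauchy_limit (fun j => S (trunc (k j) f)) (16 * CW) c0.
- by move=> j; exact: mS.
- move=> j; have t0 := half_expr_gt0 R j.
  rewrite -(@lee_pmul2l _ (2^-1 ^+ j)%:E)// ?lte_fin//.
  apply: le_trans (S_trunc_diff (k j.+1) (k j) f1 t0) _.
  apply: (@le_trans _ _ ((8 * CW)%:E *
    ((2^-1 ^+ j * 2^-1 ^+ j)%:E + (2^-1 ^+ j * 2^-1 ^+ j)%:E))%E).
    rewrite lee_wpmul2l ?lee_fin ?mulr_ge0//; apply: leeD; last by have [] := hk j.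
    have [_ h] := hk j.+1; apply: (le_trans h); rewrite lee_fin exprS.
    have := half_expr_gt0 R j; nra.
  by rewrite -EFinD -!EFinM lee_fin le_eqVlt; apply/orP; left; apply/eqP; ring.
exists F; split=> // t e t0 e0.
have q0 : 0 < t * e / (16 * CW + 1) by rewrite divr_gt0 ?mulr_gt0 ?ltr_wpDl.
have [N hN] := cvge0_lt u0 q0; exists N => m Nm.
apply: (@weak_limit _ _ _ (fun j => fun x => S (trunc (k (j + N)%N) f) x - S (trunc m f) x)).
- exact: cmeasB.
- by move=> j; exact: cmeasB.
- apply: filterS cF => x cx.
  rewrite (_ : (fun j => _) = fun j => normc (S (trunc (k (j + N)%N) f) x - F x)).
    by rewrite (cvg_shiftn N (fun j => normc (S (trunc (k j) f) x - F x))).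
  by apply/funext => j; congr normc; ring.
- move=> j; rewrite -(@lee_pmul2l _ t%:E)// ?lte_fin//.
  apply: le_trans (S_trunc_diff _ _ f1 t0) _.
  apply: (@le_trans _ _ ((8 * CW)%:E *
    ((t * e / (16 * CW + 1))%:E + (t * e / (16 * CW + 1))%:E))%E).
    rewrite lee_wpmul2l ?lee_fin ?mulr_ge0//; apply: leeD; last exact/ltW/hN.
    apply/ltW/hN; have [+ _] := hk (j + N)%N; apply: leq_trans; exact: leq_addl.
  rewrite -EFinD -!EFinM lee_fin.
  have -> : 8 * CW * (t * e / (16 * CW + 1) + t * e / (16 * CW + 1)) =
    (16 * CW) * (t * e) / (16 * CW + 1) by ring.
  by rewrite ler_pdivrMr ?ltr_wpDl// mulrC ler_wpM2l ?lerDl// mulr_ge0 ?ltW.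
Qed.

Lemma limit_of_trunc_L2 f : in_Lp 2 f -> limit_of_trunc f (S f).
Proof.
move=> f2; have /in_L2P[mf foo] := f2; split; first by have [] := S_in f2.
apply: (@cvgm_of_bound _ _ _ _ (fun t => t ^+ 2) A2 _ A20 _ (@trunc_cvg _ _ 2 f isT mf foo)).
  by move=> t t0; rewrite exprn_gt0.
move=> t m t0; have b2 := bcs_L2 (bcs_trunc m mf).
apply: L2_chebyshev_diff => //; apply/in_L2P; split.
  by apply: cmeasB => //; exact: b2.1.
apply: le_lt_trans foo; apply: nint_le => //.
- by apply: nnm_normc2; apply: cmeasB => //; exact: b2.1.
- exact: nnm_normc2.
- by move=> x _; apply: lerXn2r; rewrite ?nnegrE ?normc_ge0// trunc_dist.
Qed.

(** Truncation is not linear, but its defect of linearity [D k] tends to 0 in L^1, hence its image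
    tends to 0 in measure. *)
Lemma limit_of_trunc_lin (z : C) f g F G H : in_Lp 1 f -> in_Lp 1 g ->
  limit_of_trunc f F -> limit_of_trunc g G ->
  limit_of_trunc (fun x => z * f x + g x) H -> {ae mu, forall x, H x = z * F x + G x}.
Proof.
move=> f1 g1 [mF cF] [mG cG] [mH cH].
have /in_L1P[mf foo] := f1; have /in_L1P[mg goo] := g1.
pose h x := z * f x + g x; have mh : cmeas h by exact: cmeas_lin.
have hoo := cintegrable_lin z measurableT mf mg foo goo.
have h1 : in_Lp 1 h by apply/in_L1P.
have mS := cmeas_S_trunc.
pose D k : E -> C := fun x => trunc k h x - (z * trunc k f x + trunc k g x).
have bD k : exists b r, 0 < r /\ bcs b r (D k).
  have bh := bcs_trunc k mh; have bf := bcs_trunc k mf; have bg := bcs_trunc k mg.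
  exists (const_mx (- k%:R)), (2 * k%:R + 1); split; first by rewrite ltr_wpDl ?mulr_ge0.
  have := bcs_lin (-1) (bcs_lin z bf bg) bh; rewrite (_ : (fun x => _) = D k); last first.
    by apply/funext => x; rewrite mulN1r addrC.
  by apply: bcs_sub => x xs i; have /andP[? ?] := xs i; apply/andP; split; lra.
have D0 : cvgm (fun=> 0) (fun k => S (D k)).
  pose u k := ((\nint[mu]_(x in setT) (normc (h x - trunc k h x)) +
     ((normc z)%:E * \nint[mu]_(x in setT) (normc (f x - trunc k f x)) +
      \nint[mu]_(x in setT) (normc (g x - trunc k g x)))))%E.
  have u0 : u @ \oo --> 0%E.
    rewrite -[X in _ --> X]addr0; apply: cvgeD => //; first exact: trunc_cvg1.
    rewrite -[X in _ --> X]addr0; apply: cvgeD => //; last exact: trunc_cvg1.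
    by rewrite -[X in _ --> X](mule0 (normc z)%:E); apply: cvgeZl => //; exact: trunc_cvg1.
  have c0 : 0 <= 8 * CW by rewrite mulr_ge0.
  apply: (@cvgm_of_bound _ _ _ _ id (8 * CW) u c0 _ u0) => // t m t0.
  have [b [r [r0 bDm]]] := bD m; have [mD _ _] := bDm.
  have tm f' : cmeas f' -> cmeas (trunc m f') by move=> mf'; case: (bcs_trunc m mf').
  have nd f' : cmeas f' -> nnm (fun x => normc (f' x - trunc m f' x)).
    by move=> mf'; apply: nnm_normc; apply: cmeasB => //; exact: tm.
  under eq_set do rewrite sub0r normc_opp.
  apply: le_trans (weak11_bcs r0 t0 bDm) _.
  rewrite lee_wpmul2l ?lee_fin// /u -nintZ ?normc_ge0//; last exact: nd.
  rewrite -nintD//; [|by apply: nnmZ; [exact: normc_ge0|exact: nd]|exact: nd].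
  rewrite -nintD//; [|exact: nd|by apply: nnmD; [apply: nnmZ; [exact: normc_ge0|exact: nd]|exact: nd]].
  apply: nint_le => //; first exact: nnm_normc.
    by apply: nnmD; [exact: nd|apply: nnmD; [apply: nnmZ; [exact: normc_ge0|exact: nd]|exact: nd]].
  move=> x _; rewrite -normcM.
  have -> : D m x = z * (f x - trunc m f x) + (g x - trunc m g x) - (h x - trunc m h x).
    by rewrite /D /h; ring.
  by apply: le_trans (normc_sub _ _) _; rewrite addrC lerD2l; exact: normc_triangle.
have mD k : cmeas (S (D k)).
  by have [b [r [_ bDk]]] := bD k; have [] := S_in (bcs_L2 bDk).
have cL := cvgm_lin z mF mG (fun k => mS f k mf) (fun k => mS g k mg) cF cG.
have m0 : cmeas (fun _ : E => 0 : C) by exact: cmeas_cst.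
have mFG : cmeas (fun x => z * F x + G x) by exact: cmeas_lin.
have mFGk k : cmeas (fun x => z * S (trunc k f) x + S (trunc k g) x) by apply: cmeas_lin; exact: mS.
have cT := cvgm_lin 1 m0 mFG mD mFGk D0 cL.
apply: (cvgm_unique mH mFG (fun k => mS h k mh) cH).
apply: (cvgm_ae _ _ _ _ _ _ cT).
- by apply: cmeas_lin.
- by [].
- by move=> k; exact: cmeas_lin.
- by move=> k; exact: mS.
- by apply: nearW => x; rewrite mulr0 add0r.
- move=> k; have bh := bcs_L2 (bcs_trunc k mh).
  have bf := bcs_trunc k mf; have bg := bcs_trunc k mg.
  apply: filterS2 (ae_linB linS bh (bcs_L2 (bcs_lin z bf bg))) (linS z (bcs_L2 bf) (bcs_L2 bg)).
  by move=> x e1 e2; rewrite mul1r -e2 e1 subrK.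
Qed.

(** Splitting the level into two halves doubles the constant [8 CW] of the truncations; the
    remainder is small by convergence in measure. *)
Lemma limit_of_trunc_weak f F t : in_Lp 1 f -> limit_of_trunc f F -> 0 < t ->
  (t%:E * mu [set x | (t < normc (F x))%R] <=
   (16 * CW)%:E * \nint[mu]_(x in setT) (normc (f x)))%E.
Proof.
move=> f1 [mF cF] t0; have /in_L1P[mf foo] := f1.
have t20 : 0 < t / 2 by rewrite divr_gt0.
apply/lee_addgt0Pr => e e0; have [N hN] := cF _ _ t20 (divr_gt0 e0 t0).
have bN := bcs_trunc N mf; have mS := cmeas_S_trunc N mf.
apply: (@le_trans _ _ (t%:E * (mu [set x | (t / 2 < normc (F x - S (trunc N f) x))%R] +
   mu [set x | (t / 2 < normc (S (trunc N f) x))%R]))%E).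
  rewrite lee_wpmul2l ?lee_fin ?(ltW t0)//.
  have := measure_normcD_le (cmeasB mF mS) mS t0.
  by under eq_set do rewrite subrK.
rewrite ge0_muleDr// addeC; apply: leeD; last first.
  apply: (@le_trans _ _ (t%:E * (e / t)%:E)%E).
    by rewrite lee_wpmul2l ?lee_fin ?(ltW t0)//; exact: hN.
  by rewrite -EFinM lee_fin mulrCA mulfV ?mulr1// gt_eqF.
have [b [r [r0 [h1 _]]]] := cube_enlarge (const_mx (- N%:R)) (2 * N%:R) (const_mx (- N%:R)) (2 * N%:R).
have h := weak11_bcs r0 t20 (bcs_sub h1 bN).
have -> : t%:E = (2%:E * (t / 2)%:E)%E by rewrite -EFinM; congr EFin; field.
rewrite -muleA; have -> : 16 * CW = 2 * (8 * CW) by ring.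
rewrite (EFinM 2 (8 * CW)) -muleA lee_wpmul2l ?lee_fin//; apply: (le_trans h).
rewrite lee_wpmul2l ?lee_fin ?mulr_ge0//; apply: nint_le => //; [|exact: nnm_normc|].
  by apply: nnm_normc; case: bN.
by move=> x _; have [->|->//] := trunc_cases N f x; rewrite normc0 normc_ge0.
Qed.

Lemma schwartz_L2 f : schwartz f -> in_Lp 1 f -> in_Lp 2 f.
Proof.
move=> [_ /(_ 0%N [::])[M hM]] /in_L1P[mf foo]; apply/in_L2P; split=> //.
have fM x : normc (f x) <= M.
  by have := hM x; rewrite expr0 mul1r /cpderivs /=; case: (f x).
have M0 : 0 <= M := le_trans (normc_ge0 _) (fM 0).
apply: (@le_lt_trans _ _ (\nint[mu]_(x in setT) (M * normc (f x)))%E).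
  apply: nint_le => //; [exact: nnm_normc2|by apply: nnmZ => //; exact: nnm_normc|].
  by move=> x _; rewrite expr2 ler_wpM2r ?normc_ge0.
rewrite nintZ//; last exact: nnm_normc.
by apply: lte_mul_pinfty.
Qed.

(** On L^2 and on Schwartz functions the value [S f] itself is chosen, so that there the new
    operator equals [S] and not only almost everywhere; elsewhere in L^1 a limit of truncations is
    chosen. *)
Lemma L1_extension : exists S1 : (E -> C) -> (E -> C),
  [/\ forall f, in_Lp 2 f \/ schwartz f -> S1 f = S f,
      ae_linear_on_Lp 1 S1,
      forall f, in_Lp 1 f -> cmeas (S1 f) &
      forall f t, in_Lp 1 f -> 0 < t ->
        (t%:E * mu [set x | (t < normc (S1 f x))%R] <=
         (16 * CW)%:E * \nint[mu]_(x in setT) (normc (f x)))%E].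
Proof.
have /choice[S1 hS1] : forall f, exists F, (in_Lp 2 f \/ schwartz f -> F = S f) /\
    (in_Lp 1 f -> limit_of_trunc f F).
  move=> f; have [f1|f1] := pselect (in_Lp 1 f); last by exists (S f).
  have [fs|fs] := pselect (in_Lp 2 f \/ schwartz f); last first.
    by have [F hF] := limit_of_trunc_L1 f1; exists F.
  exists (S f); split=> // _; apply: limit_of_trunc_L2.
  by case: fs => // /schwartz_L2; exact.
exists S1; split.
- by move=> f fs; have [+ _] := hS1 f; exact.
- move=> z f g f1 g1; have [_ /(_ f1) hf] := hS1 f; have [_ /(_ g1) hg] := hS1 g.
  have fg1 : in_Lp 1 (fun y => z * f y + g y).
    move: f1 g1 => /in_L1P[mf foo] /in_L1P[mg goo]; apply/in_L1P; split.
      exact: cmeas_lin.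
    exact: cintegrable_lin.
  have [_ /(_ fg1) hfg] := hS1 (fun y => z * f y + g y).
  exact: limit_of_trunc_lin hf hg hfg.
- by move=> f f1; have [_ /(_ f1)[]] := hS1 f.
- by move=> f t f1 t0; have [_ /(_ f1) h] := hS1 f; exact: limit_of_trunc_weak.
Qed.

End L1_extension.

(** * Uniqueness of the extension and its kernel *)

Section weak_operators.
Context (R : realType) (n : nat).
Local Notation E := 'rV[R]_n.
Local Notation C := R[i].
Local Notation mu := (leb R n).
Local Notation cmeas f := (cmeasurable setT f).
Implicit Types (a x y : E) (s r : R) (u v h : E -> R) (f g : E -> C).

Definition weak_op (CW : R) (S : (E -> C) -> (E -> C)) :=
  [/\ ae_linear_on_Lp 1 S, forall f, in_Lp 1 f -> cmeas (S f) &
    forall f t, in_Lp 1 f -> 0 < t -> (t%:E * mu [set x | (t < normc (S f x))%R] <=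
      CW%:E * \nint[mu]_(x in setT) (normc (f x)))%E].

Lemma in_L1_lin (z : C) f g : in_Lp 1 f -> in_Lp 1 g -> in_Lp 1 (fun x => z * f x + g x).
Proof.
move=> /in_L1P[mf foo] /in_L1P[mg goo]; apply/in_L1P; split; first exact: cmeas_lin.
exact: cintegrable_lin.
Qed.

Lemma in_L1_sub f g : in_Lp 1 f -> in_Lp 1 g -> in_Lp 1 (fun x => f x - g x).
Proof.
move=> f1 g1; have := in_L1_lin (-1) g1 f1; congr in_Lp.
by apply/funext => x; rewrite mulN1r addrC.
Qed.

Lemma in_L1_indic f (D : set E) : measurable D -> in_Lp 1 f -> in_Lp 1 (fun x => f x * \1_D x).
Proof.
move=> mD /in_L1P[mf foo]; apply/in_L1P; have mfD := cmeas_indic mD mf; split=> //.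
apply: le_lt_trans foo; apply: nint_le => //; [exact: nnm_normc|exact: nnm_normc|].
move=> x _; rewrite normc_indic indicE; case: (_ \in _); rewrite ?mulr1// mulr0.
exact: normc_ge0.
Qed.

Lemma in_L1_zero : in_Lp 1 (fun _ : E => 0 : C).
Proof. exact: bcs_L1 (bcs_zero 0 0). Qed.

Lemma half_cvg0 (u : (\bar R)^nat) : (forall k, (0 <= u k)%E) ->
  (forall k, (u k <= (2^-1 ^+ k)%:E)%E) -> u @ \oo --> 0%E.
Proof.
move=> u0 uh; have hc : (fun k => (2^-1 ^+ k : R)%:E) @ \oo --> 0%E.
  by apply: cvg_EFinP; apply: cvg_expr; rewrite ger0_norm ?invr_ge0// invf_lt1// ltr1n.
apply: (squeeze_cvge _ (cvg_cst 0%E) hc).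
by apply: nearW => k; rewrite u0 uh.
Qed.

Lemma L1_dense f (eps : R) : 0 < eps -> in_Lp 1 f ->
  exists N a s u v, [/\ 0 < s, step N a s u, step N a s v &
    (\nint[mu]_(x in setT) (normc (f x - rci u v x)) <= eps%:E)%E].
Proof.
move=> e0 f1; have /in_L1P[mf foo] := f1.
have e20 : 0 < eps / 2 by rewrite divr_gt0.
have [N hN] := cvge0_lt (trunc_cvg1 f1) e20.
have [b [r [r0 [h1 _]]]] := cube_enlarge (const_mx (- N%:R) : E) (2 * N%:R)
  (const_mx (- N%:R)) (2 * N%:R).
have bt := bcs_sub h1 (bcs_trunc N mf); have [mt _ ts] := bt.
have [N' [u [v [su sv h]]]] := step_approx (ltW r0) e20 (bcs_L1 bt) ts.
exists N', b, r, u, v; split=> //.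
have [mr _ _] := bcs_rci (ltW r0) su sv.
apply: (@le_trans _ _ (\nint[mu]_(x in setT)
    (normc (f x - trunc N f x) + normc (trunc N f x - rci u v x)))%E).
  apply: nint_le => //; first by apply: nnm_normc; exact: cmeasB.
    by apply: nnmD; apply: nnm_normc; exact: cmeasB.
  move=> x _; apply: le_trans (normc_triangle _ _).
  by rewrite addrA subrK.
rewrite nintD//; [|by apply: nnm_normc; exact: cmeasB|by apply: nnm_normc; exact: cmeasB].
have -> : eps%:E = ((eps / 2)%:E + (eps / 2)%:E)%E by rewrite -EFinD; congr EFin; field.
by apply: leeD => //; apply/ltW/hN.
Qed.

Section one_operator.
Context (S : (E -> C) -> (E -> C)) (CW : R).
Hypothesis CW0 : 0 <= CW.
Hypothesis wS : weak_op CW S.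

Lemma weak_cvgm f (g_ : nat -> E -> C) : in_Lp 1 f -> (forall k, in_Lp 1 (g_ k)) ->
  (fun k => \nint[mu]_(x in setT) (normc (f x - g_ k x)))%E @ \oo --> 0%E ->
  cvgm (S f) (fun k => S (g_ k)).
Proof.
move=> f1 g1 fg; have [lS mS bS] := wS.
apply: (@cvgm_of_bound _ _ _ _ id CW _ CW0 _ fg) => // t m t0.
have d1 := in_L1_sub f1 (g1 m).
apply: le_trans (bS _ t d1 t0).
rewrite lee_wpmul2l ?lee_fin ?(ltW t0)//; apply: ae_le_measure.
- by apply: measurable_normc_gt; apply: cmeasB; exact: mS.
- by apply: measurable_normc_gt; exact: mS.
- by apply: filterS (ae_linB lS f1 (g1 m)) => x /= ->.
Qed.

End one_operator.

Section uniqueness.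
Context (S S' : (E -> C) -> (E -> C)) (CW CW' : R).
Hypothesis CW0 : 0 <= CW.
Hypothesis CW'0 : 0 <= CW'.
Hypothesis wS : weak_op CW S.
Hypothesis wS' : weak_op CW' S'.
Hypothesis SS'_bump : forall a s k, 0 < s ->
  {ae mu, forall x, S (rc (bump_fun k.+1%:R a s)) x = S' (rc (bump_fun k.+1%:R a s)) x}.

(** This class contains the bumps by hypothesis and is stable under linear combinations and L^1
    limits, hence it exhausts L^1. *)
Let agree f := in_Lp 1 f /\ {ae mu, forall x, S f x = S' f x}.

Lemma agree_lin (z : C) f g : agree f -> agree g -> agree (fun x => z * f x + g x).
Proof.
move=> [f1 hf] [g1 hg]; split; first exact: in_L1_lin.
have [lS _ _] := wS; have [lS' _ _] := wS'.
apply: filterS2 (filterI hf hg) (filterI (lS z f g f1 g1) (lS' z f g f1 g1)).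
by move=> x [e1 e2] [-> ->]; rewrite e1 e2.
Qed.

Lemma agree_limit f (g_ : nat -> E -> C) : in_Lp 1 f -> (forall k, agree (g_ k)) ->
  (fun k => \nint[mu]_(x in setT) (normc (f x - g_ k x)))%E @ \oo --> 0%E -> agree f.
Proof.
move=> f1 hg fg; split=> //; have g1 k : in_Lp 1 (g_ k) by case: (hg k).
have [_ mS _] := wS; have [_ mS' _] := wS'.
apply: (@cvgm_unique _ _ _ _ (fun k => S' (g_ k))); [exact: mS|exact: mS'| | |].
- by move=> k; exact: mS'.
- apply: (cvgm_ae _ _ _ _ _ _ (weak_cvgm CW0 wS f1 g1 fg)).
  + exact: mS.
  + exact: mS.
  + by move=> k; exact: mS.
  + by move=> k; exact: mS'.
  + exact: nearW.
  + by move=> k; have [] := hg k.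
- by apply: (weak_cvgm CW'0 wS' f1 g1 fg).
Qed.

Lemma agree_cube a s : 0 < s -> agree (rc \1_(cube a s)).
Proof.
move=> s0; apply: (agree_limit (bcs_L1 (bcs_cube a s)) _ (bump_cvg_cube a s)) => k.
by split; [exact: bcs_L1 (bcs_bump _ _ _)|exact: SS'_bump].
Qed.

Lemma agree_zero : agree (fun=> 0).
Proof.
split; first exact: in_L1_zero.
have [lS _ _] := wS; have [lS' _ _] := wS'.
by apply: filterS2 (ae_lin0 lS in_L1_zero) (ae_lin0 lS' in_L1_zero) => x -> ->.
Qed.

Lemma agree_step N a s u : 0 < s -> step N a s u -> agree (rc u).
Proof.
elim: N a s u => [|N IH] a s u s0 /=.
  move=> [c ->]; rewrite (_ : rc _ = fun x => c%:C%C * rc \1_(cube a s) x + 0).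
    exact: agree_lin (agree_cube _ s0) agree_zero.
  by apply/funext => x; rewrite /rc rmorphM addr0.
move=> [k [sk ->]]; rewrite rc_sum.
elim: (index_enum _) => [|e l IHl].
  rewrite (_ : (fun x => _) = (fun=> 0)); first exact: agree_zero.
  by apply/funext => x; rewrite big_nil.
rewrite (_ : (fun x => _) = (fun x => 1 * rc (k e) x + \sum_(e' <- l) rc (k e') x)).
  by apply: agree_lin => //; exact: (IH _ _ _ (halfr_gt0 s0) (sk e)).
by apply/funext => x; rewrite big_cons mul1r.
Qed.

Lemma weak_op_unique f : in_Lp 1 f -> {ae mu, forall x, S f x = S' f x}.
Proof.
move=> f1; have /choice[g hg] : forall k, exists g : E -> C, agree g /\
    (\nint[mu]_(x in setT) (normc (f x - g x)) <= (2^-1 ^+ k)%:E)%E.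
  move=> k; have [N [a [s [u [v [s0 su sv h]]]]]] := L1_dense (half_expr_gt0 R k) f1.
  exists (rci u v); split=> //.
  exact: agree_lin (agree_step s0 sv) (agree_step s0 su).
suff [_ h] : agree f by exact: h.
apply: (@agree_limit f g f1); first by move=> k; case: (hg k).
apply: half_cvg0 => k; last by case: (hg k).
have [[/in_L1P[mg _] _] _] := hg k; have /in_L1P[mf _] := f1.
by apply: nint_ge0; apply: nnm_normc; exact: cmeasB.
Qed.

End uniqueness.

Section representation.
Context (K : E -> E -> C) (AK CW : R) (S : (E -> C) -> (E -> C)).
Hypothesis AK0 : 0 < AK.
Hypothesis mK : cmeasurable setT (fun z : E * E => K z.1 z.2).
Hypothesis K1 : forall x y, x != y -> normc (K x y) <= AK * enorm (x - y) ^- n.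
Hypothesis CW0 : 0 <= CW.
Hypothesis wS : weak_op CW S.
Hypothesis S_step : forall N a s u, 0 < s -> step N a s u -> {ae mu, forall x,
  ~ closed_cube a s x -> S (rc u) x = cintegral setT (fun y => K x y * rc u y)}.

Lemma kernel_fin_le d x f : 0 < d -> cmeas f -> (forall y, d <= enorm (x - y) \/ f y = 0) ->
  (\nint[mu]_(y in setT) (normc (K x y * f y)) <=
   (AK * d ^- n)%:E * \nint[mu]_(y in setT) (normc (f y)))%E.
Proof. by move=> d0 mf h; apply: kernel_mul_fin => // y _; exact: h. Qed.

Lemma kernel_fin d x f : 0 < d -> in_Lp 1 f -> (forall y, d <= enorm (x - y) \/ f y = 0) ->
  cintegrable setT (fun y => K x y * f y) /\
  (\nint[mu]_(y in setT) (normc (K x y * f y)) < +oo)%E.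
Proof.
move=> d0 /in_L1P[mf foo] h.
have hoo : (\nint[mu]_(y in setT) (normc (K x y * f y)) < +oo)%E.
  apply: le_lt_trans (kernel_fin_le d0 mf h) _; apply: lte_mul_pinfty foo; last by [].
  by rewrite lee_fin mulr_ge0 ?invr_ge0 ?exprn_ge0// ltW.
by split=> //; apply: cintegrable_normc => //; apply: cmeasM => //; exact: cmeas_kernel_r.
Qed.

(** Step functions approximate [f] within its cube. Their images converge in measure by the weak
    type bound and their kernel integrals pointwise off the closed cube. *)
Lemma repr_off_cube a s f : 0 < s -> in_Lp 1 f -> (forall y, ~ cube a s y -> f y = 0) ->
  {ae mu, forall x, ~ closed_cube a s x -> S f x = cintegral setT (fun y => K x y * f y)}.
Proof.
move=> s0 f1 fs; have /in_L1P[mf foo] := f1; have [lS mS bS] := wS.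
have /choice[g hg] : forall k, exists g : E -> C, [/\ bcs a s g,
    {ae mu, forall x, ~ closed_cube a s x -> S g x = cintegral setT (fun y => K x y * g y)} &
    (\nint[mu]_(x in setT) (normc (f x - g x)) <= (2^-1 ^+ k)%:E)%E].
  move=> k; have [N [u [v [su sv h]]]] := step_approx (ltW s0) (half_expr_gt0 R k) f1 fs.
  exists (rci u v); split=> //; first exact: (bcs_rci (ltW s0) su sv).
  have bu := bcs_L1 (bcs_step (ltW s0) su); have bv := bcs_L1 (bcs_step (ltW s0) sv).
  apply: filterS3 (S_step s0 su) (S_step s0 sv) (lS (icplx R) _ _ bv bu) => x hu hv l xs.
  rewrite /rci l hu// hv//; have [d d0 dx] := dist_closed_cube xs.
  have off (h' : E -> R) : step N a s h' -> forall y, d <= enorm (x - y) \/ rc h' y = 0.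
    move=> sh y; have [/dx|ys] := pselect (cube a s y); [by left|right].
    by rewrite /rc (step_supp (ltW s0) sh).
  have [iu _] := kernel_fin d0 bu (off _ su); have [iv _] := kernel_fin d0 bv (off _ sv).
  by rewrite -cintegral_lin//; congr (cintegral _ _); apply/funext => y; ring.
have b1 k : in_Lp 1 (g k) by have [bg _ _] := hg k; exact: bcs_L1 bg.
have mg k : cmeas (g k) by have /in_L1P[] := b1 k.
have d1 k : in_Lp 1 (fun y => f y - g k y) by exact: in_L1_sub.
pose I k := (\nint[mu]_(x in setT) (normc (f x - g k x)))%E.
have I0 : I @ \oo --> 0%E.
  apply: half_cvg0 => k; last by have [_ _] := hg k.
  by apply: nint_ge0; apply: nnm_normc; exact: cmeasB.
apply: (@cvg_measure_ae_eq _ _ _ _ _ _ _ (fun k => S (g k))).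
- exact: mS.
- by move=> k; exact: mS.
- by apply: (weak_cvgm CW0 wS f1 b1 I0).
have Hg : {ae mu, forall x k, ~ closed_cube a s x ->
    S (g k) x = cintegral setT (fun y => K x y * g k y)}.
  by apply/ae_foralln => k; have [] := hg k.
apply: filterS Hg => x Hg xs; have [d d0 dx] := dist_closed_cube xs.
have off (h' : E -> C) : (forall y, ~ cube a s y -> h' y = 0) ->
    forall y, d <= enorm (x - y) \/ h' y = 0.
  by move=> hs y; have [/dx|ys] := pselect (cube a s y); [left|right; exact: hs].
pose c := 2 * (AK * d ^- n).
have c0 : 0 <= c by rewrite mulr_ge0// mulr_ge0 ?invr_ge0 ?exprn_ge0// ltW.
have bnd k : ((normc (S (g k) x - cintegral setT (fun y => K x y * f y)))%:E <= c%:E * I k)%E.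
  have [[_ _ gs] _ _] := hg k; have [ig _] := kernel_fin d0 (b1 k) (off _ gs).
  have [jf _] := kernel_fin d0 f1 (off _ fs).
  rewrite (Hg _ xs) normc_distC.
  have e : cintegral setT (fun y => K x y * f y) - cintegral setT (fun y => K x y * g k y) =
      cintegral setT (fun y => K x y * (f y - g k y)).
    have := cintegral_lin (-1) measurableT ig jf; rewrite mulN1r addrC => <-.
    by congr (cintegral _ _); apply/funext => y; ring.
  have md : cmeas (fun y => f y - g k y) by exact: cmeasB.
  rewrite e; apply: le_trans (normc_cintegral_le measurableT (cmeasM (cmeas_kernel_r mK x) md)) _.
  rewrite /c EFinM -muleA lee_wpmul2l ?lee_fin//; apply: kernel_fin_le => //.
  by apply: off => y ys; rewrite fs// gs// subrr.
apply/cvgrPdist_le => e e0.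
have [N IN] := cvge0_lt I0 (divr_gt0 e0 (ltr_wpDl c0 (@ltr01 R))).
exists N => // k /= /IN Ik; rewrite sub0r normrN ger0_norm ?normc_ge0//.
rewrite -lee_fin; apply: (le_trans (bnd k)).
apply: (@le_trans _ _ (c%:E * (e / (c + 1))%:E)%E).
  by rewrite lee_wpmul2l ?lee_fin// ltW.
rewrite -EFinM lee_fin mulrA ler_pdivrMr ?ltr_wpDl//.
by rewrite mulrC ler_wpM2l ?lerDl// ltW.
Qed.

(** The neighbourhood is a closed ball of the sup norm, as it is compared with cubes;
    [vanishes_dist] gives the Euclidean form. *)
Definition vanishes_near (d : R) x f := forall y, (forall i, `|x ord0 i - y ord0 i| <= d) -> f y = 0.

Lemma vanishes_dist d x f : vanishes_near d x f -> forall y, d <= enorm (x - y) \/ f y = 0.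
Proof.
move=> h y; have [hy|/existsNP[i /negP]] := pselect (forall i, `|x ord0 i - y ord0 i| <= d).
  by right; exact: h.
rewrite -ltNge => hi; left; apply: le_trans (ltW hi) _.
by have := coord_le_enorm (x - y) i; rewrite !mxE.
Qed.

Lemma cintegral_sum (I : Type) (l : seq I) (F : I -> E -> C) :
  (forall i, cmeas (F i)) -> (forall i, (\nint[mu]_(y in setT) (normc (F i y)) < +oo)%E) ->
  cintegral setT (fun y => \sum_(i <- l) F i y) = \sum_(i <- l) cintegral setT (F i).
Proof.
move=> mF Foo.
have F1 i : in_Lp 1 (F i) by exact/in_L1P.
suff [_ h] : in_Lp 1 (fun y => \sum_(i <- l) F i y) /\
  cintegral setT (fun y => \sum_(i <- l) F i y) = \sum_(i <- l) cintegral setT (F i) by exact: h.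
elim: l => [|i l [IH1 IH2]].
  have e : (fun y => \sum_(i <- [::]) F i y) = (fun=> 0) by apply/funext => y; rewrite big_nil.
  rewrite e big_nil; split; first exact: in_L1_zero.
  by rewrite /cintegral /= /Rintegral !integral0.
have e : (fun y => \sum_(j <- i :: l) F j y) = (fun y => 1 * F i y + \sum_(j <- l) F j y).
  by apply/funext => y; rewrite big_cons mul1r.
rewrite e big_cons; split; first exact: in_L1_lin.
have /in_L1P[m1 o1] := IH1.
by rewrite cintegral_lin//; [rewrite mul1r IH2|exact: cintegrable_normc|exact: cintegrable_normc].
Qed.

(* f is cut into grid cubes of side s / 2^N: it vanishes on those close to x, and the
   other ones are at a positive distance from x. *)
Lemma repr_vanishing N a s f : 0 < s -> in_Lp 1 f -> (forall y, ~ cube a s y -> f y = 0) ->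
  {ae mu, forall x, vanishes_near (s / 2 ^+ N) x f ->
    S f x = cintegral setT (fun y => K x y * f y)}.
Proof.
have [lS mS bS] := wS.
elim: N a s f => [|N IH] a s f s0 f1 fs.
  (* If [x] is in the closed cube and [f] vanishes within distance [s] of [x], then [f] is 0. A
     nonzero [f] thus puts [x] off the closed cube. *)
  have [f0|f0] := pselect (f = fun=> 0).
    rewrite f0; apply: filterS (ae_lin0 lS in_L1_zero) => x -> _.
    under eq_fun do rewrite mulr0.
    by rewrite /cintegral /= /Rintegral !integral0.
  apply: filterS (repr_off_cube s0 f1 fs) => x hx vx; apply: hx => xs; apply: f0.
  apply/funext => y; have [ys|/fs//] := pselect (cube a s y).
  apply: vx => i; rewrite expr0 divr1; have /andP[? ?] := xs i; have /andP[? ?] := ys i.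
  by rewrite ler_norml; apply/andP; split; lra.
have h20 := halfr_gt0 s0.
pose g (e : {ffun 'I_n -> bool}) y := f y * \1_(cube (child a s e) (s / 2)) y.
have g1 e : in_Lp 1 (g e) by apply: in_L1_indic => //; exact: measurable_cube.
have gs e y : ~ cube (child a s e) (s / 2) y -> g e y = 0.
  by move=> ys; rewrite /g indicE memNset// mulr0.
have fE : f = (fun y => \sum_e g e y).
  apply/funext => y; rewrite /g -mulr_sumr.
  have [ys|ys] := pselect (cube a s y); last by rewrite fs// mul0r.
  rewrite -[LHS]mulr1; congr (_ * _).
  have := @indic_children R n a s y (ltW s0); rewrite indicE mem_set// => /(congr1 (real_complex R)).
  rewrite rmorph1 rmorph_sum => ->; apply: eq_bigr => e _; by rewrite indic_real.
have L1D f' g' : in_Lp 1 f' -> in_Lp 1 g' -> in_Lp 1 (fun x => f' x + g' x).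
  move=> hf hg; have := in_L1_lin 1 hf hg; congr in_Lp.
  by apply/funext => x; rewrite mul1r.
have [_ P2] := @ae_lin_sum _ _ _ mu (in_Lp 1) S lS _ (index_enum {ffun 'I_n -> bool}) g
  in_L1_zero L1D g1.
have Hg : {ae mu, forall x e, vanishes_near (s / 2 / 2 ^+ N) x (g e) ->
    S (g e) x = cintegral setT (fun y => K x y * g e y)}.
  by apply: filter_forall => e; exact: (IH _ _ _ h20 (g1 e) (gs e)).
apply: filterS2 P2 Hg => x P2 Hg vx.
have d0 : 0 < s / 2 ^+ N.+1 by rewrite divr_gt0// exprn_gt0.
have vg e : vanishes_near (s / 2 ^+ N.+1) x (g e).
  by move=> y /vx fy; rewrite /g fy mul0r.
rewrite {1}fE P2; rewrite (eq_bigr (fun e => cintegral setT (fun y => K x y * g e y))); last first.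
  by move=> e _; apply: Hg; move: (vg e); rewrite exprS invfM mulrA.
rewrite -cintegral_sum.
- by congr (cintegral _ _); apply/funext => y; rewrite [in RHS]fE mulr_sumr.
- by move=> e; apply: cmeasM; [exact: cmeas_kernel_r|have /in_L1P[] := g1 e].
- by move=> e; have [] := kernel_fin d0 (g1 e) (vanishes_dist (vg e)).
Qed.

(** The exceptional null sets for the countably many radii [s / 2^N] are united, so the radius may
    depend on the point. *)
Lemma repr_far a s f : 0 < s -> in_Lp 1 f -> (forall y, ~ cube a s y -> f y = 0) ->
  {ae mu, forall x, (exists2 d, 0 < d & vanishes_near d x f) ->
    S f x = cintegral setT (fun y => K x y * f y)}.
Proof.
move=> s0 f1 fs.
have H : {ae mu, forall x N, vanishes_near (s / 2 ^+ N) x f ->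
    S f x = cintegral setT (fun y => K x y * f y)}.
  by apply/ae_foralln => N; exact: (repr_vanishing N s0 f1 fs).
apply: filterS H => x H [d d0 vx]; have [N hN] := half_expr_lt s d0.
apply: (H N) => y hy; apply: vx => i; apply: le_trans (hy i) _.
by apply/ltW/hN.
Qed.

End representation.
End weak_operators.

(** * The extension to L^1, its kernel and its uniqueness, gathered for a given operator *)

Section CZ_operators.
Context (R : realType) (n : nat).
Local Notation E := 'rV[R]_n.
Local Notation C := R[i].
Local Notation mu := (leb R n).
Local Notation cmeas f := (cmeasurable setT f).
Implicit Types (a x y : E) (s r : R) (u v h : E -> R) (f g : E -> C).

(** What is used of the operator from here on: a kernel measurable on the whole product that agrees
    with [K] off the diagonal, one weak type extension with its kernel formula, and its agreement
    with any other extension, since an image may be defined through any of them. *)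
Record CZ_model (theta : R -> R) (T : (E -> C) -> (E -> C) -> C) (K : E -> E -> C)
    (K0 : E -> E -> C) (AK CW : R) (S : (E -> C) -> (E -> C)) : Prop := CZModel {
  model_AK : 0 < AK ;
  model_kernel : forall x y, x != y -> K0 x y = K x y ;
  model_measurable : cmeasurable setT (fun z : E * E => K0 z.1 z.2) ;
  model_size : forall x y, x != y -> normc (K0 x y) <= AK * enorm (x - y) ^- n ;
  model_smooth : forall x y z, x != z -> enorm (x - z) < enorm (x - y) / 2 ->
    normc (K0 x y - K0 z y) + normc (K0 y x - K0 y z) <=
    AK * enorm (x - y) ^- n * theta (enorm (x - z) / enorm (x - y)) ;
  model_ext : weak11_extension T S ;
  model_CW : 0 <= CW ;
  model_weak : weak_op CW S ;
  model_repr : forall a s f, 0 < s -> in_Lp 1 f -> (forall y, ~ cube a s y -> f y = 0) ->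
    {ae mu, forall x, (exists2 d, 0 < d & vanishes_near d x f) ->
      S f x = cintegral setT (fun y => K0 x y * f y)} ;
  model_unique : forall S' f, weak11_extension T S' -> in_Lp 1 f ->
    {ae mu, forall x, S' f x = S f x} }.

Lemma weak11_weak_op T (S : (E -> C) -> (E -> C)) : weak11_extension T S ->
  exists2 CW, 0 <= CW & weak_op CW S.
Proof.
move=> [lS mS [A bS] _]; exists (Num.max 0 A); first by rewrite le_max lexx.
split=> // f t f1 t0; apply: le_trans (bS f t f1 t0) _; rewrite Lpnorm1.
have /in_L1P[mf foo] := f1; apply: lee_wpmul2r.
  by apply: nint_ge0; exact: nnm_normc.
by rewrite lee_fin le_max lexx orbT.
Qed.

(** Both functions have the same integrals against bumps, which are Schwartz functions. The argument
    is run with [p] the real part, then the imaginary part. *)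
Lemma is_function_unique (u : (E -> C) -> C) (h h' : E -> C) :
  is_function u h -> is_function u h' -> {ae mu, forall x, h x = h' x}.
Proof.
move=> [mh ih] [mh' ih'].
have H (p : C -> R) : (forall z z', p (z - z') = p z - p z') ->
    (forall z (r : R), p (z * r%:C%C) = p z * r) ->
    measurable_fun setT (fun x => p (h x)) -> measurable_fun setT (fun x => p (h' x)) ->
    (forall a s (k : nat), 0 < s ->
      mu.-integrable setT (fun x => (p (h x * rc (bump_fun k.+1%:R a s) x))%:E) /\
      mu.-integrable setT (fun x => (p (h' x * rc (bump_fun k.+1%:R a s) x))%:E) /\
      Rintegral mu setT (fun x => p (h x * rc (bump_fun k.+1%:R a s) x)) =
      Rintegral mu setT (fun x => p (h' x * rc (bump_fun k.+1%:R a s) x))) ->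
    {ae mu, forall x, p (h x) = p (h' x)}.
  move=> pB pM mp mp' hb.
  have := @ae_zero_of_bumps R n (fun x => p (h x) - p (h' x)) (measurable_funB mp mp').
  move=> h0; apply: filterS (h0 _) => [x /eqP|a s k s0]; first by rewrite subr_eq0 => /eqP.
  have [i1 [i2 i3]] := hb a s k s0.
  have e : (fun x => ((p (h x) - p (h' x)) * bump_fun k.+1%:R a s x)%:E) =
     ((fun x => (p (h x * rc (bump_fun k.+1%:R a s) x))%:E) \-
      (fun x => (p (h' x * rc (bump_fun k.+1%:R a s) x))%:E))%E.
    by apply/funext => x; rewrite /rc !pM /= -EFinB mulrBl.
  rewrite e; split; first exact: integrableB.
  rewrite integralB//; have f1 := integrable_fin_num measurableT i1.
  have f2 := integrable_fin_num measurableT i2.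
  by rewrite -(fineK f1) -(fineK f2) -EFinB; move: i3; rewrite /Rintegral => ->; rewrite subrr.
have b a s k : 0 < s -> schwartz (rc (bump_fun k.+1%:R a s)) by move=> _; exact: bump_schwartz.
have hR : {ae mu, forall x, complex.Re (h x) = complex.Re (h' x)}.
  apply: H.
  - by move=> z z'; rewrite ReD ReN.
  - by move=> [z1 z2] r /=; rewrite mulr0 subr0.
  - exact: mh.1.
  - exact: mh'.1.
  - move=> a s k s0; have [[i1 _] e1] := ih _ (b a s k s0); have [[i2 _] e2] := ih' _ (b a s k s0).
    by split=> //; split=> //; have := etrans (esym e1) e2 => -[].
have hI : {ae mu, forall x, complex.Im (h x) = complex.Im (h' x)}.
  apply: H.
  - by move=> z z'; rewrite ImD ImN.
  - by move=> [z1 z2] r /=; rewrite mulr0 add0r.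
  - exact: mh.2.
  - exact: mh'.2.
  - move=> a s k s0; have [[_ i1] e1] := ih _ (b a s k s0); have [[_ i2] e2] := ih' _ (b a s k s0).
    by split=> //; split=> //; have := etrans (esym e1) e2 => -[].
by apply: filterS2 hR hI => x; exact: complex_eqP.
Qed.

Lemma offdiag_measurable : measurable [set z : E * E | z.1 != z.2].
Proof.
rewrite (_ : mkset _ = \big[setU/set0]_(i < n) [set z : E * E | z.1 ord0 i - z.2 ord0 i != 0]).
  apply: bigsetU_measurable => i _.
  have mf : measurable_fun setT (fun z : E * E => z.1 ord0 i - z.2 ord0 i).
    have m1 : measurable_fun setT (fun x : E => x ord0 i : R) := measurable_coord i.
    by apply: measurable_funB; apply: (measurableT_comp m1).
  rewrite (_ : mkset _ = ~` ((fun z : E * E => z.1 ord0 i - z.2 ord0 i) @^-1` [set 0])).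
    by apply: measurableC; rewrite -[X in measurable X]setTI; apply: mf.
  by apply/seteqP; split => z /=; [move/eqP|move=> h; exact/eqP].
apply/seteqP; split => z /=.
  move=> /eqP zz; apply: contrapT => h; apply: zz; apply/rowP => i.
  apply/eqP; rewrite -subr_eq0; apply: contrapT => /negP hi; apply: h.
  rewrite -bigcup_seq; exists i => //=; exact: mem_index_enum.
rewrite -bigcup_seq => -[i _ /=]; apply: contraNneq => ->; by rewrite subrr.
Qed.

Lemma CZ_model_exists (hn : (0 < n)%N) theta T K : dini theta -> theta_CZ_operator theta T K ->
  exists K0 AK CW S, CZ_model theta T K K0 AK CW S.
Proof.
move=> htheta [linT [S2 [linS S_in [A2 S_bd] S_ext]] [mKo [AK AK0 [K1 K2]]] hrepr].
(* K is measurable off the diagonal only. *)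
pose K0 x y := K x y * (x != y)%:R.
have K0E x y : x != y -> K0 x y = K x y by rewrite /K0 => ->; rewrite mulr1.
have K0d x : K0 x x = 0 by rewrite /K0 eqxx mulr0.
have mK0 : cmeasurable setT (fun z : E * E => K0 z.1 z.2).
  have e (p : C -> R) : p 0 = 0 -> (fun z : E * E => p (K0 z.1 z.2)) =
      (fun z => p (K z.1 z.2)) \_ [set z : E * E | z.1 != z.2].
    move=> p0; apply/funext => z; rewrite patchE; case: ifPn; rewrite ?inE /=.
      by move=> zz; rewrite K0E.
    by move=> /negP; rewrite inE /= => /negP/negPn/eqP ->; rewrite K0d.
  have [m1 m2] := mKo.
  split; [rewrite (e (@complex.Re R))//|rewrite (e (@complex.Im R))//].
    exact: (measurable_restrictT _ offdiag_measurable).1 m1.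
  exact: (measurable_restrictT _ offdiag_measurable).1 m2.
have K01 x y : x != y -> normc (K0 x y) <= AK * enorm (x - y) ^- n.
  by move=> xy; rewrite K0E//; exact: K1.
have K02 x y z : x != z -> enorm (x - z) < enorm (x - y) / 2 ->
    normc (K0 x y - K0 z y) + normc (K0 y x - K0 y z) <=
    AK * enorm (x - y) ^- n * theta (enorm (x - z) / enorm (x - y)).
  move=> xz h; have xz0 := enorm_gt0 xz.
  have xy : x != y.
    apply: contraTneq h => ->; rewrite -leNgt.
    have -> : enorm (y - y) = 0 by rewrite subrr /enorm big1 ?sqrtr0// => i _; rewrite mxE expr0n.
    by rewrite mul0r enorm_ge0.
  have zy : z != y by apply: contraTneq h => <-; rewrite -leNgt ler_pdivrMr//; lra.
  by rewrite !K0E// 1?eq_sym//; exact: K2.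
(* The norm inequality is squared to avoid roots; its constant is first replaced by a nonnegative
   one. *)
pose A := (Num.max 0 A2) ^+ 2.
have A0 : 0 <= A by exact: sqr_ge0.
have S_bd' f : in_Lp 2 f -> (\nint[mu]_(x in setT) (normc (S2 f x) ^+ 2) <=
    A%:E * \nint[mu]_(x in setT) (normc (f x) ^+ 2))%E.
  have E2 g : (Lpnorm 2 g `^ 2)%E = \nint[mu]_(x in setT) (normc (g x) ^+ 2).
    by rewrite LpnormE//; apply: eq_integral => x _; rewrite powR_mulrn ?normc_ge0.
  move=> f2; rewrite -!E2; have M0 : 0 <= Num.max 0 A2 by rewrite le_max lexx.
  have -> : A%:E = ((Num.max 0 A2)%:E `^ 2)%E by rewrite poweR_EFin powR_mulrn.
  have L0 g : (0 <= Lpnorm 2 g)%E by exact: Lnorm_ge0.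
  rewrite -poweRM ?lee_fin//; apply: gt0_ler_poweR => //.
  - by rewrite in_itv /= L0 leey.
  - by rewrite in_itv /= mule_ge0 ?lee_fin// leey.
  apply: le_trans (S_bd f f2) _; apply: lee_wpmul2r => //.
  by rewrite lee_fin le_max lexx orbT.
have S_bump a s (k : nat) : 0 < s -> {ae mu, forall x, ~ closed_cube a s x ->
    S2 (rc (bump_fun k.+1%:R a s)) x =
    cintegral setT (fun y => K0 x y * rc (bump_fun k.+1%:R a s) y)}.
  move=> s0; have sb := @bump_schwartz R n k.+1%:R a s (ltr0Sn R k).
  have := hrepr _ _ (@bump_Cc_infty R n k.+1%:R a s (ltr0Sn R k)) (S_ext _ sb).
  apply: filterS => x hx xs.
  have b0 y : rc (bump_fun k.+1%:R a s) y != 0 -> closed_cube a s y.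
    move=> h; apply: contrapT => yc; move: h.
    by rewrite /rc bump_fun_out ?eqxx// => /open_cube_sub/cube_sub_closed.
  rewrite hx; last first.
    move=> xsup; apply: xs; apply: closed_cube_closed; move: xsup.
    by apply: closure_subset => y /=; exact: b0.
  (* The two kernels differ only at [y = x], where the bump is 0 because [x] is off the closed
     cube. *)
  congr (cintegral _ _); apply/funext => y; have [xy|xy] := eqVneq x y; last by rewrite K0E.
  have -> : (bump_fun k.+1%:R a s y)%:C%C = 0 :> C.
    by apply/eqP; apply: contrapT => /negP /b0; rewrite -xy.
  have -> : rc (bump_fun k.+1%:R a s) y = 0 by apply/eqP; apply: contrapT => /negP /b0; rewrite -xy.
  by rewrite !mulr0.
have [CH CH0 hCH] := hormander hn htheta AK0 mK0 K02.
have CWk0 : 0 <= Cweak n A CH by exact: Cweak_ge0.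
have stp N a s u t (s0 : 0 < s) (t0 : 0 < t) (su : step N a s u) :=
  weak11_step hn AK0 mK0 K01 linS S_in A0 S_bd' S_bump CH0 hCH s0 t0 su.
have [S [SE linS1 mS bS]] := L1_extension linS S_in A0 S_bd' CWk0 stp.
have CW0 : 0 <= 16 * Cweak n A CH by rewrite mulr_ge0.
have wS : weak_op (16 * Cweak n A CH) S by split.
have extS : weak11_extension T S.
  split=> //; last by move=> f sf; rewrite (SE f (or_intror sf)); exact: S_ext.
  by exists (16 * Cweak n A CH) => f t f1 t0; rewrite Lpnorm1; exact: bS.
exists K0, AK, (16 * Cweak n A CH), S; split=> //.
  apply: (repr_far AK0 mK0 K01 CW0 wS) => N a s u s0 su.
  have [_ h] := has_repr_step AK0 mK0 K01 linS S_in A0 S_bd' S_bump s0 su.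
  by rewrite (SE _ (or_introl (bcs_L2 (bcs_step (ltW s0) su)))).
move=> S' f ext' f1; have [CW' CW'0 wS'] := weak11_weak_op ext'.
have [_ _ _ e'] := ext'; have [_ _ _ e] := extS.
apply: (weak_op_unique CW'0 CW0 wS' wS _ f1) => a s k s0.
have sb := @bump_schwartz R n k.+1%:R a s (ltr0Sn R k).
exact: is_function_unique (e' _ sb) (e _ sb).
Qed.

End CZ_operators.

(** * Weights and maximal sums *)

Section powers.
Context (R : realType).
Implicit Types (x y r p q : R).

Lemma powRV x p : 0 <= x -> p != 0 -> (x `^ p^-1) `^ p = x.
Proof. by move=> x0 p0; rewrite -powRrM mulVf// powRr1. Qed.

Lemma powRVV x p : 0 <= x -> p != 0 -> (x `^ p) `^ p^-1 = x.
Proof. by move=> x0 p0; rewrite -powRrM mulfV// powRr1. Qed.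

Lemma powR_le x y r : 0 <= r -> 0 <= x -> x <= y -> x `^ r <= y `^ r.
Proof.
by move=> r0 x0 xy; apply: (ge0_ler_powR r0); rewrite ?nnegrE// (le_trans x0).
Qed.

Lemma powRB_mul x p q : 0 < x -> x `^ (p + q) = x `^ p * x `^ q.
Proof. by move=> x0; rewrite powRD// (gt_eqF x0) implybT. Qed.

(** A geometric sum of ratio [2^r] is at most this multiple of its last term. *)
Definition level_ratio r : R := 2 `^ r / (2 `^ r - 1).

Lemma level_ratio_gt0 r : 0 < r -> 0 < level_ratio r.
Proof.
move=> r0; rewrite divr_gt0 ?powR_gt0// subr_gt0.
have e1 : 1 `^ r = 1 :> R by rewrite powR1.
rewrite -[X in X < _]e1; apply: (gt0_ltr_powR r0); rewrite ?nnegrE//.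
by rewrite ltr1n.
Qed.

Lemma level_sum_le r lam M : 0 < r -> 0 < lam ->
  \sum_(k < M.+1) (lam * 2 ^+ k) `^ r <= level_ratio r * (lam * 2 ^+ M) `^ r.
Proof.
move=> r0 lam0; have q1 : 1 < 2 `^ r :> R.
  have e1 : 1 `^ r = 1 :> R by rewrite powR1.
  rewrite -[X in X < _]e1; apply: (gt0_ltr_powR r0); rewrite ?nnegrE//.
  by rewrite ltr1n.
have d0 : 0 < 2 `^ r - 1 :> R by rewrite subr_gt0.
have lev k : (lam * 2 ^+ k.+1) `^ r = 2 `^ r * (lam * 2 ^+ k) `^ r.
  by rewrite exprS mulrCA powRM// mulr_ge0 ?exprn_ge0// ltW.
elim: M => [|M IH].
  rewrite big_ord1 /= ler_peMl ?powR_ge0// /level_ratio.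
  by rewrite ler_pdivlMr// mul1r lerBlDr lerDl.
rewrite big_ord_recr /=; apply: le_trans (lerD IH (lexx _)) _; rewrite lev.
have -> : level_ratio r * (lam * 2 ^+ M) `^ r + 2 `^ r * (lam * 2 ^+ M) `^ r =
  level_ratio r * (2 `^ r * (lam * 2 ^+ M) `^ r).
  by rewrite /level_ratio; field; rewrite gt_eqF.
exact: lexx.
Qed.

(** One half of a discrete layer cake formula over the levels [lam 2^k]; [level_sum_ge] is the other
    half. *)
Lemma level_sum_lt r lam M t : 0 < r -> 0 < lam -> 0 <= t ->
  \sum_(k < M) (lam * 2 ^+ k) `^ r * (lam * 2 ^+ k < t)%R%:R <= level_ratio r * t `^ r.
Proof.
move=> r0 lam0 t0; have lr := level_ratio_gt0 r0.
elim: M => [|M IH]; first by rewrite big_ord0 mulr_ge0 ?powR_ge0// ltW.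
have [h|h] := ltP (lam * 2 ^+ M) t; last first.
  by rewrite big_ord_recr /= ltNge h mulr0 addr0.
apply: (@le_trans _ _ (\sum_(k < M.+1) (lam * 2 ^+ k) `^ r)).
  by apply: ler_sum => k _; rewrite ler_piMr ?powR_ge0//; case: (_ < _).
apply: (le_trans (level_sum_le _ r0 lam0)); rewrite ler_wpM2l ?(ltW lr)//.
by apply: powR_le; rewrite ?mulr_ge0 ?exprn_ge0// ltW.
Qed.

(** The last level below [t] suffices: twice that level is at least [t]. The premise that [t] is 0
    or above [lam] ensures that such a level exists when [t] is not 0. *)
Lemma level_sum_ge p lam M t : 0 < p -> 0 < lam -> t = 0 \/ lam < t -> t <= lam * 2 ^+ M ->
  t `^ p <= \sum_(k < M) (lam * 2 ^+ k.+1) `^ p * (lam * 2 ^+ k < t)%R%:R.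
Proof.
move=> p0 lam0 ht; elim: M => [|M IH] hM.
  case: ht => [->|h]; first by rewrite big_ord0 powR0// gt_eqF.
  by move: hM; rewrite expr0 mulr1 leNgt h.
rewrite big_ord_recr /=; have [h|h] := leP t (lam * 2 ^+ M).
  by apply: le_trans (IH h) _; rewrite lerDl mulr_ge0 ?powR_ge0//; case: (_ < _).
rewrite mulr1; apply: (@le_trans _ _ ((lam * 2 ^+ M.+1) `^ p)).
  apply: powR_le => //; first exact: ltW.
  by case: ht => [->//|/ltW]; apply: le_trans; exact: ltW.
by rewrite lerDr sumr_ge0// => k _; rewrite mulr_ge0 ?powR_ge0//; case: (_ < _).
Qed.

End powers.
Section holder.
Context d (T : measurableType d) (R : realType) (mu : {measure set T -> \bar R}).

(** Young's inequality after normalization by [X] and [Y], which are positive upper bounds of the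
    two integrals instead of their values: no degenerate case arises. *)
Lemma nint_hoelder (D : set T) (f g : T -> R) (p q X Y : R) : measurable D -> nnm f -> nnm g ->
  0 < p -> 0 < q -> p^-1 + q^-1 = 1 -> 0 < X -> 0 < Y ->
  (\nint[mu]_(x in D) (f x `^ p) <= X%:E)%E -> (\nint[mu]_(x in D) (g x `^ q) <= Y%:E)%E ->
  (\nint[mu]_(x in D) (f x * g x) <= (X `^ p^-1 * Y `^ q^-1)%:E)%E.
Proof.
move=> mD nf ng p0 q0 pq X0 Y0 fX gY; set c := X `^ p^-1 * Y `^ q^-1.
have Xp0 : 0 < X `^ p^-1 by rewrite powR_gt0.
have Yq0 : 0 < Y `^ q^-1 by rewrite powR_gt0.
have c0 : 0 < c by rewrite mulr_gt0.
have nfp := nnm_powR p nf; have ngq := nnm_powR q ng.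
have pX0 : 0 <= c / p / X by rewrite !divr_ge0// ltW.
have qY0 : 0 <= c / q / Y by rewrite !divr_ge0// ltW.
apply: (@le_trans _ _ (\nint[mu]_(x in D) (c / p / X * f x `^ p + c / q / Y * g x `^ q))%E).
  apply: nint_le => //; [exact: nnmM|by apply: nnmD; exact: nnmZ|].
  move=> x _; have f0 := nf.2 x; have g0 := ng.2 x.
  have := @conjugate_powR _ (f x / X `^ p^-1) (g x / Y `^ q^-1) p q
    (divr_ge0 f0 (ltW Xp0)) (divr_ge0 g0 (ltW Yq0)) p0 q0 pq.
  have pw z Z r : 0 <= z -> 0 < Z -> 0 < r -> (z / Z `^ r^-1) `^ r = z `^ r / Z.
    move=> z0 Z0 r0; rewrite powRM// ?invr_ge0 ?powR_ge0//; congr (_ * _).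
    by rewrite -powRN -powRrM mulNr mulVf ?gt_eqF// powR_inv1// ltW.
  rewrite !pw// -(ler_pM2l c0) => h.
  have -> : f x * g x = c * (f x / X `^ p^-1 * (g x / Y `^ q^-1)).
    by rewrite /c; field; rewrite !gt_eqF.
  apply: (le_trans h); rewrite le_eqVlt; apply/orP; left; apply/eqP; ring.
rewrite nintD//; [|exact: nnmZ|exact: nnmZ].
rewrite !nintZ//; apply: (@le_trans _ _ ((c / p / X)%:E * X%:E + (c / q / Y)%:E * Y%:E)%E).
  by apply: leeD; rewrite lee_wpmul2l ?lee_fin.
rewrite -!EFinM -EFinD lee_fin !mulfVK ?gt_eqF//.
by rewrite -mulrDr pq mulr1.
Qed.

End holder.

Section doubling.
Context (R : realType) (n : nat).
Local Notation E := 'rV[R]_n.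
Local Notation mu := (leb R n).
Implicit Types (a x y : E) (s r : R) (v g h : E -> R) (D : set E).

Lemma nint_setU_le (A B : set E) h : measurable A -> measurable B -> nnm h ->
  (\nint[mu]_(x in A `|` B) (h x) <= \nint[mu]_(x in A) (h x) + \nint[mu]_(x in B) (h x))%E.
Proof.
move=> mA mB nh; have mBA : measurable (B `\` A) by exact: measurableD.
have -> : A `|` B = A `|` (B `\` A).
  apply/seteqP; split => x; last by case=> [|[]]; [left|right].
  by case=> xh; [left|have [?|?] := pselect (A x); [left|right]].
rewrite nintU//; last by apply/seteqP; split => // x [? []].
by rewrite leeD2l//; apply: nint_sub => // x [].
Qed.

Definition fin_wt v := nnm v /\ forall a s, (\nint[mu]_(x in cube a s) (v x) < +oo)%E.

Definition doubling_wt (d : R) v := [/\ fin_wt v, 0 <= d & forall a s, 0 < s ->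
  (\nint[mu]_(x in triple a s) (v x) <= d%:E * \nint[mu]_(x in cube a s) (v x))%E].

Definition cube_union (l : seq (E * R)) : set E := [set x | exists2 c, c \in l & cube c.1 c.2 x].

Lemma cube_union_cons c l : cube_union (c :: l) = cube c.1 c.2 `|` cube_union l.
Proof.
apply/seteqP; split => x /=.
  by move=> [c']; rewrite inE => /predU1P[->|cl] ?; [left|right; exists c'].
by move=> [xc|[c' cl xc']]; [exists c|exists c']; rewrite ?mem_head ?inE ?cl ?orbT.
Qed.

Lemma measurable_cube_union l : measurable (cube_union l).
Proof.
elim: l => [|c l IH]; last by rewrite cube_union_cons; apply: measurableU => //; exact: measurable_cube.
by rewrite (_ : cube_union [::] = set0)//; apply/seteqP; split => // x [].
Qed.

Lemma max_cube (c : E * R) l : exists2 b, b \in c :: l & forall c', c' \in c :: l -> c'.2 <= b.2.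
Proof.
elim: l c => [|c' l IH] c; first by exists c; rewrite ?mem_head// => c'; rewrite inE => /eqP ->.
have [b bl hb] := IH c'; have [h|h] := leP c.2 b.2.
  exists b; first by rewrite inE bl orbT.
  by move=> c''; rewrite inE => /predU1P[->//|]; exact: hb.
exists c; rewrite ?mem_head// => c''; rewrite inE => /predU1P[->//|/hb].
by move=> /le_trans; apply; exact: ltW.
Qed.

(* Vitali selection: the largest cube absorbs, inside its triple, all the cubes
   that it meets; the others are treated by induction. *)
Lemma weak_maximal d v g lam (l : seq (E * R)) : doubling_wt d v -> nnm g -> 0 <= lam ->
  (forall c, c \in l -> 0 < c.2 /\ (lam%:E * \nint[mu]_(x in cube c.1 c.2) (v x) <=
    \nint[mu]_(x in cube c.1 c.2) (g x * v x))%E) ->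
  (lam%:E * \nint[mu]_(x in cube_union l) (v x) <=
   d%:E * \nint[mu]_(x in cube_union l) (g x * v x))%E.
Proof.
move=> [[nv vfin] d0 dv] ng lam0; have [k] := ubnP (size l); elim: k l => // k IH l lk hl.
have ngv : nnm (fun x => g x * v x) by exact: nnmM.
case: l lk hl => [|c l] lk hl.
  rewrite (_ : cube_union [::] = set0); last by apply/seteqP; split => // x [].
  by rewrite !integral_set0 !mule0.
have [b bl hb] := max_cube c l; move: (c :: l) => {c}l in lk hl b bl hb *.
have [b0 hb2] := hl b bl.
pose meets (c : E * R) := `[< cube b.1 b.2 `&` cube c.1 c.2 !=set0 >].
pose l' := [seq c <- l | ~~ meets c].
have bb : meets b by apply/asboolP; exists b.1; split; exact: corner_in_cube.
have l'k : (size l' < k)%N.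
  rewrite -ltnS; apply: leq_trans lk; rewrite ltnS size_filter.
  rewrite -(count_predC meets l) -[X in (X < _)%N]add0n ltn_add2r -has_count.
  by apply/hasP; exists b.
have IHl' := IH l' l'k (fun c cl' => hl c (mem_subseq (filter_subseq _ _) cl')).
have mb := measurable_cube b.1 b.2; have mU' := measurable_cube_union l'.
have mT := measurable_triple b.1 b.2.
apply: (@le_trans _ _ (lam%:E * (\nint[mu]_(x in triple b.1 b.2) (v x) +
    \nint[mu]_(x in cube_union l') (v x)))%E).
  rewrite lee_wpmul2l ?lee_fin//.
  apply: (@le_trans _ _ (\nint[mu]_(x in triple b.1 b.2 `|` cube_union l') (v x))%E).
    apply: nint_sub => //; [exact: measurable_cube_union|exact: measurableU|].
    move=> x [c cl xc]; have [m|m] := boolP (meets c); [left|right].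
      by apply: cube_meet_triple xc; [exact: hb|exact/asboolP].
    by exists c => //; rewrite mem_filter m.
  exact: nint_setU_le.
rewrite ge0_muleDr; [|exact: nint_ge0|exact: nint_ge0].
apply: (@le_trans _ _ (d%:E * \nint[mu]_(x in cube b.1 b.2) (g x * v x) +
    d%:E * \nint[mu]_(x in cube_union l') (g x * v x))%E).
  apply: leeD IHl'; apply: (@le_trans _ _ (lam%:E * (d%:E * \nint[mu]_(x in cube b.1 b.2) (v x)))%E).
    by rewrite lee_wpmul2l ?lee_fin// dv.
  by rewrite muleCA lee_wpmul2l ?lee_fin.
rewrite -ge0_muleDr; [|exact: nint_ge0|exact: nint_ge0].
rewrite lee_wpmul2l ?lee_fin// -nintU//.
  apply: nint_sub => //; [exact: measurableU|exact: measurable_cube_union|].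
  move=> x [xb|[c]]; first by exists b.
  by rewrite mem_filter => /andP[_ cl] xc; exists c.
apply/seteqP; split => // x [xb [c]]; rewrite mem_filter => /andP[/asboolP m _] xc.
by case: m; exists x.
Qed.

(** The factor [2^(p+1) d] is the weak type bound at one level, the rest is the sum of the powers
    [p - 1] of the levels below [2 g x]. *)
Definition Cmax (p d : R) := 2 `^ (p + 1) * d * (level_ratio (p - 1) * 2 `^ (p - 1)).

Lemma Cmax_ge0 p d : 1 < p -> 0 <= d -> 0 <= Cmax p d.
Proof.
move=> p1 d0; have h : 0 < level_ratio (p - 1) by rewrite level_ratio_gt0// subr_gt0.
have h0 := ltW h.
by apply: mulr_ge0; apply: mulr_ge0 => //; exact: powR_ge0.
Qed.

(** As the [A i] are disjoint, the sum plays the role of the integral of the [p]-th power of a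
    maximal function of [g]. It is cut into levels, [weak_maximal] is applied at each level to the
    cubes whose coefficient exceeds it, and the levels are summed again under the integral. *)
Lemma maximal_sum (I : eqType) (l : seq I) (al : I -> R) (B : I -> E * R) (A : I -> set E)
    d v g p (D : set E) : doubling_wt d v -> nnm g -> 1 < p -> measurable D ->
  (forall i, [/\ 0 < (B i).2, 0 <= al i, measurable (A i) & cube (B i).1 (B i).2 `<=` D]) ->
  (forall i, A i `<=` cube (B i).1 (B i).2) ->
  (forall i, ((al i)%:E * \nint[mu]_(x in cube (B i).1 (B i).2) (v x) <=
    \nint[mu]_(x in cube (B i).1 (B i).2) (g x * v x))%E) ->
  (forall x, \sum_(i <- l) \1_(A i) x <= 1 :> R) ->
  (\sum_(i <- l) (al i `^ p)%:E * \nint[mu]_(x in A i) (v x) <=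
   (Cmax p d)%:E * \nint[mu]_(x in D) (g x `^ p * v x))%E.
Proof.
move=> dv ng p1 mD hB hA hal hsum; have [[nv vfin] d0 _] := dv.
have p0 : 0 < p := lt_trans ltr01 p1; have pr0 : 0 < p - 1 by rewrite subr_gt0.
have al0 i : 0 <= al i by have [] := hB i.
have mA i : measurable (A i) by have [] := hB i.
(* The family is finite, so there is a positive lowest level below all the nonzero coefficients. *)
have [lam lam0 hlam] : exists2 lam, 0 < lam & forall i, i \in l -> al i = 0 \/ lam < al i.
  elim: (l) => [|i l' [lam lam0 IH]]; first by exists 1.
  have [i0|i0] := eqVneq (al i) 0.
    by exists lam => // j; rewrite inE => /predU1P[->|/IH//]; left.
  have ai : 0 < al i by rewrite lt_neqAle eq_sym i0 al0.
  exists (Num.min lam (al i / 2)); first by rewrite lt_min lam0 divr_gt0.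
  move=> j; rewrite inE => /predU1P[->|/IH[->|h]]; [right|by left|right].
    by rewrite gt_min; apply/orP; right; lra.
  by rewrite gt_min h.
have [M hM] : exists M : nat, forall i, i \in l -> al i <= lam * 2 ^+ M.
  elim: (l) => [|i l' [M IH]]; first by exists 0%N.
  exists (maxn M (Num.bound (al i / lam))) => j; rewrite inE => /predU1P[->|/IH h].
    rewrite mulrC -ler_pdivrMr//; apply: ltW.
    apply: lt_le_trans (archi_boundP _) _; first by rewrite divr_ge0// ltW.
    rewrite -natrX ler_nat; apply: leq_trans (ltnW (ltn_expl _ (ltnSn 1))) _.
    by rewrite leq_exp2l// leq_maxr.
  by apply: (le_trans h); rewrite ler_pM2l// ler_weXn2l ?ler1n// leq_maxl.
pose L k := lam * 2 ^+ k; have L0 k : 0 < L k by rewrite mulr_gt0// exprn_gt0.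
pose V D := \nint[mu]_(x in D) (v x); have V0 D' : (0 <= V D')%E by exact: nint_ge0.
(* Where [g <= L k / 2] it contributes at most half of an average exceeding [L k]; only the rest of
   [g] is kept at level [k]. *)
pose gk k x := g x * \1_[set x | L k < 2 * g x] x.
have mgk k : measurable [set x | L k < 2 * g x].
  by apply: measurable_gt; apply: (nnmZ _ ng).1.
have ngk k : nnm (gk k) by apply: nnmM => //; exact: nnm_indic.
have ngkv k : nnm (fun x => gk k x * v x) by exact: nnmM.
have ngv : nnm (fun x => g x * v x) by exact: nnmM.
pose U k := cube_union [seq B i | i <- l & L k < al i].
have mU k : measurable (U k) by exact: measurable_cube_union.
have UD k : U k `<=` D.
  by move=> x [c /mapP[i _ ->]]; have [_ _ _] := hB i; exact.
(* Disjointness enters here: the [A i] of the level are packed in the union of their cubes. *)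
have step1 k : (\sum_(i <- l) (L k < al i)%R%:R%:E * V (A i) <= V (U k))%E.
  apply: (@le_trans _ _ (\nint[mu]_(x in setT)
      (\sum_(i <- l) (L k < al i)%R%:R * (v x * \1_(A i) x)))%E).
    rewrite nint_sum//; last first.
      by move=> i; apply: nnmZ => //; apply: nnmM => //; exact: nnm_indic.
    apply: lee_sum => i _; rewrite nintZ//; last by apply: nnmM => //; exact: nnm_indic.
    by rewrite nint_indic// setTI.
  rewrite [leRHS](_ : _ = \nint[mu]_(x in setT) (v x * \1_(U k) x)); last first.
    by rewrite nint_indic// setTI.
  apply: nint_le => //.
  - apply: nnm_sum => i; apply: nnmZ => //; apply: nnmM => //; exact: nnm_indic.
  - by apply: nnmM => //; exact: nnm_indic.
  - move=> x _; have [xU|xU] := pselect (U k x).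
      rewrite [in leRHS]indicE mem_set// mulr1.
      apply: (@le_trans _ _ (\sum_(i <- l) (v x * \1_(A i) x))).
        apply: ler_sum => i _; rewrite ler_piMl ?mulr_ge0 ?nv.2// ?indicE//.
        by case: (_ < _).
      by rewrite -mulr_sumr ler_piMr// nv.2.
    rewrite [in leRHS]indicE memNset// mulr0 big_seq big1// => i il.
    have [h|h] := ltP (L k) (al i); last by rewrite mul0r.
    rewrite [\1_(A i) x]indicE memNset ?mulr0// => /hA xB; apply: xU.
    by exists (B i) => //; apply: map_f; rewrite mem_filter h.
have step2 k : ((L k / 2)%:E * V (U k) <= d%:E * \nint[mu]_(x in D) (gk k x * v x))%E.
  apply: (@le_trans _ _ (d%:E * \nint[mu]_(x in U k) (gk k x * v x))%E).
    apply: weak_maximal => //; first by rewrite divr_ge0// ltW.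
    move=> c /mapP[j]; rewrite mem_filter => /andP[Lk _] ->; have [B0 _ _ _] := hB j.
    split=> //; set Q := cube _ _; have mQ : measurable Q by exact: measurable_cube.
    have [J J0 JE] := nint_real nv (vfin (B j).1 (B j).2).
    have h1 : (\nint[mu]_(x in Q) (g x * v x) <=
        \nint[mu]_(x in Q) (gk k x * v x) + (L k / 2)%:E * V Q)%E.
      rewrite /V -nintZ ?divr_ge0 ?(ltW (L0 k))// -nintD//; last first.
        by apply: nnmZ => //; rewrite divr_ge0 ?(ltW (L0 k)).
      apply: nint_le => //.
        by apply: nnmD => //; apply: nnmZ => //; rewrite divr_ge0 ?(ltW (L0 k)).
      move=> x _; have v0 := nv.2 x; have g0 := ng.2 x; rewrite /gk indicE.
      have [h|h] := ltP (L k) (2 * g x).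
        by rewrite mem_set// mulr1 lerDl mulr_ge0// divr_ge0 ?(ltW (L0 k)).
      rewrite memNset; last by move=> /=; rewrite ltNge h.
      by rewrite mulr0 mul0r add0r ler_wpM2r//; lra.
    have h2 := le_trans (hal j) h1; move: h2; rewrite -/Q /V JE -!EFinM.
    have := nint_ge0 mu Q (ngkv k); case: (integral _ _ _) => [r|_ _|//]; last by rewrite leey.
    rewrite lee_fin -EFinD !lee_fin => r0 h2.
    have : L k * J <= al j * J by rewrite ler_wpM2r// ltW.
    lra.
  by rewrite lee_wpmul2l ?lee_fin//; apply: nint_sub.
have tp : 2 `^ (p + 1) = 2 * 2 `^ p :> R by rewrite powRB_mul// powRr1// mulrC.
(* From [L_(k+1)^p = 2^(p+1) L_k^(p-1) (L_k / 2)], with [step2] for the last factor. *)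
have step3 k : ((L k.+1 `^ p)%:E * V (U k) <=
    (2 `^ (p + 1) * d)%:E * ((L k `^ (p - 1))%:E * \nint[mu]_(x in D) (gk k x * v x)))%E.
  have -> : L k.+1 `^ p = 2 `^ (p + 1) * L k `^ (p - 1) * (L k / 2).
    rewrite /L exprS mulrCA powRM ?(ltW (L0 k))// -/(L k) tp.
    have -> : L k `^ p = L k `^ (p - 1) * L k.
      by rewrite -[X in _ * X]powRr1 ?(ltW (L0 k))// -powRB_mul// subrK.
    by field.
  rewrite (EFinM (_ * _) (L k / 2)) -muleA.
  apply: (@le_trans _ _ ((2 `^ (p + 1) * L k `^ (p - 1))%:E *
      (d%:E * \nint[mu]_(x in D) (gk k x * v x)))%E).
    by rewrite lee_wpmul2l ?lee_fin ?mulr_ge0 ?powR_ge0//; exact: step2.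
  by rewrite !EFinM !muleA le_eqVlt; apply/orP; left; apply/eqP; congr (_ * _)%E; rewrite muleAC.
have step4 : (\sum_(i <- l) (al i `^ p)%:E * V (A i) <= \sum_(k < M) (L k.+1 `^ p)%:E * V (U k))%E.
  apply: (@le_trans _ _ (\sum_(i <- l) \sum_(k < M)
      (L k.+1 `^ p)%:E * ((L k < al i)%R%:R%:E * V (A i)))%E).
    rewrite big_seq [leRHS]big_seq; apply: lee_sum => i il.
    apply: (@le_trans _ _ ((\sum_(k < M) L k.+1 `^ p * (L k < al i)%R%:R)%:E * V (A i))%E).
      by rewrite lee_wpmul2r// lee_fin level_sum_ge//; [exact: hlam|exact: hM].
    rewrite -sumEFin ge0_sume_distrl; last by move=> k _; rewrite lee_fin mulr_ge0 ?powR_ge0.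
    by apply: lee_sum => k _; rewrite EFinM muleA.
  rewrite exchange_big /=; apply: lee_sum => k _.
  rewrite -ge0_sume_distrr; last by move=> i _; rewrite mule_ge0.
  by rewrite lee_wpmul2l ?lee_fin ?powR_ge0.
apply: (le_trans step4).
apply: (@le_trans _ _ (\sum_(k < M) (2 `^ (p + 1) * d)%:E *
    ((L k `^ (p - 1))%:E * \nint[mu]_(x in D) (gk k x * v x)))%E).
  by apply: lee_sum => k _; exact: step3.
have c0 : 0 <= 2 `^ (p + 1) * d by rewrite mulr_ge0 ?powR_ge0.
rewrite -ge0_sume_distrr; last first.
  by move=> k _; rewrite mule_ge0 ?lee_fin ?powR_ge0//; exact: nint_ge0.
rewrite /Cmax (EFinM (_ * d)) -muleA lee_wpmul2l ?lee_fin//.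
rewrite -nintZ//; last first.
- by rewrite mulr_ge0 ?powR_ge0// ltW// level_ratio_gt0.
- by apply: nnmM => //; exact: nnm_powR.
apply: (@le_trans _ _ (\nint[mu]_(x in D)
    (\sum_(k < M) L k `^ (p - 1) * (gk k x * v x)))%E).
  rewrite nint_sum//; last by move=> k; apply: nnmZ => //; exact: powR_ge0.
  by apply: lee_sum => k _; rewrite nintZ//; exact: powR_ge0.
apply: nint_le => //.
- by apply: nnm_sum => k; apply: nnmZ => //; exact: powR_ge0.
- apply: nnmZ; first by rewrite mulr_ge0 ?powR_ge0// ltW// level_ratio_gt0.
  by apply: nnmM => //; exact: nnm_powR.
move=> x _; have v0 := nv.2 x; have g0 := ng.2 x.
have -> : \sum_(k < M) L k `^ (p - 1) * (gk k x * v x) =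
    (\sum_(k < M) L k `^ (p - 1) * (L k < 2 * g x)%R%:R) * (g x * v x).
  rewrite mulr_suml; apply: eq_bigr => k _; rewrite /gk indicE.
  have [h|h] := ltP (L k) (2 * g x); first by rewrite mem_set// !mulr1.
  by rewrite memNset ?mulr0 ?mul0r ?mulr0//= ltNge h.
apply: (@le_trans _ _ (level_ratio (p - 1) * (2 * g x) `^ (p - 1) * (g x * v x))).
  by rewrite ler_wpM2r ?mulr_ge0// level_sum_lt// mulr_ge0.
have key : g x `^ (p - 1) * g x <= g x `^ p.
  have [->|gx] := eqVneq (g x) 0; first by rewrite mulr0 powR_ge0.
  have gx0 : 0 < g x by rewrite lt_neqAle eq_sym gx.
  by rewrite -[X in _ * X]powRr1// -powRB_mul// subrK.
have lr := ltW (level_ratio_gt0 pr0).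
rewrite powRM//; set a1 := level_ratio _; set a2 := 2 `^ _; set a3 := g x `^ (p - 1).
have -> : a1 * (a2 * a3) * (g x * v x) = a1 * a2 * (a3 * g x * v x) by ring.
apply: ler_wpM2l; first by rewrite mulr_ge0// powR_ge0.
exact: ler_wpM2r.
Qed.

End doubling.

(** * A weight of class A_p and its dual weight *)

Section dual_weights.
Context (R : realType) (n : nat).
Local Notation E := 'rV[R]_n.
Local Notation mu := (leb R n).
Implicit Types (a x y : E) (s r : R) (v w sg g h : E -> R) (D : set E).

Lemma nint_gt0 D v : measurable D -> nnm v -> (forall x, 0 < v x) -> (0 < mu D)%E ->
  (0 < \nint[mu]_(x in D) (v x))%E.
Proof.
move=> mD nv v0 D0; rewrite lt_neqAle nint_ge0// andbT eq_sym; apply/eqP => I0.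
have : ae_eq mu D (EFin \o v) (cst 0%E).
  apply/(ae_eq_integral_abs _ mD); first exact: nnm_EFin.
  rewrite -I0; apply: eq_integral => x _ /=; rewrite ger0_norm//; exact: nv.2.
move=> h; have : mu D = 0%E.
  apply/eqP; rewrite eq_le measure_ge0 andbT -(measure0 mu); apply: ae_le_measure => //.
  by apply: filterS h => x /= h Dx; have := h Dx; move=> -[/eqP]; rewrite gt_eqF.
by move=> e; rewrite e ltxx in D0.
Qed.

Definition vol v a s : R := fine (\nint[mu]_(x in cube a s) (v x)).

Lemma volE v a s : fin_wt v -> \nint[mu]_(x in cube a s) (v x) = (vol v a s)%:E.
Proof. by move=> [nv fv]; have [J J0 JE] := nint_real nv (fv a s); rewrite /vol JE. Qed.

Lemma vol_gt0 v a s : fin_wt v -> (forall x, 0 < v x) -> 0 < s -> 0 < vol v a s.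
Proof.
move=> fv v0 s0; rewrite -lte_fin -volE//; apply: nint_gt0 => //.
- exact: measurable_cube.
- by case: fv.
- by rewrite leb_cube ?(ltW s0)// lte_fin exprn_gt0.
Qed.

(** For [sg] equal to the power [- q / p] of [w], the relation [w^(1/p) sg^(1/q) = 1] makes the
    notion symmetric under exchange of [(p, w)] and [(q, sg)]. Weights are positive everywhere, and
    the A_p condition is stated on cubes. *)
Record dual_weights (p q A : R) (w sg : E -> R) : Prop := DualWeights {
  dw_p : 1 < p ;
  dw_q : 1 < q ;
  dw_pq : p^-1 + q^-1 = 1 ;
  dw_A : 0 < A ;
  dw_w : fin_wt w ;
  dw_s : fin_wt sg ;
  dw_wpos : forall x, 0 < w x ;
  dw_spos : forall x, 0 < sg x ;
  dw_dual : forall x, w x `^ p^-1 * sg x `^ q^-1 = 1 ;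
  dw_Ap : forall a s, 0 < s -> vol w a s `^ p^-1 * vol sg a s `^ q^-1 <= A * s ^+ n }.

Lemma dual_weights_sym p q A w sg : dual_weights p q A w sg -> dual_weights q p A sg w.
Proof.
move=> [p1 q1 pq A0 fw fs w0 s0 ws Ap].
apply: (@DualWeights q p A sg w q1 p1 _ A0 fs fw s0 w0); first by rewrite addrC.
  by move=> x; rewrite mulrC.
by move=> a s s1; rewrite mulrC; exact: Ap.
Qed.

(** The measure of [D] is the integral over [D] of [w^(1/p) sg^(1/q)]. Hölder's inequality bounds it
    by [w(D)^(1/p) sg(Q)^(1/q)], and the A_p condition compares the last factor with [w(Q)]. *)
Lemma dual_sub p q A w sg a s D th : dual_weights p q A w sg -> measurable D ->
  D `<=` cube a s -> 0 < s -> 0 < th -> ((th * s ^+ n)%:E <= mu D)%E ->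
  (\nint[mu]_(x in cube a s) (w x) <= ((A / th) `^ p)%:E * \nint[mu]_(x in D) (w x))%E.
Proof.
move=> [p1 q1 pq A0 fw fs w0 sg0 ws Ap] mD DQ s0 th0 hD.
have p0 : 0 < p := lt_trans ltr01 p1; have q0 : 0 < q := lt_trans ltr01 q1.
have [nw _] := fw; have [ns _] := fs; have mQ := measurable_cube a s.
have sn0 : 0 < s ^+ n by rewrite exprn_gt0.
have D0 : (0 < mu D)%E by apply: lt_le_trans hD; rewrite lte_fin mulr_gt0.
have Dfin : (\nint[mu]_(x in D) (w x) < +oo)%E.
  by apply: le_lt_trans (fw.2 a s); exact: nint_sub.
have [X' X'0 X'E] := nint_real nw Dfin.
have X'gt : 0 < X' by rewrite -lte_fin -X'E; apply: nint_gt0.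
have Y0 := vol_gt0 a fs sg0 s0; have X0 := vol_gt0 a fw w0 s0.
have h1 : (\nint[mu]_(x in D) (w x `^ p^-1 * sg x `^ q^-1) <=
    (X' `^ p^-1 * vol sg a s `^ q^-1)%:E)%E.
  apply: nint_hoelder => //; [exact: nnm_powR|exact: nnm_powR| |].
    rewrite -X'E; apply: nint_le => //; first by do 2 apply: nnm_powR.
    by move=> x _; rewrite powRV ?gt_eqF// ltW.
  rewrite -volE//; apply: (@le_trans _ _ (\nint[mu]_(x in D) (sg x))%E); last exact: nint_sub.
  apply: nint_le => //; first by do 2 apply: nnm_powR.
  by move=> x _; rewrite powRV ?gt_eqF// ltW.
have h2 : th * s ^+ n <= X' `^ p^-1 * vol sg a s `^ q^-1.
  rewrite -lee_fin; apply: (le_trans hD); apply: le_trans h1.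
  under eq_integral do rewrite ws.
  by rewrite nint_cst// mul1e.
have h3 := Ap a s s0.
have Yq : 0 < vol sg a s `^ q^-1 by rewrite powR_gt0.
have h4 : vol w a s `^ p^-1 <= A / th * X' `^ p^-1.
  rewrite -(ler_pM2r Yq); apply: (le_trans h3); rewrite -(mulrA (A / th)).
  have -> : A * s ^+ n = A / th * (th * s ^+ n) by field; rewrite gt_eqF.
  by apply: ler_wpM2l => //; rewrite divr_ge0// ltW.
have Ath : 0 <= A / th by rewrite divr_ge0 ?ltW.
rewrite X'E volE// -EFinM lee_fin -[leLHS](powRV (ltW X0) (lt0r_neq0 p0)).
rewrite -[X in _ * X](powRV X'0 (lt0r_neq0 p0)) -powRM ?powR_ge0//.
by apply: powR_le; rewrite ?powR_ge0// ltW.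
Qed.

Lemma dual_doubling p q A w sg : dual_weights p q A w sg ->
  doubling_wt ((A * 3 ^+ n) `^ p) w.
Proof.
move=> dw; split; [exact: dw_w dw|exact: powR_ge0|] => a s s0.
have -> : A * 3 ^+ n = A / (3 ^- n) by rewrite invrK.
apply: (dual_sub dw).
- exact: measurable_cube.
- by apply: cube_sub_triple; exact: ltW.
- by rewrite mulr_gt0.
- by rewrite invr_gt0 exprn_gt0.
- by rewrite leb_cube ?(ltW s0)// lee_fin exprMn mulKf// gt_eqF// exprn_gt0.
Qed.

Lemma Muckenhoupt_dual (hn : (0 < n)%N) p w : 1 < p -> Muckenhoupt p w ->
  exists w0 sg A, dual_weights p (1 - p^-1)^-1 A w0 sg /\ {ae mu, forall x, w x = w0 x}.
Proof.
move=> p1 [[[[mw _] wloc] wpos] [A A0 hA]]; set q := (1 - p^-1)^-1 in hA *.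
have p0 : 0 < p := lt_trans ltr01 p1.
have pV : p^-1 < 1 by rewrite invf_lt1.
have d0 : 0 < 1 - p^-1 by rewrite subr_gt0.
have q1 : 1 < q by rewrite /q invf_gt1//; rewrite gtrBl invr_gt0.
have q0 : 0 < q := lt_trans ltr01 q1.
have pq : p^-1 + q^-1 = 1 by rewrite /q invrK addrC subrK.
(* The weight is positive only almost everywhere; on the exceptional set it is replaced by 1. *)
pose w0 x := if 0 < w x then w x else 1.
have mw' : measurable_fun setT w by [].
have w0pos x : 0 < w0 x by rewrite /w0; case: ifPn.
have mw0 : measurable_fun setT w0.
  by apply: measurable_fun_ifT => //; apply: measurable_fun_ltr.
have nw : nnm w0 by split=> // x; exact: ltW.
pose sg x := w0 x `^ (- (q / p)).
have ns : nnm sg by exact: nnm_powR.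
have spos x : 0 < sg x by rewrite powR_gt0.
have wE : {ae mu, forall x, w x = w0 x} by apply: filterS wpos => x wx; rewrite /w0 wx.
have wfin a s : (\nint[mu]_(x in cube a s) (w0 x) < +oo)%E.
  apply: (@le_lt_trans _ _ (\nint[mu]_(x in closed_cube a s) (normc (w x)%:C%C))%E); last first.
    by apply: wloc; exact: closed_cube_compact.
  have mC : measurable (closed_cube a s).
    rewrite (_ : closed_cube a s =
        [set x : E | forall i, `[a ord0 i, a ord0 i + s]%classic (x ord0 i)]).
      apply: (@measurable_box R n (fun i => `[a ord0 i, a ord0 i + s]%classic)) => i.
      exact: measurable_itv.
    by apply/seteqP; split => x /= xa i; have := xa i; rewrite /= in_itv.
  have nn : nnm (fun x => normc (w x)%:C%C) by apply: nnm_normc; exact: cmeas_real.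
  apply: (@le_trans _ _ (\nint[mu]_(x in cube a s) (normc (w x)%:C%C))%E).
    apply: nint_ae_le => //; first exact: measurable_cube.
    by apply: filterS wE => x <- _; rewrite normc_real ler_norm.
  by apply: nint_sub => //; [exact: measurable_cube|exact: cube_sub_closed].
have fw : fin_wt w0 by split.
have sE x : w x = w0 x -> w x `^ (- (q / p)) = sg x by move=> ->.
have mB (c : E) (r : R) : measurable (eball c r) by exact: measurable_eball.
(* The cube lies in a ball of radius [n s]; the integrals over it are smaller, and the measure [b]
   of the ball is at most [(2 n s)^n], whence the constant [A (2 n)^n]. *)
have bound a s : 0 < s -> exists2 b : R, 0 < b <= (2 * (n%:R * s)) ^+ n &
    (((b^-1)%:E * (vol w0 a s)%:E) `^ p^-1 *
     ((b^-1)%:E * \nint[mu]_(x in cube a s) (sg x)) `^ q^-1 <= A%:E)%E.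
  move=> s0; have nR : 0 < n%:R :> R by rewrite ltr0n.
  pose c : E := \row_i (a ord0 i + s / 2); pose r := n%:R * s.
  have r0 : 0 < r by rewrite mulr_gt0.
  have QB : cube a s `<=` eball c r by exact: cube_sub_eball.
  have Bfin : (mu (eball c r) <= ((2 * r) ^+ n)%:E)%E by apply: leb_eball_le; exact: ltW.
  have B0 : (0 < mu (eball c r))%E.
    apply: (@lt_le_trans _ _ (mu (cube a s))).
      by rewrite leb_cube ?(ltW s0)// lte_fin exprn_gt0.
    by apply: le_measure; rewrite ?inE//; exact: measurable_cube.
  have BE : mu (eball c r) = (fine (mu (eball c r)))%:E.
    by rewrite fineK// ge0_fin_numE//; apply: le_lt_trans Bfin _; rewrite ltry.
  exists (fine (mu (eball c r))).
    by rewrite -lte_fin -BE B0 /= -lee_fin -BE.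
  set b := fine _; have b0 : 0 < b by rewrite -lte_fin -BE.
  apply: le_trans (hA c r r0); rewrite /mean -/b.
  have e1 : (\int[mu]_(x in eball c r) (w x)%:E = \nint[mu]_(x in eball c r) (w0 x))%E.
    apply: ae_eq_integral => //.
    - by apply/measurable_EFinP; exact: measurable_funTS.
    - exact: nnm_EFin.
    - by apply: filterS wE => x -> _.
  have e2 : (\int[mu]_(x in eball c r) (w x `^ (- (q / p)))%:E = \nint[mu]_(x in eball c r) (sg x))%E.
    apply: ae_eq_integral => //.
    - apply/measurable_EFinP; apply: measurable_funTS.
      exact: (measurableT_comp (measurable_powR _) mw').
    - exact: nnm_EFin.
    - by apply: filterS wE => x wx _; rewrite sE.
  rewrite e1 e2 -volE//; have bV : (0 <= (b^-1)%:E)%E by rewrite lee_fin invr_ge0 ltW.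
  have pwle (x y : \bar R) (t : R) : 0 < t -> (0 <= x)%E -> (x <= y)%E -> (x `^ t <= y `^ t)%E.
    move=> t0 x0 xy; apply: (gt0_ler_poweR (ltW t0) _ _ xy).
    - by rewrite in_itv /= x0 leey.
    - by rewrite in_itv /= (le_trans x0 xy) leey.
  have mQ := measurable_cube a s.
  have pV0 : 0 < p^-1 by rewrite invr_gt0.
  have qV0 : 0 < q^-1 by rewrite invr_gt0.
  apply: lee_pmul; [exact: poweR_ge0|exact: poweR_ge0|apply: (pwle _ _ _ pV0)|apply: (pwle _ _ _ qV0)].
  - by apply: (mule_ge0 bV); exact: nint_ge0.
  - by apply: (lee_wpmul2l bV); apply: (nint_sub mu mQ (mB c r) nw QB).
  - by apply: (mule_ge0 bV); exact: nint_ge0.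
  - by apply: (lee_wpmul2l bV); apply: (nint_sub mu mQ (mB c r) ns QB).
(* Local integrability of [sg] comes out of the A_p bound: an infinite integral would make the
   product infinite, since the factor of [w] is positive. *)
have sfin a s : (\nint[mu]_(x in cube a s) (sg x) < +oo)%E.
  have [s0|s0] := leP s 0.
    rewrite (_ : cube a s = set0) ?integral_set0//.
    apply/seteqP; split => // x /(_ (Ordinal hn))/andP[h1 h2].
    by have := le_lt_trans h1 h2; rewrite ltrDl ltNge s0.
  have [b /andP[b0 _]] := bound a s s0; have X0 := vol_gt0 a fw w0pos s0.
  have := nint_ge0 mu (cube a s) ns; case: (integral _ _ _) => [J _ _|_|//]; first by rewrite ltry.
  rewrite gt0_muley ?lte_fin ?invr_gt0//.
  rewrite (eqy_poweR (_ : 0 < q^-1))// ?invr_gt0//.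
  rewrite -EFinM poweR_EFin gt0_muley ?lte_fin ?powR_gt0 ?mulr_gt0 ?invr_gt0//.
have fs : fin_wt sg by split.
exists w0, sg, (A * (2 * n%:R) ^+ n); split=> //.
have nR : 0 < n%:R :> R by rewrite ltr0n.
apply: (@DualWeights p q _ w0 sg p1 q1 pq _ fw fs w0pos spos).
- by rewrite mulr_gt0// exprn_gt0// mulr_gt0.
- move=> x; rewrite /sg -powRrM -powRB_mul//.
  have -> : p^-1 + - (q / p) * q^-1 = 0 by field; rewrite !gt_eqF.
  by rewrite powRr0.
- move=> a s s0; have [b /andP[b0 bs]] := bound a s s0.
  have bV : 0 <= b^-1 by rewrite invr_ge0 ltW.
  have X0 := ltW (vol_gt0 a fw w0pos s0); have Y0 := ltW (vol_gt0 a fs spos s0).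
  rewrite (volE a s fs) -(EFinM b^-1 (vol w0 a s)) -(EFinM b^-1 (vol sg a s)).
  rewrite 2!poweR_EFin -EFinM lee_fin !powRM// mulrACA -powRB_mul ?invr_gt0//.
  rewrite pq powRr1// mulrC ler_pdivrMr// => h; apply: (le_trans h).
  by rewrite -mulrA -exprMn ler_wpM2l ?(ltW A0)// -mulrA.
Qed.

End dual_weights.

(** * Sparse domination *)

Section dyadic_words.
Context (R : realType) (n : nat).
Local Notation E := 'rV[R]_n.
Local Notation mu := (leb R n).
Local Notation D := {ffun 'I_n -> bool}.
Implicit Types (x y : E) (t u v : seq D).
Context (a : E) (s : R).
Hypothesis s0 : 0 < s.

Local Notation Q := (dcube a s).
Definition dsize t : R := s / 2 ^+ size t.
Definition dtriple t : set E := triple (corner a s t) (dsize t).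

Lemma dsize_gt0 t : 0 < dsize t.
Proof. by rewrite divr_gt0// exprn_gt0. Qed.

Lemma dsize_cons e t : dsize (e :: t) = dsize t / 2.
Proof. by rewrite /dsize /= exprSr invfM mulrA. Qed.

Lemma dcubeE t : Q t = cube (corner a s t) (dsize t).
Proof. by []. Qed.

Lemma measurable_dcube t : measurable (Q t).
Proof. exact: measurable_cube. Qed.

Lemma measurable_dtriple t : measurable (dtriple t).
Proof. exact: measurable_triple. Qed.

Lemma leb_dcube t : mu (Q t) = (dsize t ^+ n)%:E.
Proof. by rewrite dcubeE leb_cube// ltW// dsize_gt0. Qed.

Lemma dcube_cons' e t : Q (e :: t) = cube (child (corner a s t) (dsize t) e) (dsize t / 2).
Proof. exact: dcube_cons. Qed.

Lemma dcube_cons_sub e t : Q (e :: t) `<=` Q t.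
Proof. by rewrite dcube_cons'; apply: child_sub; exact/ltW/dsize_gt0. Qed.

Lemma dcube_cat_sub u t : Q (u ++ t) `<=` Q t.
Proof. by elim: u => //= e u IH; apply: subset_trans IH; exact: dcube_cons_sub. Qed.

Lemma dtriple_cons_sub e t : dtriple (e :: t) `<=` dtriple t.
Proof.
by rewrite /dtriple dsize_cons; apply: triple_child; exact/ltW/dsize_gt0.
Qed.

Lemma dtriple_cat_sub u t : dtriple (u ++ t) `<=` dtriple t.
Proof. by elim: u => //= e u IH; apply: subset_trans IH; exact: dtriple_cons_sub. Qed.

Lemma dcube_sub_dtriple t : Q t `<=` dtriple t.
Proof. by apply: cube_sub_triple; exact/ltW/dsize_gt0. Qed.

(** The address of the dyadic cube of generation [N] that contains [x], by comparison with the
    midpoints. *)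
Fixpoint word (N : nat) x : seq D :=
  if N is N'.+1 then
    let t := word N' x in [ffun i => corner a s t ord0 i + dsize t / 2 <= x ord0 i] :: t
  else [::].

Lemma size_word N x : size (word N x) = N.
Proof. by elim: N => //= N ->. Qed.

Lemma mem_word N x : Q [::] x -> Q (word N x) x.
Proof.
move=> x0; elim: N => [//|N IH].
by rewrite /= dcube_cons'; exact: child_cover.
Qed.

Lemma word_unique t x : Q t x -> t = word (size t) x.
Proof.
elim: t => //= e t IH xt; have := IH (dcube_cons_sub xt) => et.
rewrite -et; congr (_ :: _).
move: (xt); rewrite dcube_cons' => xe.
by have := child_inj xe (child_cover (dcube_cons_sub xt)) => ->.
Qed.

Lemma dcube_root t : Q t `<=` Q [::].
Proof. by have := @dcube_cat_sub t [::]; rewrite cats0. Qed.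

Lemma word_leq M N x : (M <= N)%N -> exists u, word N x = u ++ word M x.
Proof.
move=> /subnK <-; elim: (N - M)%N => [|k [u hu]]; first by exists [::].
by rewrite addSn /= hu; eexists (_ :: u).
Qed.

Fixpoint words (N : nat) : seq (seq D) :=
  if N is N'.+1 then [seq e :: t | e <- enum {: D}, t <- words N'] else [:: [::]].

Lemma mem_words N t : (t \in words N) = (size t == N).
Proof.
elim: N t => [|N IH] t /=; first by rewrite inE; case: t.
apply/allpairsP/idP => [[[e u] /= [_ uN ->]]|]; first by rewrite /= eqSS -IH.
case: t => // e t; rewrite /= eqSS => tN; exists (e, t); split=> //=; last by rewrite IH.
by rewrite mem_enum.
Qed.

Lemma words_uniq N : uniq (words N).
Proof.
elim: N => //= N IH; apply: allpairs_uniq => //; first exact: enum_uniq.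
by move=> [e1 t1] [e2 t2] _ _ [-> ->].
Qed.

Definition words_le (N : nat) : seq (seq D) := flatten [seq words k | k <- iota 0 N.+1].

Lemma mem_words_le N t : (t \in words_le N) = (size t <= N)%N.
Proof.
apply/flattenP/idP => [[l /mapP[k]]|tN].
  by rewrite mem_iota add0n ltnS => /= kN -> ; rewrite mem_words => /eqP ->.
by exists (words (size t)); [apply: map_f; rewrite mem_iota add0n ltnS|rewrite mem_words].
Qed.

Lemma measurable_word_set N (P : seq D -> Prop) : measurable [set x | Q [::] x /\ P (word N x)].
Proof.
rewrite (_ : mkset _ = \big[setU/set0]_(t <- words N | `[< P t >]) Q t).
  by apply: bigsetU_measurable => t _; exact: measurable_dcube.
apply/seteqP; split => x.
  move=> [x0 Px]; rewrite -bigcup_seq_cond; exists (word N x); last exact: mem_word.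
  by rewrite /= mem_words size_word eqxx; apply/asboolP.
rewrite -bigcup_seq_cond => -[t /= /andP[tN /asboolP Pt] xt].
move: tN; rewrite mem_words => /eqP tN; have := word_unique xt; rewrite tN => <-.
by split=> //; exact: dcube_root xt.
Qed.

Lemma nint_dchildren t (f : E -> R) : nnm f ->
  \nint[mu]_(x in Q t) (f x) = (\sum_e \nint[mu]_(x in Q (e :: t)) (f x))%E.
Proof.
move=> nf; rewrite dcubeE nint_children ?(ltW (dsize_gt0 _))//.
by apply: eq_bigr => e _; rewrite dcube_cons'.
Qed.

Lemma measure_dchildren t (A : set E) : measurable A ->
  mu (A `&` Q t) = (\sum_e mu (A `&` Q (e :: t)))%E.
Proof.
move=> mA; have I B : measurable B -> mu (A `&` B) = \nint[mu]_(x in B) (\1_A x).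
  by move=> mB; rewrite integral_indic// .
rewrite I; last exact: measurable_dcube.
rewrite nint_dchildren//; apply: eq_bigr => e _; rewrite I//; exact: measurable_dcube.
Qed.

Lemma dist_dtriple t x y : Q t x -> ~ dtriple t y -> dsize t <= enorm (x - y).
Proof.
move=> xt; have := dsize_gt0 t; set r := dsize t => r0 yt.
have /existsNP[i yi] : ~ forall i, corner a s t ord0 i - r <= y ord0 i < corner a s t ord0 i + 2 * r.
  by move=> h; apply: yt; apply/tripleP.
have /andP[h1 h2] := xt i; apply: le_trans (coord_le_enorm (x - y) i); rewrite !mxE.
rewrite -/(dsize t) -/r in h2; move/negP: yi; rewrite negb_and -ltNge -leNgt => /orP[h|h].
  by rewrite ler_normr; apply/orP; left; lra.
by rewrite ler_normr; apply/orP; right; lra.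
Qed.

Lemma dtriple_near t x y : Q t x -> (forall i, `|x ord0 i - y ord0 i| <= dsize t) -> dtriple t y.
Proof.
move=> xt hy; apply/tripleP => i; have /andP[h1 h2] := xt i; have := hy i.
rewrite -/(dsize t) in h2; rewrite ler_norml => /andP[? ?]; apply/andP; split; lra.
Qed.

End dyadic_words.

Section sparse_domination.
Context (R : realType) (n : nat).
Local Notation E := 'rV[R]_n.
Local Notation C := R[i].
Local Notation mu := (leb R n).
Local Notation D := {ffun 'I_n -> bool}.
Local Notation cmeas f := (cmeasurable setT f).
Implicit Types (x y : E) (t u v : seq D) (f : E -> C).
Context (theta : R -> R) (K : E -> E -> C) (AK CW M0 : R) (S : (E -> C) -> (E -> C)).
Hypothesis hn : (0 < n)%N.
Hypothesis htheta : dini theta.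
Hypothesis M00 : 0 <= M0.
Hypothesis thetaM : forall N, \sum_(k < N) theta (2^-1 ^+ k.+1) <= M0.
Hypothesis AK0 : 0 < AK.
Hypothesis mK : cmeasurable setT (fun z : E * E => K z.1 z.2).
Hypothesis K1 : forall x y, x != y -> normc (K x y) <= AK * enorm (x - y) ^- n.
Hypothesis K2 : forall x y z, x != z -> enorm (x - z) < enorm (x - y) / 2 ->
  normc (K x y - K z y) + normc (K y x - K y z) <=
  AK * enorm (x - y) ^- n * theta (enorm (x - z) / enorm (x - y)).
Hypothesis CW0 : 0 <= CW.
Hypothesis wS : weak_op CW S.
Hypothesis S_repr : forall a s f, 0 < s -> in_Lp 1 f -> (forall y, ~ cube a s y -> f y = 0) ->
  {ae mu, forall x, (exists2 d, 0 < d & vanishes_near d x f) ->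
    S f x = cintegral setT (fun y => K x y * f y)}.
Context (a : E) (s : R) (F : E -> C) (h : E -> R).
Hypothesis s0 : 0 < s.
Hypothesis F1 : in_Lp 1 F.
Hypothesis nh : nnm h.
Hypothesis h0 : forall x, 0 < h x.
Hypothesis Fh : forall x, normc (F x) <= h x.

Local Notation Q := (dcube a s).
Local Notation T3 := (dtriple a s).
Local Notation ds := (@dsize R n s).
Local Notation word := (word a s).
Hypothesis hfin : (\nint[mu]_(x in T3 [::]) (h x) < +oo)%E.

Let ds0 t : 0 < ds t := dsize_gt0 s0 t.
Let mQ t : measurable (Q t) := measurable_dcube a s t.
Let mT t : measurable (T3 t) := measurable_dtriple a s t.

Definition tavg t : R := fine (\nint[mu]_(x in T3 t) (h x)) / (3 * ds t) ^+ n.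
(** The localization of F to the triple of a cube, written [F_t] in the comments. *)
Definition loc t : E -> C := fun x => F x * \1_(T3 t) x.

Lemma dtriple_root t : T3 t `<=` T3 [::].
Proof. by have := @dtriple_cat_sub R n a s s0 t [::]; rewrite cats0. Qed.

Lemma tavgE t : \nint[mu]_(x in T3 t) (h x) = (tavg t * (3 * ds t) ^+ n)%:E.
Proof.
have tf : (\nint[mu]_(x in T3 t) (h x) < +oo)%E.
  by apply: le_lt_trans hfin; apply: nint_sub => //; exact: dtriple_root.
have [J J0 JE] := nint_real nh tf.
by rewrite /tavg JE /= mulfVK// gt_eqF// exprn_gt0// mulr_gt0.
Qed.

Lemma tavg_gt0 t : 0 < tavg t.
Proof.
have p0 : 0 < (3 * ds t) ^+ n by rewrite exprn_gt0// mulr_gt0.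
rewrite -(pmulr_lgt0 _ p0) -lte_fin -tavgE; apply: nint_gt0 => //.
by rewrite leb_triple ?(ltW (ds0 t))// lte_fin.
Qed.

Lemma loc_L1 t : in_Lp 1 (loc t).
Proof. exact: in_L1_indic. Qed.

Lemma loc_le t : (\nint[mu]_(x in setT) (normc (loc t x)) <= (tavg t * (3 * ds t) ^+ n)%:E)%E.
Proof.
have /in_L1P[mF _] := F1; rewrite -tavgE.
have -> : \nint[mu]_(x in setT) (normc (loc t x)) = \nint[mu]_(x in T3 t) (normc (F x)).
  rewrite -[T3 t in RHS]setTI -nint_indic//; last exact: nnm_normc.
  by apply: eq_integral => x _; rewrite /loc normc_indic.
by apply: nint_le => //; exact: nnm_normc.
Qed.

(** Small enough for three uses: [2^n * 2 eta + eta < 1] yields a good point in a selected cube,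
    [2 eta <= 1/2] makes the always stopped points a null set, and the factor 2 between [eta] and
    [2 eta] leaves each selected cube half of its measure. *)
Definition eta : R := 2^-1 ^+ (n + 3).
(** Makes the stopping set occupy a proportion at most [eta] of its cube: [CW 3^n] is the
    contribution of the weak type of S, [3^n 3^n] that of the maximal inequality for Lebesgue
    measure. *)
Definition Cstop : R := 2 * (CW + 3 ^+ n) * 3 ^+ n / eta.

Lemma eta_gt0 : 0 < eta.
Proof. exact: half_expr_gt0. Qed.

Lemma Cstop_ge1 : 1 <= Cstop.
Proof.
have e0 := eta_gt0; rewrite /Cstop ler_pdivlMr// mul1r.
have h1 : eta <= 1 by exact: half_expr_le1.
have h3 : 1 <= 3 ^+ n :> R by rewrite exprn_ege1// ler1n.
have h2 : 1 <= 2 * (CW + 3 ^+ n) by have := CW0; lra.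
by apply: (le_trans h1); rewrite -[leLHS]mulr1; apply: ler_pM.
Qed.

Let A0 : 0 < Cstop := lt_le_trans ltr01 Cstop_ge1.

(* stop_set t is where S F_t, or the average of h over the triple of a smaller dyadic cube,
   exceeds Cstop times the average over the triple of t. *)
Definition stop_low t N : set E :=
  [set x | Q t x /\ (size t <= N)%N /\ Cstop * tavg t < tavg (word N x)].

Definition stop_set t : set E :=
  Q t `&` ([set x | Cstop * tavg t < normc (S (loc t) x)] `|` \bigcup_N stop_low t N).

Lemma measurable_stop_low t N : measurable (stop_low t N).
Proof.
rewrite (_ : stop_low t N = Q t `&`
    [set x | Q [::] x /\ ((size t <= N)%N /\ Cstop * tavg t < tavg (word N x))]).
  apply: measurableI => //; apply: (@measurable_word_set R n a s s0 N
    (fun w => (size t <= N)%N /\ Cstop * tavg t < tavg w)).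
apply/seteqP; split => x; first by move=> [xt h']; split=> //; split=> //; exact: dcube_root xt.
by move=> [xt [_ h']].
Qed.

Lemma measurable_S_loc t : measurable [set x | Cstop * tavg t < normc (S (loc t) x)].
Proof. by apply: measurable_normc_gt; have [_ mS _] := wS; apply: mS; exact: loc_L1. Qed.

Lemma measurable_stop_set t : measurable (stop_set t).
Proof.
apply: measurableI => //; apply: measurableU; first exact: measurable_S_loc.
by apply: bigcup_measurable => N _; exact: measurable_stop_low.
Qed.

Lemma measure_bigcup_bound (H : (set E)^nat) (c : \bar R) : (forall k, measurable (H k)) ->
  (forall k, (mu (\big[setU/set0]_(i < k) H i) <= c)%E) -> (mu (\bigcup_k H k) <= c)%E.
Proof.
move=> mH hc; pose B k := \big[setU/set0]_(i < k.+1) H i.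
have mB k : measurable (B k) by apply: bigsetU_measurable.
have ndB : nondecreasing_seq B.
  by move=> k l kl; apply/subsetPset; exact: subset_bigsetU.
have mU : measurable (\bigcup_k B k) by exact: bigcup_measurable.
rewrite -bigcup_bigsetU_bigcup -/B.
have cB := @nondecreasing_cvg_mu _ _ _ mu B mB mU ndB.
rewrite -(cvg_lim _ cB)//; apply: lime_le; first by apply/cvg_ex; exists (mu (\bigcup_k B k)).
by apply: nearW => k; exact: hc.
Qed.

Lemma doubling_one : doubling_wt (3 ^+ n) (fun _ : E => 1 : R).
Proof.
split; first split.
- by apply: nnm_cst.
- by move=> b r; rewrite nint_cst ?mul1e ?cube_lt_pinfty//; exact: measurable_cube.
- exact: exprn_ge0.
- move=> b r r0; rewrite /triple !nint_cst_cube ?mulr_ge0 ?(ltW r0)//.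
  by rewrite !mul1r -EFinM lee_fin exprMn.
Qed.

(** Weak type (1,1) of S applied to [F_t], and the maximal inequality applied to [h] on the triple
    of [t]; both compare with the average over that triple, of volume [3^n] times that of the
    cube. *)
Lemma stop_set_small t : (mu (stop_set t) <= (eta * ds t ^+ n)%:E)%E.
Proof.
have mt0 := tavg_gt0 t; have r0 := ds0 t; have e0 := eta_gt0.
have sn0 : 0 < ds t ^+ n by rewrite exprn_gt0.
have At0 : 0 < Cstop * tavg t by rewrite mulr_gt0.
have h1 : (mu [set x | (Cstop * tavg t < normc (S (loc t) x))%R] <=
    (CW * 3 ^+ n / Cstop * ds t ^+ n)%:E)%E.
  have [_ _ bS] := wS; rewrite -(@lee_pmul2l _ (Cstop * tavg t)%:E)// ?lte_fin//.
  apply: le_trans (bS _ _ (loc_L1 t) At0) _.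
  apply: (@le_trans _ _ (CW%:E * (tavg t * (3 * ds t) ^+ n)%:E)%E).
    by rewrite lee_wpmul2l ?lee_fin//; exact: loc_le.
  rewrite -!EFinM lee_fin exprMn le_eqVlt; apply/orP; left; apply/eqP.
  by field; rewrite gt_eqF.
have h2 : (mu (\bigcup_N stop_low t N) <= (3 ^+ n * 3 ^+ n / Cstop * ds t ^+ n)%:E)%E.
  apply: measure_bigcup_bound => [N|M]; first exact: measurable_stop_low.
  (* The triples of the descendants of [t] with large average, up to generation [M]: a finite
     family, as the covering lemma requires. *)
  pose l := [seq (\row_i (corner a s u ord0 i - ds u), 3 * ds u) | u <- words_le n M &
    `[< Cstop * tavg t < tavg u /\ exists r, u = r ++ t >] ].
  have lE : \big[setU/set0]_(i < M) stop_low t i `<=` cube_union l.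
    move=> x; rewrite -bigcup_mkord => -[N /= NM [xt [tN hN]]].
    have x0 := dcube_root s0 xt; have wN := mem_word N x0.
    exists (\row_i (corner a s (word N x) ord0 i - ds (word N x)), 3 * ds (word N x)).
      apply: map_f; rewrite mem_filter mem_words_le size_word (ltnW NM) andbT.
      apply/asboolP; split=> //; have [r hr] := word_leq a s x tN.
      by exists r; rewrite hr -(word_unique s0 xt).
    by have := dcube_sub_dtriple s0 wN.
  have mU := measurable_cube_union l.
  apply: (@le_trans _ _ (mu (cube_union l))).
    by apply: le_measure; rewrite ?inE//; apply: bigsetU_measurable => i _; exact: measurable_stop_low.
  have g0 : nnm (fun x => h x * \1_(T3 t) x) by apply: nnmM => //; exact: nnm_indic.
  have := @weak_maximal R n (3 ^+ n) (fun=> 1) (fun x => h x * \1_(T3 t) x)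
    (Cstop * tavg t) l doubling_one g0 (ltW At0) _.
  have hl c : c \in l -> 0 < c.2 /\ ((Cstop * tavg t)%:E * \nint[mu]_(x in cube c.1 c.2) 1 <=
      \nint[mu]_(x in cube c.1 c.2) (h x * \1_(T3 t) x * 1))%E.
    move=> /mapP[u]; rewrite mem_filter => /andP[/asboolP[hu [r ur]] _] ->.
    rewrite /= mulr_gt0//; split=> //.
    have -> : \nint[mu]_(x in T3 u) (h x * \1_(T3 t) x * 1) = \nint[mu]_(x in T3 u) (h x).
      apply: eq_integral => x; rewrite inE => xu; rewrite mulr1 indicE mem_set ?mulr1//.
      by move: xu; rewrite ur; exact: dtriple_cat_sub.
    have e1 : \nint[mu]_(x in cube (\row_i (corner a s u ord0 i - ds u)) (3 * ds u)) 1 =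
        ((3 * ds u) ^+ n)%:E by rewrite nint_cst_cube ?mul1r// mulr_ge0// ltW.
    rewrite tavgE e1 -EFinM lee_fin.
    by rewrite ler_wpM2r ?exprn_ge0 ?mulr_ge0 ?(ltW (ds0 u))// ltW.
  move=> /(_ hl); rewrite nint_cst// mul1e => hw.
  rewrite -(@lee_pmul2l _ (Cstop * tavg t)%:E)// ?lte_fin//; apply: (le_trans hw).
  apply: (@le_trans _ _ ((3 ^+ n)%:E * (tavg t * (3 * ds t) ^+ n)%:E)%E).
    rewrite lee_wpmul2l ?lee_fin ?exprn_ge0// -tavgE.
    under eq_integral do rewrite mulr1.
    by rewrite nint_indic//; apply: nint_sub => //; exact: measurableI.
  rewrite -!EFinM lee_fin [(3 * ds t) ^+ n]exprMn le_eqVlt; apply/orP; left; apply/eqP.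
  by field; rewrite gt_eqF.
apply: (@le_trans _ _ (mu [set x | (Cstop * tavg t < normc (S (loc t) x))%R] +
    mu (\bigcup_N stop_low t N))%E).
  have mS := measurable_S_loc t.
  have mL : measurable (\bigcup_N stop_low t N).
    by apply: bigcup_measurable => N _; exact: measurable_stop_low.
  apply: le_trans (measureU2 _ mS mL); apply: le_measure; rewrite ?inE; first exact: measurable_stop_set.
    exact: measurableU.
  by move=> x [].
apply: (le_trans (leeD h1 h2)); rewrite -EFinD lee_fin -mulrDl ler_wpM2r ?(ltW sn0)//.
rewrite -mulrDl -mulrDl ler_pdivrMr// /Cstop.
have -> : eta * (2 * (CW + 3 ^+ n) * 3 ^+ n / eta) = 2 * ((CW + 3 ^+ n) * 3 ^+ n).
  by field; rewrite gt_eqF.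
by rewrite ler_peMl ?ler1n// mulr_ge0 ?addr_ge0 ?exprn_ge0.
Qed.

(* The innermost selected cube containing t: a child is selected when the stopping set of
   the current selected cube fills a proportion 2 eta of it. *)
Fixpoint cur t : seq D :=
  if t is d :: t' then
    if `[< ((2 * eta)%:E * mu (Q (d :: t')) < mu (stop_set (cur t') `&` Q (d :: t')))%E >]
    then d :: t' else cur t'
  else [::].

Lemma cur_suffix t : exists r, t = r ++ cur t.
Proof.
elim: t => [|d t [r hr]]; first by exists [::].
rewrite /=; case: ifP => _; first by exists [::].
by exists (d :: r); rewrite {1}hr.
Qed.

Lemma cur_cases d t : cur (d :: t) = d :: t \/ cur (d :: t) = cur t.
Proof. by rewrite /=; case: ifP => _; [left|right]. Qed.

Lemma stop_set_small_self t : (mu (stop_set t `&` Q t) <= (2 * eta)%:E * mu (Q t))%E.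
Proof.
apply: (@le_trans _ _ (mu (stop_set t))).
  by apply: le_measure; rewrite ?inE; [apply: measurableI => //; exact: measurable_stop_set|exact: measurable_stop_set|exact: subIsetl].
apply: (le_trans (stop_set_small t)); rewrite leb_dcube// -EFinM lee_fin.
rewrite ler_wpM2r ?exprn_ge0 ?(ltW (ds0 t))//; have := eta_gt0; lra.
Qed.

(** A cube that is not selected has failed the test against the current one; a selected cube has
    become the current one, and its stopping set is small by [stop_set_small]. *)
Lemma cur_small t : (mu (stop_set (cur t) `&` Q t) <= (2 * eta)%:E * mu (Q t))%E.
Proof.
case: t => [|d t]; first exact: stop_set_small_self.
rewrite /=; case: asboolP => [_|/negP]; first exact: stop_set_small_self.
by rewrite -leNgt.
Qed.

Lemma measurable_word_family N (H : seq D -> set E) : (forall t, measurable (H t)) ->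
  measurable [set x | Q [::] x /\ H (word N x) x].
Proof.
move=> mH; rewrite (_ : mkset _ = \big[setU/set0]_(t <- words n N) (Q t `&` H t)).
  by apply: bigsetU_measurable => t _; exact: measurableI.
apply/seteqP; split => x.
  move=> [x0 Hx]; rewrite -bigcup_seq; exists (word N x); first by rewrite /= mem_words size_word.
  by split=> //; exact: mem_word.
rewrite -bigcup_seq => -[t /=]; rewrite mem_words => /eqP tN [xt Hx].
have := word_unique s0 xt; rewrite tN => <-; split=> //; exact: dcube_root xt.
Qed.

(** The points stopped at all generations form a set of density at most [2 eta <= 1/2] in every
    dyadic cube, hence a null set by [thin_null]. *)
Lemma ae_unstopped : {ae mu, forall x, Q [::] x -> exists N, ~ stop_set (cur (word N x)) x}.
Proof.
pose Z := \bigcap_N [set x | Q [::] x /\ stop_set (cur (word N x)) x].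
have mZ : measurable Z.
  apply: bigcapT_measurable => N.
  by apply: (@measurable_word_family N (fun t => stop_set (cur t))) => t; exact: measurable_stop_set.
have ZQ : Z `<=` cube a s.
  by move=> x /(_ 0%N I)[+ _]; rewrite dcube_nil.
have Z0 : mu Z = 0%E.
  apply: (thin_null (ltW s0) mZ ZQ) => t _.
  apply: (@le_trans _ _ (mu (stop_set (cur t) `&` Q t))).
    apply: le_measure; rewrite ?inE; [exact: measurableI|apply: measurableI => //; exact: measurable_stop_set|].
    move=> x [/(_ (size t) I)[_ hx] xt]; split=> //.
    by move: hx; rewrite -(word_unique s0 xt).
  apply: (le_trans (cur_small t)); apply: lee_wpmul2r => //.
  rewrite lee_fin /eta addnC addSn exprS.
  by have := half_expr_le1 R (2 + n); rewrite addSn exprS; have := half_expr_le1 R (1 + n); lra.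
exists Z; split=> // x /= hx N _; apply: contrapT => hN; apply: hx => x0.
by exists N => hs; apply: hN.
Qed.

(* For 2 q >= 1 the smoothness condition says nothing: the size condition bounds both
   values of the kernel. *)
Definition ring_coef (q : R) : R := if 2 * q < 1 then theta q else 2.

(** Both points are at distance at least the side [r] of the inner cube from the ring, and the outer
    triple has volume [(6 r)^n]: the size or smoothness bound of the kernel times the integral of
    [h] gives an average times [6^n]. *)
Lemma ring_bound e v x x' rho M : Q (e :: v) x -> Q (e :: v) x' -> 0 < rho ->
  enorm (x - x') <= rho -> tavg v <= M ->
  (\nint[mu]_(y in T3 v `\` T3 (e :: v)) (normc ((K x y - K x' y) * F y)) <=
   (AK * 6 ^+ n * ring_coef (rho / ds (e :: v)) * M)%:E)%E.
Proof.
move=> xv x'v rho0 xx' vM; have r0 := ds0 (e :: v); set r := ds (e :: v) in r0 *.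
have [th0 thm _] := htheta; have /in_L1P[mF _] := F1.
have q0 : 0 < rho / r by rewrite divr_gt0.
have c0 : 0 <= ring_coef (rho / r) by rewrite /ring_coef; case: ifP => // _; exact: th0.
have rV : 0 <= r ^- n by rewrite invr_ge0 exprn_ge0// ltW.
have B0 : 0 <= AK * r ^- n * ring_coef (rho / r) by rewrite !mulr_ge0// ltW.
have mTT : measurable (T3 v `\` T3 (e :: v)) by exact: measurableD.
have dV d : r <= d -> d ^- n <= r ^- n.
  move=> rd; have d0 := lt_le_trans r0 rd.
  rewrite lef_pV2 ?posrE ?exprn_gt0//.
  by apply: lerXn2r => //; rewrite nnegrE ltW.
have pt y : ~ T3 (e :: v) y -> normc (K x y - K x' y) <= AK * r ^- n * ring_coef (rho / r).
  move=> yv; have d1 := dist_dtriple s0 xv yv; have d2 := dist_dtriple s0 x'v yv.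
  rewrite -/r in d1 d2; rewrite /ring_coef; case: ifP => hq; last first.
    apply: le_trans (normc_sub _ _) _.
    have k1 := kernel_bound AK0 K1 r0 d1; have k2 := kernel_bound AK0 K1 r0 d2; lra.
  have [->|xx] := eqVneq x x'; first by rewrite subrr normc0 mulr_ge0 ?th0// mulr_ge0// ltW.
  have xx0 := enorm_gt0 xx; have xy0 := lt_le_trans r0 d1.
  have hr : 2 * rho < r by move: hq; rewrite mulrA ltr_pdivrMr// mul1r.
  have hd : enorm (x - x') < enorm (x - y) / 2 by lra.
  apply: (@le_trans _ _ (AK * enorm (x - y) ^- n * theta (enorm (x - x') / enorm (x - y)))).
    by apply: le_trans (K2 xx hd); rewrite lerDl normc_ge0.
  apply: ler_pM.
  - by rewrite mulr_ge0 ?invr_ge0 ?exprn_ge0 ?enorm_ge0// ltW.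
  - by rewrite th0// divr_gt0.
  - by rewrite ler_wpM2l ?(ltW AK0)// dV.
  - apply: thm; first by rewrite divr_gt0.
    apply: ler_pM; rewrite ?enorm_ge0 ?invr_ge0 ?enorm_ge0//.
    by rewrite lef_pV2 ?posrE.
apply: (@le_trans _ _ ((AK * r ^- n * ring_coef (rho / r))%:E * \nint[mu]_(y in T3 v) (h y))%E).
  rewrite -nintZ//; apply: (@le_trans _ _
      (\nint[mu]_(y in T3 v `\` T3 (e :: v)) (AK * r ^- n * ring_coef (rho / r) * h y))%E).
    apply: nint_le => //; last 2 first.
    - exact: nnmZ.
    - move=> y [_ yv]; rewrite normcM; apply: ler_pM; rewrite ?normc_ge0//; exact: pt.
    apply: nnm_normc; apply: cmeasM => //.
    by apply: cmeasB; exact: cmeas_kernel_r.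
  by apply: nint_sub => //; first [exact: subDsetl|exact: nnmZ].
rewrite tavgE -EFinM lee_fin.
have -> : 3 * ds v = 6 * r by rewrite /r dsize_cons; field.
rewrite [(6 * r) ^+ n]exprMn.
have -> : AK * r ^- n * ring_coef (rho / r) * (tavg v * (6 ^+ n * r ^+ n)) =
    AK * 6 ^+ n * ring_coef (rho / r) * tavg v.
  by field; rewrite gt_eqF// exprn_gt0.
by rewrite ler_wpM2l// !mulr_ge0 ?exprn_ge0// ltW.
Qed.

(** The difference of the two triples is cut into the rings between consecutive cubes of the branch;
    halving the side doubles the ratio of [rho] to it. *)
Lemma rings_bound r t x x' rho M : Q (r ++ t) x -> Q (r ++ t) x' -> 0 < rho ->
  enorm (x - x') <= rho -> (forall r1 r2, r = r1 ++ r2 -> tavg (r2 ++ t) <= M) ->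
  (\nint[mu]_(y in T3 t `\` T3 (r ++ t)) (normc ((K x y - K x' y) * F y)) <=
   (AK * 6 ^+ n * (\sum_(i < size r) ring_coef (rho * 2 ^+ i.+1 / ds t)) * M)%:E)%E.
Proof.
elim: r => [|e r IH] xr x'r rho0 xx' hM.
  by rewrite setDv integral_set0 big_ord0 mulr0 mul0r.
have /in_L1P[mF _] := F1.
have nK : nnm (fun y => normc ((K x y - K x' y) * F y)).
  by apply: nnm_normc; apply: cmeasM => //; apply: cmeasB; exact: cmeas_kernel_r.
apply: (@le_trans _ _ (\nint[mu]_(y in (T3 t `\` T3 (r ++ t)) `|` (T3 (r ++ t) `\` T3 (e :: r ++ t)))
    (normc ((K x y - K x' y) * F y)))%E).
  apply: nint_sub => //.
  - exact: measurableD.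
  - by apply: measurableU; exact: measurableD.
  - move=> y [yt yr]; have [yr'|yr'] := pselect (T3 (r ++ t) y); [by right|by left].
apply: le_trans (nint_setU_le _ _ nK) _; [exact: measurableD|exact: measurableD|].
have h1 := IH (dcube_cons_sub s0 xr) (dcube_cons_sub s0 x'r) rho0 xx'
  (fun r1 r2 e' => hM (e :: r1) r2 (congr1 (cons e) e')).
have h2 := ring_bound xr x'r rho0 xx' (hM [:: e] r erefl).
apply: (le_trans (leeD h1 h2)); rewrite -EFinD lee_fin big_ord_recr /=.
have -> : rho / ds (e :: r ++ t) = rho * 2 ^+ (size r).+1 / ds t.
  rewrite /dsize /= size_cat -addSn exprD.
  by field; rewrite ?expf_neq0 ?gt_eqF.
rewrite le_eqVlt; apply/orP; left; apply/eqP; ring.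
Qed.

(** The ratios met are [n 2^-k]. The first [n + 1] coefficients are at most 2 or [theta (1/2)],
    hence at most [2 + M0]; the other ratios are below [2^-(k+1)] after reindexing, and are summed
    by the Dini condition. *)
Definition Cring : R := (n.+1)%:R * (2 + M0) + M0.

Lemma Cring_ge0 : 0 <= Cring.
Proof. by rewrite /Cring addr_ge0// mulr_ge0// addr_ge0. Qed.

Lemma ring_sum L : \sum_(k < L) ring_coef (n%:R * 2^-1 ^+ k) <= Cring.
Proof.
have [th0 thm _] := htheta; have nR : 0 < n%:R :> R by rewrite ltr0n.
have p0 k : 0 < n%:R * (2^-1 : R) ^+ k by apply: mulr_gt0 => //; exact: half_expr_gt0.
have rc0 k : 0 <= ring_coef (n%:R * 2^-1 ^+ k).
  by rewrite /ring_coef; case: ifP => // _; exact: th0.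
have thM1 : theta 2^-1 <= M0.
  by have := thetaM 1; rewrite big_ord1.
apply: (@le_trans _ _ (\sum_(k < n.+1 + L) ring_coef (n%:R * 2^-1 ^+ k))).
  rewrite (big_ord_widen (n.+1 + L) (fun k => ring_coef (n%:R * 2^-1 ^+ k))) ?leq_addl//.
  rewrite [leRHS](bigID (fun i : 'I_(n.+1 + L) => (i < L)%N)) /= lerDl.
  exact: sumr_ge0.
rewrite big_split_ord /= /Cring; apply: lerD.
  apply: (@le_trans _ _ (\sum_(i < n.+1) (2 + M0))); last first.
    have -> : \sum_(i < n.+1) (2 + M0) = n.+1%:R * (2 + M0) by rewrite sumr_const card_ord mulr_natl.
    exact: lexx.
  apply: ler_sum => k _; rewrite /ring_coef; case: ifP => hk; last by rewrite lerDl.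
  apply: (@le_trans _ _ M0); last by rewrite lerDr.
  by apply: le_trans thM1; apply: thm => //; lra.
apply: le_trans (thetaM L); apply: ler_sum => k _.
(* This is [n < 2^n]. *)
have hk : n%:R * 2^-1 ^+ (n.+1 + k) < 2^-1 ^+ k.+1 :> R.
  rewrite addSnnS exprD mulrA gtr_pMl ?half_expr_gt0//.
  by rewrite exprVn ltr_pdivrMr ?exprn_gt0// mul1r -natrX ltr_nat ltn_expl.
rewrite /ring_coef; case: ifP => [_|]; first exact/thm/ltW.
move/negbT; rewrite -leNgt => h2; have h3 := half_expr_le1 R k.
by rewrite exprS in hk; have h4 := half_expr_gt0 R k; lra.
Qed.

Definition Cosc : R := AK * 6 ^+ n * Cring.

Lemma Cosc_ge0 : 0 <= Cosc.
Proof. by rewrite /Cosc !mulr_ge0 ?exprn_ge0 ?Cring_ge0// ltW. Qed.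

(** [F_t - F_u], with [u] the smaller cube, lives on the rings between the two triples. Two points
    of the smaller cube are at distance at most [n] times its side, so the coefficients of the rings
    add up to at most [Cring]. *)
Lemma oscillation r t x x' M : Q (r ++ t) x -> Q (r ++ t) x' ->
  (forall r1 r2, r = r1 ++ r2 -> tavg (r2 ++ t) <= M) ->
  (\nint[mu]_(y in setT) (normc ((K x y - K x' y) * (loc t y - loc (r ++ t) y))) <=
   (Cosc * M)%:E)%E.
Proof.
move=> xr x'r hM; have r0 := ds0 (r ++ t).
have nR : 0 < n%:R :> R by rewrite ltr0n.
have M1 : 0 <= M by apply: le_trans (hM r [::] _); [exact/ltW/tavg_gt0|rewrite cats0].
have rho0 : 0 < n%:R * ds (r ++ t) by rewrite mulr_gt0.
have := rings_bound xr x'r rho0 (enorm_cube_le xr x'r) hM.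
have /in_L1P[mF _] := F1; have /in_L1P[ml _] := loc_L1 t; have /in_L1P[mr _] := loc_L1 (r ++ t).
have mKK : cmeas (fun y => K x y - K x' y) by apply: cmeasB; exact: cmeas_kernel_r.
have e y : loc t y - loc (r ++ t) y = F y * \1_(T3 t `\` T3 (r ++ t)) y.
  rewrite /loc !indicE; have [yr|yr] := pselect (T3 (r ++ t) y).
    rewrite (mem_set (dtriple_cat_sub s0 yr)) (mem_set yr) memNset ?mulr0 ?subrr//.
    by case.
  rewrite (memNset yr) mulr0 subr0; have [yt|yt] := pselect (T3 t y); first by rewrite !mem_set.
  by rewrite !memNset// => -[].
have -> : \nint[mu]_(y in setT) (normc ((K x y - K x' y) * (loc t y - loc (r ++ t) y))) =
    \nint[mu]_(y in T3 t `\` T3 (r ++ t)) (normc ((K x y - K x' y) * F y)).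
  rewrite -[T3 t `\` _ in RHS]setTI -nint_indic//; last 2 first.
  - exact: measurableD.
  - by apply: nnm_normc; exact: cmeasM.
  apply: eq_integral => y _; rewrite e mulrA; congr EFin.
  exact: (normc_indic (fun y => (K x y - K x' y) * F y)).
move=> hb; apply: (le_trans hb); rewrite lee_fin /Cosc.
rewrite ler_wpM2r// ler_wpM2l ?mulr_ge0 ?exprn_ge0 ?(ltW AK0)//.
apply: le_trans (ring_sum (size r)); rewrite le_eqVlt; apply/orP; left; apply/eqP.
rewrite (reindex_inj rev_ord_inj) /=; apply: eq_bigr => k _; congr ring_coef.
have kr : (size r = size r - k + k)%N by rewrite subnK// ltnW.
rewrite /dsize size_cat subnSK// exprD exprVn {1}kr exprD.
by field; rewrite ?expf_neq0 ?gt_eqF.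
Qed.

Lemma stop_avoid t u x : Q u x -> ~ stop_set t x -> (size t <= size u)%N -> Q t x ->
  tavg u <= Cstop * tavg t.
Proof.
move=> xu xt tu xQ; rewrite leNgt; apply/negP => h1; apply: xt; split=> //; right.
by exists (size u) => //; split=> //; split=> //; rewrite -(word_unique s0 xu).
Qed.

(** At the comparison point, [Cstop] bounds the image of [F_t] and its square that of the smaller
    localization; the last term is the oscillation of the kernel from that point to the given
    one. *)
Definition Cdom : R := Cstop + Cstop * Cstop + 2 * (Cosc * Cstop).

Lemma Cdom_ge : Cstop <= Cdom.
Proof.
have c0 := ltW A0; rewrite /Cdom -addrA lerDl addr_ge0//; first exact: mulr_ge0.
by apply: mulr_ge0 => //; apply: mulr_ge0 => //; exact: Cosc_ge0.
Qed.

Lemma loc_out t y : ~ T3 t y -> loc t y = 0.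
Proof. by move=> h'; rewrite /loc indicE memNset// mulr0. Qed.

Lemma loc_diff_near r t x : Q (r ++ t) x ->
  vanishes_near (ds (r ++ t)) x (fun y => -1 * loc (r ++ t) y + loc t y).
Proof.
move=> xr y hy; have yr := dtriple_near xr hy.
by rewrite /loc !indicE !mem_set//; [ring|exact: dtriple_cat_sub s0 r t y yr].
Qed.

(** On the new selected cube [u] the difference of the images of [F_t] and [F_u] is a kernel
    integral, because [F_t - F_u] vanishes near each point of it. That integral is bounded at one
    point outside both stopping sets, and varies little over the cube by [oscillation]. *)
Lemma stop_transfer e v : cur (e :: v) = e :: v ->
  {ae mu, forall x, Q (e :: v) x ->
    normc (S (loc (cur v)) x) <= normc (S (loc (e :: v)) x) + Cdom * tavg (cur v)}.
Proof.
move=> uu; set t := cur v; set u := e :: v; have [r vr] := cur_suffix v.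
have ur : u = (e :: r) ++ t by rewrite /u {1}vr.
have [lin mS _] := wS; have r0 := ds0 u; have e0 := eta_gt0.
pose g y := -1 * loc u y + loc t y.
pose I x := cintegral setT (fun y => K x y * g y).
have g1 : in_Lp 1 g by apply: in_L1_lin; exact: loc_L1.
have gnear x : Q u x -> vanishes_near (ds u) x g.
  by rewrite /g ur; exact: loc_diff_near.
have hI : {ae mu, forall x, Q u x -> S (loc t) x - S (loc u) x = I x}.
  have hs : 0 < 3 * s by rewrite mulr_gt0.
  have g0 y : ~ cube (\row_i (a ord0 i - s)) (3 * s) y -> g y = 0.
    move=> hy; have hy' : ~ T3 [::] y by rewrite /dtriple /triple /dsize/= expr0 invr1 mulr1.
    rewrite /g !loc_out; [by rewrite mulr0 addr0| |]; by move=> /dtriple_root.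
  apply: filterS2 (lin (-1) _ _ (loc_L1 u) (loc_L1 t)) (S_repr hs g1 g0) => x h1 h2 xu.
  rewrite -/(I x) in h2; rewrite -h2; last by exists (ds u) => //; exact: gnear.
  by rewrite /g h1 mulN1r addrC.
have tu : (size t <= size u)%N by rewrite ur size_cat leq_addl.
have uQt x : Q u x -> Q t x by rewrite ur; exact: dcube_cat_sub.
(* Otherwise the two stopping sets would cover [Q u] up to a null set. The one of [t] fills at most
   [2 eta] of the parent, that is [2^n * 2 eta = 1/4] of [Q u], and the one of [u] at most [eta]. *)
have [x' [x'u x't x'us x'I]] : exists x', [/\ Q u x', ~ stop_set t x', ~ stop_set u x' &
    S (loc t) x' - S (loc u) x' = I x'].
  apply: contrapT => hno.
  have ms1 := measurable_stop_set t; have ms2 := measurable_stop_set u.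
  have : (mu (Q u) <= mu (stop_set t `&` Q v) + mu (stop_set u))%E.
    have m1 : measurable (stop_set t `&` Q v) by exact: measurableI.
    apply: le_trans (measureU2 _ m1 ms2); apply: ae_le_measure => //; first exact: measurableU.
    apply: filterS hI => x hx xu; apply: contrapT => xn; apply: hno; exists x; split=> //; last exact: hx.
      by move=> xt; apply: xn; left; split=> //; exact: dcube_cons_sub xu.
    by move=> xt; apply: xn; right.
  apply/negP; rewrite -ltNge.
  apply: (@le_lt_trans _ _ ((2 * eta)%:E * mu (Q v) + (eta * ds u ^+ n)%:E)%E).
    by apply: leeD; [exact: cur_small|exact: stop_set_small].
  rewrite !leb_dcube// -EFinM -EFinD lte_fin -/(ds u) -/(ds v).
  have -> : ds v = 2 * ds u by rewrite /u dsize_cons; field.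
  rewrite exprMn mulrA -mulrDl gtr_pMl ?exprn_gt0//.
  have -> : 2 * eta * 2 ^+ n = 2^-1 ^+ 2.
    rewrite /eta exprD !exprVn; field; by rewrite expf_neq0.
  have : eta <= 2^-1 ^+ 1.
    rewrite /eta addnC exprD expr1 (exprS _ 2) -mulrA ler_piMr//.
    by rewrite -exprD; exact: half_expr_le1.
  rewrite !expr2 expr1; lra.
(* All cubes from [u] up to [t] contain [x'], which avoids the stopping set of [t]: their averages
   are at most [Cstop] times that of [t]. *)
have hM r1 r2 : e :: r = r1 ++ r2 -> tavg (r2 ++ t) <= Cstop * tavg t.
  move=> er; apply: (@stop_avoid t (r2 ++ t) x') => //; last exact: uQt.
    by move: x'u; rewrite ur er -catA; exact: dcube_cat_sub.
  by rewrite size_cat leq_addl.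
have c0 := ltW A0; have t0 := ltW (tavg_gt0 t).
have notS w : Q w x' -> ~ stop_set w x' -> normc (S (loc w) x') <= Cstop * tavg w.
  by move=> xw h1; rewrite leNgt; apply/negP => h2; apply: h1; split=> //; left.
apply: filterS hI => x xI xu.
have hx y : ds u <= enorm (x - y) \/ g y = 0 by apply: vanishes_dist; exact: gnear.
have hx' y : ds u <= enorm (x' - y) \/ g y = 0 by apply: vanishes_dist; exact: gnear.
have [i1 _] := kernel_fin AK0 mK K1 r0 g1 hx.
have [i2 _] := kernel_fin AK0 mK K1 r0 g1 hx'.
have II : I x = cintegral setT (fun y => (K x y - K x' y) * (loc t y - loc u y)) + I x'.
  have := cintegral_lin (-1) measurableT i2 i1; rewrite mulN1r -/(I x') -/(I x) => h1.
  have -> : I x = (- I x' + I x) + I x' by ring.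
  rewrite -h1; congr (_ + _); congr cintegral; apply/funext => y; rewrite /g; ring.
have osc : normc (cintegral setT (fun y => (K x y - K x' y) * (loc t y - loc u y))) <=
    2 * (Cosc * (Cstop * tavg t)).
  have /in_L1P[ml _] := loc_L1 t; have /in_L1P[mr _] := loc_L1 u.
  rewrite -lee_fin EFinM; apply: le_trans (normc_cintegral_le _ _) _ => //.
    by apply: cmeasM; apply: cmeasB => //; exact: cmeas_kernel_r.
  rewrite lee_pmul2l ?lte_fin//; move: x'u xu; rewrite ur => x'u xu.
  exact: oscillation.
have h1 : normc (I x') <= Cstop * tavg t + Cstop * (Cstop * tavg t).
  rewrite -x'I; apply: le_trans (normc_sub _ _) _; apply: lerD.
    by apply: notS => //; exact: uQt.
  apply: le_trans (notS u x'u x'us) _; rewrite ler_wpM2l//.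
  exact: (stop_avoid x'u x't tu (uQt _ x'u)).
have -> : S (loc t) x = S (loc u) x + I x by rewrite -xI//; ring.
apply: le_trans (normc_triangle _ _) _; rewrite lerD2l II; apply: le_trans (normc_triangle _ _) _.
rewrite /Cdom; lra.
Qed.

Fixpoint stops N : seq (seq D) :=
  if N is M.+1 then stops M ++ [seq t <- words n N | cur t == t] else [:: [::]].

Lemma stopsS N : stops N.+1 = stops N ++ [seq t <- words n N.+1 | cur t == t].
Proof. by []. Qed.

Lemma mem_stops N t : (t \in stops N) = (size t <= N)%N && (cur t == t).
Proof.
elim: N t => [|N IH] t; first by case: t => //=; rewrite inE.
rewrite stopsS mem_cat IH mem_filter mem_words [in RHS]leq_eqVlt ltnS.
by rewrite [in LHS]orbC [X in X || _]andbC -andb_orl.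
Qed.

Lemma stops_uniq N : uniq (stops N).
Proof.
elim: N => // N IH; rewrite stopsS cat_uniq IH filter_uniq ?words_uniq// andbT.
apply/hasPn => t; rewrite mem_filter mem_words mem_stops => /andP[_ /eqP ->].
by rewrite ltnn.
Qed.

Definition sparse_sum N x : R := \sum_(t <- stops N) tavg t * \1_(Q t) x.

Lemma sparse_term_ge0 t x : 0 <= tavg t * \1_(Q t) x.
Proof. by rewrite mulr_ge0 ?indicE// ltW ?tavg_gt0. Qed.

Lemma sparse_sumS N x : sparse_sum N x <= sparse_sum N.+1 x.
Proof.
by rewrite /sparse_sum stopsS big_cat lerDl; apply: sumr_ge0 => t _; exact: sparse_term_ge0.
Qed.

(** [stop_transfer] is telescoped along the branch of [x]. The sum already counts the current cube,
    whose average is charged only at the next selection: the left-hand side carries this pending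
    term. *)
Lemma sparse_chain N : {ae mu, forall x, Q [::] x ->
  normc (S (loc [::]) x) + Cdom * tavg (cur (word N x)) <=
  normc (S (loc (cur (word N x))) x) + Cdom * sparse_sum N x}.
Proof.
have A10 : 0 <= Cdom by apply: le_trans Cdom_ge; exact: ltW.
elim: N => [|N IH].
  apply: aeW => x x0; rewrite /sparse_sum /= big_seq1 indicE mem_set// mulr1.
  exact: lexx.
have tr : {ae mu, forall x, forall e v, cur (e :: v) = e :: v -> Q (e :: v) x ->
    normc (S (loc (cur v)) x) <= normc (S (loc (e :: v)) x) + Cdom * tavg (cur v)}.
  (* There are countably many words, so the exceptional null sets of all transfers can be united
     through an enumeration. *)
  have : {ae mu, forall x, forall k, forall e v, unpickle k = Some (e, v) -> cur (e :: v) = e :: v ->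
      Q (e :: v) x -> normc (S (loc (cur v)) x) <= normc (S (loc (e :: v)) x) + Cdom * tavg (cur v)}.
    apply/ae_foralln => k; case E : (@unpickle (D * seq D)%type k) => [[e v]|]; last exact: aeW.
    have [uu|uu] := eqVneq (cur (e :: v)) (e :: v).
      by apply: filterS (stop_transfer uu) => x hx e' v' [<- <-] _.
    by apply: aeW => x e' v' [<- <-] /eqP; rewrite (negPf uu).
  by apply: filterS => x hx e v; apply: (hx (pickle (e, v))); exact: pickleK.
apply: filterS2 IH tr => x IH tr x0.
have := mem_word N.+1 x0; have [e ew] : exists e, word N.+1 x = e :: word N x by eexists.
rewrite ew => xw; have {}IH := IH x0.
have sS := sparse_sumS N x.
have [ec|ec] := cur_cases e (word N x); last first.
  rewrite ec; apply: (le_trans IH); rewrite lerD2l; exact: ler_wpM2l.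
rewrite ec; have h1 := tr _ _ ec xw.
have h2 : sparse_sum N x + tavg (e :: word N x) <= sparse_sum N.+1 x.
  rewrite /sparse_sum stopsS big_cat lerD2l.
  have ul : uniq [seq t <- words n N.+1 | cur t == t] by rewrite filter_uniq// words_uniq.
  have il : e :: word N x \in [seq t <- words n N.+1 | cur t == t].
    by rewrite mem_filter ec eqxx mem_words /= size_word.
  rewrite (bigD1_seq _ il ul) /= indicE mem_set// mulr1 lerDl.
  by apply: sumr_ge0 => t _; exact: sparse_term_ge0.
have h3 : Cdom * (sparse_sum N x + tavg (e :: word N x)) <= Cdom * sparse_sum N.+1 x by exact: ler_wpM2l.
lra.
Qed.

(** At a generation where [x] is outside the stopping set of its current cube, the image of the
    current localization is at most [Cstop] times the average, which the pending term of
    [sparse_chain] absorbs. *)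
Lemma sparse_domination : {ae mu, forall x, Q [::] x ->
  exists N, normc (S (loc [::]) x) <= Cdom * sparse_sum N x}.
Proof.
have ch : {ae mu, forall x, forall N, Q [::] x ->
    normc (S (loc [::]) x) + Cdom * tavg (cur (word N x)) <=
    normc (S (loc (cur (word N x))) x) + Cdom * sparse_sum N x}.
  by apply/ae_foralln => N; exact: sparse_chain.
apply: filterS2 ch ae_unstopped => x ch us x0; have [N hN] := us x0; exists N.
have h1 := ch N x0; set t := cur (word N x) in h1 hN *.
have h2 : normc (S (loc t) x) <= Cstop * tavg t.
  rewrite leNgt; apply/negP => h2; apply: hN; split; last by left.
  have := mem_word N x0; have [r hr] := cur_suffix (word N x).
  by rewrite {1}hr; exact: dcube_cat_sub.
have h3 : Cstop * tavg t <= Cdom * tavg t by rewrite ler_wpM2r ?Cdom_ge// ltW// tavg_gt0.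
lra.
Qed.

(* The points whose innermost selected cube of generation at most N is t. *)
Definition part N t : set E := [set x | Q [::] x /\ cur (word N x) = t].

Lemma measurable_part N t : measurable (part N t).
Proof. exact: (@measurable_word_set R n a s s0 N (fun u => cur u = t)). Qed.

Lemma part_sub N t : part N t `<=` Q t.
Proof.
move=> x [x0 hx]; have := mem_word N x0; have [r hr] := cur_suffix (word N x).
by rewrite hr hx; exact: dcube_cat_sub.
Qed.

(** Induction on the number of remaining generations. A child that is selected may be lost entirely,
    but then the stopping set fills more than [2 eta] of it; the induction hypothesis treats the
    other children. *)
Lemma part_loss N k v : (size v + k = N)%N ->
  ((2 * eta)%:E * mu (~` part N (cur v) `&` Q v) <= mu (stop_set (cur v) `&` Q v))%E.
Proof.
have e2 : 0 <= 2 * eta by rewrite mulr_ge0// ltW// eta_gt0.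
elim: k v => [|k IH] v vN.
  rewrite [X in (_ * mu X)%E](_ : _ = set0) ?measure0 ?mule0//.
  apply/seteqP; split => // x [hx xv]; apply: hx; split; first exact: dcube_root xv.
  by rewrite -vN addn0 -(word_unique s0 xv).
rewrite !measure_dchildren//; [|exact: measurable_stop_set|by apply: measurableC; exact: measurable_part].
rewrite ge0_sume_distrr//; apply: lee_sum => d _.
have := IH (d :: v); rewrite /= addSnnS => /(_ vN).
case: asboolP => [h1 _|_ //]; apply: le_trans (ltW h1); apply: lee_wpmul2l; first by rewrite lee_fin.
have mm : measurable (~` part N (cur v) `&` Q (d :: v)).
  by apply: measurableI => //; apply: measurableC; exact: measurable_part.
by apply: le_measure; rewrite ?inE//; exact: subIsetr.
Qed.

(** The stopping set has measure at most [eta] times that of its cube, so by [part_loss] at most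
    half of the cube is lost. *)
Lemma part_large N t : t \in stops N -> ((2^-1 * ds t ^+ n)%:E <= mu (part N t))%E.
Proof.
rewrite mem_stops => /andP[tN /eqP tt]; have e0 := eta_gt0.
have := @part_loss N (N - size t) t; rewrite subnKC// tt => /(_ erefl) h1.
have mP := measurable_part N t.
have mPC : measurable (~` part N t `&` Q t) by apply: measurableI => //; exact: measurableC.
have h2 : (mu (stop_set t `&` Q t) <= (eta * ds t ^+ n)%:E)%E.
  apply: le_trans (stop_set_small t); apply: le_measure; rewrite ?inE; last exact: subIsetl.
    by apply: measurableI => //; exact: measurable_stop_set.
  exact: measurable_stop_set.
have {h1 h2} := le_trans h1 h2.
have hf : (mu (~` part N t `&` Q t) < +oo)%E.
  apply: le_lt_trans (_ : mu (Q t) < +oo)%E; last by rewrite leb_dcube// ltry.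
  by apply: le_measure; rewrite ?inE//; exact: subIsetr.
have hq : ((ds t ^+ n)%:E <= mu (part N t) + mu (~` part N t `&` Q t))%E.
  rewrite -(leb_dcube a s0); apply: le_trans (measureU2 _ mP mPC).
  apply: le_measure; rewrite ?inE//; first exact: measurableU.
  by move=> x xt; have [?|?] := pselect (part N t x); [left|right].
have := fineK (_ : mu (~` part N t `&` Q t) \is a fin_num); rewrite ge0_fin_numE//.
move=> /(_ hf); set b := fine _ => bE; rewrite -bE in hq *.
rewrite -EFinM !lee_fin => h1.
have {h1} h2 : b <= 2^-1 * ds t ^+ n.
  have : 2 * b <= ds t ^+ n by rewrite -(ler_pM2l e0); lra.
  lra.
rewrite -(@leeD2rE _ b%:E)//; apply: le_trans hq; rewrite -EFinD lee_fin; lra.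
Qed.

Lemma part_disjoint N x : \sum_(t <- stops N) (\1_(part N t) x : R) <= 1.
Proof.
have [x0|x0] := pselect (Q [::] x); last first.
  by rewrite big1// => t _; rewrite indicE memNset// => -[].
rewrite (eq_bigr (fun t => (cur (word N x) == t)%:R)) => [|t _]; last first.
  rewrite indicE; congr (_%:R); congr nat_of_bool; apply/idP/eqP.
    by rewrite inE => -[].
  by move=> h1; rewrite inE.
have [i1|i1] := boolP (cur (word N x) \in stops N).
  rewrite (bigD1_seq _ i1 (stops_uniq N)) /= eqxx big1 ?addr0// => t /negPf.
  by rewrite eq_sym => ->.
rewrite big_seq big1// => t tN; case: eqP => // e1.
by rewrite -e1 (negPf i1) in tN.
Qed.

End sparse_domination.

(** * Weighted bounds *)

Section weighted_sparse.
Context (R : realType) (n : nat).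
Local Notation E := 'rV[R]_n.
Local Notation mu := (leb R n).
Context (p q Aw : R) (w sg : E -> R).
Hypothesis dw : dual_weights p q Aw w sg.

Let p1 : 1 < p := dw_p dw.
Let q1 : 1 < q := dw_q dw.
Let p0 : 0 < p := lt_trans ltr01 p1.
Let q0 : 0 < q := lt_trans ltr01 q1.
Let Aw0 : 0 < Aw := dw_A dw.

Lemma conj_pq : p * (1 - p^-1) = p - 1.
Proof. by rewrite mulrBr mulr1 mulfV// gt_eqF. Qed.

Lemma dual_power x : w x = sg x `^ (1 - p).
Proof.
have ws : w x * sg x `^ (p - 1) = 1.
  have := congr1 (fun z => z `^ p) (dw_dual dw x).
  rewrite powRM ?powR_ge0// powRV ?(ltW (dw_wpos dw x)) ?gt_eqF// powR1 -powRrM.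
  by have -> : q^-1 * p = p - 1 by rewrite -conj_pq -(dw_pq dw) addrAC subrr add0r mulrC.
have s0 := powR_gt0 (p - 1) (dw_spos dw x).
rewrite -[1 - p]opprB powRN; apply: (@mulIf _ (sg x `^ (p - 1))); first by rewrite gt_eqF.
by rewrite ws mulVf// gt_eqF.
Qed.

(** Averages of [h] become averages of [h / sg] for the measure [sg], while the [p]-th power of the
    norm of [h / sg] for [sg] is that of [h] for [w]. *)
Lemma dual_quotient x c : 0 <= c -> (c / sg x) `^ p * sg x = c `^ p * w x.
Proof.
move=> c0; have s0 := dw_spos dw x.
rewrite powRM// ?invr_ge0 ?(ltW s0)// dual_power -mulrA; congr (_ * _).
by rewrite -powR_inv1 ?(ltW s0)// -powRrM mulN1r addrC powRB_mul// powRr1 ?ltW.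
Qed.

(** The part of the triple that its disjoint set is guaranteed to occupy: half of the central
    cube. *)
Definition frac : R := 2^-1 * 3 ^- n.

Lemma frac_gt0 : 0 < frac.
Proof. by rewrite /frac mulr_gt0// invr_gt0 exprn_gt0. Qed.

Definition Cw : R := (Aw / frac) `^ p.
Definition Cs : R := (Aw / frac) `^ q.
Definition Cg : R := Cw * Cmax q ((Aw * 3 ^+ n) `^ p).
Definition Ch : R := Cs * Cmax p ((Aw * 3 ^+ n) `^ q).
(** The scaling factor in Young's inequality: it leaves on the term in [G] a coefficient whose
    product with [Cg] is at most 1/2, so that this term is absorbed. *)
Definition young : R := (2 * Aw * Cg + 1) `^ q^-1.
Definition Csparse : R := 2 * (Aw * young `^ p * Ch).

Lemma Cg_ge0 : 0 <= Cg.
Proof. by rewrite mulr_ge0 ?powR_ge0// Cmax_ge0 ?powR_ge0. Qed.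

Lemma Ch_ge0 : 0 <= Ch.
Proof. by rewrite mulr_ge0 ?powR_ge0// Cmax_ge0 ?powR_ge0. Qed.

Lemma Csparse_ge0 : 0 <= Csparse.
Proof.
apply: mulr_ge0 => //; apply: mulr_ge0; last exact: Ch_ge0.
by apply: mulr_ge0; [exact: ltW|exact: powR_ge0].
Qed.

Lemma young_den_gt0 : 0 < 2 * Aw * Cg + 1.
Proof.
apply: ltr_wpDl => //; apply: mulr_ge0; last exact: Cg_ge0.
by apply: mulr_ge0 => //; exact: ltW.
Qed.

Lemma youngP x y : 0 <= x -> 0 <= y ->
  Aw * (x * y) <= Aw * young `^ p * x `^ p + (Aw / (2 * Aw * Cg + 1)) * y `^ q.
Proof.
move=> x0 y0; have d0 := young_den_gt0; rewrite /young; set d := 2 * Aw * Cg + 1 in d0 *.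
set z := d `^ q^-1; have l0 : 0 < z by rewrite powR_gt0.
have := @conjugate_powR _ (z * x) (y / z) p q (mulr_ge0 (ltW l0) x0) (divr_ge0 y0 (ltW l0))
  p0 q0 (dw_pq dw).
have -> : z * x * (y / z) = x * y by field; rewrite gt_eqF.
rewrite powRM ?(ltW l0)// powRM ?invr_ge0 ?(ltW l0)//.
have -> : z^-1 `^ q = d^-1.
  by rewrite -powR_inv1 ?(ltW l0)// -powRrM mulN1r powRN powRV ?(ltW d0)// gt_eqF.
move=> h; rewrite -!mulrA -mulrDr ler_pM2l//; apply: (le_trans h); apply: lerD.
  by rewrite ler_pdivrMr// ler_peMr ?(ltW p1)// mulr_ge0 ?powR_ge0.
rewrite [leRHS]mulrC ler_pdivrMr// ler_peMr ?(ltW q1)//.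
by apply: mulr_ge0; [exact: powR_ge0|rewrite invr_ge0 ltW].
Qed.

(** With [al = z V / sT], the product [z be wQ] is at most [al be sT wT / V]. Splitting [sT wT] into
    [sT^(1/p) wT^(1/q)] and [wT^(1/p) sT^(1/q)], the A_p condition bounds the second factor by
    [Aw V], and Young's inequality ends the proof. *)
Lemma sparse_term (z be V sT wT wQ : R) : 0 <= z -> 0 <= be -> 0 < V -> 0 < sT -> 0 < wT -> 0 < wQ ->
  wQ <= wT -> wT `^ p^-1 * sT `^ q^-1 <= Aw * V ->
  z * (be * wQ) <= Aw * young `^ p * ((z * V / sT) `^ p * sT) +
    Aw / (2 * Aw * Cg + 1) * (be `^ q * wT).
Proof.
move=> z0 be0 V0 sT0 wT0 wQ0 wQT Ap; set al := z * V / sT.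
have al0 : 0 <= al by rewrite divr_ge0 ?(ltW sT0)// mulr_ge0// ltW.
pose x := al * sT `^ p^-1; pose y := be * wT `^ q^-1.
have x0 : 0 <= x by rewrite mulr_ge0 ?powR_ge0.
have y0 : 0 <= y by rewrite mulr_ge0 ?powR_ge0.
have xp : x `^ p = al `^ p * sT.
  by rewrite powRM ?powR_ge0// powRV ?(ltW sT0)// gt_eqF.
have yq : y `^ q = be `^ q * wT.
  by rewrite powRM ?powR_ge0// powRV ?(ltW wT0)// gt_eqF.
rewrite -xp -yq; apply: le_trans (youngP x0 y0).
rewrite -(ler_pM2r V0).
have -> : z * (be * wQ) * V = al * be * (sT * wQ).
  by rewrite /al; field; rewrite gt_eqF.
have ab0 : 0 <= al * be := mulr_ge0 al0 be0.
apply: (@le_trans _ _ (al * be * (sT * wT))).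
  by rewrite ler_wpM2l// ler_pM2l.
have -> : Aw * (x * y) * V = al * be * (sT `^ p^-1 * wT `^ q^-1 * (Aw * V)) by rewrite /x /y; ring.
rewrite ler_wpM2l//.
have sp t : 0 < t -> t = t `^ p^-1 * t `^ q^-1.
  by move=> t0; rewrite -powRB_mul// (dw_pq dw) powRr1// ltW.
have -> : sT * wT = sT `^ p^-1 * wT `^ q^-1 * (wT `^ p^-1 * sT `^ q^-1).
  rewrite {1}(sp _ sT0) {1}(sp _ wT0); ring.
by rewrite ler_wpM2l ?mulr_ge0 ?powR_ge0.
Qed.

Context (I : eqType) (l : seq I) (m : I -> R) (c : I -> E * R) (A : I -> set E) (b : E) (r : R).
Context (h : E -> R).
Local Notation T i := (triple (c i).1 (c i).2).
Local Notation Q i := (cube (c i).1 (c i).2).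
Hypothesis nh : nnm h.
Hypothesis c0 : forall i, 0 < (c i).2.
Hypothesis mA : forall i, measurable (A i).
Hypothesis AQ : forall i, A i `<=` Q i.
Hypothesis Tsub : forall i, T i `<=` cube b r.
Hypothesis Alarge : forall i, i \in l -> ((2^-1 * (c i).2 ^+ n)%:E <= mu (A i))%E.
Hypothesis Adisj : forall x, \sum_(i <- l) \1_(A i) x <= 1 :> R.
Hypothesis m0 : forall i, 0 <= m i.
Hypothesis mE : forall i, \nint[mu]_(x in T i) (h x) = (m i * (3 * (c i).2) ^+ n)%:E.

Let G x : R := \sum_(i <- l) m i * \1_(Q i) x.

Let mQ i : measurable (Q i) := measurable_cube _ _.
Let mT i : measurable (T i) := measurable_triple _ _.
Let QT i : Q i `<=` T i := cube_sub_triple (ltW (c0 i)).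

Lemma nnm_sparse : nnm G.
Proof. by apply: nnm_sum => i; apply: nnmZ => //; exact: nnm_indic. Qed.

Lemma large_wt i p' q' v v' : dual_weights p' q' Aw v v' -> i \in l ->
  (\nint[mu]_(x in T i) (v x) <= ((Aw / frac) `^ p')%:E * \nint[mu]_(x in A i) (v x))%E.
Proof.
move=> dv il; apply: (dual_sub dv) => //.
- by move=> x xi; apply: QT; exact: AQ.
- by rewrite mulr_gt0.
- exact: frac_gt0.
- apply: le_trans (Alarge il); rewrite lee_fin exprMn /frac.
  by rewrite mulrA -(mulrA 2^-1) mulVf ?mulr1// gt_eqF// exprn_gt0.
Qed.

(** A finite sum of indicators is bounded with bounded support, hence the finiteness that makes
    absorption legitimate. *)
Lemma sparse_fin e (D : set E) : 0 < e -> measurable D ->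
  (\nint[mu]_(x in D) (G x `^ e * w x) < +oo)%E.
Proof.
move=> e0 mD; pose M := \sum_(i <- l) m i.
have M0 : 0 <= M by apply: sumr_ge0.
have [nw fw] := dw_w dw; have nG := nnm_sparse.
have nGw : nnm (fun x => G x `^ e * w x) by apply: nnmM => //; exact: nnm_powR.
have G0 x : ~ cube b r x -> G x = 0.
  move=> hx; rewrite /G big1// => i _; rewrite indicE memNset ?mulr0// => xi.
  by apply: hx; apply: (Tsub (i := i)); exact: QT.
have GM x : G x <= M.
  by apply: ler_sum => i _; rewrite indicE; case: (_ \in _); rewrite ?mulr1// mulr0.
apply: (@le_lt_trans _ _ (\nint[mu]_(x in cube b r) (M `^ e * w x))%E); last first.
  rewrite nintZ ?powR_ge0//; first by rewrite (volE b r (dw_w dw)) ltry.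
  exact: measurable_cube.
have mC : measurable (cube b r) by exact: measurable_cube.
have nM : nnm (fun x => M `^ e * w x) by apply: nnmZ => //; exact: powR_ge0.
have nMC : nnm (fun x => M `^ e * w x * \1_(cube b r) x) by apply: nnmM => //; exact: nnm_indic.
apply: (@le_trans _ _ (\nint[mu]_(x in D) (M `^ e * w x * \1_(cube b r) x))%E); last first.
  rewrite nint_indic//; apply: nint_sub => //; exact: measurableI.
apply: nint_le => //.
move=> x _; rewrite indicE; have [xb|xb] := pselect (cube b r x).
  rewrite mem_set// mulr1 ler_wpM2r ?(ltW (dw_wpos dw x))//.
  by apply: powR_le => //; [exact: ltW|exact: nG.2].
by rewrite G0// powR0 ?gt_eqF// mul0r memNset ?mulr0.
Qed.

(* [\int G^p w] is the sum of the [m_i \int_{Q_i} G^(p-1) w]; by A_p and Young each term is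
   at most a small multiple of a term of the maximal sum of G^(p-1) for w, whose total is
   absorbed in [\int G^p w < oo], plus a term of the maximal sum of h / sg for sg. *)
Lemma sparse_weighted :
  (\nint[mu]_(x in setT) (G x `^ p * w x) <=
   Csparse%:E * \nint[mu]_(x in cube b r) (h x `^ p * w x))%E.
Proof.
have [nw fw] := dw_w dw; have [ns fs] := dw_s dw; have nG := nnm_sparse.
have pw0 := dw_wpos dw; have ps0 := dw_spos dw; have a0 := ltW Aw0.
have pm : 0 < p - 1 by rewrite subr_gt0.
have nGp : nnm (fun x => G x `^ (p - 1) * w x) by apply: nnmM => //; exact: nnm_powR.
have nGw : nnm (fun x => G x `^ p * w x) by apply: nnmM => //; exact: nnm_powR.
have nhw : nnm (fun x => h x `^ p * w x) by apply: nnmM => //; exact: nnm_powR.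
pose c3 i : E := \row_k ((c i).1 ord0 k - (c i).2); pose s3 i := 3 * (c i).2.
have s30 i : 0 < s3 i by rewrite mulr_gt0.
pose sT i := vol sg (c3 i) (s3 i); pose wT i := vol w (c3 i) (s3 i).
pose wQ i := vol w (c i).1 (c i).2.
have sT0 i : 0 < sT i by exact: vol_gt0 (dw_s dw) ps0 (s30 i).
have wT0 i : 0 < wT i by exact: vol_gt0 (dw_w dw) pw0 (s30 i).
have wQ0 i : 0 < wQ i by exact: vol_gt0 (dw_w dw) pw0 (c0 i).
have sTE i : \nint[mu]_(x in T i) (sg x) = (sT i)%:E by exact: volE (dw_s dw).
have wTE i : \nint[mu]_(x in T i) (w x) = (wT i)%:E by exact: volE (dw_w dw).
have wQE i : \nint[mu]_(x in Q i) (w x) = (wQ i)%:E by exact: volE (dw_w dw).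
have wQT i : wQ i <= wT i by rewrite -lee_fin -wQE -wTE; apply: nint_sub.
(* The average over the triple of [h / sg] for the measure [sg]. *)
pose al i := m i * s3 i ^+ n / sT i.
have al0 i : 0 <= al i by rewrite divr_ge0 ?(ltW (sT0 i))// mulr_ge0 ?exprn_ge0// ltW.
(* The average over the cube of [G^(p-1)] for the measure [w]. *)
pose be i := fine (\nint[mu]_(x in Q i) (G x `^ (p - 1) * w x)) / wQ i.
have beE i : \nint[mu]_(x in Q i) (G x `^ (p - 1) * w x) = (be i * wQ i)%:E.
  have [J J0 JE] := nint_real nGp (sparse_fin pm (mQ i)).
  by rewrite /be JE /= mulfVK// gt_eqF.
have be0 i : 0 <= be i.
  rewrite -(pmulr_lge0 _ (wQ0 i)) -lee_fin -beE; exact: nint_ge0.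
have [Y Y0 YE] := nint_real nGw (sparse_fin p0 measurableT).
have YS : Y = \sum_(i <- l) m i * (be i * wQ i).
  apply: EFin_inj; rewrite -YE -sumEFin.
  have nt i : nnm (fun x => m i * (\1_(Q i) x * (G x `^ (p - 1) * w x))).
    by apply: nnmZ => //; apply: nnmM => //; exact: nnm_indic.
  rewrite (eq_bigr (fun i => \nint[mu]_(x in setT) (m i * (\1_(Q i) x * (G x `^ (p - 1) * w x))))).
    rewrite -nint_sum//; apply: eq_integral => x _; congr EFin.
    rewrite -(mulr_powRB1 (nG.2 x) p0) /G -mulrA mulr_suml; apply: eq_bigr => i _; ring.
  move=> i _; rewrite EFinM -beE nintZ//; last by apply: nnmM => //; exact: nnm_indic.
  congr (_ * _)%E; under [in RHS]eq_integral do rewrite mulrC.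
  by rewrite nint_indic// setTI.
pose d := 2 * Aw * Cg + 1.
have g0 := Cg_ge0; have d0 : 0 < d := young_den_gt0.
pose k1 := Aw * young `^ p; pose k2 := Aw / d.
have k10 : 0 <= k1 by rewrite mulr_ge0 ?powR_ge0.
have k20 : 0 <= k2 by rewrite divr_ge0// ltW.
have term i : m i * (be i * wQ i) <= k1 * (al i `^ p * sT i) + k2 * (be i `^ q * wT i).
  have sn0 : 0 < s3 i ^+ n by rewrite exprn_gt0.
  exact: sparse_term (m0 i) (be0 i) sn0 (sT0 i) (wT0 i) (wQ0 i) (wQT i) (dw_Ap dw _ (s30 i)).
have mC : measurable (cube b r) by exact: measurable_cube.
set X := \nint[mu]_(x in cube b r) (h x `^ p * w x).
have hX : (\sum_(i <- l) (al i `^ p)%:E * \nint[mu]_(x in A i) (sg x) <=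
    (Cmax p ((Aw * 3 ^+ n) `^ q))%:E * X)%E.
  have nhs : nnm (fun x => h x / sg x).
    rewrite (_ : (fun _ => _) = (fun x => h x * sg x `^ (- 1))).
      by apply: nnmM => //; exact: nnm_powR.
    by apply/funext => x; rewrite powR_inv1// ltW.
  have e1 : \nint[mu]_(x in cube b r) ((h x / sg x) `^ p * sg x) = X.
    by apply: eq_integral => x _; rewrite dual_quotient// nh.2.
  have h1 i : [/\ 0 < s3 i, 0 <= al i, measurable (A i) & T i `<=` cube b r].
    by split; [exact: s30|exact: al0|exact: mA|exact: (Tsub (i := i))].
  have h2 i : ((al i)%:E * \nint[mu]_(x in T i) (sg x) <= \nint[mu]_(x in T i) (h x / sg x * sg x))%E.
    have -> : \nint[mu]_(x in T i) (h x / sg x * sg x) = \nint[mu]_(x in T i) (h x).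
      by apply: eq_integral => x _; rewrite mulfVK// gt_eqF.
    by rewrite mE sTE -EFinM lee_fin /al mulfVK// gt_eqF.
  have AT i : A i `<=` T i by move=> x xi; apply: QT; exact: AQ.
  have := @maximal_sum R n I l al (fun i => (c3 i, s3 i)) A _ sg (fun x => h x / sg x) p (cube b r)
    (dual_doubling (dual_weights_sym dw)) nhs p1 mC h1 AT h2 Adisj.
  by rewrite e1.
have hY : (\sum_(i <- l) (be i `^ q)%:E * \nint[mu]_(x in A i) (w x) <=
    (Cmax q ((Aw * 3 ^+ n) `^ p))%:E * Y%:E)%E.
  have nGq : nnm (fun x => G x `^ (p - 1)) by exact: nnm_powR.
  have pq1 : (p - 1) * q = p.
    have e1 : q^-1 = 1 - p^-1 by rewrite -(dw_pq dw) addrAC subrr add0r.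
    by rewrite -conj_pq -e1 mulfVK// gt_eqF.
  have e1 : \nint[mu]_(x in cube b r) ((G x `^ (p - 1)) `^ q * w x) =
      \nint[mu]_(x in cube b r) (G x `^ p * w x).
    by apply: eq_integral => x _; rewrite -powRrM pq1.
  have h1 i : [/\ 0 < (c i).2, 0 <= be i, measurable (A i) & Q i `<=` cube b r].
    split; [exact: c0|exact: be0|exact: mA|].
    by move=> x xi; apply: (Tsub (i := i)); exact: QT.
  have h2 i : ((be i)%:E * \nint[mu]_(x in Q i) (w x) <=
      \nint[mu]_(x in Q i) (G x `^ (p - 1) * w x))%E.
    by rewrite beE wQE -EFinM.
  have h3 : (\nint[mu]_(x in cube b r) (G x `^ p * w x) <= Y%:E)%E.
    by rewrite -YE; exact: (nint_sub mu mC measurableT nGw (@subsetT _ _)).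
  have := @maximal_sum R n I l be c A _ w (fun x => G x `^ (p - 1)) q (cube b r)
    (dual_doubling dw) nGq q1 mC h1 AQ h2 Adisj.
  rewrite e1 => hm; apply: (le_trans hm); apply: lee_wpmul2l h3.
  by rewrite lee_fin; exact: (Cmax_ge0 q1 (powR_ge0 _ _)).
have main : (Y%:E <= (k1 * Ch)%:E * X + (k2 * Cg * Y)%:E)%E.
  apply: (@le_trans _ _ (k1%:E * (Cs%:E * \sum_(i <- l) (al i `^ p)%:E * \nint[mu]_(x in A i) (sg x)) +
     k2%:E * (Cw%:E * \sum_(i <- l) (be i `^ q)%:E * \nint[mu]_(x in A i) (w x)))%E); last first.
    apply: leeD.
      have -> : (k1 * Ch)%:E = (k1%:E * (Cs%:E * (Cmax p ((Aw * 3 ^+ n) `^ q))%:E))%E by rewrite -!EFinM.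
      rewrite -muleA; apply: lee_wpmul2l; first by rewrite lee_fin.
      rewrite -muleA.
      by apply: lee_wpmul2l hX; rewrite lee_fin powR_ge0.
    have -> : (k2 * Cg * Y)%:E = (k2%:E * (Cw%:E * ((Cmax q ((Aw * 3 ^+ n) `^ p))%:E * Y%:E)))%E.
      by rewrite -!EFinM /Cg !mulrA.
    apply: lee_wpmul2l; first by rewrite lee_fin.
    by apply: lee_wpmul2l hY; rewrite lee_fin powR_ge0.
  have ge1 i : (0 <= (al i `^ p)%:E * \nint[mu]_(x in A i) (sg x))%E.
    by rewrite mule_ge0 ?lee_fin ?powR_ge0//; exact: nint_ge0.
  have ge2 i : (0 <= (be i `^ q)%:E * \nint[mu]_(x in A i) (w x))%E.
    by rewrite mule_ge0 ?lee_fin ?powR_ge0//; exact: nint_ge0.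
  rewrite YS !ge0_sume_distrr//; last 2 first.
  - by move=> i _; rewrite mule_ge0 ?lee_fin ?powR_ge0.
  - by move=> i _; rewrite mule_ge0 ?lee_fin ?powR_ge0.
  rewrite -big_split /= -sumEFin [leLHS]big_seq [leRHS]big_seq; apply: lee_sum => i il.
  apply: (@le_trans _ _ (k1 * (al i `^ p * sT i) + k2 * (be i `^ q * wT i))%:E).
    by rewrite lee_fin.
  rewrite EFinD; apply: leeD.
    rewrite EFinM; apply: lee_wpmul2l; first by rewrite lee_fin.
    rewrite muleCA EFinM; apply: lee_wpmul2l; first by rewrite lee_fin powR_ge0.
    by rewrite -sTE; exact: large_wt (dual_weights_sym dw) il.
  rewrite EFinM; apply: lee_wpmul2l; first by rewrite lee_fin.
  rewrite muleCA EFinM; apply: lee_wpmul2l; first by rewrite lee_fin powR_ge0.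
  by rewrite -wTE; exact: large_wt dw il.
(* The absorption: [Aw Cg / (2 Aw Cg + 1)] is at most 1/2. *)
have half : k2 * Cg * Y <= Y / 2.
  rewrite [leRHS]mulrC ler_wpM2r// /k2 mulrAC ler_pdivrMr// /d; lra.
have {main}main : (Y%:E <= (k1 * Ch)%:E * X + (Y / 2)%:E)%E.
  by apply: (le_trans main); apply: leeD => //; rewrite lee_fin.
rewrite YE /Csparse -/k1 EFinM -muleA.
have : ((Y / 2)%:E <= (k1 * Ch)%:E * X)%E.
  have -> : (Y / 2)%:E = (Y%:E - (Y / 2)%:E)%E by rewrite -EFinB; congr EFin; lra.
  by rewrite leeBlDr.
by rewrite -(@lee_pmul2l _ 2%:E)// -EFinM mulrCA mulfV// mulr1.
Qed.

End weighted_sparse.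

(** * The operator on weighted Lebesgue spaces over a cube *)

Section local_weighted.
Context (R : realType) (n : nat).
Local Notation E := 'rV[R]_n.
Local Notation C := R[i].
Local Notation mu := (leb R n).
Implicit Types (a x y : E) (F : E -> C).

Lemma nint_nondecreasing_le (X : (set E)^nat) f (c : \bar R) : (forall N, measurable (X N)) ->
  (forall N, X N `<=` X N.+1) -> nnm f -> (forall N, (\nint[mu]_(x in X N) (f x) <= c)%E) ->
  (\nint[mu]_(x in \bigcup_N X N) (f x) <= c)%E.
Proof.
move=> mX ndX nf hc.
have nd : nondecreasing_seq X.
  by apply/nondecreasing_seqP => N; rewrite subsetEset; exact: ndX.
have mf N : measurable_fun (X N) (EFin \o f) by exact: nnm_EFin.
have f0 N x : X N x -> (0 <= (EFin \o f) x)%E by move=> _; rewrite lee_fin nf.2.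
have cv := @ge0_nondecreasing_set_cvg_integral _ _ R X (EFin \o f) mu nd mX mf f0.
rewrite -(cvg_lim _ cv)//; apply: lime_le; last by apply: nearW => N; exact: hc.
by apply/cvg_ex; eexists; exact: cv.
Qed.

Context (theta : R -> R) (T : (E -> C) -> (E -> C) -> C) (K K0 : E -> E -> C) (AK CW M0 : R)
  (S : (E -> C) -> (E -> C)).
Hypothesis hn : (0 < n)%N.
Hypothesis htheta : dini theta.
Hypothesis M00 : 0 <= M0.
Hypothesis thetaM : forall N, \sum_(k < N) theta (2^-1 ^+ k.+1) <= M0.
Hypothesis hS : CZ_model theta T K K0 AK CW S.
Context (p q Aw : R) (w sg : E -> R).
Hypothesis dw : dual_weights p q Aw w sg.

Let AS : R := Cdom n AK CW M0.

Lemma AS_ge0 : 0 <= AS.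
Proof.
have c1 := @Cstop_ge1 R n CW (model_CW hS).
apply: le_trans (@Cdom_ge R n AK CW M0 M00 (model_AK hS) (model_CW hS)).
exact: le_trans ler01 c1.
Qed.

(** The number of generations in the sparse bound depends on the point. The sets [X N] where [N]
    generations suffice increase to almost all of the cube, and the weighted bound is uniform in
    [N]. *)
Lemma local_weighted_gt0 a s F h : 0 < s -> in_Lp 1 F ->
  (forall y, ~ dtriple a s [::] y -> F y = 0) -> nnm h -> (forall x, 0 < h x) ->
  (forall x, normc (F x) <= h x) -> (\nint[mu]_(x in dtriple a s [::]) (h x) < +oo)%E ->
  (\nint[mu]_(x in cube a s) (normc (S F x) `^ p * w x) <=
   (AS `^ p * Csparse n p q Aw)%:E * \nint[mu]_(x in dtriple a s [::]) (h x `^ p * w x))%E.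
Proof.
move=> s0 F1 F0 nh h0 Fh hfin.
have p0 : 0 < p by exact: lt_trans ltr01 (dw_p dw).
have [wk1 wk2 wk3] := model_weak hS; have [nw _] := dw_w dw.
have locE : loc a s F [::] = F.
  apply/funext => x; rewrite /loc indicE; have [xt|xt] := pselect (dtriple a s [::] x).
    by rewrite mem_set// mulr1.
  by rewrite memNset// mulr0 F0.
pose G N := sparse_sum CW S a s F h N.
have nG N : nnm (G N).
  apply: nnm_sum => t; apply: nnmZ; last by apply: nnm_indic; exact: measurable_dcube.
  by apply/ltW; apply: tavg_gt0.
have nS : nnm (fun x => normc (S F x)) by apply: nnm_normc; exact: wk2.
have nf : nnm (fun x => normc (S F x) `^ p * w x) by apply: nnmM => //; exact: nnm_powR.
pose X N := cube a s `&` [set x | normc (S F x) <= AS * G N x].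
have mX N : measurable (X N).
  apply: measurableI; first exact: measurable_cube.
  rewrite (_ : mkset _ = [set x | 0 <= AS * G N x - normc (S F x)]).
    apply: measurable_ge; apply: measurable_funB; last exact: nS.1.
    by apply: measurable_funM => //; exact: (nG N).1.
  by apply/seteqP; split => x /=; rewrite subr_ge0.
apply: (@le_trans _ _ (\nint[mu]_(x in \bigcup_N X N) (normc (S F x) `^ p * w x))%E).
  have mU : measurable (\bigcup_N X N) by exact: bigcup_measurable.
  have mC : measurable (cube a s) by exact: measurable_cube.
  have nfU : nnm (fun x => normc (S F x) `^ p * w x * \1_(\bigcup_N X N) x).
    by apply: nnmM => //; exact: nnm_indic.
  apply: (@le_trans _ _ (\nint[mu]_(x in cube a s) (normc (S F x) `^ p * w x * \1_(\bigcup_N X N) x))%E).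
    apply: nint_ae_le => //.
    have := sparse_domination hn htheta M00 thetaM (model_AK hS) (model_measurable hS)
      (model_size hS) (model_smooth hS) (model_CW hS) (model_weak hS) (model_repr hS) s0 F1 nh h0 Fh hfin.
    apply: filterS => x hx xa; have := hx; rewrite dcube_nil locE => /(_ xa) [N xN].
    by rewrite indicE mem_set ?mulr1//; exists N.
  rewrite nint_indic//; apply: nint_sub => //; first exact: measurableI.
apply: nint_nondecreasing_le => // N.
  move=> x [xa xN]; split=> //; apply: (le_trans xN); rewrite ler_wpM2l ?AS_ge0//.
  exact: sparse_sumS.
have nGw : nnm (fun x => G N x `^ p * w x) by apply: nnmM => //; exact: nnm_powR.
have nAG : nnm (fun x => AS `^ p * (G N x `^ p * w x)) by apply: nnmZ => //; exact: powR_ge0.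
apply: (@le_trans _ _ (\nint[mu]_(x in X N) (AS `^ p * (G N x `^ p * w x)))%E).
  apply: nint_le => // x [_ xN]; rewrite mulrA ler_wpM2r ?nw.2// -powRM ?AS_ge0 ?(nG N).2//.
  by apply: powR_le; [exact: ltW|exact: nS.2|exact: xN].
apply: (@le_trans _ _ (\nint[mu]_(x in setT) (AS `^ p * (G N x `^ p * w x)))%E).
  by apply: nint_sub.
have A0 := powR_ge0 AS p; rewrite (nintZ mu measurableT nGw A0).
rewrite (EFinM (AS `^ p)) -muleA; apply: lee_wpmul2l; first by rewrite lee_fin.
have := @sparse_weighted R n p q Aw w sg dw _ (stops CW S a s F h N) (tavg a s h)
  (fun t => (corner a s t, @dsize R n s t)) (part CW S a s F h N)
  (\row_i (corner a s [::] ord0 i - @dsize R n s [::])) (3 * @dsize R n s [::]) h nh.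
apply.
- by move=> t; exact: dsize_gt0.
- by move=> t; exact: measurable_part.
- by move=> t; exact: part_sub.
- by move=> t; exact: dtriple_root.
- by move=> t tl; have := part_large (model_CW hS) (model_weak hS) s0 F1 nh h0 Fh hfin tl.
- by move=> x; exact: part_disjoint.
- by move=> t; apply/ltW/tavg_gt0.
- by move=> t; exact: tavgE.
Qed.

(* The sparse domination needs positive averages: it is applied to |F| + d, d > 0. *)
Lemma local_weighted a s F : 0 < s -> in_Lp 1 F -> (forall y, ~ triple a s y -> F y = 0) ->
  (\nint[mu]_(x in cube a s) (normc (S F x) `^ p * w x) <=
   (AS `^ p * Csparse n p q Aw * 2 `^ p)%:E * \nint[mu]_(x in triple a s) (normc (F x) `^ p * w x))%E.
Proof.
move=> s0 F1 F0'.
have dE : dtriple a s [::] = triple a s by rewrite /dtriple /dsize /= expr0 divr1.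
have F0 y : ~ dtriple a s [::] y -> F y = 0 by rewrite dE; exact: F0'.
have p0 : 0 < p by exact: lt_trans ltr01 (dw_p dw).
have [nw _] := dw_w dw; have /in_L1P[mF Foo] := F1; have nF := nnm_normc mF.
have mT : measurable (triple a s) by exact: measurable_triple.
have nFp : nnm (fun x => normc (F x) `^ p * w x) by apply: nnmM => //; exact: nnm_powR.
set c := AS `^ p * Csparse n p q Aw.
have c0 : 0 <= c by rewrite mulr_ge0 ?powR_ge0//; exact: Csparse_ge0 dw.
pose W := vol w (\row_i (a ord0 i - s)) (3 * s).
have WE : \nint[mu]_(x in triple a s) (w x) = W%:E by exact: volE (dw_w dw).
have W0 : 0 <= W by rewrite -lee_fin -WE; exact: nint_ge0.
(* [k] is chosen so that the contribution [c 2^p d^p W] of the added constant [d], with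
   [d^p = e / k], is at most [e]. *)
apply/lee_addgt0Pr => e e0; pose k := c * 2 `^ p * W + 1.
have c20 : 0 <= c * 2 `^ p := mulr_ge0 c0 (powR_ge0 _ _).
have k0 : 0 < k by apply: ltr_wpDl => //; exact: mulr_ge0.
pose d := (e / k) `^ p^-1; have d0 : 0 < d by rewrite powR_gt0// divr_gt0.
have dp : d `^ p = e / k by rewrite powRV ?gt_eqF// divr_ge0// ltW.
pose h x := normc (F x) + d.
have nh : nnm h by apply: nnmD => //; apply: nnm_cst; exact: ltW.
have h0 x : 0 < h x by rewrite ltr_wpDl// normc_ge0.
have Fh x : normc (F x) <= h x by rewrite lerDl ltW.
have hfin : (\nint[mu]_(x in dtriple a s [::]) (h x) < +oo)%E.
  rewrite dE nintD//; last by apply: nnm_cst; exact: ltW.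
  apply: lte_add_pinfty.
    by apply: le_lt_trans Foo; apply: nint_sub.
  by rewrite /triple nint_cst_cube ?mulr_ge0 ?(ltW s0)// ltry.
apply: (le_trans (local_weighted_gt0 s0 F1 F0 nh h0 Fh hfin)); rewrite dE.
have nd : nnm (fun x => d `^ p * w x) by apply: nnmZ => //; exact: powR_ge0.
apply: (@le_trans _ _ (c%:E * \nint[mu]_(x in triple a s)
    (2 `^ p * (normc (F x) `^ p * w x + d `^ p * w x)))%E).
  apply: lee_wpmul2l; first by rewrite lee_fin.
  apply: nint_le => //.
  - by apply: nnmM => //; exact: nnm_powR.
  - by apply: nnmZ; [exact: powR_ge0|exact: nnmD].
  move=> x _; rewrite -mulrDl mulrA ler_wpM2r ?nw.2//.
  have f0 := normc_ge0 (F x).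
  have [fd|df] := leP (normc (F x)) d.
    apply: (@le_trans _ _ ((2 * d) `^ p)).
      by apply: powR_le; [exact: ltW|exact/ltW/h0|rewrite /h; lra].
    by rewrite powRM ?(ltW d0)// ler_wpM2l ?powR_ge0// lerDr powR_ge0.
  apply: (@le_trans _ _ ((2 * normc (F x)) `^ p)).
    by apply: powR_le; [exact: ltW|exact/ltW/h0|rewrite /h; lra].
  by rewrite powRM// ler_wpM2l ?powR_ge0// lerDl powR_ge0.
rewrite nintZ ?powR_ge0//; last exact: nnmD.
rewrite nintD// (nintZ _ mT nw (powR_ge0 _ _)) WE muleA -EFinM ge0_muleDr//; last 2 first.
- exact: nint_ge0.
- by rewrite -EFinM lee_fin mulr_ge0// powR_ge0.
rewrite leeD2l// -!EFinM lee_fin dp.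
have -> : c * 2 `^ p * (e / k * W) = (c * 2 `^ p * W) / k * e by ring.
by rewrite ler_piMl ?(ltW e0)// ler_pdivrMr// mul1r /k lerDl.
Qed.

End local_weighted.

(** * Morrey spaces *)

Lemma powR_exp (R : realType) (t e : R) k : 0 <= t -> (t `^ e) ^+ k = (t ^+ k) `^ e.
Proof.
move=> t0; elim: k => [|k IH]; first by rewrite !expr0 powR1.
by rewrite !exprS powRM ?exprn_ge0// IH.
Qed.

Section growth.
Context (R : realType) (kappa : R) (psi : R -> R).
Hypothesis hkappa : 0 <= kappa < 1.
Hypothesis hpsi : D_condition kappa psi.
Let k0 : 0 <= kappa. Proof. by have /andP[] := hkappa. Qed.
Let k1 : kappa < 1. Proof. by have /andP[] := hkappa. Qed.

(* The constant of D_condition, enlarged to allow t1 = t2. *)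
Definition Dconst (Ak : R) := 0 < Ak /\ forall t1 t2, 0 < t1 -> t1 <= t2 ->
  psi t2 / t2 `^ kappa <= Ak * (psi t1 / t1 `^ kappa).

Lemma Dconst_exists : exists Ak, Dconst Ak.
Proof.
have [ps0 _ [A A0 hA]] := hpsi; exists (A + 1); split; first by rewrite addr_gt0.
move=> t1 t2 t10; have q0 : 0 <= psi t1 / t1 `^ kappa.
  by rewrite divr_ge0 ?powR_ge0// ltW// ps0.
rewrite le_eqVlt => /predU1P[<-|t12]; first by rewrite ler_peMl// lerDr ltW.
by apply: le_trans (hA _ _ t10 t12) _; rewrite ler_wpM2r ?lerDl.
Qed.

Context (Ak : R).
Hypothesis hAk : Dconst Ak.
Let Ak0 : 0 < Ak. Proof. by case: hAk. Qed.
Let hA t1 t2 : 0 < t1 -> t1 <= t2 -> psi t2 / t2 `^ kappa <= Ak * (psi t1 / t1 `^ kappa).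
Proof. by case: hAk => _; apply. Qed.

Lemma psi_gt0 t : 0 < t -> 0 < psi t.
Proof. by case: hpsi => h _ _; exact: h. Qed.

Lemma growth_mul a b L : 0 < a -> 0 < L -> a <= b -> b <= L * a ->
  psi b <= Ak * L `^ kappa * psi a.
Proof.
move=> a0 L0 ab bL; have b0 := lt_le_trans a0 ab; have P0 := psi_gt0 a0.
have := hA a0 ab; have A0 := powR_gt0 kappa a0; have B0 := powR_gt0 kappa b0.
rewrite ler_pdivrMr// => h; apply: (le_trans h).
have hB : b `^ kappa <= L `^ kappa * a `^ kappa.
  by rewrite -powRM ?(ltW L0) ?(ltW a0)//; apply: powR_le => //; exact: ltW.
have -> : Ak * (psi a / a `^ kappa) * b `^ kappa = (Ak * psi a / a `^ kappa) * b `^ kappa by ring.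
have -> : Ak * L `^ kappa * psi a = (Ak * psi a / a `^ kappa) * (L `^ kappa * a `^ kappa).
  by field; rewrite gt_eqF.
by rewrite ler_wpM2l// divr_ge0 ?(ltW A0)// mulr_ge0 ?ltW.
Qed.

(** Written as [psi b / b = (psi b / b^kappa) / b^(1 - kappa)]: the first factor is almost
    decreasing, the second gains the power [1 - kappa] of [t^k]. *)
Lemma growth_decay a b t p k : 0 < a -> 0 < b -> 0 < t -> t < 1 -> 0 < p -> a <= t ^+ k * b ->
  (psi b / b) `^ p^-1 <= (Ak * (psi a / a)) `^ p^-1 * (t `^ ((1 - kappa) / p)) ^+ k.
Proof.
move=> a0 b0 t0 t1 p0 ab; have P0 := psi_gt0 a0; have Pb0 := psi_gt0 b0.
have tk0 : 0 < t ^+ k by rewrite exprn_gt0.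
have ab' : a <= b by apply: (le_trans ab); rewrite ler_piMl ?(ltW b0)// exprn_ile1 ?ltW.
set u := 1 - kappa; have u0 : 0 <= u by rewrite subr_ge0 ltW.
have -> : (t `^ (u / p)) ^+ k = ((t ^+ k) `^ u) `^ p^-1.
  by rewrite powR_exp ?(ltW t0)// powRrM.
have q0 : 0 <= Ak * (psi a / a) by rewrite mulr_ge0 ?divr_ge0 ?ltW.
rewrite -powRM ?powR_ge0//; apply: powR_le; [by rewrite invr_ge0 ltW|by rewrite divr_ge0 ?ltW|].
have e z : 0 < z -> z = z `^ kappa * z `^ u.
  by move=> z0; rewrite -powRB_mul// /u addrC subrK powRr1// ltW.
have := hA a0 ab'.
have hu : a `^ u <= (t ^+ k) `^ u * b `^ u.
  by rewrite -powRM ?(ltW tk0) ?(ltW b0)//; apply: powR_le => //; exact: ltW.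
have A0 := powR_gt0 kappa a0; have B0 := powR_gt0 kappa b0.
have A1 := powR_gt0 u a0; have B1 := powR_gt0 u b0.
have -> : psi b / b = psi b / b `^ kappa / b `^ u by rewrite {2}(e b b0) invfM mulrA.
have -> : psi a / a = psi a / a `^ kappa / a `^ u by rewrite {2}(e a a0) invfM mulrA.
set X := psi b / _; set Y := psi a / _ => h; rewrite ler_pdivrMr//; apply: (le_trans h).
have Y0 : 0 <= Y by rewrite divr_ge0 ?ltW.
have -> : Ak * (Y / a `^ u) * (t ^+ k) `^ u * b `^ u = Ak * Y * ((t ^+ k) `^ u * b `^ u / a `^ u) by ring.
have AY : 0 <= Ak * Y by apply: mulr_ge0 => //; exact: ltW.
by rewrite ler_peMr// ler_pdivlMr// mul1r.
Qed.

End growth.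

Section balls.
Context (R : realType) (n : nat).
Local Notation E := 'rV[R]_n.
Local Notation C := R[i].
Local Notation mu := (leb R n).
Implicit Types (a b c x y : E) (v : E -> R).

Definition wball v c r : R := fine (\nint[mu]_(x in eball c r) (v x)).

Lemma eball_le c r r' : r <= r' -> eball c r `<=` eball c r'.
Proof. by move=> rr x; rewrite /eball /= => h; apply: lt_le_trans rr. Qed.

Lemma wball_fin v c r : fin_wt v -> (\nint[mu]_(x in eball c r) (v x) < +oo)%E.
Proof.
move=> [nv fv]; apply: le_lt_trans (fv (\row_i (c ord0 i - r)) (2 * r)).
by apply: nint_sub => //; [exact: measurable_eball|exact: measurable_cube|exact: eball_sub_cube].
Qed.

Lemma wballE v c r : fin_wt v -> \nint[mu]_(x in eball c r) (v x) = (wball v c r)%:E.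
Proof.
by move=> fv; have [J J0 JE] := nint_real fv.1 (wball_fin c r fv); rewrite /wball JE.
Qed.

Lemma wball_le v c r D : fin_wt v -> measurable D -> D `<=` eball c r ->
  (\nint[mu]_(x in D) (v x) <= (wball v c r)%:E)%E.
Proof.
move=> fv mD Dr; rewrite -wballE//; apply: nint_sub => //; last exact: fv.1.
exact: measurable_eball.
Qed.

Lemma wball_le_vol v c r : fin_wt v -> wball v c r <= vol v (\row_i (c ord0 i - r)) (2 * r).
Proof.
move=> fv; rewrite -lee_fin -wballE// -volE//; apply: nint_sub; last exact: eball_sub_cube.
- exact: measurable_eball.
- exact: measurable_cube.
- exact: fv.1.
Qed.

Lemma wball_ge0 v c r : fin_wt v -> 0 <= wball v c r.
Proof. by move=> fv; rewrite -lee_fin -wballE//; apply: nint_ge0; exact: fv.1. Qed.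

Hypothesis hn : (0 < n)%N.
Let nR : 0 < n%:R :> R. Proof. by rewrite ltr0n. Qed.

Lemma enorm_ltP r x : 0 < r -> (forall i, `|x ord0 i| <= r / (2 * n%:R)) -> enorm x < r.
Proof.
move=> r0 /enorm_le; have -> : n%:R * (r / (2 * n%:R)) = r / 2 by field; rewrite gt_eqF.
move=> h; lra.
Qed.

Lemma small_cube_in c r : 0 < r -> cube c (r / (2 * n%:R)) `<=` eball c r.
Proof.
move=> r0 x xc; rewrite /eball /=; apply: enorm_ltP => // i; rewrite !mxE ler_norml.
have /andP[h1 h2] := xc i; have h3 : 0 < r / (2 * n%:R) by rewrite divr_gt0// mulr_gt0.
apply/andP; split; lra.
Qed.

(** The centre moved by [r] along one axis, so that a small cube with this corner lies between the
    balls of radii [r] and [2 r]. A coordinate is available because the dimension is positive. *)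
Definition shift c (r : R) : E := \row_i (c ord0 i + r * (i == Ordinal hn)%:R).

Lemma small_cube_out c r : 0 < r ->
  cube (shift c r) (r / (2 * n%:R)) `<=` eball c (2 * r) `\` eball c r.
Proof.
move=> r0 x xc; set s := r / (2 * n%:R) in xc.
have s0 : 0 < s by rewrite divr_gt0// mulr_gt0.
split; last first.
  apply/negP; rewrite -leNgt; apply: le_trans (coord_le_enorm _ (Ordinal hn)).
  have /andP[+ _] := xc (Ordinal hn); rewrite !mxE eqxx mulr1 => h.
  by apply: le_trans (ler_norm _); lra.
rewrite /eball /=; apply: le_lt_trans (enorm_dist_triangle (shift c r) _ _) _.
have h1 : enorm (x - shift c r) <= n%:R * s.
  apply: enorm_le => i; have /andP[] := xc i; rewrite !mxE => h1 h2.
  rewrite ler_norml; apply/andP; split; lra.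
have h2 : enorm (shift c r - c) <= r.
  rewrite /enorm (_ : \sum_i _ = r ^+ 2) ?sqrtr_sqr ?gtr0_norm//.
  rewrite (bigD1 (Ordinal hn))//= big1 => [|i /negPf i0].
    by rewrite !mxE eqxx mulr1 addr0; congr (_ ^+ 2); ring.
  by rewrite !mxE i0 mulr0 addr0 subrr expr0n.
have h3 : n%:R * s = r / 2 by rewrite /s; field; rewrite gt_eqF.
lra.
Qed.

Section weights.
Context (p q Aw : R) (w sg : E -> R).
Hypothesis dw : dual_weights p q Aw w sg.
Let fw := dw_w dw.
Let fs := dw_s dw.
Let p1 := dw_p dw.
Let q1 := dw_q dw.
Let p0 : 0 < p := lt_trans ltr01 p1.
Let q0 : 0 < q := lt_trans ltr01 q1.
Let Aw0 := dw_A dw.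

(** [8 n] is the ratio of the side [4 r] of the cube around the ball of radius [2 r] to the side
    [r / (2 n)] of the small cubes. *)
Definition Lball : R := (Aw / (8 * n%:R) ^- n) `^ p.

Lemma wball_gt0 c r : 0 < r -> 0 < wball w c r.
Proof.
move=> r0; rewrite -lte_fin -wballE//; apply: nint_gt0.
- exact: measurable_eball.
- exact: fw.1.
- exact: dw_wpos dw.
- have s0 : 0 < r / (2 * n%:R) by rewrite divr_gt0// mulr_gt0.
  apply: (@lt_le_trans _ _ (mu (cube c (r / (2 * n%:R))))).
    by rewrite leb_cube ?(ltW s0)// lte_fin exprn_gt0.
  apply: le_measure; rewrite ?inE; [exact: measurable_cube|exact: measurable_eball|exact: small_cube_in].
Qed.

Lemma wball_small b c r : 0 < r -> cube b (r / (2 * n%:R)) `<=` eball c (2 * r) ->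
  ((wball w c (2 * r))%:E <= Lball%:E * \nint[mu]_(x in cube b (r / (2 * n%:R))) (w x))%E.
Proof.
move=> r0 bc; have s0 : 0 < r / (2 * n%:R) by rewrite divr_gt0// mulr_gt0.
apply: (@le_trans _ _ (vol w (\row_i (c ord0 i - 2 * r)) (2 * (2 * r)))%:E).
  by rewrite lee_fin; exact: wball_le_vol.
rewrite -volE//; apply: (dual_sub dw).
- exact: measurable_cube.
- by apply: subset_trans bc _; exact: eball_sub_cube.
- by rewrite !mulr_gt0.
- by rewrite invr_gt0 exprn_gt0// mulr_gt0.
- rewrite leb_cube ?(ltW s0)// lee_fin -exprVn -exprMn le_eqVlt; apply/orP; left; apply/eqP.
  by congr (_ ^+ n); field; rewrite gt_eqF.
Qed.

Lemma wball_double c r : 0 < r -> wball w c (2 * r) <= Lball * wball w c r.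
Proof.
move=> r0; rewrite -lee_fin EFinM.
apply: le_trans (wball_small r0 (_ : cube c _ `<=` _)) _.
  apply: subset_trans (small_cube_in r0) _; apply: eball_le; lra.
apply: lee_wpmul2l; first by rewrite lee_fin powR_ge0.
by apply: wball_le => //; [exact: measurable_cube|exact: small_cube_in].
Qed.

Lemma Lball_gt0 : 0 < Lball.
Proof. by rewrite powR_gt0// divr_gt0// invr_gt0 exprn_gt0// mulr_gt0. Qed.

(** The ratio of reverse doubling; the form [L / (L + 1)] is below 1 whatever the size of [L]. *)
Definition tau : R := Lball / (Lball + 1).

Lemma tau_gt0 : 0 < tau.
Proof. by have L0 := Lball_gt0; rewrite divr_gt0// addr_gt0. Qed.

Lemma tau_lt1 : tau < 1.
Proof. by have L0 := Lball_gt0; rewrite ltr_pdivrMr ?addr_gt0// mul1r ltrDl. Qed.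

(** A small cube in the annulus carries at least the fraction [1 / Lball] of the weight of the
    doubled ball, and it is disjoint from the ball. *)
Lemma wball_reverse c r : 0 < r -> wball w c r <= tau * wball w c (2 * r).
Proof.
move=> r0; have L0 := Lball_gt0.
pose P := cube (shift c r) (r / (2 * n%:R)).
have PD : P `<=` eball c (2 * r) `\` eball c r := small_cube_out r0.
have mP : measurable P by exact: measurable_cube.
have := wball_small r0 (fun x px => (PD x px).1); rewrite -/P.
have h1 : ((wball w c r)%:E + \nint[mu]_(x in P) (w x) <= (wball w c (2 * r))%:E)%E.
  rewrite -wballE// -nintU//; last 3 first.
  - exact: measurable_eball.
  - exact: fw.1.
  - by apply/seteqP; split => // x [h1 /PD [_ /(_ h1)]].
  apply: wball_le => //; first by apply: measurableU => //; exact: measurable_eball.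
  move=> x [|/PD []//]; apply: eball_le; lra.
have W0 := wball_ge0 c r fw; have W2 := wball_gt0 c (mulr_gt0 (ltr0n R 2) r0).
have := nint_ge0 mu P fw.1; move: h1; case: (\nint[mu]_(x in P) (w x)) => // z.
rewrite -EFinD -EFinM !lee_fin => h1 z0 h2.
rewrite /tau mulrAC ler_pdivlMr ?addr_gt0//.
have h3 : Lball * (wball w c r + z) <= Lball * wball w c (2 * r) by rewrite ler_pM2l.
nra.
Qed.

Lemma wball_iter c r k : 0 < r -> wball w c r <= tau ^+ k * wball w c (2 ^+ k * r).
Proof.
move=> r0; elim: k => [|k IH]; first by rewrite !expr0 !mul1r.
apply: (le_trans IH); rewrite exprSr -mulrA; apply: ler_wpM2l.
  by rewrite exprn_ge0// ltW// tau_gt0.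
by rewrite exprS -mulrA; apply: wball_reverse; rewrite mulr_gt0// exprn_gt0.
Qed.

Lemma wball_Ap c r : 0 < r -> wball w c r `^ p^-1 * wball sg c r `^ q^-1 <= Aw * (2 * r) ^+ n.
Proof.
move=> r0; have r20 : 0 < 2 * r by rewrite mulr_gt0.
apply: le_trans (dw_Ap dw (\row_i (c ord0 i - r)) r20).
have pV : 0 <= p^-1 by rewrite invr_ge0 ltW.
have qV : 0 <= q^-1 by rewrite invr_ge0 ltW.
apply: ler_pM; [exact: powR_ge0|exact: powR_ge0| |].
- by apply: powR_le => //; [exact: wball_ge0|exact: wball_le_vol].
- by apply: powR_le => //; [exact: wball_ge0|exact: wball_le_vol].
Qed.

Lemma dual_mul x : w x `^ p^-1 * sg x `^ q^-1 = 1.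
Proof. exact: dw_dual dw x. Qed.

Lemma hoelder_ball f c r X : nnm f -> 0 < X -> 0 < r ->
  (\nint[mu]_(x in eball c r) (f x `^ p * w x) <= X%:E)%E ->
  (\nint[mu]_(x in eball c r) (f x) <= (X `^ p^-1 * wball sg c r `^ q^-1)%:E)%E.
Proof.
move=> nf X0 r0 hX; have [nw _] := fw; have [ns _] := fs.
have mB : measurable (eball c r) by exact: measurable_eball.
have s0 : 0 < wball sg c r.
  rewrite -lte_fin -wballE//; apply: nint_gt0 => //; first exact: dw_spos dw.
  have k0 : 0 < r / (2 * n%:R) by rewrite divr_gt0// mulr_gt0.
  apply: (@lt_le_trans _ _ (mu (cube c (r / (2 * n%:R))))).
    by rewrite leb_cube ?(ltW k0)// lte_fin exprn_gt0.
  apply: le_measure; rewrite ?inE; [exact: measurable_cube|exact: measurable_eball|exact: small_cube_in].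
have nF : nnm (fun x => f x * w x `^ p^-1) by apply: nnmM => //; exact: nnm_powR.
have nG : nnm (fun x => sg x `^ q^-1) by exact: nnm_powR.
have := @nint_hoelder _ _ R mu (eball c r) _ _ p q X (wball sg c r) mB nF nG p0 q0 (dw_pq dw) X0 s0.
have eF x : (f x * w x `^ p^-1) `^ p = f x `^ p * w x.
  by rewrite powRM ?powR_ge0 ?nf.2// powRV ?nw.2// gt_eqF.
have eG x : (sg x `^ q^-1) `^ q = sg x by rewrite powRV ?ns.2// gt_eqF.
have eFG x : f x * w x `^ p^-1 * sg x `^ q^-1 = f x by rewrite -mulrA dual_mul mulr1.
under eq_integral do rewrite eF.
under [X in _ -> (X <= _)%E -> _]eq_integral do rewrite eG.
under [X in _ -> _ -> (X <= _)%E]eq_integral do rewrite eFG.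
by rewrite (wballE c r fs) => H; apply: H.
Qed.

Section psi.
Context (kappa : R) (psi : R -> R).
Hypothesis hkappa : 0 <= kappa < 1.
Hypothesis hpsi : D_condition kappa psi.

Context (Ak : R).
Hypothesis hAk : Dconst kappa psi Ak.
Let k0 : 0 <= kappa. Proof. by have /andP[] := hkappa. Qed.
Let k1 : kappa < 1. Proof. by have /andP[] := hkappa. Qed.

Lemma psi_double c r : 0 < r ->
  psi (wball w c (2 * r)) <= Ak * Lball `^ kappa * psi (wball w c r).
Proof.
move=> r0; have W0 := wball_gt0 c r0; have L0 := Lball_gt0.
apply: (growth_mul hkappa hpsi hAk W0 L0); last exact: wball_double.
rewrite -lee_fin -[leLHS]wballE//; apply: wball_le => //; first exact: measurable_eball.
apply: eball_le; lra.
Qed.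

(** The ratio of the geometric series that the tail produces. *)
Definition rho : R := tau `^ ((1 - kappa) / p).

Lemma rho_ge0 : 0 <= rho. Proof. exact: powR_ge0. Qed.

Lemma rho_lt1 : rho < 1.
Proof.
have t0 := tau_gt0; have t1 := tau_lt1; rewrite /rho; set t := tau in t0 t1 *.
have u0 : 0 < (1 - kappa) / p by rewrite divr_gt0// subr_gt0.
have := @gt0_ltr_powR R _ u0 t 1; rewrite powR1; apply => //; rewrite nnegrE; [exact: ltW|exact: ler01].
Qed.

Lemma decay c r k : 0 < r ->
  (psi (wball w c (2 ^+ k * r)) / wball w c (2 ^+ k * r)) `^ p^-1 <=
  (Ak * (psi (wball w c r) / wball w c r)) `^ p^-1 * rho ^+ k.
Proof.
move=> r0; have rk0 : 0 < 2 ^+ k * r by rewrite mulr_gt0// exprn_gt0.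
exact: (growth_decay hkappa hpsi hAk (wball_gt0 c r0) (wball_gt0 c rk0) tau_gt0 tau_lt1 p0 (wball_iter c k r0)).
Qed.

Context (N : R) (f : E -> C).
Hypothesis N0 : 0 < N.
Hypothesis mf : cmeasurable setT f.
Hypothesis fN : forall c r, 0 < r ->
  (\nint[mu]_(x in eball c r) (normc (f x) `^ p * w x) <= (N `^ p * psi (wball w c r))%:E)%E.

(** Hölder's inequality gives [sg(B)^(1/q)], which the A_p condition exchanges for
    [Aw (2 r)^n / w(B)^(1/p)]. *)
Lemma morrey_L1 c r : 0 < r -> (\nint[mu]_(x in eball c r) (normc (f x)) <=
   (N * Aw * (2 * r) ^+ n * (psi (wball w c r) / wball w c r) `^ p^-1)%:E)%E.
Proof.
move=> r0; have W0 := wball_gt0 c r0; have P0 := psi_gt0 hpsi W0.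
have X0 : 0 < N `^ p * psi (wball w c r) by rewrite mulr_gt0// powR_gt0.
apply: le_trans (hoelder_ball (nnm_normc mf) X0 r0 (fN c r0)) _; rewrite lee_fin.
have := wball_Ap c r0; move: W0 P0; set W := wball w c r; set s := wball sg c r => W0 P0 h.
rewrite powRM ?powR_ge0 ?(ltW P0)// powRVV ?(ltW N0) ?gt_eqF//.
have V0 := powR_gt0 p^-1 W0; have Q0 := powR_gt0 p^-1 P0.
have -> : (psi W / W) `^ p^-1 = psi W `^ p^-1 / W `^ p^-1.
  rewrite powRM ?invr_ge0 ?(ltW P0) ?(ltW W0)//; congr (_ * _).
  by rewrite -powR_inv1 ?(ltW W0)// -powRrM mulN1r powRN.
have -> : N * Aw * (2 * r) ^+ n * (psi W `^ p^-1 / W `^ p^-1) =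
    N * psi W `^ p^-1 / W `^ p^-1 * (Aw * (2 * r) ^+ n) by ring.
have -> : N * psi W `^ p^-1 * s `^ q^-1 = N * psi W `^ p^-1 / W `^ p^-1 * (W `^ p^-1 * s `^ q^-1).
  by rewrite [RHS]mulrA mulfVK// gt_eqF.
by rewrite ler_wpM2l// divr_ge0 ?(ltW V0)// mulr_ge0 ?ltW.
Qed.

Context (K : E -> E -> C) (AK : R).
Hypothesis AK0 : 0 < AK.
Hypothesis mK : cmeasurable setT (fun z : E * E => K z.1 z.2).
Hypothesis K1 : forall x y, x != y -> normc (K x y) <= AK * enorm (x - y) ^- n.

Definition Ctail : R := AK * 8 ^+ n * Aw * Ak `^ p^-1 / (1 - rho).

Lemma Ctail_ge0 : 0 <= Ctail.
Proof.
have h := rho_lt1; have a0 := ltW Aw0; have b0 := ltW AK0; rewrite /Ctail divr_ge0 ?subr_ge0 ?(ltW h)//.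
by rewrite mulr_ge0 ?powR_ge0// mulr_ge0// mulr_ge0 ?exprn_ge0.
Qed.

Lemma geom_sum (z : R) M : 0 <= z -> z < 1 -> \sum_(k < M) z ^+ k <= (1 - z)^-1.
Proof.
move=> z0 z1; have d0 : 0 < 1 - z by rewrite subr_gt0.
rewrite -[leRHS]mul1r ler_pdivlMr// mulrC.
have -> : (1 - z) * \sum_(k < M) z ^+ k = 1 - z ^+ M.
  by rewrite -[RHS]opprB subrX1 -mulNr opprB.
by rewrite gerBl exprn_ge0.
Qed.

(** On the annulus [k] the kernel is at most [AK (2^k r)^-n]; [f] is integrated over the ball of
    radius [2^(k+2) r], whose circumscribed cube has side [8 * 2^k r]. The powers of [2^k r] cancel,
    leaving [8^n] and the geometric decay of [decay]. *)
Lemma tail_bound c r x : 0 < r -> eball c r x ->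
  (\nint[mu]_(y in ~` eball c (2 * r)) (normc (K x y * f y)) <=
   (Ctail * N * (psi (wball w c r) / wball w c r) `^ p^-1)%:E)%E.
Proof.
move=> r0 xc; have r20 : 0 < 2 * r by rewrite mulr_gt0.
have mKx : cmeasurable setT (fun y => K x y) by exact: cmeas_kernel_r mK x.
have nf : nnm (fun y => normc (f y)) := nnm_normc mf.
have nKf : nnm (fun y => normc (K x y * f y)) by apply: nnm_normc; exact: cmeasM.
pose F k := eball c (2 ^+ k.+1 * (2 * r)) `\` eball c (2 ^+ k * (2 * r)).
have mF k : measurable (F k) by apply: measurableD; exact: measurable_eball.
apply: (@le_trans _ _ (\nint[mu]_(y in \bigcup_k F k) (normc (K x y * f y)))%E).
  apply: nint_sub => //; last exact: eball_annuli.
  - by apply: measurableC; exact: measurable_eball.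
  - exact: bigcup_measurable.
apply: (le_trans (nint_bigcup_le _ mF nKf)).
have W0 := wball_gt0 c r0; have P0 := psi_gt0 hpsi W0.
set u := (psi (wball w c r) / wball w c r) `^ p^-1.
have u0 : 0 <= u by exact: powR_ge0.
have z0 := rho_ge0; have z1 := rho_lt1.
pose B := AK * 8 ^+ n * Aw * Ak `^ p^-1 * N * u.
have a0 := ltW Aw0; have b0 := ltW AK0.
have B0 : 0 <= B.
  have e8 : 0 <= 8 ^+ n :> R by exact: exprn_ge0.
  rewrite /B; apply: mulr_ge0 => //; apply: mulr_ge0; last exact: ltW.
  apply: mulr_ge0; last exact: powR_ge0.
  by apply: mulr_ge0 => //; exact: mulr_ge0.
have piece k : (\nint[mu]_(y in F k) (normc (K x y * f y)) <= (B * rho ^+ k)%:E)%E.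
  have d0 : 0 < 2 ^+ k * r by rewrite mulr_gt0// exprn_gt0.
  (* [y] is at distance at least [2^(k+1) r] of the centre and [x] at distance less than [r]. *)
  have far y : F k y -> 2 ^+ k * r <= enorm (x - y) \/ f y = 0.
    move=> [_ /negP]; rewrite -leNgt => h; left.
    have h1 := enorm_dist_triangle x y c; rewrite [enorm (y - x)]enorm_sub in h1.
    have h2 : r <= 2 ^+ k * r by rewrite ler_peMl ?(ltW r0)// exprn_ege1// ler1n.
    move: xc; rewrite /eball /= => h3; rewrite mulrCA in h; lra.
  apply: le_trans (kernel_mul_fin AK0 mK K1 (mF k) mf d0 far) _.
  have r4 : 0 < 2 ^+ k.+2 * r by rewrite mulr_gt0// exprn_gt0.
  have hB : (\nint[mu]_(y in F k) (normc (f y)) <= (N * Aw * (2 * (2 ^+ k.+2 * r)) ^+ n *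
      ((Ak * (psi (wball w c r) / wball w c r)) `^ p^-1 * rho ^+ k.+2))%:E)%E.
    apply: (@le_trans _ _ (\nint[mu]_(y in eball c (2 ^+ k.+2 * r)) (normc (f y)))%E).
      apply: nint_sub => //; first exact: measurable_eball.
      have -> : 2 ^+ k.+2 * r = 2 ^+ k.+1 * (2 * r) by rewrite (exprSr _ k.+1) mulrA.
      by move=> y [].
    apply: le_trans (morrey_L1 c r4) _; rewrite lee_fin ler_wpM2l//; last exact: decay.
    have r80 : 0 <= 2 * (2 ^+ k.+2 * r) by rewrite mulr_ge0// ltW.
    by apply: mulr_ge0; [apply: mulr_ge0 => //; exact: ltW|exact: exprn_ge0].
  apply: (@le_trans _ _ ((AK * (2 ^+ k * r) ^- n)%:E * (N * Aw * (2 * (2 ^+ k.+2 * r)) ^+ n *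
      ((Ak * (psi (wball w c r) / wball w c r)) `^ p^-1 * rho ^+ k.+2))%:E)%E).
    by apply: lee_wpmul2l => //; rewrite lee_fin mulr_ge0// invr_ge0 exprn_ge0// ltW.
  rewrite -EFinM lee_fin /B.
  have [Ak0 _] := hAk; have qq : 0 <= psi (wball w c r) / wball w c r := divr_ge0 (ltW P0) (ltW W0).
  rewrite (powRM _ (ltW Ak0) qq) -/u.
  have -> : 2 * (2 ^+ k.+2 * r) = 8 * (2 ^+ k * r) by rewrite !exprS; ring.
  rewrite [(8 * _) ^+ n]exprMn; set v := (2 ^+ k * r) ^+ n.
  have v0 : v != 0 by rewrite gt_eqF// exprn_gt0.
  have -> : AK / v * (N * Aw * (8 ^+ n * v) * (Ak `^ p^-1 * u * rho ^+ k.+2)) =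
      AK * 8 ^+ n * Aw * Ak `^ p^-1 * N * u * rho ^+ k.+2 by field.
  have hB' : B * rho ^+ k.+2 <= B * rho ^+ k.
    apply: ler_wpM2l => //; rewrite -addn2 exprD ler_piMr ?exprn_ge0//.
    by rewrite exprn_ile1// ltW.
  exact: hB'.
apply: nneseries_le => [k|M]; first exact: nint_ge0.
apply: (@le_trans _ _ (\sum_(k < M) B * rho ^+ k)%:E).
  by rewrite big_mkord -sumEFin; apply: lee_sum => k _; exact: piece.
rewrite lee_fin -mulr_sumr.
have -> : Ctail * N * u = B * (1 - rho)^-1 by rewrite /Ctail /B; ring.
by rewrite ler_wpM2l// geom_sum.
Qed.

End psi.

End weights.
End balls.

(** Proved from the supremum over simple functions, for arbitrary sets: it is applied to a compact
    set whose measurability is not established. *)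
Lemma nint_mono d (T : measurableType d) (R : realType) (mu : {measure set T -> \bar R})
    (A B : set T) (f : T -> R) : (forall x, 0 <= f x) -> A `<=` B ->
  (\nint[mu]_(x in A) (f x) <= \nint[mu]_(x in B) (f x))%E.
Proof.
move=> f0 AB; rewrite !ge0_integralE => [|x _|x _]; rewrite ?lee_fin//.
apply: ereal_sup_le => _ [h hA <-]; exists h => //= x; apply: le_trans (hA x) _.
by rewrite /patch; case: ifPn => [/set_mem/AB/mem_set ->//|_]; case: ifPn => _; rewrite ?lee_fin.
Qed.

(** * The Morrey norm as a bound on balls *)

Section morrey_norm.
Context (R : realType) (n : nat).
Local Notation E := 'rV[R]_n.
Local Notation C := R[i].
Local Notation mu := (leb R n).
Implicit Types (c x y : E) (f : E -> C).

Lemma compact_eball (A : set E) : compact A -> exists2 r : R, 0 < r & A `<=` eball 0 r.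
Proof.
move=> /compact_bounded [M [_ hM]].
pose m : R := `|M| + 1; have m0 : 0 <= m by rewrite addr_ge0.
exists (n%:R * m + 1); first by rewrite ltr_wpDl// mulr_ge0.
move=> x Ax; have := hM m _ x Ax; have Mm : M < m by apply: le_lt_trans (ler_norm M) _; rewrite ltrDl.
move=> /(_ Mm) /= xm; rewrite /eball /= subr0.
apply: (@le_lt_trans _ _ (n%:R * m)); last by rewrite ltrDl.
apply: enorm_le => i; apply: le_trans xm.
(* The library norm of a row vector is the maximum of its entries; it is unfolded to compare one
   coordinate with it. *)
rewrite [leRHS]/Num.norm /= /mx_norm.
pose z : {nonneg R} := NngNum (normr_ge0 (x ord0 i)); set B := \big[_/_]_(_ <- _) _.
suff : z <= B by rewrite -num_le.
by apply/bigmax_geP; right; exists (ord0, i) => //; rewrite -num_le.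
Qed.

Context (p : R) (psi : R -> R) (w : E -> R).
Hypothesis p0 : 0 < p.
Hypothesis fw : fin_wt w.
Hypothesis psi0 : forall c r, 0 < r -> 0 < psi (wball w c r).

Lemma morrey_ball f N c r : cmeasurable setT f -> 0 <= N -> (Morrey_norm p psi w f <= N%:E)%E -> 0 < r ->
  (\nint[mu]_(x in eball c r) (normc (f x) `^ p * w x) <= (N `^ p * psi (wball w c r))%:E)%E.
Proof.
move=> mf N0 hN r0; have P0 := psi0 c r0.
set I := integral _ _ _.
have : (((psi (wball w c r))^-1%:E * I) `^ p^-1 <= N%:E)%E.
  by apply: le_trans hN; apply: ereal_sup_ubound; exists c, r.
have : (0 <= I)%E.
  by apply: nint_ge0; apply: nnmM; [apply: nnm_powR; exact: nnm_normc|exact: fw.1].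
case: I => [J| |] //.
  rewrite lee_fin => J0; rewrite -EFinM poweR_EFin !lee_fin => h.
  have := powR_le (ltW p0) (powR_ge0 _ _) h; rewrite powRV ?gt_eqF//; last first.
    by rewrite mulr_ge0// invr_ge0 ltW.
  by rewrite ler_pdivrMl// mulrC.
by rewrite gt0_muley ?lte_fin ?invr_gt0// poweRyr// gt_eqF// invr_gt0.
Qed.

Lemma morrey_le f N : cmeasurable setT f -> 0 <= N ->
  (forall c r, 0 < r -> (\nint[mu]_(x in eball c r) (normc (f x) `^ p * w x) <=
    (N `^ p * psi (wball w c r))%:E)%E) -> (Morrey_norm p psi w f <= N%:E)%E.
Proof.
move=> mf N0 h; apply: ge_ereal_sup => _ [c [r [r0 ->]]] /=.
have P0 := psi0 c r0; have := h c r r0; set I := integral _ _ _.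
have : (0 <= I)%E.
  by apply: nint_ge0; apply: nnmM; [apply: nnm_powR; exact: nnm_normc|exact: fw.1].
case: I => [J| |] //; rewrite !lee_fin => J0 hJ.
rewrite -[leRHS](@powRVV _ N p)// ?gt_eqF//.
have J1 : 0 <= (psi (wball w c r))^-1 * J by rewrite mulr_ge0// invr_ge0 ltW.
apply: powR_le; [by rewrite invr_ge0 ltW|exact: J1|].
by rewrite ler_pdivrMl// mulrC.
Qed.

Lemma morrey_norm_ge0 f : (0 <= Morrey_norm p psi w f)%E.
Proof.
apply: (@le_trans _ _ ((((psi (wball w 0 1))^-1%:E *
  \nint[mu]_(x in eball 0 1) (normc (f x) `^ p * w x)) `^ p^-1)%E)); first exact: poweR_ge0.
by apply: ereal_sup_ubound; exists 0, 1.
Qed.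

(** Allows the weight to be replaced by its everywhere positive version. *)
Lemma morrey_norm_ae (w' : E -> R) f : cmeasurable setT f -> measurable_fun setT w' ->
  {ae mu, forall x, w' x = w x} -> Morrey_norm p psi w' f = Morrey_norm p psi w f.
Proof.
move=> mf mw' ww; rewrite /Morrey_norm; congr ereal_sup; apply/seteqP.
have mB c r : measurable (eball c r : set E) by exact: measurable_eball.
have e1 c r : (\int[mu]_(x in eball c r) w' x)%R = (\int[mu]_(x in eball c r) w x)%R.
  rewrite /Rintegral; congr fine; apply: ae_eq_integral => //.
  - by apply/measurable_EFinP; exact: measurable_funTS.
  - by apply: nnm_EFin; exact: fw.1.
  - by apply: filterS ww => x -> _.
have nf := nnm_powR p (nnm_normc mf).
have e2 c r : (\int[mu]_(x in eball c r) (normc (f x) `^ p * w' x)%:E)%E =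
    (\int[mu]_(x in eball c r) (normc (f x) `^ p * w x)%:E)%E.
  apply: ae_eq_integral => //.
  - apply/measurable_EFinP; apply: measurable_funTS; apply: measurable_funM => //; exact: nf.1.
  - by apply: nnm_EFin; apply: nnmM => //; exact: fw.1.
  - by apply: filterS ww => x -> _.
by split=> _ [c [r [r0 ->]]]; exists c, r; split=> //=; rewrite e1 e2.
Qed.

End morrey_norm.

(** * Restriction of complex integrals and dependence on a parameter *)

Section cintegrals.
Context (R : realType) (n : nat).
Local Notation E := 'rV[R]_n.
Local Notation C := R[i].
Local Notation mu := (leb R n).
Local Notation cmeas f := (cmeasurable setT f).
Implicit Types (x y : E) (f g : E -> C) (D : set E).

Lemma integral_indicE D (f : E -> R) :
  (\int[mu]_(x in D) (f x)%:E)%E = (\int[mu]_x (f x * \1_D x)%:E)%E.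
Proof.
rewrite integral_mkcond; apply: eq_integral => x _; rewrite /patch indicE.
by case: (_ \in _); rewrite ?mulr1 ?mulr0.
Qed.

Lemma Re_indic f D x : complex.Re (f x * \1_D x) = complex.Re (f x) * \1_D x.
Proof. by rewrite indic_real; case: (f x) => u v /=; rewrite mulr0 subr0. Qed.

Lemma Im_indic f D x : complex.Im (f x * \1_D x) = complex.Im (f x) * \1_D x.
Proof. by rewrite indic_real; case: (f x) => u v /=; rewrite mulr0 add0r. Qed.

Lemma cintegral_indic D f : cintegral D f = cintegral setT (fun x => f x * \1_D x).
Proof.
rewrite /cintegral /Rintegral (integral_indicE D (fun x => complex.Re (f x))).
rewrite (integral_indicE D (fun x => complex.Im (f x))).
by congr Complex; congr fine; apply: eq_integral => x _; rewrite ?Re_indic ?Im_indic.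
Qed.

Lemma eq_cintegral D f g : (forall x, D x -> f x = g x) -> cintegral D f = cintegral D g.
Proof.
move=> fg; rewrite cintegral_indic [RHS]cintegral_indic; congr cintegral; apply/funext => x.
rewrite indicE; have [xD|xD] := pselect (D x); first by rewrite fg.
by rewrite memNset// !mulr0.
Qed.

Lemma eq_cintegrable D f g : measurable D -> (forall x, D x -> f x = g x) -> cintegrable D f -> cintegrable D g.
Proof.
move=> mD fg [f1 f2].
split; [apply: eq_integrable f1 => //|apply: eq_integrable f2 => //]; by move=> x; rewrite inE => xD; rewrite fg.
Qed.

(** The positive and negative parts have measurable integrals by Tonelli's theorem; [fine] gives the
    value 0 at the points where the difference is infinite. *)
Lemma measurable_param_integral D (F : E * E -> R) : measurable D -> measurable_fun setT F ->
  measurable_fun setT (fun x => fine (\int[mu]_(y in D) (F (x, y))%:E)%E).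
Proof.
move=> mD mF; pose G (z : E * E) := F z * \1_D z.2.
have mG : measurable_fun setT G.
  by apply: measurable_funM => //; apply: (measurableT_comp _ measurable_snd); exact: measurable_indic.
have pos (H : E * E -> R) : measurable_fun setT H ->
    measurable_fun setT (fun x => \int[mu]_y (maxe (H (x, y))%:E 0))%E.
  move=> mH; apply: (@measurable_fun_fubini_tonelli_F _ _ _ _ _ mu (fun z => maxe (H z)%:E 0)).
    by apply: measurable_maxe => //; apply/measurable_EFinP.
  by move=> z; rewrite le_max lexx orbT.
have -> : (fun x => fine (\int[mu]_(y in D) (F (x, y))%:E)%E) =
    fine \o ((fun x => \int[mu]_y (maxe (G (x, y))%:E 0)) \- (fun x => \int[mu]_y (maxe (- G (x, y))%:E 0)))%E.
  apply/funext => x /=; congr fine; rewrite integral_indicE integralE.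
  by congr (_ - _)%E; apply: eq_integral => y _; rewrite ?funeposE ?funenegE.
apply: measurableT_comp; first exact: fine_measurable.
apply: emeasurable_funB; first exact: pos.
by apply: (pos (fun z => - G z)); exact: measurableT_comp.
Qed.

Lemma cmeas_param_integral D (F : E * E -> C) : measurable D -> cmeasurable setT F ->
  cmeas (fun x => cintegral D (fun y => F (x, y))).
Proof.
move=> mD [m1 m2]; split.
- exact: (measurable_param_integral mD m1).
- exact: (measurable_param_integral mD m2).
Qed.

End cintegrals.

Lemma powR_sum_le (R : realType) (p x y : R) : 0 <= p -> 0 <= x -> 0 <= y ->
  (x + y) `^ p <= 2 `^ p * (x `^ p + y `^ p).
Proof.
move=> p0 x0 y0; have xy0 : 0 <= x + y by exact: addr_ge0.
have [xy|yx] := leP x y.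
  apply: (@le_trans _ _ ((2 * y) `^ p)); first by apply: powR_le => //; lra.
  by rewrite powRM// ler_wpM2l ?powR_ge0// lerDr powR_ge0.
apply: (@le_trans _ _ ((2 * x) `^ p)); first by apply: powR_le => //; lra.
by rewrite powRM// ler_wpM2l ?powR_ge0// lerDl powR_ge0.
Qed.

(** * The image of a Morrey function *)

Section morrey_CZ.
Context (R : realType) (n : nat).
Local Notation E := 'rV[R]_n.
Local Notation C := R[i].
Local Notation mu := (leb R n).
Local Notation cmeas f := (cmeasurable setT f).
Implicit Types (c x y : E).
Context (theta : R -> R) (T : (E -> C) -> (E -> C) -> C) (K K0 : E -> E -> C) (AK CW M0 : R)
  (S : (E -> C) -> (E -> C)).
Hypothesis hn : (0 < n)%N.
Hypothesis htheta : dini theta.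
Hypothesis M00 : 0 <= M0.
Hypothesis thetaM : forall N, \sum_(k < N) theta (2^-1 ^+ k.+1) <= M0.
Hypothesis hS : CZ_model theta T K K0 AK CW S.
Context (p q Aw : R) (w sg : E -> R).
Hypothesis dw : dual_weights p q Aw w sg.
Context (kappa : R) (psi : R -> R) (Ak : R).
Hypothesis hkappa : 0 <= kappa < 1.
Hypothesis hpsi : D_condition kappa psi.
Hypothesis hAk : Dconst kappa psi Ak.
Context (N : R) (f : E -> C).
Hypothesis N0 : 0 < N.
Hypothesis mf : cmeas f.
Hypothesis fN : forall c r, 0 < r ->
  (\nint[mu]_(x in eball c r) (normc (f x) `^ p * w x) <= (N `^ p * psi (wball w c r))%:E)%E.

Local Notation B2 c r := (eball c (2 * r)).
Let mB c r : measurable (eball c r : set E) := measurable_eball c r.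
Let mBC c r : measurable (~` eball c r : set E) := measurableC (measurable_eball c r).

Definition cut c r : E -> C := fun y => f y * \1_(eball c r) y.
Definition tail c r x : C := cintegral (~` B2 c r) (fun y => K0 x y * f y).
Definition image c r x : C := S (cut c (2 * r)) x + tail c r x.

Lemma cut_L1 c r : 0 < r -> in_Lp 1 (cut c r).
Proof.
move=> r0; have nf := nnm_normc mf; apply/in_L1P; split; first exact: cmeas_indic.
apply: le_lt_trans (_ : \nint[mu]_(x in eball c r) (normc (f x)) < +oo)%E.
  under eq_integral do rewrite normc_indic.
  by rewrite nint_indic// setTI.
by apply: le_lt_trans (morrey_L1 hn dw hpsi N0 mf fN c r0) _; rewrite ltry.
Qed.

Lemma tail_fin c r x : 0 < r -> eball c r x ->
  (\nint[mu]_(y in ~` B2 c r) (normc (K0 x y * f y)) < +oo)%E.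
Proof.
move=> r0 xc; apply: le_lt_trans (tail_bound hn dw hkappa hpsi hAk N0 mf fN (model_AK hS)
  (model_measurable hS) (model_size hS) r0 xc) _.
by rewrite ltry.
Qed.

Lemma cmeas_Kf x : cmeas (fun y => K0 x y * f y).
Proof. by apply: cmeasM => //; exact: cmeas_kernel_r (model_measurable hS) x. Qed.

Lemma tail_integrable c r x : 0 < r -> eball c r x ->
  cintegrable (~` B2 c r) (fun y => K0 x y * f y).
Proof.
move=> r0 xc; apply: cintegrable_normc => //; [exact: cmeas_Kf|exact: tail_fin].
Qed.

Lemma tail_integrableT c r x : 0 < r -> eball c r x ->
  cintegrable setT (fun y => K0 x y * f y * \1_(~` B2 c r) y).
Proof.
move=> r0 xc; have mK := cmeas_Kf x; apply: cintegrable_normc => //; first exact: cmeas_indic.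
under eq_integral do rewrite (normc_indic (fun y => K0 x y * f y)).
rewrite nint_indic// ?setTI; [exact: tail_fin|exact: nnm_normc].
Qed.

Lemma cut_near c r x y : 0 < r -> eball c r x -> enorm (x - y) < r -> cut c (2 * r) y = f y.
Proof.
move=> r0 xc xy; rewrite /cut indicE mem_set ?mulr1// /eball /=.
move: xc; rewrite /eball /= => xc; have := enorm_dist_triangle x y c.
rewrite [enorm (y - x)]enorm_sub; lra.
Qed.

(* f 1_2B - f 1_2B' vanishes near the points of B and B', hence S is given there by the
   kernel. *)
Lemma image_consistent c r c' r' : 0 < r -> 0 < r' ->
  {ae mu, forall x, eball c r x -> eball c' r' x -> image c r x = image c' r' x}.
Proof.
move=> r0 r'0; have r20 : 0 < 2 * r by rewrite mulr_gt0.
have r'20 : 0 < 2 * r' by rewrite mulr_gt0.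
have [lin _ _] := model_weak hS.
have L1 := cut_L1 c r20; have L2 := cut_L1 c' r'20.
pose g y := -1 * cut c' (2 * r') y + cut c (2 * r) y.
have g1 : in_Lp 1 g by exact: in_L1_lin.
pose M := 2 * r + (enorm (c' - c) + 2 * r').
have M1 : 0 < M by rewrite addr_gt0// ltr_wpDl ?enorm_ge0.
have g0 y : ~ cube (\row_i (c ord0 i - M)) (2 * M) y -> g y = 0.
  move=> hy; have hM : ~ eball c M y by move=> /eball_sub_cube.
  have o1 : ~ eball c (2 * r) y.
    by move=> h; apply: hM; apply: eball_le h; rewrite /M lerDl addr_ge0 ?enorm_ge0// ltW.
  have o2 : ~ eball c' (2 * r') y.
    move=> h; apply: hM; move: h; rewrite /eball /= => h.
    have := enorm_dist_triangle c' y c; rewrite /M; lra.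
  by rewrite /g /cut !indicE !memNset// !mulr0 addr0.
have M20 : 0 < 2 * M by rewrite mulr_gt0.
apply: filterS2 (lin (-1) _ _ L2 L1) (model_repr hS M20 g1 g0) => x hlin hrep xc xc'.
pose m := Num.min r r'; have m0 : 0 < m by rewrite lt_min r0.
have nR : 0 < n%:R :> R by rewrite ltr0n.
have d0 : 0 < m / (2 * n%:R) by rewrite divr_gt0// mulr_gt0.
have gv : vanishes_near (m / (2 * n%:R)) x g.
  move=> y hy; have xy : enorm (x - y) < m.
    by apply: enorm_ltP => // i; have := hy i; rewrite !mxE.
  move: xy; rewrite lt_min => /andP[xy xy'].
  by rewrite /g (cut_near r0 xc xy) (cut_near r'0 xc' xy'); ring.
have {hrep} := hrep (ex_intro2 (fun d => 0 < d) (fun d => vanishes_near d x g) _ d0 gv).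
rewrite hlin /image /tail (cintegral_indic (~` B2 c r)) (cintegral_indic (~` B2 c' r')) => hg.
have i1 := tail_integrableT r0 xc; have i2 := tail_integrableT r'0 xc'.
have := cintegral_lin (-1) measurableT i1 i2.
rewrite (_ : (fun y => _) = (fun y => K0 x y * g y)); last first.
  apply/funext => y; rewrite /g /cut !indicE !in_setC; case: (_ \in _); case: (_ \in _) => /=; ring.
rewrite -hg; set a := S _ x; set b := S _ x; set u := cintegral _ _; set v := cintegral _ _ => h.
have -> : b = (-1 * a + b) + a by ring.
by rewrite h; ring.
Qed.

Lemma cmeas_image c r : 0 < r -> cmeas (image c r).
Proof.
move=> r0; have [_ mS _] := model_weak hS; apply: cmeasD.
  by apply: mS; apply: cut_L1; rewrite mulr_gt0.
apply: (@cmeas_param_integral R n (~` B2 c r) (fun z => K0 z.1 z.2 * f z.2)) => //.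
apply: cmeasM; first exact: model_measurable hS.
split; [exact: (measurableT_comp mf.1 measurable_snd)|exact: (measurableT_comp mf.2 measurable_snd)].
Qed.

(** The value at [x] is read on the ball about 0 whose radius is the least integer above the norm of
    [x]: countably many balls, so that consistency holds almost everywhere simultaneously. *)
Definition glued x : C := image 0 (Num.truncn (enorm x)).+1%:R x.

Lemma in_truncn x : eball 0 (Num.truncn (enorm x)).+1%:R x.
Proof. by rewrite /eball /= subr0 truncnS_gt. Qed.

Lemma cmeas_glued : cmeas glued.
Proof.
pose P m : set E := eball 0 m.+1%:R `\` eball 0 m%:R.
have mP m : measurable (P m) by exact: measurableD.
have PT : \bigcup_m P m = setT.
  apply/seteqP; split => // x _; exists (Num.truncn (enorm x)) => //; split; first exact: in_truncn.
  apply/negP; rewrite -leNgt subr0; have := truncn_itv (enorm_ge0 x); by case/andP.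
have PE m x : P m x -> Num.truncn (enorm x) = m.
  move=> [h1 /negP]; rewrite -leNgt subr0 => h2.
  move: h1; rewrite /eball /= subr0 => h1; apply/eqP; rewrite eqn_leq.
  by rewrite -ltnS -(ltr_nat R) (le_lt_trans _ h1) ?truncn_ge_nat ?enorm_ge0//=; have/andP[] := truncn_itv (enorm_ge0 x).
split; rewrite -PT; apply/measurable_fun_bigcup => // m; have r0 : 0 < m.+1%:R :> R by rewrite ltr0n.
- apply: (@eq_measurable_fun _ _ _ _ _ (fun x => complex.Re (image 0 m.+1%:R x))).
    by move=> x; rewrite inE => /PE; rewrite /glued => ->.
  exact: measurable_funTS (cmeas_image 0 r0).1.
- apply: (@eq_measurable_fun _ _ _ _ _ (fun x => complex.Im (image 0 m.+1%:R x))).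
    by move=> x; rewrite inE => /PE; rewrite /glued => ->.
  exact: measurable_funTS (cmeas_image 0 r0).2.
Qed.

Lemma kernel_eq c r x y : 0 < r -> eball c r x -> ~ B2 c r y -> K0 x y * f y = K x y * f y.
Proof.
move=> r0 xc yc; rewrite (model_kernel hS)//; apply/eqP => xy; apply: yc; rewrite -xy.
by apply: eball_le xc; lra.
Qed.

Lemma image_exists : is_CZ_image T K f glued.
Proof.
split; first exact: cmeas_glued.
exists S; first exact: model_ext hS.
move=> c r r0 /=.
have : {ae mu, forall x, forall m : nat, eball c r x -> eball 0 m.+1%:R x ->
    image c r x = image 0 m.+1%:R x}.
  by apply/ae_foralln => m; apply: image_consistent.
apply: filterS => x hx xc; have ke y := @kernel_eq c r x y r0 xc; split.
  exact: eq_cintegrable (mBC c (2 * r)) ke (tail_integrable r0 xc).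
rewrite /glued -(hx _ xc (in_truncn x)) /image /tail; congr (_ + _).
exact: eq_cintegral ke.
Qed.

(** The local bound times the doubling constant of [psi (w B)], plus the [p]-th power of the tail
    constant; [2^p] comes from the power of the sum. *)
Definition Cmorrey : R :=
  2 `^ p * (Cdom n AK CW M0 `^ p * Csparse n p q Aw * 2 `^ p * (Ak * Lball n p Aw `^ kappa) +
    (2 * Ctail n p Aw kappa Ak AK) `^ p).

Let p0 : 0 < p := lt_trans ltr01 (dw_p dw).

Lemma Cmorrey_ge0 : 0 <= Cmorrey.
Proof.
have [Ak0 _] := hAk; have c0 := Csparse_ge0 dw; rewrite /Cmorrey.
set L := Lball n p Aw; set c1 := Csparse _ _ _ _ in c0 *; set c2 := Ctail _ _ _ _ _ _; set c3 := Cdom _ _ _ _.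
apply: mulr_ge0; first exact: powR_ge0.
apply: addr_ge0; last exact: powR_ge0.
apply: mulr_ge0; last by apply: mulr_ge0; [exact: ltW|exact: powR_ge0].
by apply: mulr_ge0; [apply: mulr_ge0 => //; exact: powR_ge0|exact: powR_ge0].
Qed.

(** The cube circumscribed about the ball has a triple that contains the doubled ball, so
    [local_weighted] applies to [cut c (2 * r)]; the doubling of [psi (w B)] returns to the original
    ball. *)
Lemma local_part c r : 0 < r ->
  (\nint[mu]_(x in eball c r) (normc (S (cut c (2 * r)) x) `^ p * w x) <=
   (Cdom n AK CW M0 `^ p * Csparse n p q Aw * 2 `^ p * (Ak * Lball n p Aw `^ kappa) *
     (N `^ p * psi (wball w c r)))%:E)%E.
Proof.
move=> r0; have r20 : 0 < 2 * r by rewrite mulr_gt0.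
have [nw _] := dw_w dw; have [_ mS _] := model_weak hS; have L1 := cut_L1 c r20.
set Cl := Cdom n AK CW M0 `^ p * Csparse n p q Aw * 2 `^ p.
have Cl0 : 0 <= Cl.
  have c0 := Csparse_ge0 dw; rewrite /Cl; set c1 := Csparse _ _ _ _ in c0 *; set c3 := Cdom _ _ _ _.
  by apply: mulr_ge0; [apply: mulr_ge0 => //; exact: powR_ge0|exact: powR_ge0].
pose a : E := \row_i (c ord0 i - r).
have off y : ~ triple a (2 * r) y -> cut c (2 * r) y = 0.
  move=> hy; rewrite /cut indicE memNset ?mulr0// => /eball_sub_cube yc; apply: hy.
  apply/tripleP => i; have := yc i; rewrite !mxE => /andP[h1 h2]; apply/andP; split; lra.
have nS : nnm (fun x => normc (S (cut c (2 * r)) x) `^ p * w x).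
  by apply: nnmM => //; apply: nnm_powR; apply: nnm_normc; exact: mS.
have nf : nnm (fun x => normc (f x) `^ p * w x).
  by apply: nnmM => //; apply: nnm_powR; exact: nnm_normc.
have mT : measurable (triple a (2 * r)) by exact: measurable_triple.
apply: (@le_trans _ _ (\nint[mu]_(x in cube a (2 * r)) (normc (S (cut c (2 * r)) x) `^ p * w x))%E).
  by apply: nint_sub => //; [exact: measurable_cube|exact: eball_sub_cube].
apply: le_trans (local_weighted hn htheta M00 thetaM hS dw r20 L1 off) _.
have e1 x : normc (cut c (2 * r) x) `^ p * w x = normc (f x) `^ p * w x * \1_(B2 c r) x.
  rewrite /cut normc_indic indicE; case: (_ \in _); rewrite ?mulr1 ?mulr0// powR0 ?mul0r// gt_eqF//.
apply: (@le_trans _ _ (Cl%:E * \nint[mu]_(x in B2 c r) (normc (f x) `^ p * w x))%E).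
  apply: lee_wpmul2l; first by rewrite lee_fin.
  under eq_integral do rewrite e1.
  rewrite nint_indic//; apply: nint_sub => //; exact: measurableI.
apply: (@le_trans _ _ (Cl%:E * (N `^ p * psi (wball w c (2 * r)))%:E)%E).
  by apply: lee_wpmul2l; [rewrite lee_fin|exact: fN].
rewrite -EFinM lee_fin -[leRHS]mulrA; apply: ler_wpM2l => //.
rewrite mulrCA; apply: ler_wpM2l; first exact: powR_ge0.
exact: (psi_double hn dw hkappa hpsi hAk c r0).
Qed.

(** The extension used in the image is replaced by [S] through [model_unique]; then the local part
    and the tail are bounded separately, the latter by a constant on the ball. *)
Lemma image_bound h c r : is_CZ_image T K f h -> 0 < r ->
  (\nint[mu]_(x in eball c r) (normc (h x) `^ p * w x) <=
   (Cmorrey * (N `^ p * psi (wball w c r)))%:E)%E.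
Proof.
move=> [mh [S' extS' hS']] r0; have r20 : 0 < 2 * r by rewrite mulr_gt0.
have [nw _] := dw_w dw; have [_ mS _] := model_weak hS; have L1 := cut_L1 c r20.
have W0 := wball_gt0 hn dw c r0; have P0 := psi_gt0 hpsi W0.
set W := wball w c r in W0 P0 *.
set Ct := Ctail n p Aw kappa Ak AK; have Ct0 : 0 <= Ct := Ctail_ge0 hn dw hkappa Ak (model_AK hS).
pose u := (psi W / W) `^ p^-1; pose k := 2 * (Ct * N * u).
have u0 : 0 <= u by exact: powR_ge0.
have CN0 : 0 <= Ct * N by apply: mulr_ge0 => //; exact: ltW.
have k0 : 0 <= k by apply: mulr_ge0 => //; exact: mulr_ge0.
have nSp : nnm (fun x => normc (S (cut c (2 * r)) x) `^ p * w x).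
  by apply: nnmM => //; apply: nnm_powR; apply: nnm_normc; exact: mS.
have nk : nnm (fun x => k `^ p * w x) by apply: nnmZ => //; exact: powR_ge0.
have nh : nnm (fun x => normc (h x) `^ p * w x).
  by apply: nnmM => //; apply: nnm_powR; exact: nnm_normc.
apply: (@le_trans _ _ (\nint[mu]_(x in eball c r)
    (2 `^ p * (normc (S (cut c (2 * r)) x) `^ p * w x + k `^ p * w x)))%E).
  apply: nint_ae_le => //; first by apply: nnmZ; [exact: powR_ge0|exact: nnmD].
  apply: filterS2 (hS' c r r0) (model_unique hS extS' L1) => x hx uq xc.
  have [_ ->] := hx xc; rewrite -/(cut c (2 * r)) uq.
  rewrite -(eq_cintegral (fun y => @kernel_eq c r x y r0 xc)) -/(tail c r x).
  have hk : normc (tail c r x) <= k.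
    rewrite -lee_fin; apply: le_trans (normc_cintegral_le (mBC c (2 * r)) (cmeas_Kf x)) _.
    rewrite /k EFinM; apply: lee_wpmul2l => //.
    have := tail_bound hn dw hkappa hpsi hAk N0 mf fN (model_AK hS) (model_measurable hS) (model_size hS) r0 xc; exact.
  rewrite -mulrDl mulrA ler_wpM2r ?nw.2//.
  have s0 := normc_ge0 (S (cut c (2 * r)) x).
  apply: le_trans (powR_sum_le (ltW p0) s0 k0).
  apply: powR_le; [exact: ltW|exact: normc_ge0|].
  by apply: le_trans (normc_triangle _ _) _; rewrite lerD2l.
have c20 := powR_ge0 2 p; have kp0 := powR_ge0 k p.
rewrite (nintZ _ (mB c r) (nnmD nSp nk) c20) nintD// (nintZ _ (mB c r) nw kp0) (wballE c r (dw_w dw)) -/W.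
have -> : (Cmorrey * (N `^ p * psi W))%:E = ((2 `^ p)%:E *
   ((Cdom n AK CW M0 `^ p * Csparse n p q Aw * 2 `^ p * (Ak * Lball n p Aw `^ kappa) *
     (N `^ p * psi W))%:E + ((2 * Ct) `^ p * (N `^ p * psi W))%:E))%E.
  by rewrite -EFinD -EFinM -mulrDl; congr EFin; rewrite /Cmorrey -[LHS]mulrA.
apply: lee_wpmul2l; first by rewrite lee_fin.
apply: leeD; first exact: local_part.
rewrite -EFinM lee_fin.
(* The [p]-th power of the tail bound is [(2 Ct N)^p psi W / W]; integrated against [w] over a ball
   of weight [W] it gives [(2 Ct N)^p psi W]. *)
have -> : k = 2 * Ct * N * u by rewrite /k; ring.
have tC : 0 <= 2 * Ct by exact: mulr_ge0.
have tCN : 0 <= 2 * Ct * N by apply: mulr_ge0 => //; exact: ltW.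
have qq : 0 <= psi W / W := divr_ge0 (ltW P0) (ltW W0).
have up : u `^ p = psi W / W by rewrite powRV// gt_eqF.
rewrite (powRM _ tCN u0) (powRM _ tC (ltW N0)) up.
by rewrite le_eqVlt; apply/orP; left; apply/eqP; field; rewrite gt_eqF.
Qed.

End morrey_CZ.

Lemma local_integrable_morrey (R : realType) (n : nat) (hn : (0 < n)%N) (p q Aw N kappa : R)
    (psi : R -> R) (w sg : 'rV[R]_n -> R) (h : 'rV[R]_n -> R[i]) :
  dual_weights p q Aw w sg -> D_condition kappa psi -> 0 < N -> cmeasurable setT h ->
  (forall c r, 0 < r -> (\nint[leb R n]_(x in eball c r) (normc (h x) `^ p * w x) <=
     (N `^ p * psi (wball w c r))%:E)%E) ->
  locally_integrable_on_Rn h.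
Proof.
move=> dw hpsi N0 mh hN; split=> // A /compact_eball [r r0 Ar].
apply: (@le_lt_trans _ _ (\nint[leb R n]_(x in eball 0 r) (normc (h x)))%E).
  by apply: nint_mono => // x; exact: normc_ge0.
by apply: le_lt_trans (morrey_L1 hn dw hpsi N0 mh hN 0 r0) _; rewrite ltry.
Qed.

Theorem theorem2p1 (R : realType) (n : nat) (hn : (0 < n)%N)
    (p kappa : R) (w : 'rV[R]_n -> R) (psi theta : R -> R)
    (T : ('rV[R]_n -> R[i]) -> ('rV[R]_n -> R[i]) -> R[i])
    (K : 'rV[R]_n -> 'rV[R]_n -> R[i])
    (hp : 1 < p) (hw : Muckenhoupt p w)
    (hkappa : 0 <= kappa < 1) (hpsi : D_condition kappa psi)
    (htheta : dini theta) (hT : theta_CZ_operator theta T K) :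
  exists2 A : R, 0 < A &
    forall f : 'rV[R]_n -> R[i], in_Morrey p psi w f ->
      (exists h, is_CZ_image T K f h) /\
      (forall h, is_CZ_image T K f h ->
         in_Morrey p psi w h /\
         (Morrey_norm p psi w h <= A%:E * Morrey_norm p psi w f)%E).
Proof.
have [w0 [sg [Aw [dw ww]]]] := Muckenhoupt_dual hn hp hw.
have [M0 M00 thetaM] := dini_sum htheta.
have [K0 [AK [CW [S hS]]]] := CZ_model_exists hn htheta hT.
have [Ak hAk] := Dconst_exists hpsi.
have p0 : 0 < p := lt_trans ltr01 hp.
have mw : measurable_fun setT w by case: hw => -[[[]]].
have fw := dw_w dw.
have psi0 c r : 0 < r -> 0 < psi (wball w0 c r).
  by move=> r0; apply: (psi_gt0 hpsi); have := wball_gt0 hn dw c r0.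
have normE f : cmeasurable setT f -> Morrey_norm p psi w f = Morrey_norm p psi w0 f.
  by move=> mf; exact: morrey_norm_ae.
set q := (1 - p^-1)^-1 in dw.
pose C := Cmorrey n AK CW M0 p q Aw kappa Ak.
have C0 : 0 <= C := Cmorrey_ge0 AK CW M0 dw hAk.
(* [C] bounds [p]-th powers of norms, whence the root; 1 is added for positivity. *)
pose A := (C + 1) `^ p^-1.
have A0 : 0 < A by rewrite powR_gt0// ltr_wpDl.
have Ap : A `^ p = C + 1 by rewrite powRV ?gt_eqF// addr_ge0.
exists A; first exact: A0.
move=> f [[mf locf] foo]; have nE := normE f mf; rewrite nE in foo.
have f0 := morrey_norm_ge0 p psi w0 f.
have fE : Morrey_norm p psi w0 f = (fine (Morrey_norm p psi w0 f))%:E.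
  by rewrite fineK// ge0_fin_numE.
set N := fine _ in fE; have N0 : 0 <= N by rewrite -lee_fin -fE.
(* The estimates ask for a positive bound of the norm, and [N] may be 0: all [M > N] are used, and
   [M] tends to [N] at the end. *)
have bnd M : N < M -> forall c r, 0 < r ->
    (\nint[leb R n]_(x in eball c r) (normc (f x) `^ p * w0 x) <= (M `^ p * psi (wball w0 c r))%:E)%E.
  move=> NM c r r0; apply: morrey_ball => //; first by apply: le_trans N0 (ltW NM).
  by rewrite fE lee_fin ltW.
have M1 M : N < M -> 0 < M by exact: le_lt_trans.
split.
  have N1 : N < N + 1 by rewrite ltrDl.
  have ie := image_exists hn hS dw hkappa hpsi hAk (M1 _ N1) mf (bnd _ N1).
  by eexists; exact: ie.
move=> h hh; have mh := hh.1.
have hb M : N < M -> forall c r, 0 < r ->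
    (\nint[leb R n]_(x in eball c r) (normc (h x) `^ p * w0 x) <=
      ((A * M) `^ p * psi (wball w0 c r))%:E)%E.
  move=> NM c r r0; have M0' := M1 _ NM.
  have ib := image_bound hn htheta M00 thetaM hS dw hkappa hpsi hAk M0' mf (bnd _ NM) c hh r0.
  apply: (le_trans ib).
  rewrite lee_fin powRM ?(ltW A0) ?(ltW M0')// Ap -mulrA ler_wpM2r ?lerDl//.
  by rewrite mulr_ge0 ?powR_ge0// ltW// psi0.
have hle M : N < M -> (Morrey_norm p psi w0 h <= (A * M)%:E)%E.
  move=> NM; apply: (morrey_le p0 fw psi0 mh _ (hb _ NM)).
  by rewrite mulr_ge0 ?(ltW A0)// ltW// M1.
have N1 : N < N + 1 by rewrite ltrDl.
split.
  split; last by rewrite (normE h mh); apply: le_lt_trans (hle _ N1) _; rewrite ltry.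
  apply: (local_integrable_morrey hn dw hpsi _ mh (hb _ N1)).
  by rewrite mulr_gt0// M1.
rewrite (normE h mh) nE fE -EFinM; apply/lee_addgt0Pr => e e0.
(* Chosen so that [A (N + e / A) = A N + e]. *)
have Ne : N < N + e / A by rewrite ltrDl divr_gt0.
apply: le_trans (hle _ Ne) _; rewrite -EFinD lee_fin mulrDr mulrCA divff ?gt_eqF// mulr1.
exact: lexx.
Qed.
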